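(* Let $(M,g,\mu)$ be a smooth connected weighted Riemannian manifold without boundary, $V:M\to[0,\infty)$ smooth and $\rho:M\to(0,\infty)$ smooth. With $H$, $N_\alpha$ and $\mathcal{L}_{\rho,V}$ as defined in the context, the following assertions are equivalent. (i) The function $1-H$ is nontrivial. (ii) For some/any $\alpha>0$ the function $1-N_\alpha$ is nontrivial. (iii) For some/any $\alpha>0$ there exists a nontrivial bounded $g\in C^\infty(M)$ with $(\alpha-\mathcal{L}_{\rho,V})g=0$. (iv) For some/any $\alpha>0$ there exists a nontrivial nonnegative bounded $g\in C^\infty(M)$ with $(\alpha-\mathcal{L}_{\rho,V})g\le 0$. (v) There exists a nontrivial $u\in C^\infty((0,\infty)\times M)\cap C_b([0,\infty)\times M)$ that satisfies $$\begin{cases}(\partial_t-\mathcal{L}_{\rho,V})u=0 & \text{on }(0,\infty)\times M,\\ u_0=0.\end{cases}$$ (vi) There exists a nontrivial nonnegative $u\in C^\infty((0,\infty)\times M)\cap C_b([0,\infty)\times M)$ that satisfies $$\begin{cases}(\partial_t-\mathcal{L}_{\rho,V})u\le 0 & \text{on }(0,\infty)\times M,\\ u_0=0.\end{cases}$$ Here ''for some/any $\alpha>0$'' means that the version with ''for some $\alpha>0$'' and the version with ''for every $\alpha>0$'' both belong to the list of equivalent assertions, and ''nontrivial'' means not identically zero.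
   Context: All functions are real-valued. The measure is $\mu=\Psi\,\mathrm{vol}_g$ with $\Psi$ smooth and strictly positive, $\mathrm{vol}_g$ the Riemannian measure. The weighted Laplacian acts on distributions by $\Delta u=\Psi^{-1}\mathrm{div}(\Psi\nabla u)$, and $\mathcal{L}_{\rho,V}=\rho^{-1}\Delta-\rho^{-1}V$. For a smooth $w:M\to(0,\infty)$ let $W^1(M,w)=\{f\in L^2(M,w\mu): |\nabla f|\in L^2(M,\mu)\}$ (distributional gradient) with norm $\|f\|_{W^1}=(\int_M|\nabla f|^2d\mu+\int_M f^2 w\,d\mu)^{1/2}$, and let $W^1_0(M,w)$ be the closure of $C_c^\infty(M)$ in it. The quadratic form $Q_{\rho,V}$ with domain $W_0^1(M,\rho+V)$, $Q_{\rho,V}(f,h)=\int_M\langle\nabla f,\nabla h\rangle d\mu+\int_M fhV\,d\mu$, is a Dirichlet form on $L^2(M,\rho\mu)$. Let $L_{\rho,V}$ be the associated nonpositive self-adjoint operator on $L^2(M,\rho\mu)$ (a restriction of $\mathcal{L}_{\rho,V}$), and let $T^{\rho,V}_t=e^{tL_{\rho,V}}$ ($t>0$) and $G^{\rho,V}_\alpha=(\alpha-L_{\rho,V})^{-1}$ ($\alpha>0$) be its semigroup and resolvent, which are positivity preserving and Markovian. $L^+(M)$ denotes the cone of $[0,\infty]$-valued, $\mu$-a.e. defined measurable functions. Any positivity preserving linear operator $T$ on $L^2(M,\rho\mu)$ is extended to $L^+(M)$ by $Tf=\lim_{n\to\infty}Tf_n$, where $(f_n)$ is any increasing sequence of nonnegative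 functions in $L^2(M,\rho\mu)$ with $f_n\to f$ $\mu$-a.e. (this is well defined). Let $\hat V=V/\rho$. For $t>0$ define $$H_t=T_t^{\rho,V}1+\int_0^tT_s^{\rho,V}\hat V\,ds,$$ where the integral denotes the $L^+(M)$-extension of the positivity preserving operator $f\mapsto\int_0^tT_s^{\rho,V}f\,ds$ on $L^2(M,\rho\mu)$, applied to $\hat V$. For $\alpha>0$ define $N_\alpha=\alpha G_\alpha^{\rho,V}1+G_\alpha^{\rho,V}\hat V$. It is known that $H(t,x)=H_t(x)$ has a version in $C^\infty((0,\infty)\times M)$ and $N_\alpha$ a version in $C^\infty(M)$; these versions are used. For a function $u$ of time and space, $u_t=u(t,\cdot)$. $C_b$ denotes bounded continuous functions; $u\in C^\infty((0,\infty)\times M)\cap C_b([0,\infty)\times M)$ means that $u$ is smooth on $(0,\infty)\times M$ and extends to a bounded continuous function on $[0,\infty)\times M$, and $u_0$ is the value of this extension at $t=0$. *)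

(* Defs.v *)
From HB Require Import structures.
From mathcomp Require Import all_boot all_order all_algebra.
From mathcomp Require Import all_classical all_reals all_analysis.

Set Implicit Arguments.
Unset Strict Implicit.
Unset Printing Implicit Defensive.
Import Order.TTheory GRing.Theory Num.Theory.
Import numFieldNormedType.Exports.
Local Open Scope classical_set_scope.
Local Open Scope ring_scope.

(* Used on open sets of finite-dimensional spaces, where having continuous
   directional derivatives of all orders is the same as being C^oo. *)
Definition iterD {R : realType} {E F : normedModType R} (s : seq E)
    (f : E -> F) : E -> F :=
  foldr (fun v h => 'D_v h) f s.

Definition smooth_on {R : realType} {E F : normedModType R} (U : set E)
    (f : E -> F) : Prop :=
  forall (s : seq E) (x : E), U x ->
    {for x, continuous (iterD s f)} /\ forall v, derivable (iterD s f) x v.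

(* Lebesgue measure on R^n, as a measure on n-tuples. *)
Section lebesgue_tuple.
Context {R : realType}.

Definition tcons n (p : R * n.-tuple R) : n.+1.-tuple R :=
  [tuple of p.1 :: p.2].

Lemma measurable_tcons n : measurable_fun [set: R * n.-tuple R] (@tcons n).
Proof. exact: measurable_cons. Qed.

Section cons_measure.
Context n (m : {sigma_finite_measure set (n.-tuple R) -> \bar R}).
Local Open Scope ereal_scope.

Definition lebesgue_cons : set (n.+1.-tuple R) -> \bar R :=
  pushforward (@lebesgue_measure R \x m) (@tcons n).

Let lebesgue_cons0 : lebesgue_cons set0 = 0.
Proof. by rewrite /lebesgue_cons /pushforward preimage_set0 measure0. Qed.

Let lebesgue_cons_ge0 A : 0 <= lebesgue_cons A.
Proof. by rewrite /lebesgue_cons /pushforward; exact: measure_ge0. Qed.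

Let lebesgue_cons_sigma_additive : semi_sigma_additive lebesgue_cons.
Proof.
move=> F mF tF mUF; rewrite /lebesgue_cons /pushforward preimage_bigcup.
apply: measure_semi_sigma_additive.
- by move=> k; rewrite -[X in measurable X]setTI; exact: measurable_tcons.
- apply/trivIsetP => /= i j _ _ ij; rewrite -preimage_setI.
  by move/trivIsetP : tF => /(_ _ _ _ _ ij) ->//; rewrite preimage_set0.
- by rewrite -preimage_bigcup -[X in measurable X]setTI; exact: measurable_tcons.
Qed.

HB.instance Definition _ := isMeasure.Build _ _ _ lebesgue_cons
  lebesgue_cons0 lebesgue_cons_ge0 lebesgue_cons_sigma_additive.

Let lebesgue_cons_sigma_finite : sigma_finite setT lebesgue_cons.
Proof.
have /sigma_finiteP[F [TF ndF Foo]] := sigma_finiteT (@lebesgue_measure R).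
have /sigma_finiteP[G [TG ndG Goo]] := sigma_finiteT m.
exists (fun k => (fun t : n.+1.-tuple R => (thead t, [tuple of behead t]))
   @^-1` (F k `*` G k)).
  apply/esym; rewrite -subTset => t _.
  have : [set: R] (thead t) by [].
  rewrite TF => -[i _ Fi].
  have : [set: n.-tuple R] [tuple of behead t] by [].
  rewrite TG => -[j _ Gj].
  exists (maxn i j) => //; split => /=.
  - by move: Fi; exact/subsetPset/ndF/leq_maxl.
  - by move: Gj; exact/subsetPset/ndG/leq_maxr.
move=> k; have [mF Fk] := Foo k; have [mG Gk] := Goo k; split.
  rewrite -[X in measurable X]setTI.
  apply: (measurable_fun_pair _ _) => //; last exact: measurableX.
  - exact: measurable_tnth.
  - exact: measurable_behead.
rewrite /lebesgue_cons /pushforward -comp_preimage.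
rewrite (_ : _ \o _ = id).
  by rewrite preimage_id product_measure1E// lte_mul_pinfty// ge0_fin_numE.
apply/funext => -[x t] /=; congr pair.
exact/val_inj.
Qed.

HB.instance Definition _ := @Measure_isSigmaFinite.Build _ _ _
  lebesgue_cons lebesgue_cons_sigma_finite.
End cons_measure.

Fixpoint lebesgue_tuple n : {sigma_finite_measure set (n.-tuple R) -> \bar R} :=
  match n with
  | 0 => dirac [tuple]
  | n'.+1 => lebesgue_cons (lebesgue_tuple n')
  end.

Definition rV_of_tuple n (t : n.-tuple R) : 'rV[R]_n := \row_k tnth t k.

End lebesgue_tuple.

(* A manifold of dimension n is given by a smooth atlas; [coord c] and
   [param c] are only meaningful on [dom c] and [img c]. *)
Record manifold (R : realType) (n : nat) (M : ptopologicalType) := Manifold {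
  chart : Type;
  dom : chart -> set M;
  coord : chart -> M -> 'rV[R]_n;
  param : chart -> 'rV[R]_n -> M;
  chart_at : M -> chart;
  img := fun c => coord c @` dom c;
  transition := fun c d => coord d \o param c;
  _ : hausdorff_space M;
  _ : @second_countable M;
  _ : forall x, dom (chart_at x) x;
  _ : forall c, open (dom c);
  _ : forall c, open (img c);
  _ : forall c x, dom c x -> param c (coord c x) = x;
  _ : forall c, {within dom c, continuous (coord c)};
  _ : forall c, {within img c, continuous (param c)};
  _ : forall c d, smooth_on (coord c @` (dom c `&` dom d)) (transition c d)
}.

Section manifold_theory.
Context {R : realType} {n : nat} {M : ptopologicalType} (A : manifold R n M).

Definition smooth (f : M -> R) : Prop :=
  forall c : chart A, smooth_on (img c) (f \o param c).

Definition smooth_cpt (f : M -> R) : Prop :=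
  smooth f /\ exists2 K, compact K & forall x, ~ K x -> f x = 0.

(* C^oo((0,oo) x M) *)
Definition smooth_pos_time (u : R -> M -> R) : Prop :=
  forall c : chart A,
    smooth_on [set p : R * 'rV[R]_n | 0 < p.1 /\ img c p.2]
      (fun p => u p.1 (param c p.2)).

Definition partial (c : chart A) (k : 'I_n) (f : M -> R) (x : M) : R :=
  'D_(delta_mx 0 k) (f \o param c) (coord c x).

(* X c x is the row of components of X(x) in the chart c. *)
Definition vector_field (X : chart A -> M -> 'rV[R]_n) : Prop :=
  forall c d x, dom c x -> dom d x ->
    X d x = X c x *m 'J (transition c d) (coord c x).

Definition smooth_cpt_field (X : chart A -> M -> 'rV[R]_n) : Prop :=
  [/\ vector_field X,
      forall c, smooth_on (img c) (X c \o param c) &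
      exists2 K, compact K & forall c x, dom c x -> ~ K x -> X c x = 0].

End manifold_theory.

(* [metric c x] is the Gram matrix of the coordinate frame of c at x. *)
Record riemannian (R : realType) (n : nat) (M : ptopologicalType) := Riemannian {
  riem_manifold :> manifold R n M;
  metric : chart riem_manifold -> M -> 'M[R]_n;
  _ : forall c, smooth_on (img c) (metric c \o param c);
  _ : forall c x, dom c x -> (metric c x)^T = metric c x;
  _ : forall c x (v : 'rV[R]_n), dom c x -> v != 0 -> 0 < (v *m metric c x *m v^T) 0 0;
  _ : forall c d x, dom c x -> dom d x ->
        let J := 'J (transition c d) (coord c x) in
        metric c x = J *m metric d x *m J^T
}.

Definition borel (M : ptopologicalType) := g_sigma_algebraType (@open M).

Section riemannian_theory.
Context {R : realType} {n : nat} {M : ptopologicalType} (A : riemannian R n M).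
Implicit Types (X Y : chart A -> M -> 'rV[R]_n) (f u : M -> R).

Definition vol_density (c : chart A) (x : M) : R := Num.sqrt (\det (metric c x)).

Definition inner X Y (x : M) : R :=
  let c := chart_at A x in (X c x *m metric c x *m (Y c x)^T) 0 0.

Definition grad f : chart A -> M -> 'rV[R]_n := fun c x =>
  (\row_k partial c k f x) *m invmx (metric c x).

Definition div X (x : M) : R :=
  let c := chart_at A x in
  (vol_density c x)^-1 *
  \sum_(k < n) partial c k (fun y => vol_density c y * X c y 0 k) x.

(* In every chart, vol_g has density sqrt(det g) with respect to Lebesgue
   measure; this determines vol_g on Borel sets. *)
Definition is_riemannian_measure (vol : set (borel M) -> \bar R) : Prop :=
  forall (c : chart A) (B : set (borel M)), measurable B -> B `<=` dom c ->
    vol B = (\int[lebesgue_tuple n]_(t in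
               [set t | (coord c @` B) (rV_of_tuple t)])
               (vol_density c (param c (rV_of_tuple t)))%:E)%E.

End riemannian_theory.
Arguments grad {R n M} A f.

Record weighted (R : realType) (n : nat) (M : ptopologicalType) := Weighted {
  wt_riemannian :> riemannian R n M;
  vol : {measure set (borel M) -> \bar R};
  weight : M -> R;
  mu : {measure set (borel M) -> \bar R};
  _ : is_riemannian_measure wt_riemannian vol;
  _ : smooth wt_riemannian weight;
  _ : forall x, 0 < weight x;
  _ : forall B : set (borel M), measurable B ->
        mu B = (\int[vol]_(x in B) (weight x)%:E)%E
}.

Section weighted_theory.
Context {R : realType} {n : nat} {M : ptopologicalType} (A : weighted R n M).
Implicit Types (f h u w rho V : M -> R) (X Y : chart A -> M -> 'rV[R]_n).

Definition laplacian u (x : M) : R :=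
  (weight A x)^-1 * div (fun c y => weight A y *: grad A u c y) x.

Definition schrodinger rho V u (x : M) : R :=
  (rho x)^-1 * laplacian u x - (rho x)^-1 * V x * u x.

(* Elements of L^2(M, w mu) are represented by Borel functions. *)
Definition L2 w f : Prop :=
  measurable_fun [set: borel M] f /\
  (\int[mu A]_x ((f x) ^+ 2 * w x)%:E < +oo)%E.

Definition L2dot w f h : R := \int[mu A]_x (f x * h x * w x).

Definition L2norm w f : \bar R := sqrte (\int[mu A]_x ((f x) ^+ 2 * w x)%:E)%E.

(* X is the distributional gradient of f, with |X| in L^2(M, mu). *)
Definition L2_gradient f X : Prop :=
  [/\ vector_field X,
      forall c k, measurable_fun (dom c : set (borel M)) (fun x => X c x 0 k),
      (\int[mu A]_x (inner X X x)%:E < +oo)%E &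
      forall Y, smooth_cpt_field Y ->
        \int[vol A]_x inner X Y x = - \int[vol A]_x (f x * div Y x)].

Definition wgrad f : chart A -> M -> 'rV[R]_n :=
  xget (fun _ _ => 0) [set X | L2_gradient f X].

Definition W1 w f : Prop := L2 w f /\ exists X, L2_gradient f X.

Definition W1norm w f : \bar R :=
  sqrte (\int[mu A]_x (inner (wgrad f) (wgrad f) x)%:E +
         \int[mu A]_x ((f x) ^+ 2 * w x)%:E)%E.

Definition W10 w f : Prop :=
  W1 w f /\
  forall e : R, 0 < e -> exists2 eta, smooth_cpt A eta &
    (W1norm w (fun x => f x - eta x)%R < e%:E)%E.

Definition Qform V f h : R :=
  \int[mu A]_x inner (wgrad f) (wgrad h) x + \int[mu A]_x (f x * h x * V x).

(* The graph of L_{rho,V}: f is in its domain and L_{rho,V} f = u. *)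
Definition Lop rho V f u : Prop :=
  let w := fun x => rho x + V x in
  [/\ W10 w f, L2 rho u &
      forall h, W10 w h -> Qform V f h = - L2dot rho u h].

Definition is_resolvent rho V (G : R -> (M -> R) -> M -> R) : Prop :=
  forall alpha f, 0 < alpha -> L2 rho f ->
    exists2 u, Lop rho V (G alpha f) u &
      \forall x \ae mu A, alpha * G alpha f x - u x = f x.

(* e^{t L_{rho,V}}: the strongly continuous semigroup on L^2(M, rho mu) whose
   generator is L_{rho,V}. *)
Record is_semigroup rho V (T : R -> (M -> R) -> M -> R) : Prop := IsSemigroup {
  semigroup_L2 : forall t f, 0 <= t -> L2 rho f -> L2 rho (T t f);
  semigroup_linear : forall t a f h, 0 <= t -> L2 rho f -> L2 rho h ->
    \forall x \ae mu A, T t (fun y => a * f y + h y) x = a * T t f x + T t h x;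
  semigroup_bounded : forall t, 0 <= t -> exists C : R, forall f, L2 rho f ->
    (L2norm rho (T t f) <= C%:E * L2norm rho f)%E;
  semigroup0 : forall f, L2 rho f -> \forall x \ae mu A, T 0 f x = f x;
  semigroupD : forall s t f, 0 <= s -> 0 <= t -> L2 rho f ->
    \forall x \ae mu A, T (s + t) f x = T s (T t f) x;
  semigroup_continuous : forall f, L2 rho f ->
    L2norm rho (fun x => T t f x - f x) @[t --> 0^'+] --> 0%E;
  semigroup_generator : forall f u, L2 rho f -> L2 rho u ->
    (L2norm rho (fun x => t^-1 * (T t f x - f x) - u x) @[t --> 0^'+] --> 0%E)
    <-> Lop rho V f u
}.

(* The L^2(M, rho mu)-valued integral of s |-> T s f over [0, t]; the integrand
   is strongly continuous, so weak, Bochner and Riemann integrals agree. *)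
Definition time_integral rho (T : R -> (M -> R) -> M -> R) (t : R) f : M -> R :=
  xget (cst 0) [set u | L2 rho u /\ forall h, L2 rho h ->
    L2dot rho u h = \int[lebesgue_measure]_(s in `[0, t]) L2dot rho (T s f) h].

(* F is a version of the extension of T to L^+(M), applied to f. *)
Definition Lplus_ext rho (T : (M -> R) -> M -> R) (f F : M -> \bar R) : Prop :=
  exists fk : nat -> M -> R,
    [/\ forall k, L2 rho (fk k),
        forall k, \forall x \ae mu A, 0 <= fk k x <= fk k.+1 x,
        \forall x \ae mu A, (fk k x)%:E @[k --> \oo] --> f x &
        \forall x \ae mu A, (T (fk k) x)%:E @[k --> \oo] --> F x].

Definition is_H rho V (T : R -> (M -> R) -> M -> R) (H : R -> M -> R) : Prop :=
  smooth_pos_time A H /\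
  forall t, 0 < t -> exists F1 F2 : M -> \bar R,
    [/\ Lplus_ext rho (T t) (cst 1%E) F1,
        Lplus_ext rho (time_integral rho T t) (fun x => (V x / rho x)%:E) F2 &
        \forall x \ae mu A, (H t x)%:E = (F1 x + F2 x)%E].

Definition is_N rho V (G : R -> (M -> R) -> M -> R) (N : R -> M -> R) : Prop :=
  forall alpha, 0 < alpha ->
  smooth A (N alpha) /\
  exists F1 F2 : M -> \bar R,
    [/\ Lplus_ext rho (G alpha) (cst 1%E) F1,
        Lplus_ext rho (G alpha) (fun x => (V x / rho x)%:E) F2 &
        \forall x \ae mu A, (N alpha x)%:E = (alpha%:E * F1 x + F2 x)%E].

Definition nontrivial (f : M -> R) : Prop := exists x, f x != 0.

Definition nontrivial_pos_time (u : R -> M -> R) : Prop :=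
  exists t, 0 < t /\ nontrivial (u t).

Definition bounded (f : M -> R) : Prop := exists C : R, forall x, `|f x| <= C.

(* C_b([0,oo) x M) *)
Definition bounded_continuous (u : R -> M -> R) : Prop :=
  {within [set p : R * M | 0 <= p.1], continuous (fun p => u p.1 p.2)} /\
  exists C : R, forall t x, 0 <= t -> `|u t x| <= C.

(* (d/dt - L_{rho,V}) u *)
Definition heat_op rho V (u : R -> M -> R) (t : R) (x : M) : R :=
  derive1 (u ^~ x) t - schrodinger rho V (u t) x.

End weighted_theory.

(* Main.v *)
(** (i) => (v) => (vi) => (ii) for every alpha, (ii) for some alpha => (i), and (ii) => (iii) =>
    (iv) => (ii) for each fixed alpha.

    Let theta_k be test functions with 0 <= theta_k <= 1 and theta_k -> 1. Symmetry, positivity and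
    the Markov property give, for phi in L^2(rho mu) with phi rho in L^1(mu), int H_t phi rho dmu =
    lim_k (<theta_k, T_t phi> + <theta_k V/rho, int_0^t T_s phi ds>), and similarly for N_alpha;
    this duality replaces the L^+-extensions. For test functions phi it yields the equations
    satisfied by H and N_alpha, first weakly and then pointwise, as well as a bound H_t >= tau - C t
    (tau a cut-off) that makes 1 - H vanish continuously at t = 0. Squares of solutions are
    nonnegative subsolutions.

    Subsolutions are compared with N_alpha by an elliptic principle: if f is in the domain of L, s
    >= 0 is smooth and (alpha - L) f <= (alpha - L) s, then f <= s. A parabolic subsolution u enters
    it through int_eps^b e^(-alpha t) u_t dt, with eps -> 0. If H = 1, then pairing T_t G phi - G
    phi = int_0^t T_s (alpha G phi - phi) ds with 1 gives int (1 - N) (int_0^t T_s phi ds) rho dmu =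
    0 for all t, so N = 1.

    Symmetry and the Markov property of T_t are inherited from the resolvent through the exponential
    formula T_t = lim_n (1 - (t/n) L)^-n. *)

From HB Require Import structures.
Require Import Defs.
From mathcomp Require Import all_boot all_order all_algebra.
From mathcomp Require Import all_classical all_reals all_analysis.
From mathcomp Require Import measurable_realfun ring lra.
Set Implicit Arguments.
Unset Strict Implicit.
Unset Printing Implicit Defensive.
Import Order.TTheory GRing.Theory Num.Theory.
Import numFieldNormedType.Exports.
Local Open Scope classical_set_scope.
Local Open Scope ring_scope.

(** * Smooth functions on normed spaces *)

(** The hypotheses contain little analysis. [T] and [G] act on functions up to null sets, and each
    [T t] is only assumed bounded; positivity, symmetry and contractivity have to be derived. The
    only regularity at hand is that [H] and [N] have smooth versions, so every equation is obtained
    by pairing with test functions and moving derivatives across by Green's formula, without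
    elliptic or parabolic regularity theory. M need not be complete, so nothing controls functions
    at infinity; the comparison principle exploits instead that elements of the form domain are
    limits of test functions. Hence only functions in the domain of L can be bounded above by a
    supersolution, which is why [N] is always reached through resolvents of cut-offs and why no
    comparison principle for the heat equation is used: a Laplace transform in time turns a
    parabolic subsolution into an elliptic inequality. Starting the time integral at eps > 0 keeps
    it where u is smooth, at the price of an error at most u_eps, which disappears because u_0 =
    0. *)

Section derive_basics.
Context {R : realType} {E : normedModType R}.
Implicit Types (U : set E) (x v : E).

Lemma line_growth_rate {F : normedModType R} (f : E -> F) x v (s : R) :
  (fun h : R => h^-1 *: (((fun t : R => f (x + t *: v)) \o shift s) (h *: 1) - f (x + s *: v)))
  = (fun h : R => h^-1 *: ((f \o shift (x + s *: v)) (h *: v) - f (x + s *: v))).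
Proof.
apply/funext => h /=; congr (_ *: (f _ - _)).
by rewrite [_%:A]mulr1 scalerDl addrCA.
Qed.

Lemma derivable_line {F : normedModType R} (f : E -> F) x v (s : R) :
  derivable (fun t : R => f (x + t *: v)) s 1 <-> derivable f (x + s *: v) v.
Proof. by rewrite /derivable line_growth_rate. Qed.

Lemma derive_line {F : normedModType R} (f : E -> F) x v (s : R) :
  'D_1 (fun t : R => f (x + t *: v)) s = 'D_v f (x + s *: v).
Proof. by rewrite /derive line_growth_rate. Qed.

Lemma derivable_line0 {F : normedModType R} (f : E -> F) x v :
  derivable (fun t : R => f (x + t *: v)) 0 1 <-> derivable f x v.
Proof. by have := derivable_line f x v 0; rewrite scale0r addr0. Qed.

Lemma derive_line0 {F : normedModType R} (f : E -> F) x v :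
  'D_1 (fun t : R => f (x + t *: v)) 0 = 'D_v f x.
Proof. by have := derive_line f x v 0; rewrite scale0r addr0. Qed.

Lemma derivable_comp1 (h : R -> R) (f : E -> R) x v :
  derivable f x v -> derivable h (f x) 1 -> derivable (h \o f) x v.
Proof.
move=> /(derivable_line0 f x v).2 df dh; apply: (derivable_line0 (h \o f) x v).1.
have -> : (fun t : R => (h \o f) (x + t *: v)) = h \o (fun t => f (x + t *: v)) by [].
apply: (derivable1_diffP _ _).2; apply: differentiable_comp.
  exact: (derivable1_diffP _ _).1 df.
by rewrite scale0r addr0; exact: (derivable1_diffP _ _).1 dh.
Qed.

Lemma derive_comp1 (h : R -> R) (f : E -> R) x v :
  derivable f x v -> derivable h (f x) 1 ->
  'D_v (h \o f) x = 'D_1 h (f x) * 'D_v f x.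
Proof.
move=> /(derivable_line0 f x v).2 df dh.
rewrite -(derive_line0 (h \o f)) -(derive_line0 f).
have -> : (fun t : R => (h \o f) (x + t *: v)) = h \o (fun t => f (x + t *: v)) by [].
have := @derive1_comp R (fun t => f (x + t *: v)) h 0 df.
by rewrite scale0r addr0 !derive1E; apply.
Qed.

Lemma MVT_dir (f : E -> R) x v :
  (forall s : R, 0 <= s <= 1 -> derivable f (x + s *: v) v) ->
  exists2 s : R, 0 <= s <= 1 & f (x + v) - f x = 'D_v f (x + s *: v).
Proof.
move=> df.
have [|||s + sE] := @MVT _ (fun s : R => f (x + s *: v))
    (fun s => 'D_v f (x + s *: v)) 0 1.
- exact: ltr01.
- move=> s; rewrite in_itv /= => /andP[s0 s1]; split; last exact: derive_line.
  by apply: (derivable_line f x v s).2; apply: df; rewrite !ltW.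
- apply: derivable_within_continuous => s; rewrite in_itv /= => s01.
  by apply: (derivable_line f x v s).2; exact: df.
- rewrite in_itv /= => /andP[s0 s1]; exists s; first by rewrite !ltW.
  by move: sE; rewrite scale1r scale0r addr0 subr0 mulr1.
Qed.

Lemma deriveZdir {F : normedModType R} (f : E -> F) x v (k : R) :
  derivable f x v -> derivable f x (k *: v) /\ 'D_(k *: v) f x = k *: 'D_v f x.
Proof.
have [->|k0] := eqVneq k 0; first by rewrite !scale0r derive0; split => //; exact: derivable0.
move=> /cvg_ex[/= l fl].
suff H : h^-1 *: ((f \o shift x) (h *: (k *: v)) - f x) @[h --> 0^'] --> k *: l.
  split; first by apply/cvg_ex; exists (k *: l).
  by rewrite /derive (cvg_lim _ H)// (cvg_lim _ fl).
have -> : (fun h : R => h^-1 *: ((f \o shift x) (h *: (k *: v)) - f x)) =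
   k *: (fun h : R => (k * h)^-1 *: ((f \o shift x) ((k * h) *: v) - f x)).
  apply/funext => h; rewrite [RHS]/= !fctE/= !scalerA.
  by rewrite (mulrC h k) invfM mulrA divff// mul1r.
apply: cvgZr.
apply: cvg_trans fl; apply: (cvg_comp (fun h => k * h) (fun h : R => h^-1 *: ((f \o shift x) (h *: v) - f x))); last exact: cvg_id.
move=> A /= [e /= e0 eA].
exists (e / `|k|) => /=; first by rewrite divr_gt0// normr_gt0.
move=> h; rewrite /ball_ /= sub0r normrN ltr_pdivlMr ?normr_gt0// => hk h0.
apply: eA; rewrite /= ?mulf_neq0// sub0r normrN normrM mulrC //.
Qed.

End derive_basics.

Section smooth_def.
Context {R : realType} {E : normedModType R}.
Implicit Types (U : set E) (x v : E).

Lemma iterD_rcons {F : normedModType R} (f : E -> F) s v : Defs.iterD (rcons s v) f = Defs.iterD s ('D_v f).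
Proof. by rewrite /Defs.iterD foldr_rcons. Qed.

(** A finite order of differentiability is the induction measure for the closure properties: the
    derivative of a sum, product or composite is built from functions of one order less, whereas
    [smooth_on] quantifies over lists of directions and offers no such induction. *)
Fixpoint Ck {F : normedModType R} n U (f : E -> F) : Prop :=
  (forall x, U x -> {for x, continuous f}) /\
  match n with
  | 0 => True
  | m.+1 => (forall x v, U x -> derivable f x v) /\ forall v, Ck m U ('D_v f)
  end.

Lemma smooth_onP {F : normedModType R} U (f : E -> F) :
  smooth_on U f <-> [/\ (forall x, U x -> {for x, continuous f}),
     (forall x v, U x -> derivable f x v) & forall v, smooth_on U ('D_v f)].
Proof.
split=> [sf|[cf df sf] s].
  split=> [x /(sf [::])[]//|x v /(sf [::])[]//|v s x Ux].
  by rewrite -iterD_rcons; exact: sf.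
case/lastP: s => [|s v] x Ux; first by split; [exact: cf|move=> v; exact: df].
by rewrite iterD_rcons; exact: sf.
Qed.

Lemma smooth_Ck {F : normedModType R} U (f : E -> F) : smooth_on U f <-> forall n, Ck n U f.
Proof.
split=> [sf n|].
  elim: n f sf => [|n ih] f /smooth_onP[cf df sf]; first by split.
  by split => //; split => // v; exact: ih.
move=> sf s; elim/last_ind: s f sf => [|s v ih] f sf x Ux.
  by case: (sf 1%N) => cf [df _]; split; [exact: cf|move=> v; exact: df].
by rewrite iterD_rcons; apply: ih => // n; have [_ [_]] := sf n.+1; exact.
Qed.

(* The inductive wrapper keeps unification from unfolding the quantifiers of smooth_on. *)
Inductive Smooth {F : normedModType R} U (f : E -> F) : Prop :=
  SmoothI of smooth_on U f.

Lemma SmoothE {F : normedModType R} U (f : E -> F) : Smooth U f <-> smooth_on U f.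
Proof. by split=> [[]|]. Qed.

Lemma Smooth_Ck {F : normedModType R} U (f : E -> F) : Smooth U f <-> forall n, Ck n U f.
Proof. by rewrite SmoothE smooth_Ck. Qed.

Lemma SmoothP {F : normedModType R} U (f : E -> F) :
  Smooth U f <-> [/\ (forall x, U x -> {for x, continuous f}),
     (forall x v, U x -> derivable f x v) & forall v, Smooth U ('D_v f)].
Proof.
rewrite SmoothE smooth_onP; split=> -[cf df sf]; split=> // v; exact/SmoothE.
Qed.

End smooth_def.

Section smooth_calculus.
Context {R : realType} {E : normedModType R}.
Implicit Types (U : set E) (x v : E).

Lemma CkW {F : normedModType R} n U (f : E -> F) : Ck n.+1 U f -> Ck n U f.
Proof.
elim: n f => [|n ih] f; first by case=> cf _; split.
by move=> [cf [df sf]]; split => //; split => // v; exact: ih.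
Qed.

Lemma derive_eq_on {F : normedModType R} U (f g : E -> F) v x : open U ->
  (forall y, U y -> f y = g y) -> U x -> 'D_v f x = 'D_v g x.
Proof.
move=> oU fg Ux; apply: near_eq_derive.
by apply: filterS (open_nbhs_nbhs (conj oU Ux)).
Qed.

Lemma derivable_eq_on {F : normedModType R} U (f g : E -> F) v x : open U ->
  (forall y, U y -> f y = g y) -> U x -> derivable f x v -> derivable g x v.
Proof.
move=> oU fg Ux; apply: near_eq_derivable.
by apply: filterS (open_nbhs_nbhs (conj oU Ux)).
Qed.

Lemma continuous_eq_on {T : topologicalType} {F : topologicalType} (U : set T) (f g : T -> F) (x : T) : open U ->
  (forall y, U y -> f y = g y) -> U x -> {for x, continuous f} ->
  {for x, continuous g}.
Proof.
move=> oU fg Ux cf; rewrite /prop_for /continuous_at -fg//.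
apply: cvg_trans cf; apply: near_eq_cvg.
by apply: filterS (open_nbhs_nbhs (conj oU Ux)) => y Uy; rewrite fg.
Qed.

Lemma Ck_eq {F : normedModType R} n U (f g : E -> F) : open U ->
  (forall y, U y -> f y = g y) -> Ck n U f -> Ck n U g.
Proof.
move=> oU; elim: n f g => [|n ih] f g fg [cf]; first by move=> _; split=> // x Ux; exact: (continuous_eq_on oU fg Ux (cf x Ux)).
move=> [df sf]; split.
  by move=> x Ux; exact: (continuous_eq_on oU fg Ux (cf x Ux)).
split=> [x v Ux|v].
  exact: (derivable_eq_on oU fg Ux (df x v Ux)).
by apply: ih (sf v) => y Uy; exact: derive_eq_on fg Uy.
Qed.

Lemma Smooth_eq {F : normedModType R} U (f g : E -> F) : open U ->
  (forall y, U y -> f y = g y) -> Smooth U f -> Smooth U g.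
Proof. by move=> oU fg /Smooth_Ck sf; apply/Smooth_Ck => n; exact: Ck_eq fg _. Qed.

Lemma Smooth_subset {F : normedModType R} U U' (f : E -> F) : U' `<=` U ->
  Smooth U f -> Smooth U' f.
Proof. by move=> sU [sf]; split=> s x /sU; exact: sf. Qed.

Lemma SmoothU {F : normedModType R} U U' (f : E -> F) :
  Smooth U f -> Smooth U' f -> Smooth (U `|` U') f.
Proof. by move=> [sf] [sf']; split=> s x []; [exact: sf|exact: sf']. Qed.

Lemma Smooth_cont {F : normedModType R} U (f : E -> F) x :
  Smooth U f -> U x -> {for x, continuous f}.
Proof. by move=> /SmoothP[+ _ _]; exact. Qed.

Lemma Smooth_derivable {F : normedModType R} U (f : E -> F) x v :
  Smooth U f -> U x -> derivable f x v.
Proof. by move=> /SmoothP[_ + _] Ux; exact. Qed.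

Lemma Smooth_derive {F : normedModType R} U (f : E -> F) v :
  Smooth U f -> Smooth U ('D_v f).
Proof. by move=> /SmoothP[_ _]; exact. Qed.

Lemma Ck_cst {F : normedModType R} n U (a : F) : Ck n U (cst a).
Proof.
elim: n a => [|n ih] a; split=> //; try by move=> x _; exact: cst_continuous.
split=> [x v _|v]; first exact: derivable_cst.
rewrite (_ : 'D_v (cst a) = cst 0); first exact: ih.
by apply/funext => x; rewrite derive_cst.
Qed.

Lemma Smooth_cst {F : normedModType R} U (a : F) : Smooth U (fun=> a).
Proof. by apply/Smooth_Ck => n; exact: Ck_cst. Qed.

Lemma CkD {F : normedModType R} n U (f g : E -> F) : open U -> Ck n U f -> Ck n U g -> Ck n U (f + g).
Proof.
move=> oU; elim: n f g => [|n ih] f g [cf +] [cg +] => [_ _|[df sf] [dg sg]].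
  by split=> // x Ux; apply: continuousD; [exact: cf|exact: cg].
split; first by move=> x Ux; apply: continuousD; [exact: cf|exact: cg].
split=> [x v Ux|v]; first by apply: derivableD; [exact: df|exact: dg].
apply: Ck_eq (ih _ _ (sf v) (sg v)) => // y Uy.
by rewrite deriveD//; [exact: df|exact: dg].
Qed.

Lemma CkM n U (f g : E -> R) : open U -> Ck n U f -> Ck n U g -> Ck n U (f * g).
Proof.
move=> oU; elim: n f g => [|n ih] f g [cf +] [cg +] => [_ _|[df sf] [dg sg]].
  by split=> // x Ux; apply: continuousM; [exact: cf|exact: cg].
have ccf : Ck n U f by apply: CkW; split.
have ccg : Ck n U g by apply: CkW; split.
split; first by move=> x Ux; apply: continuousM; [exact: cf|exact: cg].
split=> [x v Ux|v]; first by apply: derivableM; [exact: df|exact: dg].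
apply: Ck_eq (CkD oU (ih _ _ ccf (sg v)) (ih _ _ ccg (sf v))) => // y Uy.
by rewrite deriveM//; [exact: df|exact: dg].
Qed.

End smooth_calculus.

Section smooth_calculus2.
Context {R : realType} {E : normedModType R}.
Implicit Types (U : set E) (x v : E).

(** The outer function stays fully smooth, so the induction hypothesis applies to its derivative;
    only [f] loses an order. *)
Lemma Ck_comp1 n (W : set R) (U : set E) (h : R -> R) (f : E -> R) : open U ->
  (forall x, U x -> W (f x)) ->
  Smooth W h -> Ck n U f -> Ck n U (h \o f).
Proof.
move=> oU fW; elim: n h f fW => [|n ih] h f fW sh [cf +] => [_|[df sf]].
  by split=> // x Ux; apply: continuous_comp; [exact: cf|exact: (Smooth_cont sh (fW _ Ux))].
split.
  move=> x Ux; apply: continuous_comp; first exact: cf.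
  exact: (Smooth_cont sh (fW _ Ux)).
split=> [x v Ux|v].
  by apply: derivable_comp1; [exact: df|exact: (Smooth_derivable sh (fW x Ux))].
have ccf : Ck n U f by apply: CkW; split.
have sh' : Smooth W ('D_1 h) by apply: Smooth_derive.
apply: (Ck_eq oU _ (CkM oU (ih _ f fW sh' ccf) (sf v))) => y Uy.
rewrite derive_comp1//; [exact: df|exact: (Smooth_derivable sh (fW y Uy))].
Qed.

Lemma SmoothD {F : normedModType R} U (f g : E -> F) : open U ->
  Smooth U f -> Smooth U g -> Smooth U (fun x => f x + g x).
Proof.
by move=> oU /Smooth_Ck sf /Smooth_Ck sg; apply/Smooth_Ck => n; exact: CkD.
Qed.

Lemma SmoothM U (f g : E -> R) : open U ->
  Smooth U f -> Smooth U g -> Smooth U (fun x => f x * g x).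
Proof.
by move=> oU /Smooth_Ck sf /Smooth_Ck sg; apply/Smooth_Ck => n; exact: CkM.
Qed.

Lemma SmoothN U (f : E -> R) : open U -> Smooth U f -> Smooth U (fun x => - f x).
Proof.
move=> oU sf; rewrite (_ : (fun x => - f x) = (fun x => -1 * f x)).
  by apply: SmoothM => //; exact: Smooth_cst.
by apply/funext => x; rewrite mulN1r.
Qed.

Lemma SmoothB U (f g : E -> R) : open U ->
  Smooth U f -> Smooth U g -> Smooth U (fun x => f x - g x).
Proof. by move=> oU sf sg; apply: SmoothD => //; exact: SmoothN. Qed.

Lemma Smooth_sum I (r : seq I) (P : pred I) U (f : I -> E -> R) : open U ->
  (forall i, P i -> Smooth U (f i)) -> Smooth U (fun x => \sum_(i <- r | P i) f i x).
Proof.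
move=> oU sf; rewrite (_ : (fun x => _) = \sum_(i <- r | P i) f i); last first.
  by apply/funext => x; rewrite fct_sumE.
apply: (@big_ind _ (fun h : E -> R => Smooth U h)) => [|g h|]; [exact: Smooth_cst|exact: SmoothD|exact: sf].
Qed.

Lemma Smooth_prod I (r : seq I) (P : pred I) U (f : I -> E -> R) : open U ->
  (forall i, P i -> Smooth U (f i)) -> Smooth U (fun x => \prod_(i <- r | P i) f i x).
Proof.
move=> oU sf; rewrite (_ : (fun x => _) = \prod_(i <- r | P i) f i); last first.
  by apply/funext => x; rewrite fct_prodE.
apply: (@big_ind _ (fun h : E -> R => Smooth U h)) => [|g h|]; [exact: Smooth_cst|exact: SmoothM|exact: sf].
Qed.

Lemma Smooth_comp1 (W : set R) (U : set E) (h : R -> R) (f : E -> R) : open U ->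
  (forall x, U x -> W (f x)) ->
  Smooth W h -> Smooth U f -> Smooth U (fun x => h (f x)).
Proof.
by move=> oU fW sh /Smooth_Ck sf; apply/Smooth_Ck => n; exact: Ck_comp1 fW sh (sf n).
Qed.

(** Induction on the order stays inside the family [P], since each derivative agrees on U with
    another member. This serves explicit families such as p(1/s) exp(-1/s) and the time slices of
    smooth functions. *)
Lemma Smooth_derive_family {F : normedModType R} U (P : (E -> F) -> Prop) : open U ->
  (forall f, P f -> [/\ forall x, U x -> {for x, continuous f},
      forall x v, U x -> derivable f x v &
      forall v, exists2 g, P g & forall x, U x -> g x = 'D_v f x]) ->
  forall f, P f -> Smooth U f.
Proof.
move=> oU HP f Pf; apply/Smooth_Ck => n.
elim: n f Pf => [|n ih] f /HP[cf df gf]; first by split.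
split=> //; split=> // v; have [g Pg gE] := gf v.
exact: Ck_eq gE (ih _ Pg).
Qed.

Lemma Smooth_linear {F : normedModType R} U (f : {linear E -> F}) : open U -> continuous f -> Smooth U f.
Proof.
move=> oU cf; apply/SmoothP; split=> [x _|x v _|v].
- exact: cf.
- exact/diff_derivable/linear_differentiable.
- apply: Smooth_eq (Smooth_cst U (f v)) => // y Uy.
  by rewrite deriveE ?diff_lin//; exact: linear_differentiable.
Qed.

End smooth_calculus2.

Section mx_smooth.
Context {R : realType} {E : normedModType R}.
Implicit Types (U : set E).

Lemma mx_cvgP {T : Type} {F : set_system T} {FF : Filter F} m n (f : T -> 'M[R]_(m, n)) (l : 'M[R]_(m, n)) :
  f @ F --> l <-> forall i j, (fun x => f x i j) @ F --> l i j.
Proof.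
split=> [fl i j|fl].
  apply/cvgrPdist_le => e e0; move/cvgrPdist_le : fl => /(_ e e0).
  apply: filterS => x; apply: le_trans.
  rewrite [leRHS]/Num.Def.normr/= mx_normrE.
  by apply: le_trans (le_bigmax _ _ (i, j)); rewrite !mxE.
apply/cvgrPdist_le => e e0.
have : \forall x \near F, forall ij : 'I_m * 'I_n, `|l ij.1 ij.2 - f x ij.1 ij.2| <= e.
  apply: filter_forall => -[i j] /=.
  by move/cvgrPdist_le : (fl i j); exact.
apply: filterS => x xe.
rewrite [leLHS]/Num.Def.normr/= mx_normrE (bigmax_le _ (ltW e0))//= => ij _.
by rewrite !mxE.
Qed.

Lemma Smooth_mxP m n U (f : E -> 'M[R]_(m, n)) : open U ->
  Smooth U f <-> forall i j, Smooth U (fun x => f x i j).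
Proof.
move=> oU; split=> [/Smooth_Ck sf i j|sf]; apply/Smooth_Ck => k.
  have {sf} := sf k; elim: k f => [|k ih] f [cf sf].
    by split=> // x Ux; apply: (mx_cvgP f _).1; exact: cf.
  case: sf => df sf; split; first by move=> x Ux; apply: (mx_cvgP f _).1; exact: cf.
  split=> [x v Ux|v]; first by apply: (derivable_mxP f x v).1; exact: df.
  apply: Ck_eq (ih _ (sf v)) => // y Uy.
  by rewrite derive_mx ?mxE//; exact: df.
have {sf} sf i j : Ck k U (fun x => f x i j) by apply: (Smooth_Ck _ _).1 k; exact: sf.
elim: k f sf => [|k ih] f sf.
  by split=> // x Ux; apply/mx_cvgP => i j; case: (sf i j) => + _; exact.
split; first by move=> x Ux; apply/mx_cvgP => i j; case: (sf i j) => + _; exact.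
have df x v : U x -> derivable f x v.
  by move=> Ux; apply/derivable_mxP => i j; case: (sf i j) => _ [+ _]; exact.
split=> [x v Ux|v]; first exact: df.
apply: ih => i j; case: (sf i j) => _ [_ /(_ v)].
by apply: Ck_eq => // y Uy; rewrite derive_mx ?mxE//; exact: df.
Qed.

Lemma Smooth_mx_entry m n U (f : E -> 'M[R]_(m, n)) i j : open U ->
  Smooth U f -> Smooth U (fun x => f x i j).
Proof. by move=> oU /(Smooth_mxP _ oU). Qed.

Lemma Smooth_mulmx m n p U (f : E -> 'M[R]_(m, n)) (g : E -> 'M[R]_(n, p)) : open U ->
  Smooth U f -> Smooth U g -> Smooth U (fun x => f x *m g x).
Proof.
move=> oU /(Smooth_mxP _ oU) sf /(Smooth_mxP _ oU) sg.
apply/(Smooth_mxP _ oU) => i j.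
under eq_fun do rewrite mxE.
by apply: Smooth_sum => // k _; exact: SmoothM.
Qed.

Lemma Smooth_scalemx m n U (a : E -> R) (f : E -> 'M[R]_(m, n)) : open U ->
  Smooth U a -> Smooth U f -> Smooth U (fun x => a x *: f x).
Proof.
move=> oU sa /(Smooth_mxP _ oU) sf.
by apply/(Smooth_mxP _ oU) => i j; under eq_fun do rewrite mxE; exact: SmoothM.
Qed.

Lemma Smooth_det n U (f : E -> 'M[R]_n) : open U ->
  Smooth U f -> Smooth U (fun x => \det (f x)).
Proof.
move=> oU /(Smooth_mxP _ oU) sf; rewrite /determinant.
apply: Smooth_sum => // s _; apply: SmoothM => //; first exact: Smooth_cst.
exact: Smooth_prod.
Qed.

End mx_smooth.

(** * Differentiability from continuous directional derivatives *)

Section C1_differentiable.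
Context {R : realType}.

Lemma Smooth_id m (U : set 'rV[R]_m) : open U -> Smooth U id.
Proof.
move=> oU; apply: (@Smooth_linear _ _ _ U idfun) => //.
by move=> x; exact: cvg_id.
Qed.

Lemma Smooth_coord m (U : set 'rV[R]_m) k : open U -> Smooth U (fun x : 'rV[R]_m => x 0 k).
Proof. by move=> oU; apply: (Smooth_mx_entry 0 k oU); exact: Smooth_id. Qed.

Lemma mx_entry_le_norm m n (A : 'M[R]_(m, n)) i j : `|A i j| <= `|A|.
Proof.
by rewrite [leRHS]/Num.Def.normr/= mx_normrE; exact: (le_bigmax _ _ (i, j)).
Qed.

Lemma mx_norm_le m n (A : 'M[R]_(m, n)) (c : R) : 0 <= c ->
  (forall i j, `|A i j| <= c) -> `|A| <= c.
Proof.
move=> c0 Ac; rewrite [leLHS]/Num.Def.normr/= mx_normrE.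
by apply: bigmax_le => // -[i j] _ /=.
Qed.

Let trunc m (h : 'rV[R]_m) (k : nat) : 'rV[R]_m := \row_i (if (i < k)%N then h 0 i else 0).

(** The path from x to x + h runs along the coordinate axes through the corners x + [trunc h k],
    with the mean value theorem on each edge. In the sup norm every point of this path stays within
    |h| of x. *)
Lemma C1_increment m (W : set 'rV[R]_m) (f : 'rV[R]_m -> R) (x h : 'rV[R]_m) (e : R) :
  (forall y v, W y -> derivable f y v) ->
  (forall y, `|y - x| <= `|h| -> W y) ->
  (forall y k, `|y - x| <= `|h| ->
     `|'D_(delta_mx 0 k) f y - 'D_(delta_mx 0 k) f x| <= e) ->
  `|f (x + h) - f x - \sum_(k < m) h 0 k * 'D_(delta_mx 0 k) f x| <= m%:R * (e * `|h|).
Proof.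
move=> df xW cf.
have truncS (k : 'I_m) : trunc h k.+1 = trunc h k + h 0 k *: delta_mx 0 k.
  apply/rowP => i; rewrite !mxE eqxx /= ltnS leq_eqVlt.
  case: (eqVneq i k) => [->|ik]; first by rewrite eqxx ltnn add0r mulr1.
  by rewrite (negbTE (_ : i != k :> nat))//= mulr0 addr0.
have -> : f (x + h) - f x = \sum_(k < m) (f (x + trunc h k.+1) - f (x + trunc h k)).
  rewrite -(big_mkord xpredT (fun k => f (x + trunc h k.+1) - f (x + trunc h k))).
  rewrite (telescope_sumr (fun k => f (x + trunc h k)))//.
  by congr (f _ - f _); [congr (_ + _)|rewrite -[LHS]addr0; congr (_ + _)];
     apply/rowP => i; rewrite !mxE ?ltn_ord.
rewrite -sumrB; apply: (le_trans (ler_norm_sum _ _ _)).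
rewrite (_ : m%:R * _ = \sum_(k < m) e * `|h|); last by rewrite sumr_const card_ord mulr_natl.
apply: ler_sum => k _.
have near_x s : 0 <= s <= 1 -> `|x + trunc h k + s *: (h 0 k *: delta_mx 0 k) - x| <= `|h|.
  move=> /andP[s0 s1]; rewrite addrAC [x + _]addrC addrK.
  apply: mx_norm_le => // i j; rewrite !mxE ord1 eqxx /=.
  case: (eqVneq j k) => [->|jk].
    rewrite ltnn add0r mulr1 normrM (ger0_norm s0).
    by apply: le_trans (mx_entry_le_norm h 0 k); rewrite ler_piMl.
  rewrite mulr0 mulr0 addr0; case: ifP => _; first exact: mx_entry_le_norm.
  by rewrite normr0.
have [|s s01] := @MVT_dir R _ f (x + trunc h k) (h 0 k *: delta_mx 0 k).
  by move=> s s01; apply: df; apply: xW; exact: near_x.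
rewrite -addrA -truncS => ->.
have [_ ->] := deriveZdir (h 0 k) (df _ (delta_mx 0 k) (xW _ (near_x s s01))).
rewrite -mulrBr normrM mulrC ler_pM//; last exact: mx_entry_le_norm.
exact/cf/near_x.
Qed.

Lemma C1_differentiable m (W : set 'rV[R]_m) (f : 'rV[R]_m -> R) x : open W ->
  (forall y v, W y -> derivable f y v) ->
  (forall v, {for x, continuous ('D_v f)}) -> W x ->
  differentiable f x /\
  forall v, 'D_v f x = \sum_(k < m) v 0 k * 'D_(delta_mx 0 k) f x.
Proof.
move=> oW df cf Wx.
pose d (v : 'rV[R]_m) := \sum_(k < m) v 0 k * 'D_(delta_mx 0 k) f x.
have dlin : linear d.
  move=> a u v; rewrite /d scaler_sumr -big_split/=; apply: eq_bigr => k _.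
  by rewrite !mxE mulrDl -mulrA.
pose dM := GRing.isLinear.Build _ _ _ _ _ dlin.
pose dL : {linear 'rV[R]_m -> R} := HB.pack d dM.
have cd : continuous dL.
  move=> y; apply: (@Smooth_cont _ _ _ setT d y _ I).
  apply: Smooth_sum => [|k _]; first exact: openT.
  by apply: SmoothM; [exact: openT|apply: Smooth_coord; exact: openT|exact: Smooth_cst].
have dfE : f \o shift x = cst (f x) + dL +o_ 0 id.
  apply/eqaddoP => e e0.
  (* Dividing by m + 1 instead of m covers m = 0 and still leaves m e / (m + 1) <= e. *)
  have e'0 : 0 < e / m.+1%:R by rewrite divr_gt0.
  have H : \forall y \near x, W y /\ forall k : 'I_m, `|'D_(delta_mx 0 k) f y - 'D_(delta_mx 0 k) f x| <= e / m.+1%:R.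
    apply: filterI; first exact: open_nbhs_nbhs.
    apply: (@filter_forall _ _ (fun (k : 'I_m) (y : 'rV[R]_m) => `|'D_(delta_mx 0 k) f y - 'D_(delta_mx 0 k) f x| <= e / m.+1%:R) _ (nbhs_filter x)) => k; have /cvgrPdist_le /(_ _ e'0) := cf (delta_mx 0 k).
    by apply: filterS => y; rewrite distrC.
  have [r /= r0 rH] := (nbhs_ballP _ _).1 H.
  apply/nbhs_ballP; exists r => //= h.
  rewrite -ball_normE /= sub0r normrN => hr.
  have bx y : `|y - x| <= `|h| -> ball x r y.
    by move=> yx; rewrite -ball_normE /= distrC (le_lt_trans yx).
  have := @C1_increment m W f x h (e / m.+1%:R) df
     (fun y yx => (rH y (bx y yx)).1) (fun y k yx => (rH y (bx y yx)).2 k).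
  rewrite /= !fctE/= opprD addrA [h + x]addrC => /le_trans; apply.
  rewrite mulrA ler_wpM2r// [leLHS]mulrC -mulrA ler_piMr ?ltW//.
  by rewrite ltr_pdivrMl// mulr1 ltr_nat.
have dd : 'd f x = dL :> ('rV[R]_m -> R) by exact: diff_unique.
have dif : differentiable f x by apply/diff_locallyP; rewrite dd; split.
by split=> // v; rewrite deriveE// dd.
Qed.

End C1_differentiable.

Section smooth_rV.
Context {R : realType}.

Lemma Smooth_differentiable m (W : set 'rV[R]_m) (f : 'rV[R]_m -> R) x : open W ->
  Smooth W f -> W x -> differentiable f x.
Proof.
move=> oW sf Wx; have [|v|//] := @C1_differentiable R m W f x oW _ _ Wx.
- by move=> y v Wy; exact: (Smooth_derivable sf Wy).
- exact: (Smooth_cont (Smooth_derive v sf) Wx).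
Qed.

Lemma Smooth_deriveE m (W : set 'rV[R]_m) (f : 'rV[R]_m -> R) x v : open W ->
  Smooth W f -> W x -> 'D_v f x = \sum_(k < m) v 0 k * 'D_(delta_mx 0 k) f x.
Proof.
move=> oW sf Wx; have [|u|//] := @C1_differentiable R m W f x oW _ _ Wx.
- by move=> y u Wy; exact: (Smooth_derivable sf Wy).
- exact: (Smooth_cont (Smooth_derive u sf) Wx).
Qed.

Lemma mx_differentiable {E : normedModType R} m n (f : E -> 'M[R]_(m, n)) x :
  (forall i j, differentiable (fun y => f y i j) x) -> differentiable f x.
Proof.
move=> df.
rewrite (_ : f = fun y => \sum_(ij : 'I_m * 'I_n) f y ij.1 ij.2 *: delta_mx ij.1 ij.2); last first.
  by apply/funext => y; rewrite {1}(matrix_sum_delta (f y)) pair_big.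
rewrite (_ : (fun y => _) = \sum_(ij : 'I_m * 'I_n) (fun y => f y ij.1 ij.2 *: delta_mx ij.1 ij.2)); last first.
  by apply/funext => y; rewrite fct_sumE.
apply: (@big_ind _ (fun g : E -> 'M[R]_(m, n) => differentiable g x)) => [|g h dg dh|[i j] _].
- exact: differentiable_cst.
- exact: differentiableD.
- exact: differentiableZl.
Qed.

Lemma Smooth_mx_differentiable m n p (W : set 'rV[R]_m) (f : 'rV[R]_m -> 'M[R]_(n, p)) x : open W ->
  Smooth W f -> W x -> differentiable f x.
Proof.
move=> oW /(Smooth_mxP _ oW) sf Wx; apply: mx_differentiable => i j.
exact: Smooth_differentiable (sf i j) Wx.
Qed.

Lemma derive_comp_curve m (h : 'rV[R]_m -> R) (g : R -> 'rV[R]_m) y :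
  g 0 = y -> derivable g 0 1 -> differentiable h y ->
  derivable (h \o g) 0 1 /\ 'D_1 (h \o g) 0 = 'd h y ('D_1 g 0).
Proof.
move=> <- /(derivable1_diffP _ _).1 dg dh.
have dhg := differentiable_comp dg dh.
split; first exact/derivable1_diffP.
by rewrite (deriveE _ dhg) (deriveE _ dg) (diff_comp dg dh).
Qed.

Lemma derivable_comp_rV {E : normedModType R} m (h : 'rV[R]_m -> R) (f : E -> 'rV[R]_m) x v :
  derivable f x v -> differentiable h (f x) ->
  derivable (h \o f) x v /\ 'D_v (h \o f) x = 'd h (f x) ('D_v f x).
Proof.
move=> df dh.
have df1 : derivable (fun t : R => f (x + t *: v)) 0 1 by apply/derivable_line0.
have g0 : (fun t : R => f (x + t *: v)) 0 = f x by rewrite /= scale0r addr0.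
have [d1 d2] := derive_comp_curve g0 df1 dh.
split; first exact/derivable_line0.
by rewrite -(derive_line0 (h \o f)) -(derive_line0 f); exact: d2.
Qed.

(** The chain rule writes the derivative as the sum over k of D_v f_k times (D_k h) o f. The
    induction runs over all smooth [h] with [f] fixed, so the second factor is covered by the
    hypothesis and the first one is smooth. *)
Lemma Ck_comp_rV {E : normedModType R} n m (W : set 'rV[R]_m) (U : set E)
    (h : 'rV[R]_m -> R) (f : E -> 'rV[R]_m) :
  open U -> open W -> (forall x, U x -> W (f x)) ->
  Smooth W h -> Smooth U f -> Ck n U (h \o f).
Proof.
move=> oU oW fW; elim: n h => [|n ih] h sh sf.
  split=> // x Ux; apply: continuous_comp; first exact: (Smooth_cont sf Ux).
  exact: (Smooth_cont sh (fW x Ux)).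
split.
  move=> x Ux; apply: continuous_comp; first exact: (Smooth_cont sf Ux).
  exact: (Smooth_cont sh (fW x Ux)).
have D x v : U x -> derivable (h \o f) x v /\ 'D_v (h \o f) x =
    \sum_(k < m) 'D_v (fun y => f y 0 k) x * 'D_(delta_mx 0 k) h (f x).
  move=> Ux; have df : derivable f x v by exact: (Smooth_derivable sf Ux).
  have dh : differentiable h (f x) by exact: Smooth_differentiable oW sh (fW x Ux).
  have [d1 d2] := derivable_comp_rV df dh; split=> //.
  rewrite d2 -deriveE// (Smooth_deriveE _ oW sh (fW x Ux)); apply: eq_bigr => k _.
  by congr (_ * _); rewrite derive_mx// mxE.
split=> [x v Ux|v]; first by have [] := D x v Ux.
suff H : Ck n U (\sum_(k < m) (('D_v (fun y => f y 0 k)) * ('D_(delta_mx 0 k) h \o f))).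
  apply: (Ck_eq oU _ H) => y Uy; rewrite (D y v Uy).2 fct_sumE.
  by apply: eq_bigr.
apply: (@big_ind _ (fun g : E -> R => Ck n U g)) => [|g1 g2|k _].
- exact: Ck_cst.
- exact: CkD.
- apply: CkM => //; last exact/ih/sf/Smooth_derive.
  by apply: (Smooth_Ck _ _).1; apply: Smooth_derive; exact: Smooth_mx_entry.
Qed.

Lemma Smooth_comp_rV {E : normedModType R} m (W : set 'rV[R]_m) (U : set E)
    (h : 'rV[R]_m -> R) (f : E -> 'rV[R]_m) :
  open U -> open W -> (forall x, U x -> W (f x)) ->
  Smooth W h -> Smooth U f -> Smooth U (fun x => h (f x)).
Proof. by move=> oU oW fW sh sf; apply/Smooth_Ck => n; exact: Ck_comp_rV oW fW sh sf. Qed.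

End smooth_rV.

(** * Smooth functions of one real variable *)

Section smooth_functions.
Context {R : realType}.
Implicit Types (U : set R).

Lemma open_pos : open [set s : R | 0 < s].
Proof. by have := @open_gt R 0. Qed.

Lemma open_neq0 : open [set s : R | s != 0].
Proof.
have -> : [set s : R | s != 0] = [set s | s < 0] `|` [set s | 0 < s].
  by apply/seteqP; split=> s /=; rewrite neq_lt => /orP.
by apply: openU; [exact: open_lt|exact: open_gt].
Qed.

(** A bootstrap for functions whose derivative is an expression in themselves, such as h' = g h or
    h' = - h^2: order n for [h] gives order n for the derivative, hence order n + 1 for [h]. *)
Lemma Smooth_boot {E : normedModType R} (U : set E) (h : E -> R) : open U ->
  (forall x, U x -> {for x, continuous h}) ->
  (forall x v, U x -> derivable h x v) ->
  (forall n, Ck n U h -> forall v, Ck n U ('D_v h)) -> Smooth U h.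
Proof.
move=> oU ch dh H; apply/Smooth_Ck; elim=> [|n ih]; first by split.
by split=> //; split=> //; exact: H.
Qed.

Lemma derive_R_dir (h : R -> R) (x v : R) : derivable h x 1 ->
  derivable h x v /\ 'D_v h x = v * 'D_1 h x.
Proof. by move=> dh; have := deriveZdir v dh; rewrite [v *: 1]mulr1. Qed.

Lemma Smooth_R_ode U (h g : R -> R) : open U -> Smooth U g ->
  (forall x, U x -> is_derive x 1 h (g x * h x)) -> Smooth U h.
Proof.
move=> oU sg dh.
have d1 x : U x -> derivable h x 1 by move=> /dh[].
apply: Smooth_boot => //.
- by move=> x /d1 /derivable1_diffP /differentiable_continuous.
- by move=> x v /d1 /derive_R_dir-/(_ v)[].
- move=> n Ch v.
  have H : Ck n U (cst v * (g * h)).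
    by apply: CkM => //; [exact: Ck_cst|apply: CkM => //; exact: (Smooth_Ck _ _).1].
  apply: (Ck_eq oU _ H) => x Ux.
  by have [_ ->] := derive_R_dir v (d1 x Ux); have [_ ->] := dh x Ux.
Qed.

Lemma Smooth_expR U : open U -> Smooth U (@expR R).
Proof.
move=> oU; apply: (@Smooth_R_ode _ _ (fun=> 1)) => //; first exact: Smooth_cst.
by move=> x _; rewrite mul1r; exact: is_derive_expR.
Qed.

Lemma Smooth_inv : Smooth [set s : R | s != 0] (@GRing.inv R).
Proof.
have d1 (x : R) : x != 0 -> is_derive x 1 (@GRing.inv R) (- x^-1 * x^-1).
  move=> x0; apply: is_derive_eq; first exact: (@is_deriveV R id x 1 1 x0 (is_derive_id x 1)).
  by rewrite [LHS]mulr1 mulNr -expr2 exprVn.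
apply: Smooth_boot; first exact: open_neq0.
- by move=> x /d1[/derivable1_diffP/differentiable_continuous].
- by move=> x v /d1[/derive_R_dir-/(_ v)[]].
- move=> n Ch v.
  have H : Ck n [set s : R | s != 0] (cst (- v) * (GRing.inv * GRing.inv)).
    by apply: CkM; [exact: open_neq0|exact: Ck_cst|apply: CkM => //; exact: open_neq0].
  apply: (Ck_eq open_neq0 _ H) => x x0; have [dx dE] := d1 x x0.
  have [_ ->] := derive_R_dir v dx; rewrite dE.
  by rewrite !mulNr mulrN.
Qed.

Lemma Smooth_sqrt : Smooth [set s : R | 0 < s] (@Num.sqrt R).
Proof.
(* The square root solves h' = h / (2 x) on the positive half-line. *)
apply: (@Smooth_R_ode _ _ (fun x => 2^-1 * x^-1)); first exact: open_pos.
  apply: SmoothM; [exact: open_pos|exact: Smooth_cst|].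
  by apply: Smooth_subset Smooth_inv => x /= /gt_eqF ->.
move=> x x0; apply: is_derive_eq; first exact: is_derive1_sqrt.
rewrite invfM -mulrA; congr (_ * _).
by rewrite -{2}(sqr_sqrtr (ltW x0)) expr2 invfM mulfVK// sqrtr_eq0 -ltNge.
Qed.

Lemma SmoothV {E : normedModType R} (U : set E) (f : E -> R) : open U ->
  (forall x, U x -> f x != 0) -> Smooth U f -> Smooth U (fun x => (f x)^-1).
Proof. by move=> oU f0 sf; exact: (Smooth_comp1 oU f0 Smooth_inv sf). Qed.

Lemma expR_ge_pow (y : R) n : 0 <= y -> y ^+ n <= n`!%:R * expR y.
Proof.
case: n => [|n] y0.
  by rewrite expr0 fact0 mul1r (le_trans _ (expR_ge1Dx y))// lerDl.
rewrite -ler_pdivrMl ?ltr0n ?fact_gt0// mulrC.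
by apply: le_trans (expR_ge1Dxn n y0); rewrite lerDr.
Qed.

Lemma poly_le_expR (p : {poly R}) : exists2 C, 0 <= C &
  forall y, 0 <= y -> `|p.[y]| <= C * expR y.
Proof.
exists (\sum_(i < size p) `|p`_i| * i`!%:R); first by apply: sumr_ge0 => i _; rewrite mulr_ge0.
move=> y y0; rewrite horner_coef mulr_suml; apply: (le_trans (ler_norm_sum _ _ _)).
apply: ler_sum => i _; rewrite normrM -mulrA ler_wpM2l//.
by rewrite ger0_norm ?exprn_ge0//; exact: expR_ge_pow.
Qed.

(** The functions p(1/s) exp(-1/s), extended by 0 to s <= 0, form a family closed under
    differentiation; the flat function exp(-1/s) is the member with p = 1. *)
Definition flat_poly (p : {poly R}) (s : R) : R :=
  if 0 < s then p.[s^-1] * expR (- s^-1) else 0.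

(** The exponential bound is applied to ['X * p]; the extra factor 1/s is what turns boundedness
    into a linear bound at 0. *)
Lemma flat_poly_bound (p : {poly R}) : exists2 C, 0 <= C & forall s, `|flat_poly p s| <= C * `|s|.
Proof.
have [C C0 HC] := poly_le_expR ('X * p); exists C => // s.
rewrite /flat_poly; case: ifPn => [s0|_]; last by rewrite normr0 mulr_ge0.
have := HC s^-1; rewrite invr_ge0 ltW// => /(_ isT).
rewrite hornerM hornerX normrM (gtr0_norm (x := s^-1)) ?invr_gt0//.
rewrite ler_pdivrMl// => H; rewrite normrM (gtr0_norm (expR_gt0 _)) expRN ler_pdivrMr ?expR_gt0//.
by rewrite (gtr0_norm s0) (_ : C * s * _ = s * (C * expR s^-1))//; ring.
Qed.

(** In the variable y = 1/s, differentiation in s sends p(y) exp(-y) to y^2 (p - p')(y) exp(-y). *)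
Definition flat_poly_deriv (p : {poly R}) : {poly R} := 'X^2 * (p - p^`()).

Lemma flat_poly_is_derive (p : {poly R}) (s : R) : is_derive s 1 (flat_poly p) (flat_poly (flat_poly_deriv p) s).
Proof.
have [s0|s0|->] := ltgtP s 0.
- have E : \forall y \near s, cst 0 y = flat_poly p y.
    have := open_nbhs_nbhs (conj (@open_lt R 0) s0).
    by apply: filterS => y /= y0; rewrite /flat_poly ltNge ltW.
  apply: (near_eq_is_derive E).
  by rewrite /flat_poly ltNge ltW//=; exact: is_derive_cst.
- have E : \forall y \near s, (fun y => p.[y^-1] * expR (- y^-1)) y = flat_poly p y.
    have := open_nbhs_nbhs (conj (@open_gt R 0) s0).
    by apply: filterS => y /= y0; rewrite /flat_poly y0.
  apply: (near_eq_is_derive E).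
  have dV : is_derive s 1 (@GRing.inv R) (- s ^- 2).
    apply: is_derive_eq; first exact: (@is_deriveV R id s 1 1 (lt0r_neq0 s0) (is_derive_id s 1)).
    by rewrite [LHS]mulr1.
  have dp : is_derive (s^-1) 1 (horner p) (p^`().[s^-1]).
    by split; [exact: derivable_horner|rewrite -derive1E -derivE].
  have d1 := is_derive1_comp dp dV.
  have d2 := @is_derive1_comp R expR (fun y => - y^-1) s _ _ (is_derive_expR (- s^-1)) (is_deriveN dV).
  have -> : (fun y : R => p.[y^-1] * expR (- y^-1)) = (horner p \o GRing.inv) * (expR \o (fun y : R => - y^-1)) by [].
  have [e1 e2] := is_deriveM d1 d2; split; [exact: e1|rewrite e2].
  rewrite /flat_poly s0 /flat_poly_deriv hornerM hornerXn hornerD hornerN /=.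
  rewrite /GRing.scale/= opprK exprVn; ring.
(* At 0 the difference quotient of [flat_poly p] is [flat_poly ('X * p)], which the linear bound
   sends to 0. *)
- have [C C0 HC] := flat_poly_bound ('X * p).
  suff H : h^-1 *: ((flat_poly p \o shift 0) (h *: 1) - flat_poly p 0) @[h --> 0^'] --> (0 : R).
    split; first by apply/cvg_ex; exists 0.
    by rewrite /flat_poly ltxx; exact: cvg_lim H.
  apply/cvgrPdist_le => e e0.
  exists (e / (C + 1)) => /=; first by rewrite divr_gt0// ltr_wpDl.
  move=> h /=; rewrite sub0r normrN => he h0.
  rewrite sub0r normrN {2}/flat_poly ltxx subr0 addr0 [h *: 1]mulr1.
  have -> : h^-1 *: flat_poly p h = flat_poly ('X * p) h.
    rewrite /flat_poly; case: ifP => _; last by rewrite scaler0.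
    by rewrite hornerM hornerX /GRing.scale/= mulrA.
  apply: (le_trans (HC h)).
  apply: (@le_trans _ _ ((C + 1) * `|h|)); first by rewrite ler_wpM2r// lerDl.
  by rewrite -ler_pdivlMl ?ltr_wpDl// mulrC ltW.
Qed.

Lemma Smooth_flat_poly p : Smooth [set: R] (flat_poly p).
Proof.
apply: (@Smooth_derive_family R R R setT (fun h => exists q, h = flat_poly q)); last by exists p.
  exact: openT.
move=> _ [q ->]; have d := flat_poly_is_derive q.
split=> [x _|x v _|v].
- by have [/derivable1_diffP/differentiable_continuous] := d x.
- by have [/derive_R_dir-/(_ v)[]] := d x.
- exists (flat_poly (v *: flat_poly_deriv q)); first by exists (v *: flat_poly_deriv q).
  move=> x _; have [d1 d2] := d x; have [_ ->] := derive_R_dir v d1.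
  rewrite d2 /flat_poly; case: ifP; last by rewrite mulr0.
  by rewrite hornerZ mulrA.
Qed.

Definition flat (s : R) : R := if 0 < s then expR (- s^-1) else 0.

Lemma flatE : flat = flat_poly 1.
Proof. by apply/funext => s; rewrite /flat/flat_poly hornerC mul1r. Qed.

Lemma Smooth_flat U : open U -> Smooth U flat.
Proof. by move=> oU; rewrite flatE; apply: Smooth_subset (Smooth_flat_poly 1). Qed.

Lemma flat_ge0 s : 0 <= flat s.
Proof. by rewrite /flat; case: ifP => // _; exact: expR_ge0. Qed.

Lemma flat_le0 s : s <= 0 -> flat s = 0.
Proof. by rewrite /flat leNgt => /negbTE ->. Qed.

Lemma flat_gt0 s : 0 < s -> 0 < flat s.
Proof. by rewrite /flat => ->; exact: expR_gt0. Qed.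

Lemma flat_le s : 0 <= s -> flat s <= s.
Proof.
rewrite le_eqVlt => /predU1P[<-|s0]; first by rewrite flat_le0.
rewrite /flat s0 expRN -[leRHS]invrK lef_pV2 ?posrE ?expR_gt0 ?invr_gt0//.
by rewrite (le_trans _ (expR_ge1Dx _))// lerDr.
Qed.

Lemma flat_le_mono s t : s <= t -> flat s <= flat t.
Proof.
move=> st; rewrite /flat; case: ifP => s0; last by case: ifP => // _; exact: expR_ge0.
rewrite (lt_le_trans s0 st) ler_expR lerN2 lef_pV2 ?posrE//.
exact: lt_le_trans st.
Qed.

(** With y = 1/s > 0 the derivative is y^2 exp(-y), and exp y = (exp(y/2))^2 >= (y/2)^2 yields the
    constant 4. Monotonicity and a bound on the slope are what the energy estimate behind the
    comparison principle asks of its truncation. *)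
Lemma flat_derive s : derivable flat s 1 /\ 0 <= 'D_1 flat s <= 4.
Proof.
have [d1] := flat_poly_is_derive 1 s; rewrite -flatE => d2; split; first by rewrite flatE.
rewrite d2 /flat_poly /flat_poly_deriv derivC subr0 mulr1 hornerXn.
case: ifPn => [s0|_]; last by rewrite lexx ler0n.
rewrite mulr_ge0 ?exprn_ge0 ?invr_ge0 ?(ltW s0) ?expR_ge0//=.
rewrite expRN ler_pdivrMr ?expR_gt0//.
set y := s^-1; have y0 : 0 < y by rewrite invr_gt0.
have -> : expR y = expR (y / 2) ^+ 2 by rewrite -expRM_natl -mulr_natl mulrC divfK.
rewrite -[4](_ : 2 ^+ 2 = 4 :> R); last by rewrite expr2 -natrM.
rewrite -exprMn ler_sqr ?nnegrE ?mulr_ge0 ?expR_ge0 ?(ltW y0)//.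
rewrite -ler_pdivrMl// mulrC.
by apply: le_trans (expR_ge1Dx _); rewrite lerDr.
Qed.

End smooth_functions.

(** * Integrals over a compact interval depending on a parameter *)

Section param_integral.
Context {R : realType}.
Local Notation leb := (@lebesgue_measure R).

Lemma itv_continuous_integrable (a b : R) (f : R -> R) :
  (forall t, a <= t <= b -> {for t, continuous f}) ->
  leb.-integrable `[a, b] (EFin \o f).
Proof.
move=> cf; apply: continuous_compact_integrable; first exact: segment_compact.
by apply: continuous_in_subspaceT => t; rewrite inE /= in_itv /= => /cf.
Qed.

Lemma norm_Rintegral_itv_le (a b c : R) (f : R -> R) : a <= b ->
  (forall t, a <= t <= b -> {for t, continuous f}) ->
  (forall t, a <= t <= b -> `|f t| <= c) ->
  `|\int[leb]_(t in `[a, b]) f t| <= (b - a) * c.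
Proof.
move=> ab cf fc.
have If := itv_continuous_integrable cf.
apply: le_trans (le_normr_Rintegral _ If) _ => //.
apply: (@le_trans _ _ (\int[leb]_(t in `[a, b]) c)).
  apply: le_Rintegral => //.
  - exact: integrable_norm.
  - apply: itv_continuous_integrable => t _; exact: cst_continuous.
rewrite Rintegral_cst//= lebesgue_measure_itv /= lte_fin; case: ltP => [_|ba] /=.
  by rewrite mulrC.
by rewrite mulr0 (_ : b = a) ?subrr ?mul0r//; apply/eqP; rewrite eq_le ab ba.
Qed.

Lemma RintegralB_itv (a b : R) (f g : R -> R) :
  (forall t, a <= t <= b -> {for t, continuous f}) ->
  (forall t, a <= t <= b -> {for t, continuous g}) ->
  \int[leb]_(t in `[a, b]) (f t - g t) =
  \int[leb]_(t in `[a, b]) f t - \int[leb]_(t in `[a, b]) g t.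
Proof. by move=> cf cg; rewrite RintegralB//; exact: itv_continuous_integrable. Qed.

Context {E : normedModType R}.

Lemma continuous_slice1 (f : R * E -> R) t x :
  {for (t, x), continuous f} -> {for t, continuous (fun s => f (s, x))}.
Proof.
move=> cf; apply: (@continuous_comp _ _ _ (fun s => (s, x)) f) => //.
move=> A [[P Q] /= [Pt Qx] PQ]; rewrite /= nbhs_simpl /=.
by apply: filterS Pt => s Ps; apply: PQ; split=> //; exact: nbhs_singleton.
Qed.

(** Compactness of [a, b] turns continuity at each point (t, x) into one neighbourhood of x that
    works for all t; half of e is spent on each of the two comparisons with the value at the
    centre. *)
Lemma uniform_near_itv (a b : R) (f : R * E -> R) x e : 0 < e ->
  (forall t, a <= t <= b -> {for (t, x), continuous f}) ->
  \forall y \near x, forall t, a <= t <= b -> `|f (t, y) - f (t, x)| <= e.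
Proof.
move=> e0 cf.
have /compact_near_coveringP/(_ _ (nbhs x) (fun y t => `|f (t, y) - f (t, x)| <= e) _) := @segment_compact R a b.
move=> H; have {H}: \forall y \near x, `[a, b]%classic `<=` (fun t => `|f (t, y) - f (t, x)| <= e).
  apply: H => t; rewrite /= in_itv /= => tab.
  have e20 : 0 < e / 2 by rewrite divr_gt0.
  have /cvgrPdist_le/(_ _ e20) H := cf t tab.
  have /cvgrPdist_le/(_ _ e20) H' := continuous_slice1 (cf t tab).
  have [[A B] /= [At Bx] AB] := H.
  exists (A `&` [set s | `|f (t, x) - f (s, x)| <= e / 2], B) => /=.
    by split => //; apply: filterI.
  move=> [s y] /= [[As s2] By].
  have := AB (s, y) (conj As By); rewrite /= => s1.
  rewrite -(subrKA (f (t, x))) (splitr e); apply: le_trans (ler_normD _ _) _.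
  by rewrite lerD// distrC.
by apply: filterS => y H t tab; apply: H; rewrite /= in_itv.
Qed.

Lemma continuous_param_integral (a b : R) (f : R * E -> R) x : a <= b ->
  (\forall y \near x, forall t, a <= t <= b -> {for (t, y), continuous f}) ->
  {for x, continuous (fun y => \int[leb]_(t in `[a, b]) f (t, y))}.
Proof.
move=> ab cf; apply/cvgrPdist_le => e e0.
(* The summand 1 keeps the denominator positive when a = b. *)
have e'0 : 0 < e / (b - a + 1) by rewrite divr_gt0// ltr_wpDl// subr_ge0.
have cfx := nbhs_singleton cf.
have H := uniform_near_itv e'0 cfx.
near=> y.
have cfy : forall t, a <= t <= b -> {for (t, y), continuous f} by near: y.
have Hy : forall t, a <= t <= b -> `|f (t, y) - f (t, x)| <= e / (b - a + 1) by near: y.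
rewrite distrC -RintegralB_itv; last 2 first.
- by move=> t tab; exact/continuous_slice1/cfy.
- by move=> t tab; exact/continuous_slice1/cfx.
apply: (@le_trans _ _ ((b - a) * (e / (b - a + 1)))).
  apply: norm_Rintegral_itv_le => // t tab.
  by apply: continuousB; [exact/continuous_slice1/cfy|exact/continuous_slice1/cfx].
rewrite mulrCA ler_piMr ?(ltW e0)// ler_pdivrMr ?ltr_wpDl ?subr_ge0// mul1r lerDl.
exact: ler01.
Unshelve. all: by end_near. Qed.

Lemma slice_growth (f : R * E -> R) t x v :
  derivable f (t, x) (0, v) ->
  derivable (fun y => f (t, y)) x v /\ 'D_v (fun y => f (t, y)) x = 'D_(0, v) f (t, x).
Proof.
rewrite /derivable /derive.
suff -> : (fun h : R => h^-1 *: (((fun y => f (t, y)) \o shift x) (h *: v) - f (t, x))) =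
  (fun h : R => h^-1 *: ((f \o shift (t, x)) (h *: (0, v)) - f (t, x))) by [].
apply/funext => h /=; congr (_ *: (f _ - _)).
by apply: injective_projections => //=; rewrite scaler0 add0r.
Qed.

(** The mean value theorem in direction h v rewrites the difference quotient as the derivative at an
    intermediate point that depends on t; continuity of the derivative, uniform in t, makes the
    error small under the integral. *)
Lemma derive_param_integral (a b : R) (f : R * E -> R) x v : a <= b ->
  (\forall y \near x, forall t, a <= t <= b ->
     [/\ {for (t, y), continuous f}, derivable f (t, y) (0, v) &
         {for (t, y), continuous ('D_(0, v) f)}]) ->
  let g := fun y => \int[leb]_(t in `[a, b]) f (t, y) in
  derivable g x v /\ 'D_v g x = \int[leb]_(t in `[a, b]) 'D_(0, v) f (t, x).
Proof.
move=> ab Hf g.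
suff H : h^-1 *: ((g \o shift x) (h *: v) - g x) @[h --> 0^'] --> \int[leb]_(t in `[a, b]) 'D_(0, v) f (t, x).
  by split; [apply/cvg_ex; eexists; exact: H|exact: cvg_lim H].
apply/cvgrPdist_le => e e0.
have e'0 : 0 < e / (b - a + 1) by rewrite divr_gt0// ltr_wpDl// subr_ge0.
have cD t : a <= t <= b -> {for (t, x), continuous ('D_(0, v) f)}.
  by move=> tab; have [] := nbhs_singleton Hf t tab.
have cf t : a <= t <= b -> {for (t, x), continuous f}.
  by move=> tab; have [] := nbhs_singleton Hf t tab.
have HU := uniform_near_itv e'0 cD.
have [r /= r0 rH] := (nbhs_ballP _ _).1 (filterI Hf HU).
(* With this bound on |h| the whole segment from x to x + h v lies in the ball of radius r, also
   when v = 0. *)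
exists (r / (`|v| + 1)) => /=; first by rewrite divr_gt0// ltr_wpDl.
move=> h /=; rewrite sub0r normrN ltr_pdivlMr ?ltr_wpDl// => hr h0.
have inball s : 0 <= s <= 1 -> ball x r (x + s *: (h *: v)).
  move=> /andP[s0 s1]; rewrite -ball_normE /= opprD addrA subrr sub0r normrN !normrZ.
  rewrite (ger0_norm s0); apply: le_lt_trans hr.
  apply: (@le_trans _ _ (`|h| * `|v|)); first by rewrite ler_piMl// mulr_ge0.
  by rewrite ler_wpM2l// lerDl.
have in1 : ball x r (x + h *: v) by have := inball 1; rewrite scale1r lexx ler01; exact.
have cfh t : a <= t <= b -> {for (t, x + h *: v), continuous f}.
  by move=> tab; have [] := (rH _ in1).1 t tab.
rewrite /= [h *: v + x]addrC /g -RintegralB_itv; last 2 first.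
- by move=> t tab; exact/continuous_slice1/cfh.
- by move=> t tab; exact/continuous_slice1/cf.
have cdiff t : a <= t <= b -> {for t, continuous (fun t => f (t, x + h *: v) - f (t, x))}.
  by move=> tab; apply: continuousB; [exact: (continuous_slice1 (cfh t tab))|exact: (continuous_slice1 (cf t tab))].
have cD1 t : a <= t <= b -> {for t, continuous (fun t => 'D_(0, v) f (t, x))}.
  by move=> tab; exact: (continuous_slice1 (cD t tab)).
have -> : h^-1 *: \int[leb]_(t in `[a, b]) (f (t, x + h *: v) - f (t, x)) =
   \int[leb]_(t in `[a, b]) (h^-1 * (f (t, x + h *: v) - f (t, x))).
  by rewrite RintegralZl//; exact: itv_continuous_integrable.
rewrite -RintegralB_itv; last 2 first.
- exact: cD1.
- by move=> t tab; apply: continuousM; [exact: cst_continuous|exact: (cdiff t tab)].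
apply: (@le_trans _ _ ((b - a) * (e / (b - a + 1)))); last first.
  rewrite mulrCA ler_piMr ?(ltW e0)// ler_pdivrMr ?ltr_wpDl ?subr_ge0// mul1r lerDl.
  exact: ler01.
apply: norm_Rintegral_itv_le => // t tab.
  apply: continuousB; first exact: (cD1 t tab).
  by apply: continuousM; [exact: cst_continuous|exact: (cdiff t tab)].
have dft s : 0 <= s <= 1 -> derivable (fun y => f (t, y)) (x + s *: (h *: v)) (h *: v).
  move=> s01; have [_ d _] := (rH _ (inball s s01)).1 t tab.
  exact: (deriveZdir h (slice_growth d).1).1.
have [s s01 ->] := MVT_dir dft.
have [_ d _] := (rH _ (inball s s01)).1 t tab.
have [d1 d2] := slice_growth d.
rewrite (deriveZdir h d1).2 d2 /GRing.scale/= mulrA mulVf// mul1r distrC.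
exact: (rH _ (inball s s01)).2.
Qed.

Lemma Smooth_param_integral (a b : R) (U : set E) (W : set (R * E)) (f : R * E -> R) : a <= b ->
  open U -> (forall t x, a <= t <= b -> U x -> W (t, x)) -> Smooth W f ->
  Smooth U (fun y => \int[leb]_(t in `[a, b]) f (t, y)).
Proof.
move=> ab oU UW sf; apply/Smooth_Ck => n; elim: n f sf => [|n ih] f sf.
  split=> // x Ux; apply: continuous_param_integral => //.
  have : \forall y \near x, U y by exact: open_nbhs_nbhs.
  by apply: filterS => y Uy t tab; exact: (Smooth_cont sf (UW t y tab Uy)).
have near3 x v : U x -> \forall y \near x, forall t, a <= t <= b ->
     [/\ {for (t, y), continuous f}, derivable f (t, y) (0, v) &
         {for (t, y), continuous ('D_(0, v) f)}].
  move=> Ux; have : \forall y \near x, U y by exact: open_nbhs_nbhs.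
  apply: filterS => y Uy t tab; have Wty := UW t y tab Uy; split.
  - exact: (Smooth_cont sf Wty).
  - exact: (Smooth_derivable sf Wty).
  - exact: (Smooth_cont (Smooth_derive _ sf) Wty).
split.
  move=> x Ux; apply: continuous_param_integral => //.
  have := near3 x 0 Ux; apply: filterS => y H t tab.
  by have [] := H t tab.
split; first by move=> x v Ux; have [] := derive_param_integral ab (near3 x v Ux).
move=> v; apply: (Ck_eq oU _ (ih _ (Smooth_derive (0, v) sf))) => x Ux.
by have [_ ->] := derive_param_integral ab (near3 x v Ux).
Qed.

End param_integral.

(** * Lebesgue measure on R^n *)

Section density.
Local Open Scope ereal_scope.
Context d1 d2 (T1 : measurableType d1) (T2 : measurableType d2) (R : realType).
Variables (m1 : {measure set T1 -> \bar R}) (m2 : {measure set T2 -> \bar R}).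
Variables (D : set T1) (p : T2 -> T1) (g : T2 -> R).
Hypotheses (mD : measurable D) (mp : measurable_fun setT p)
  (mg : measurable_fun (p @^-1` D) g) (g0 : forall x, (0 <= g x)%R).
Hypothesis m1E : forall A, measurable A -> A `<=` D ->
  m1 A = \int[m2]_(x in p @^-1` A) (g x)%:E.

Import HBNNSimple.

Let mpD A : measurable A -> measurable (p @^-1` A).
Proof. by move=> mA; rewrite -[X in measurable X]setTI; exact: mp. Qed.

(** The hypothesis [m1E] on sets is carried to simple functions and then, by monotone convergence,
    to all nonnegative ones. Allowing both a map [p] and a density [g] covers the Lebesgue measure
    on tuples, the Riemannian measure in a chart and the weighted measure by one statement. *)
Lemma ge0_integral_density (f : T1 -> \bar R) : measurable_fun D f -> (forall x, 0 <= f x) ->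
  \int[m1]_(x in D) f x = \int[m2]_(x in p @^-1` D) (f (p x) * (g x)%:E).
Proof.
move=> mf f0; pose h := nnsfun_approx mD mf.
have mpD' := mpD mD.
have mgE : measurable_fun (p @^-1` D) (EFin \o g) by exact/measurable_EFinP.
have hp n : measurable_fun (p @^-1` D) (fun x => (h n (p x))%:E).
  apply/measurable_EFinP; apply: measurable_funTS.
  by apply: measurableT_comp => //; exact: measurable_funP.
have -> : \int[m1]_(x in D) f x =
    lim (\int[m1]_(x in D) (EFin \o h n) x @[n --> \oo]).
  have fE x : D x -> f x = lim ((EFin \o h n) x @[n --> \oo]).
    by move=> Ex; apply/esym/cvg_lim => //; exact: cvg_nnsfun_approx.
  under eq_integral => x /[!inE] /fE -> //.
  apply: monotone_convergence => //.
  - move=> n; apply/measurable_EFinP.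
    by apply: (measurable_funS measurableT) => //; exact/measurable_funP.
  - by move=> n x Ex //=; rewrite lee_fin.
  - by move=> x Ex a b ab; rewrite lee_fin; exact/lefP/nd_nnsfun_approx.
have -> : \int[m2]_(x in p @^-1` D) (f (p x) * (g x)%:E) =
    lim (\int[m2]_(x in p @^-1` D) ((h n (p x))%:E * (g x)%:E) @[n --> \oo]).
  have fg x : D (p x) -> f (p x) * (g x)%:E = lim (((h n (p x))%:E * (g x)%:E) @[n --> \oo]).
    by move=> Ex; apply/esym/cvg_lim => //; apply: cvgeZr => //; exact: cvg_nnsfun_approx.
  under eq_integral => x /[!inE] /fg -> //.
  apply: monotone_convergence => [//| | |].
  - by move=> n; apply/emeasurable_funM.
  - by move=> n x Ex /=; rewrite mule_ge0 ?lee_fin.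
  - move=> x Ex a b ab/=; rewrite lee_wpmul2r ?lee_fin//.
    by have /lefP := nd_nnsfun_approx mD mf ab; exact.
suff suf n : \int[m2]_(x in p @^-1` D) ((h n (p x))%:E * (g x)%:E) =
    \int[m1]_(x in D) (EFin \o h n) x.
  by under [in RHS]eq_fun do rewrite suf.
have mh r : measurable (h n @^-1` [set r]) by exact: measurable_sfunP.
transitivity (\int[m1]_(x in D)
   (\sum_(y \in range (h n)) (y * \1_(h n @^-1` [set y]) x)%:E)); last first.
  by apply: eq_integral => t tE; rewrite /= fimfunE -fsumEFin.
have indich r : measurable_fun D (fun x => (r * \1_(h n @^-1` [set r]) x)%:E).
  by apply: (measurable_comp measurableT) => //; exact: measurable_funM.
rewrite ge0_integral_fsum//; last by move=> m y Ey; exact: nnfun_muleindic_ge0.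
transitivity (\int[m2]_(x in p @^-1` D) (\sum_(y \in range (h n))
    (y * \1_(h n @^-1` [set y]) (p x))%:E * (g x)%:E)).
  apply: eq_integral => x xE.
  rewrite -ge0_mule_fsuml => [|y]; last exact: nnfun_muleindic_ge0.
  by rewrite fsumEFin // -(fimfunE _ (p x)).
rewrite ge0_integral_fsum//; last 2 first.
  - move=> y; apply: emeasurable_funM => //.
    apply/measurable_EFinP; apply: measurable_funTS; apply: measurable_funM => //.
    exact: measurableT_comp.
  - by move=> m y Ey; rewrite mule_ge0 ?lee_fin// -lee_fin nnfun_muleindic_ge0.
apply: eq_fsbigr => r rhn.
have r0 : (0 <= r)%R by move: rhn; rewrite inE => -[t _ <-].
under [RHS]eq_integral do rewrite EFinM.
rewrite integralZl_indic_nnsfun => //.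
under eq_integral do rewrite EFinM -muleA.
rewrite ge0_integralZl//; last 2 first.
- apply: emeasurable_funM => //; apply/measurable_EFinP; apply: measurable_funTS.
  exact: measurableT_comp.
- by move=> t Et; rewrite mule_ge0 ?lee_fin.
congr (_ * _).
rewrite integral_indic// m1E; last 2 first.
- exact: measurableI.
- by move=> x [].
rewrite preimage_setI setIC integral_mkcondr; apply: eq_integral => x _.
by rewrite epatch_indic muleC.
Qed.

Lemma integral_density (f : T1 -> \bar R) : measurable_fun D f ->
  \int[m1]_(x in D) f x = \int[m2]_(x in p @^-1` D) (f (p x) * (g x)%:E).
Proof.
move=> mf; rewrite integralE [RHS]integralE; congr (_ - _).
  rewrite ge0_integral_density//; last exact: measurable_funepos.
  by apply: eq_integral => x _; rewrite !funeposE maxeMl ?lee_fin// mul0e.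
rewrite ge0_integral_density//; last exact: measurable_funeneg.
by apply: eq_integral => x _; rewrite !funenegE maxeMl ?lee_fin// mul0e mulNe.
Qed.

End density.

Section countable_union.

Lemma bigcup_countable_measurable d (T : sigmaRingType d) (I : Type) (D : set I) (F : I -> set T) :
  countable D -> (forall i, D i -> measurable (F i)) -> measurable (\bigcup_(i in D) F i).
Proof.
move=> /countable_injP[f finj] mF.
have -> : \bigcup_(i in D) F i = \bigcup_n (\bigcup_(i in [set i | D i /\ f i = n]) F i).
  apply/seteqP; split=> [x [i Di Fx]|x [n _ [i [Di _] Fx]]]; last by exists i.
  by exists (f i) => //; exists i.
apply: bigcupT_measurable => n.
have [[i [Di fi]]|H] := pselect (exists i, D i /\ f i = n); last first.
  rewrite (_ : \bigcup_(i in _) F i = set0) ?measurable0//.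
  by apply/seteqP; split=> // x [i [Di fi] _]; apply: H; exists i.
rewrite (_ : \bigcup_(i in _) F i = F i); first exact: mF.
apply/seteqP; split=> [x [j [Dj fj]]|x Fx]; last by exists i.
by rewrite (finj j i) ?inE//; rewrite fj.
Qed.

End countable_union.

Section borel_lemmas.
Context {R : realType}.

(** Tuples carry a product sigma-algebra while row vectors enter through their topology; asking that
    open sets have measurable preimages under [p] bridges the two. *)
Lemma measurable_comp_open d (X : measurableType d) (T : topologicalType)
    (p : X -> T) (W : set T) (f : T -> R) :
  (forall U, open U -> measurable (p @^-1` U)) -> open W ->
  (forall y, W y -> {for y, continuous f}) ->
  measurable_fun (p @^-1` W) (fun x => f (p x)).
Proof.
move=> mp oW cf; apply: (measurability _ (RGenOInfty.measurableE R)).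
move=> _ [_ [r ->] <-].
have -> : p @^-1` W `&` (fun x => f (p x)) @^-1` `]r, +oo[ = p @^-1` (W `&` [set y | r < f y]).
  by rewrite preimage_setI; congr (_ `&` _); apply/seteqP; split=> x /=; rewrite in_itv/= andbT.
apply: mp; rewrite openE => y [Wy /= ry]; rewrite /interior.
apply: filterI; first exact: open_nbhs_nbhs.
exact: (cf y Wy) (open_nbhs_nbhs (conj (@open_gt R r) ry)).
Qed.

Lemma borel_open (M : ptopologicalType) (U : set M) : open U -> measurable (U : set (borel M)).
Proof. by move=> oU; exact: sub_sigma_algebra. Qed.

Lemma borel_measurable_fun (M : ptopologicalType) (U : set M) (f : M -> R) : open U ->
  (forall y, U y -> {for y, continuous f}) -> measurable_fun (U : set (borel M)) f.
Proof.
move=> oU cf; apply: (@measurable_comp_open _ (borel M) M id U f) => // W oW.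
exact: borel_open.
Qed.

Lemma borel_map d (X : measurableType d) (M : ptopologicalType) (p : X -> M) :
  (forall U, open U -> measurable (p @^-1` U)) -> measurable_fun setT (p : X -> borel M).
Proof.
move=> mp; apply: (@measurability _ _ X (borel M) setT p (@open M)) => //.
by move=> _ [U oU <-]; rewrite setTI; exact: mp.
Qed.

Lemma closed_borel (M : ptopologicalType) (K : set M) : closed K -> measurable (K : set (borel M)).
Proof.
by move=> cK; rewrite -(setCK K); apply: measurableC; apply: borel_open; exact: closed_openC.
Qed.

End borel_lemmas.

Section rV_of_tuple_measurable.
Context {R : realType}.

Let box n (qk : 'rV[rat]_n * nat) : set 'rV[R]_n :=
  [set y | forall i, `|y 0 i - ratr (qk.1 0 i)| < qk.2.+1%:R^-1].

(** Cubes with rational centre and radius 1/(k+1) form a countable base, and membership in a cube is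
    a finite conjunction of conditions on single coordinates, hence measurable on tuples. *)
Lemma open_rV_boxes n (U : set 'rV[R]_n) : open U ->
  U = \bigcup_(qk in [set qk | box qk `<=` U]) box qk.
Proof.
move=> oU; apply/seteqP; split=> [y Uy|y [qk /= H /H//]].
have /nbhs_ballP[e /= e0 eU] := open_nbhs_nbhs (conj oU Uy).
(* Two points of a cube are within 2/(k+1) of each other, hence the half of e. *)
have [k ke] : exists k : nat, k.+1%:R^-1 < e / 2.
  have [k] := @ltr_add_invr R 0 (e / 2) (divr_gt0 e0 (ltr0Sn _ 1)).
  by rewrite add0r => ke; exists k.
have k0 : 0 < k.+1%:R^-1 :> R by rewrite invr_gt0.
have q_ex i : exists q : rat, `|y 0 i - ratr q| < k.+1%:R^-1.
  have [|q] := @rat_in_itvoo R (y 0 i - k.+1%:R^-1) (y 0 i + k.+1%:R^-1).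
    by rewrite ltrD2l gtrN.
  by rewrite in_itv /= => /andP[q1 q2]; exists q; rewrite ltr_distlC q1 q2.
pose q : 'rV[rat]_n := \row_i sval (cid (q_ex i)).
have bq : box (q, k) y by move=> i; rewrite /= !mxE; case: cid.
exists (q, k) => //= z bz; apply: eU; rewrite -ball_normE /=.
apply: le_lt_trans (_ : 2 * k.+1%:R^-1 < _); last by rewrite -ltr_pdivlMl// mulrC.
apply: mx_norm_le; first by rewrite mulr_ge0// ltW.
move=> i j; rewrite ord1 !mxE -(subrKA (ratr (q 0 j))).
apply: le_trans (ler_normD _ _) _; rewrite mulr2n mulrDl mul1r lerD ?(ltW (bq j))//.
by rewrite distrC ltW// bz.
Qed.

Lemma measurable_rV_of_tuple n (U : set 'rV[R]_n) : open U ->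
  measurable (@rV_of_tuple R n @^-1` U).
Proof.
move=> oU; rewrite (open_rV_boxes oU) preimage_bigcup.
apply: bigcup_countable_measurable; first exact: countableP.
move=> -[q k] _.
pose F (i : 'I_n) := (fun t : n.-tuple R => tnth t i) @^-1` [set z | `|z - ratr (q 0 i)| < k.+1%:R^-1].
have -> : @rV_of_tuple R n @^-1` box (q, k) = ~` (\bigcup_i ~` F i).
  rewrite setC_bigcup; under eq_bigcapr do rewrite setCK.
  apply/seteqP; split=> t /= H i; first by move=> _; have := H i; rewrite /F/= mxE.
  by rewrite mxE; exact: H.
apply: measurableC; apply: bigcup_countable_measurable; first exact: countableP.
move=> i _; apply: measurableC; rewrite /F.
rewrite -[X in measurable X]setTI; apply: measurable_tnth => //.
apply: open_measurable.
have -> : [set z | `|z - ratr (q 0 i)| < k.+1%:R^-1] = ball (ratr (q 0 i) : R^o) k.+1%:R^-1.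
  by rewrite -ball_normE; apply/seteqP; split=> z /=; rewrite distrC.
exact: ball_open.
Qed.

End rV_of_tuple_measurable.

(** * Integration of compactly supported functions on R^n *)

Section euclidean_integral.
Context {R : realType}.
Local Notation leb := (@lebesgue_measure R).

Lemma compact_cont_bounded (T : topologicalType) (K : set T) (f : T -> R) :
  compact K -> (forall x, K x -> {for x, continuous f}) ->
  exists2 C, 0 <= C & forall x, K x -> `|f x| <= C.
Proof.
move=> cK cf.
have wK : {within K, continuous f}.
  by apply: continuous_in_subspaceT => x; rewrite inE; exact: cf.
have /compact_bounded[N [_ NK]] := continuous_compact wK cK.
exists (`|N| + 1); first by rewrite addr_ge0.
move=> x Kx; apply: (NK (`|N| + 1)); last by exists x.
by rewrite (le_lt_trans (ler_norm _))// ltrDl.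
Qed.

Lemma rV_closed_ball_compact n (a : R) : compact [set y : 'rV[R]_n | `|y| <= a].
Proof.
apply: bounded_closed_compact.
  by exists a; split; [exact: num_real|]=> b ab y /= ya; rewrite (le_trans ya)// ltW.
apply: (closed_comp (f := fun y : 'rV[R]_n => `|y|) (D := [set z | z <= a])).
  by move=> y _; exact: norm_continuous.
exact: closed_le.
Qed.

Lemma integral_lebesgue_tupleS n (f : n.+1.-tuple R -> \bar R) : measurable_fun setT f ->
  (\int[lebesgue_tuple n.+1]_t f t = \int[leb \x lebesgue_tuple n]_p f (tcons p))%E.
Proof.
move=> mf.
rewrite (@integral_density _ _ _ _ _ _ (leb \x lebesgue_tuple n)%E setT (@tcons R n) (cst 1) _ _ _ _ _ f)//=.
- by rewrite preimage_setT; under eq_integral do rewrite mule1.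
- exact: measurable_tcons.
- move=> A mA _; rewrite integral_cst ?mul1e//.
  by rewrite -[X in measurable X]setTI; exact: measurable_tcons.
Qed.

Lemma mx_continuousP (T : topologicalType) m n (f : T -> 'M[R]_(m, n)) (x : T) :
  (forall i j, {for x, continuous (fun y => f y i j)}) -> {for x, continuous f}.
Proof. by move=> H; exact: ((@mx_cvgP R T (nbhs x) (nbhs_filter x) _ _ f (f x)).2 H). Qed.

Definition tuple_box n (a : R) : set (n.-tuple R) := [set t | forall i, `|tnth t i| <= a].

Lemma measurable_tuple_box n a : measurable (@tuple_box n a).
Proof.
have -> : tuple_box a = ~` (\bigcup_i ~` ((fun t : n.-tuple R => tnth t i) @^-1` `[- a, a])).
  rewrite setC_bigcup; under eq_bigcapr do rewrite setCK.
  apply/seteqP; split=> t /= H i; first by move=> _ /=; rewrite in_itv/= -ler_norml.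
  by have := H i I; rewrite /= in_itv/= -ler_norml.
apply: measurableC; apply: bigcup_countable_measurable; first exact: countableP.
move=> i _; apply: measurableC.
by rewrite -[X in measurable X]setTI; exact: measurable_tnth.
Qed.

Lemma lebesgue_tuple_box_fin n a : (lebesgue_tuple n (@tuple_box n a) < +oo)%E.
Proof.
elim: n => [|n ih] /=; first by rewrite diracE ltry.
rewrite /lebesgue_cons /pushforward.
have -> : @tcons R n @^-1` tuple_box a = `[- a, a] `*` tuple_box a.
  apply/seteqP; split=> -[x t] /=.
    move=> H; split; first by have := H ord0; rewrite in_itv/= -ler_norml.
    by move=> i; have := H (lift ord0 i); rewrite tnthS.
  move=> [xa H] i; case: (unliftP ord0 i) => [j ->|->]; first by rewrite tnthS; exact: H.
  by move: xa; rewrite in_itv/= -ler_norml.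
rewrite product_measure1E//; last exact: measurable_tuple_box.
have E : (leb `[(- a)%R, a]%classic < +oo)%E.
  by rewrite lebesgue_measure_itv/=; case: ifP => _; rewrite ?ltry// -EFinN -EFinD ltry.
by apply: lte_mul_pinfty; [exact: measure_ge0|rewrite ge0_fin_numE//; exact: measure_ge0|exact: ih].
Qed.

Lemma rV_of_tuple_norm_le n (t : n.-tuple R) (a : R) : 0 <= a ->
  `|rV_of_tuple t| <= a <-> tuple_box a t.
Proof.
move=> a0; split=> [ta i|ta].
  by apply: le_trans ta; have := mx_entry_le_norm (rV_of_tuple t) 0 i; rewrite mxE.
by apply: mx_norm_le => // i j; rewrite mxE.
Qed.

Lemma tuple_integrable n (F : 'rV[R]_n -> R) (a : R) :
  (forall y, {for y, continuous F}) -> (forall y, a < `|y| -> F y = 0) ->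
  (lebesgue_tuple n).-integrable setT (EFin \o (F \o @rV_of_tuple R n)).
Proof.
(* The radius [a] may be negative; [b] is a nonnegative radius of a box outside which F vanishes. *)
move=> cF F0; pose b := Num.max a 0; have b0 : 0 <= b by rewrite le_max lexx orbT.
have [C C0 HC] := compact_cont_bounded (@rV_closed_ball_compact n b) (fun y _ => cF y).
have -> : EFin \o (F \o @rV_of_tuple R n) = (EFin \o (F \o @rV_of_tuple R n)) \_ (tuple_box b).
  apply/funext => t; rewrite patchE; case: ifPn => // tb.
  rewrite /= F0// (le_lt_trans (_ : a <= b)) ?le_max ?lexx// ltNge.
  by apply/negP => /(rV_of_tuple_norm_le _ b0); move: tb; rewrite notin_setE.
apply/(integrable_mkcond _ (measurable_tuple_box _)).
have mF : measurable_fun setT (F \o @rV_of_tuple R n).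
  by apply: (@measurable_comp_open R _ _ _ _ setT) => //; [exact: measurable_rV_of_tuple|exact: openT].
apply: measurable_bounded_integrable.
- exact: measurable_tuple_box.
- exact: lebesgue_tuple_box_fin.
- exact: measurable_funTS.
- exists C; split; [exact: num_real|]=> M CM t tb /=; rewrite (le_trans _ (ltW CM))//.
  by apply: HC => /=; apply/rV_of_tuple_norm_le.
Qed.

Lemma integral_derive1_compact (f : R -> R) (a : R) : 0 <= a ->
  (forall x, derivable f x 1) -> (forall x, {for x, continuous ('D_1 f)}) ->
  (forall x, a < `|x| -> f x = 0) -> (forall x, a < `|x| -> 'D_1 f x = 0) ->
  (\int[leb]_x ('D_1 f x)%:E = 0)%E.
Proof.
move=> a0 df cf f0 f'0.
(* On the slightly larger interval f vanishes at both end points, since |x| = a + 1 > a there. *)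
have -> : (\int[leb]_x ('D_1 f x)%:E = \int[leb]_(x in `[(- (a + 1))%R, (a + 1)%R]) ('D_1 f x)%:E)%E.
  rewrite [RHS]integral_mkcond; apply: eq_integral => x _; rewrite patchE.
  case: ifPn => //; rewrite notin_setE/= in_itv/= -ler_norml => /negP; rewrite -ltNge => xa.
  by rewrite f'0// (lt_trans _ xa)// ltrDl.
have aa : - (a + 1) < a + 1 by rewrite gtrN// ltr_wpDl.
rewrite (@continuous_FTC2 _ _ f)//.
- rewrite !f0 ?subee// ?normrN; rewrite ger0_norm ?ltrDl// addr_ge0//.
- by apply: continuous_in_subspaceT => x _; exact: cf.
- have cc x : {for x, continuous f} by apply/differentiable_continuous/derivable1_diffP.
  by split; [move=> x _; exact: df|exact/cvg_at_right_filter/cc|exact/cvg_at_left_filter/cc].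
- by move=> x _; rewrite derive1E.
Qed.

Definition consr n (x : R) (z : 'rV[R]_n) : 'rV[R]_n.+1 :=
  \row_i (if unlift ord0 i is Some j then z 0 j else x).

Lemma rV_of_tuple_cons n x (t : n.-tuple R) : rV_of_tuple (tcons (x, t)) = consr x (rV_of_tuple t).
Proof.
apply/rowP => i; rewrite !mxE; case: unliftP => [j ->|->]; last by [].
by rewrite mxE tnthS.
Qed.

Lemma consr_continuous n x : continuous (@consr n x).
Proof.
move=> z; apply: mx_continuousP => i j.
have -> : (fun y : 'rV[R]_n => consr x y i j) = (fun y : 'rV[R]_n => if unlift ord0 j is Some l then y 0 l else x).
  by apply/funext => y; rewrite mxE.
by case: unliftP => [k _|_]; [exact: coord_continuous|exact: cst_continuous].
Qed.

Lemma consr_line n x (z : 'rV[R]_n) k (h : R) :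
  consr x (h *: delta_mx 0 k + z) = h *: delta_mx 0 (lift ord0 k) + consr x z.
Proof.
apply/rowP => i; rewrite !mxE; case: unliftP => [j ->|->].
  by rewrite !mxE (inj_eq lift_inj).
by rewrite (negbTE (neq_lift _ _)) andbF mulr0 add0r.
Qed.

Lemma consr_line0 n x (z : 'rV[R]_n) (h : R) :
  consr (h + x) z = h *: delta_mx 0 ord0 + consr x z.
Proof.
apply/rowP => i; rewrite !mxE; case: unliftP => [j ->|->].
  by rewrite (negbTE (_ : lift ord0 j != ord0)) ?andbF ?mulr0 ?add0r// eq_sym neq_lift.
by rewrite eqxx /= mulr1.
Qed.

Lemma consr_growth n (f : 'rV[R]_n.+1 -> R) x z k :
  derivable (f \o consr x) z (delta_mx 0 k) = derivable f (consr x z) (delta_mx 0 (lift ord0 k)) /\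
  'D_(delta_mx 0 k) (f \o consr x) z = 'D_(delta_mx 0 (lift ord0 k)) f (consr x z).
Proof.
rewrite /derivable /derive.
suff -> : (fun h : R => h^-1 *: (((f \o consr x) \o shift z) (h *: delta_mx 0 k) - (f \o consr x) z)) =
   (fun h : R => h^-1 *: ((f \o shift (consr x z)) (h *: delta_mx 0 (lift ord0 k)) - f (consr x z))) by [].
by apply/funext => h /=; rewrite consr_line.
Qed.

Lemma consr_growth0 n (f : 'rV[R]_n.+1 -> R) x (z : 'rV[R]_n) :
  derivable (fun s => f (consr s z)) x 1 = derivable f (consr x z) (delta_mx 0 ord0) /\
  'D_1 (fun s => f (consr s z)) x = 'D_(delta_mx 0 ord0) f (consr x z).
Proof.
rewrite /derivable /derive.
suff -> : (fun h : R => h^-1 *: (((fun s => f (consr s z)) \o shift x) (h *: 1) - f (consr x z))) =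
   (fun h : R => h^-1 *: ((f \o shift (consr x z)) (h *: delta_mx 0 ord0) - f (consr x z))) by [].
by apply/funext => h /=; rewrite [h *: 1]mulr1 consr_line0.
Qed.

Lemma consr_norm_ge n x (z : 'rV[R]_n) : `|x| <= `|consr x z| /\ `|z| <= `|consr x z|.
Proof.
split.
  by apply: le_trans (mx_entry_le_norm _ 0 ord0); rewrite mxE unlift_none.
apply: mx_norm_le => // i j; rewrite ord1.
by apply: le_trans (mx_entry_le_norm _ 0 (lift ord0 j)); rewrite mxE liftK.
Qed.

(** Fubini isolates the first coordinate. If k is that coordinate, the inner integral is that of a
    derivative with compact support and vanishes by the fundamental theorem of calculus; otherwise
    the integral over the remaining coordinates vanishes by induction on the dimension. *)
Lemma integral_derive_compact n (f : 'rV[R]_n -> R) (k : 'I_n) (a : R) : 0 <= a ->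
  (forall y, derivable f y (delta_mx 0 k)) ->
  (forall y, {for y, continuous ('D_(delta_mx 0 k) f)}) ->
  (forall y, a < `|y| -> f y = 0) -> (forall y, a < `|y| -> 'D_(delta_mx 0 k) f y = 0) ->
  (\int[lebesgue_tuple n]_t ('D_(delta_mx 0 k) f (rV_of_tuple t))%:E = 0)%E.
Proof.
move=> a0; elim: n f k => [f []//|n ih] f k df cf f0 f'0.
have intF := tuple_integrable cf f'0.
have mF := measurable_int _ intF.
rewrite integral_lebesgue_tupleS//.
have intP : (leb \x lebesgue_tuple n)%E.-integrable setT (fun p => ('D_(delta_mx 0 k) f (rV_of_tuple (tcons p)))%:E).
  apply/integrableP; split; first by apply: (measurableT_comp mF); exact: measurable_tcons.
  move/integrableP : intF => [_]; rewrite integral_lebesgue_tupleS//.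
  by apply: measurableT_comp mF.
have [k' kk'|k0] := unliftP ord0 k.
  rewrite -(integral12_prod_meas1 intP) /fubini_F /=.
  apply: integral0_eq => x _.
  transitivity (\int[lebesgue_tuple n]_t ('D_(delta_mx 0 k') (f \o consr x) (rV_of_tuple t))%:E)%E.
    by apply: eq_integral => t _; rewrite rV_of_tuple_cons kk' (consr_growth f x (rV_of_tuple t) k').2.
  have E : 'D_(delta_mx 0 k') (f \o consr x) = 'D_(delta_mx 0 k) f \o consr x.
    by apply/funext => z /=; rewrite (consr_growth f x z k').2 kk'.
  apply: ih.
  - by move=> y; rewrite (consr_growth f x y k').1 -kk'.
  - by move=> y; rewrite E; apply: continuous_comp; [exact: consr_continuous|exact: cf].
  - by move=> y ya /=; apply: f0; apply: lt_le_trans ya (consr_norm_ge x y).2.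
  - by move=> y ya; have := congr1 (@^~ y) E; rewrite /= => ->; apply: f'0; apply: lt_le_trans ya (consr_norm_ge x y).2.
rewrite -(integral21_prod_meas1 intP) /fubini_G /=.
apply: integral0_eq => t _.
transitivity (\int[leb]_x ('D_1 (fun s => f (consr s (rV_of_tuple t))) x)%:E)%E.
  by apply: eq_integral => x _; rewrite rV_of_tuple_cons k0 (consr_growth0 f x (rV_of_tuple t)).2.
have E : 'D_1 (fun s => f (consr s (rV_of_tuple t))) = fun s => 'D_(delta_mx 0 k) f (consr s (rV_of_tuple t)).
  by apply/funext => x; rewrite (consr_growth0 f x (rV_of_tuple t)).2 k0.
apply: (integral_derive1_compact a0).
- by move=> x; rewrite (consr_growth0 f x (rV_of_tuple t)).1 -k0.
- move=> x; rewrite E.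
  apply: (@continuous_comp _ _ _ (fun s => consr s (rV_of_tuple t)) ('D_(delta_mx 0 k) f)); last exact: cf.
  apply: mx_continuousP => i j.
  have -> : (fun s : R => consr s (rV_of_tuple t) i j) = (fun s : R => if unlift ord0 j is Some l then rV_of_tuple t 0 l else s).
    by apply/funext => s; rewrite mxE.
  by case: unliftP => [l _|_]; [exact: cst_continuous|exact: cvg_id].
- by move=> x xa; apply: f0; apply: lt_le_trans xa (consr_norm_ge _ _).1.
- by move=> x xa; have := congr1 (@^~ x) E; rewrite /= => ->; apply: f'0; apply: lt_le_trans xa (consr_norm_ge _ _).1.
Qed.

End euclidean_integral.

(** * Riemannian geometry in charts *)

Section manifold_charts.
Context {R : realType} {n : nat} {M : ptopologicalType} (A : manifold R n M).
Implicit Types (c d : chart A) (U : set M) (f : M -> R).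

Lemma mfd_hausdorff : hausdorff_space M. Proof. by case: A. Qed.

Lemma mfd_second_countable : @second_countable M. Proof. by case: A. Qed.

Lemma dom_chart_at x : dom (chart_at A x) x.
Proof. by case: A x => ? ? ? ? ? ? ? h1 h2 h3 h4 h5 h6 h7 h8 h9 x; exact: h3. Qed.

Lemma open_dom c : open (dom c).
Proof. by case: A c => ? ? ? ? ? ? ? h1 h2 h3 h4 h5 h6 h7 h8 h9 c; exact: h4. Qed.

Lemma open_img c : open (img c).
Proof. by case: A c => ? ? ? ? ? ? ? h1 h2 h3 h4 h5 h6 h7 h8 h9 c; exact: h5. Qed.

Lemma coordK c x : dom c x -> param c (Defs.coord c x) = x.
Proof. by case: A c => ? ? ? ? ? ? ? h1 h2 h3 h4 h5 h6 h7 h8 h9 c; exact: h6. Qed.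

Lemma coord_cont c x : dom c x -> {for x, continuous (Defs.coord c)}.
Proof.
move=> cx; have : {within dom c, continuous (Defs.coord c)}.
  by move: c {cx}; case: A => ? ? ? ? ? ? ? h1 h2 h3 h4 h5 h6 h7 h8 h9 c; exact: h7.
by rewrite continuous_open_subspace; [apply; rewrite inE|exact: open_dom].
Qed.

Lemma param_cont c y : img c y -> {for y, continuous (param c)}.
Proof.
move=> cy; have : {within img c, continuous (param c)}.
  by move: c {cy}; case: A => ? ? ? ? ? ? ? h1 h2 h3 h4 h5 h6 h7 h8 h9 c; exact: h8.
by rewrite continuous_open_subspace; [apply; rewrite inE|exact: open_img].
Qed.

Lemma transition_Smooth c d : Smooth (Defs.coord c @` (dom c `&` dom d)) (transition c d).
Proof. by split; case: A c d => ? ? ? ? ? ? ? h1 h2 h3 h4 h5 h6 h7 h8 h9 c d; exact: h9. Qed.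

Lemma img_coord c x : dom c x -> img c (Defs.coord c x).
Proof. by move=> cx; exists x. Qed.

Lemma dom_param c y : img c y -> dom c (param c y).
Proof. by move=> [x cx <-]; rewrite coordK. Qed.

Lemma paramK c y : img c y -> Defs.coord c (param c y) = y.
Proof. by move=> [x cx <-]; rewrite coordK. Qed.

Lemma coord_imageE c U : Defs.coord c @` (U `&` dom c) = img c `&` param c @^-1` U.
Proof.
apply/seteqP; split=> [_ [x [Ux cx] <-]|y [cy Uy]].
  by split; [exact: img_coord|rewrite /= coordK].
exists (param c y); last exact: paramK.
by split=> //; exact: dom_param.
Qed.

Lemma open_preimage_cont (T1 T2 : topologicalType) (W : set T1) (f : T1 -> T2) (U : set T2) :
  open W -> (forall x, W x -> {for x, continuous f}) -> open U -> open (W `&` f @^-1` U).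
Proof.
move=> oW cf oU; rewrite openE => x [Wx Ux]; apply: filterI.
  exact: open_nbhs_nbhs.
by apply: (cf x Wx); exact: open_nbhs_nbhs.
Qed.

Lemma open_coord_image c U : open U -> open (Defs.coord c @` (U `&` dom c)).
Proof.
by move=> oU; rewrite coord_imageE; apply: open_preimage_cont => //;
  [exact: open_img|move=> y; exact: param_cont].
Qed.

Arguments open_coord_image c {U}.

(** Smoothness on an open subset U, tested in every chart; it allows a function to be glued from a
    chart domain and the complement of a compact set. *)
Inductive msmooth U f : Prop :=
  MSmooth of forall c, Smooth (Defs.coord c @` (U `&` dom c)) (f \o param c).

Lemma msmoothP U f c : msmooth U f -> Smooth (Defs.coord c @` (U `&` dom c)) (f \o param c).
Proof. by case. Qed.

Notation smth := (msmooth setT).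

Lemma smoothE f : smooth A f <-> msmooth setT f.
Proof.
split=> [sf|[sf] c]; last by have [+] := sf c; rewrite setTI.
by split=> c; rewrite setTI; split; exact: sf.
Qed.

Lemma smooth_Smooth f c : smth f -> Smooth (img c) (f \o param c).
Proof. by move=> /(msmoothP c); rewrite setTI. Qed.

Lemma msmooth_eq U f g : open U -> (forall x, U x -> f x = g x) -> msmooth U f -> msmooth U g.
Proof.
move=> oU fg [sf]; split=> c; apply: Smooth_eq (sf c); first exact: open_coord_image.
by move=> _ [x [Ux cx] <-] /=; rewrite coordK// fg.
Qed.

(** In any other chart the function is the composite of its expression in c with a smooth transition
    map. *)
Lemma msmooth_chart c U f : open U -> U `<=` dom c -> Smooth (Defs.coord c @` U) (f \o param c) -> msmooth U f.
Proof.
move=> oU Uc sf; split=> d.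
have oV := open_coord_image d oU.
have E y : (Defs.coord d @` (U `&` dom d)) y -> (f \o param c) (transition d c y) = (f \o param d) y.
  by move=> [x [Ux dx] <-]; rewrite /transition /= (coordK dx) coordK//; exact: Uc.
apply: (Smooth_eq oV E).
have UE : Defs.coord c @` U = Defs.coord c @` (U `&` dom c).
  by congr (_ @` _); apply/seteqP; split=> [x Ux|x []//]; split=> //; exact: Uc.
apply: (Smooth_comp_rV oV _ _ sf).
- by rewrite UE; exact: open_coord_image.
- by move=> _ [x [Ux dx] <-]; rewrite /transition /= coordK//; exists x.
- apply: Smooth_subset (transition_Smooth d c).
  by move=> _ [x [Ux dx] <-]; exists x => //; split=> //; exact: Uc.
Qed.

Lemma smooth_local f : (forall x, exists U, [/\ open U, U x & msmooth U f]) -> smth f.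
Proof.
move=> H; split=> c; split=> s y [x [_ cx] <-]; have [U [oU Ux [/(_ c)[sfc]]]] := H x.
by apply: sfc; exists x.
Qed.

Lemma smooth_cover U U' f : open U -> open U' -> U `|` U' = setT ->
  msmooth U f -> msmooth U' f -> smth f.
Proof.
move=> oU oU' UU' sf sf'; apply: smooth_local => x.
have : (U `|` U') x by rewrite UU'.
by move=> [Ux|Ux]; [exists U|exists U'].
Qed.

Lemma msmooth_cst U (a : R) : msmooth U (fun=> a).
Proof. by split=> c; exact: Smooth_cst. Qed.

Lemma msmoothD U f g : open U -> msmooth U f -> msmooth U g -> msmooth U (fun x => f x + g x).
Proof. by move=> oU [sf] [sg]; split=> c; exact: (SmoothD (open_coord_image c oU) (sf c) (sg c)). Qed.

Lemma msmoothM U f g : open U -> msmooth U f -> msmooth U g -> msmooth U (fun x => f x * g x).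
Proof. by move=> oU [sf] [sg]; split=> c; exact: (SmoothM (open_coord_image c oU) (sf c) (sg c)). Qed.

Lemma msmooth_comp1 U f (W : set R) (h : R -> R) : open U -> (forall x, U x -> W (f x)) ->
  Smooth W h -> msmooth U f -> msmooth U (fun x => h (f x)).
Proof.
move=> oU fW sh [sf]; split=> c; apply: (Smooth_comp1 (open_coord_image c oU) _ sh (sf c)).
by move=> _ [x [Ux cx] <-] /=; rewrite coordK//; exact: fW.
Qed.

Lemma msmoothZ U (a : R) f : open U -> msmooth U f -> msmooth U (fun x => a * f x).
Proof. by move=> oU sf; exact: (msmoothM oU (msmooth_cst U a) sf). Qed.

Lemma msmoothB U f g : open U -> msmooth U f -> msmooth U g -> msmooth U (fun x => f x - g x).
Proof.
move=> oU sf sg; have := msmoothD oU sf (msmoothZ (-1) oU sg).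
by under eq_fun do rewrite mulN1r.
Qed.

Lemma smooth_cont f : smth f -> continuous f.
Proof.
move=> sf x; set c := chart_at A x; have cx : dom c x := dom_chart_at x.
have E : forall y, dom c y -> (f \o param c \o Defs.coord c) y = f y.
  by move=> y cy /=; rewrite coordK.
apply: (continuous_eq_on (open_dom c) E cx).
apply: continuous_comp; first exact: coord_cont.
by apply: (Smooth_cont (smooth_Smooth c sf)); exact: img_coord.
Qed.

Lemma compact_closed_mfd (K : set M) : compact K -> closed K.
Proof. exact: (compact_closed mfd_hausdorff). Qed.

End manifold_charts.
Arguments open_coord_image {R n M A} c {U}.

(** * Bump functions *)

Section bumps.
Context {R : realType}.

(** The usual quotient of flat functions; 4 - s^2 and s^2 - 1 are never both nonpositive, so the
    denominator does not vanish. *)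
Definition plateau (s : R) : R := flat (4 - s ^+ 2) / (flat (4 - s ^+ 2) + flat (s ^+ 2 - 1)).

Let den_gt0 (s : R) : 0 < flat (4 - s ^+ 2) + flat (s ^+ 2 - 1).
Proof.
have [s1|s1] := ltP (s ^+ 2) 4.
  by rewrite ltr_pwDl ?flat_ge0// flat_gt0// subr_gt0.
by rewrite ltr_wpDl ?flat_ge0// flat_gt0// subr_gt0 (lt_le_trans _ s1)// ltr1n.
Qed.

Lemma Smooth_plateau : Smooth [set: R] plateau.
Proof.
have oT := @openT R.
have sid : Smooth [set: R] (fun s : R => s).
  by apply: (@Smooth_linear _ R R setT idfun) => // x; exact: cvg_id.
have s2 : Smooth [set: R] (fun s : R => s ^+ 2) by exact: (SmoothM oT sid sid).
have f1 : Smooth [set: R] (fun s : R => flat (4 - s ^+ 2)).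
  by apply: (@Smooth_comp1 _ _ setT) => //; [exact: Smooth_flat|apply: SmoothB => //; exact: Smooth_cst].
have f2 : Smooth [set: R] (fun s : R => flat (s ^+ 2 - 1)).
  by apply: (@Smooth_comp1 _ _ setT) => //; [exact: Smooth_flat|apply: SmoothB => //; exact: Smooth_cst].
apply: SmoothM => //; apply: SmoothV => //; last exact: SmoothD.
by move=> s _; rewrite gt_eqF.
Qed.

Lemma plateau_ge0 s : 0 <= plateau s.
Proof. by rewrite divr_ge0 ?flat_ge0// ltW. Qed.

Lemma plateau_le1 s : plateau s <= 1.
Proof. by rewrite ler_pdivrMr// mul1r lerDl flat_ge0. Qed.

Lemma plateau1 s : `|s| <= 1 -> plateau s = 1.
Proof.
move=> s1; have s2 : s ^+ 2 <= 1 by rewrite -real_normK ?num_real// expr_le1.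
rewrite /plateau (@flat_le0 _ (s ^+ 2 - 1)) ?subr_le0// addr0 divff//.
by rewrite gt_eqF// flat_gt0// subr_gt0 (le_lt_trans s2)// ltr1n.
Qed.

Lemma plateau0 s : 2 <= `|s| -> plateau s = 0.
Proof.
move=> s2; rewrite /plateau flat_le0 ?mul0r// subr_le0 -real_normK ?num_real//.
by rewrite -[4](_ : 2 ^+ 2 = 4 :> R) ?ler_sqr ?nnegrE// expr2 -natrM.
Qed.

Definition rV_plateau n (r : R) (y0 y : 'rV[R]_n) : R :=
  \prod_(i < n) plateau (r^-1 * (y 0 i - y0 0 i)).

Lemma Smooth_rV_plateau n r (y0 : 'rV[R]_n) : Smooth setT (rV_plateau r y0).
Proof.
have oT := @openT 'rV[R]_n; apply: Smooth_prod => // i _.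
apply: (@Smooth_comp1 _ _ setT setT plateau (fun y : 'rV[R]_n => r^-1 * (y 0 i - y0 0 i))) => //.
  exact: Smooth_plateau.
apply: SmoothM => //; first exact: Smooth_cst.
by apply: SmoothB => //; [exact: Smooth_coord|exact: Smooth_cst].
Qed.

Lemma rV_plateau01 n r (y0 y : 'rV[R]_n) : 0 <= rV_plateau r y0 y <= 1.
Proof.
rewrite /rV_plateau; apply: (@big_ind _ (fun z : R => 0 <= z <= 1)) => [|a b|i _].
- by rewrite ler01 lexx.
- by move=> /andP[a0 a1] /andP[b0 b1]; rewrite mulr_ge0//= mulr_ile1.
- by rewrite plateau_ge0 plateau_le1.
Qed.

Lemma rV_plateau1 n r (y0 y : 'rV[R]_n) : 0 < r -> `|y - y0| <= r -> rV_plateau r y0 y = 1.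
Proof.
move=> r0 yr; rewrite /rV_plateau big1// => i _; apply: plateau1.
rewrite normrM gtr0_norm ?invr_gt0// ler_pdivrMl// mulr1.
by apply: le_trans yr; have := mx_entry_le_norm (y - y0) 0 i; rewrite !mxE.
Qed.

Lemma rV_plateau0 n r (y0 y : 'rV[R]_n) : 0 < r -> 2 * r < `|y - y0| -> rV_plateau r y0 y = 0.
Proof.
move=> r0 yr.
have [i Hi] : exists i, 2 * r <= `|y 0 i - y0 0 i|.
  apply: contrapT => H; move: yr; rewrite ltNge => /negP; apply.
  apply: mx_norm_le; first by rewrite mulr_ge0// ltW.
  move=> j i; rewrite ord1 !mxE leNgt; apply/negP => /ltW Hi; apply: H; by exists i.
rewrite /rV_plateau (bigD1 i)//= plateau0 ?mul0r//.
by rewrite normrM gtr0_norm ?invr_gt0// ler_pdivlMl// mulrC.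
Qed.

Context {n : nat} {M : ptopologicalType} (A : manifold R n M).

(** The cut-off is built in coordinates and extended by 0. It is smooth because the chart domain and
    the complement of the compact support form an open cover of M, compact sets being closed in the
    Hausdorff space M. *)
Lemma bump_exists (c : chart A) (x0 : M) (U : set M) : open U -> U x0 -> dom c x0 ->
  exists b : M -> R, [/\ msmooth A setT b, forall x, 0 <= b x <= 1,
    exists K, [/\ compact K, K `<=` U `&` dom c & forall x, ~ K x -> b x = 0] &
    \forall x \near x0, b x = 1].
Proof.
move=> oU Ux0 cx0; pose y0 := Defs.coord c x0.
have oW := open_coord_image c oU.
have Wy0 : (Defs.coord c @` (U `&` dom c)) y0 by exists x0.
have /nbhs_ballP[e /= e0 eW] := open_nbhs_nbhs (conj oW Wy0).
(* The support is a cube of radius 2 r, so a third of e keeps it inside the ball. *)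
pose r := e / 3; have r0 : 0 < r by rewrite divr_gt0.
pose b x := if x \in dom c then rV_plateau r y0 (Defs.coord c x) else 0.
pose B := [set y : 'rV[R]_n | `|y - y0| <= 2 * r].
have cB : compact B.
  have -> : B = (fun z => z + y0) @` [set z | `|z| <= 2 * r].
    apply/seteqP; split=> [y yB|_ [z zB <-]]; last by rewrite /B/= addrK.
    by exists (y - y0) => //; rewrite subrK.
  apply: continuous_compact; last exact: rV_closed_ball_compact.
  apply: continuous_subspaceT => z.
  exact: (@cvgD _ _ _ (nbhs z) _ id (cst y0) z y0 cvg_id (cvg_cst y0)).
have BW : B `<=` Defs.coord c @` (U `&` dom c).
  move=> y yB; apply: eW; rewrite -ball_normE /= distrC (le_lt_trans yB)// /r mulrCA.
  by rewrite gtr_pMr// ltr_pdivrMr// mul1r ltr_nat.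
have Bimg : B `<=` img c by move=> y /BW[x [_ cx] <-]; exact: img_coord.
pose K := param c @` B.
have cK : compact K.
  apply: continuous_compact => //; apply: continuous_in_subspaceT => y; rewrite inE => yB.
  exact/param_cont/Bimg.
have KU : K `<=` U `&` dom c.
  by move=> _ [y /BW[x [Ux cx] <-] <-]; rewrite coordK.
have b0 x : ~ K x -> b x = 0.
  move=> Kx; rewrite /b; case: ifPn => //; rewrite inE => cx; apply: rV_plateau0 => //.
  by rewrite ltNge; apply/negP => xB; apply: Kx; exists (Defs.coord c x) => //; rewrite coordK.
have b1 : \forall x \near x0, b x = 1.
  have : \forall x \near x0, ball y0 r (Defs.coord c x).
    by apply: (coord_cont cx0); exact: nbhsx_ballx.
  move=> H; have : \forall x \near x0, dom c x by exact: open_nbhs_nbhs (conj (open_dom c) cx0).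
  apply: filterS2 H => x xr cx; rewrite /b mem_set//; apply: rV_plateau1 => //.
  by move: xr; rewrite -ball_normE /= distrC => /ltW.
exists b; split=> //; last 1 first.
- by exists K.
- have oK : open (~` K) by apply: closed_openC; exact: (compact_closed_mfd A).
  apply: (smooth_cover (open_dom c) oK).
  + by apply/seteqP; split=> // x _; have [/KU[_ cx]|Kx] := pselect (K x); [left|right].
  + apply: (@msmooth_chart _ _ _ A c _ b (open_dom c)); first by [].
    have : Smooth (Defs.coord c @` dom c) (rV_plateau r y0) by apply: Smooth_subset (Smooth_rV_plateau r y0).
    have oi : open (Defs.coord c @` dom c) by exact: (@open_img _ _ _ A c).
    move=> H; apply: (Smooth_eq oi _ H).
    by move=> _ [x cx <-] /=; rewrite coordK// /b mem_set.
  + by apply: (msmooth_eq oK _ (msmooth_cst A _ 0)) => x Kx; rewrite b0.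
- by move=> x; rewrite /b; case: ifP => _; [exact: rV_plateau01|rewrite lexx ler01].
Qed.

End bumps.

(** * Positive definite matrices *)

Section posdef.
Context {R : realType}.

Definition posdef m (G : 'M[R]_m) := forall v : 'rV[R]_m, v != 0 -> 0 < (v *m G *m v^T) 0 0.

Lemma posdef_det_neq0 m (G : 'M[R]_m) : posdef G -> \det G != 0.
Proof.
move=> Gp; apply/negP => /det0P[v v0 vG].
by have := Gp v v0; rewrite vG mul0mx mxE ltxx.
Qed.

(** The segment from the identity to G consists of positive definite, hence invertible, matrices; a
    nonpositive determinant at G would force a zero of the determinant on it by the intermediate
    value theorem. *)
Lemma posdef_det_gt0 m (G : 'M[R]_m) : posdef G -> 0 < \det G.
Proof.
move=> Gp; rewrite ltNge; apply/negP => detG.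
pose F (t : R) : 'M[R]_m := t *: G + (1 - t) *: 1%:M.
have oT := @openT R.
have sid : Smooth [set: R] (fun s : R => s).
  by apply: (@Smooth_linear _ R R setT idfun) => // x; exact: cvg_id.
have sF : Smooth [set: R] (fun t => \det (F t)).
  apply: Smooth_det => //; apply/(Smooth_mxP _ oT) => i j.
  under eq_fun do rewrite !mxE; apply: SmoothD => //; apply: SmoothM => //.
  - exact: Smooth_cst.
  - by apply: SmoothB => //; exact: Smooth_cst.
  - exact: Smooth_cst.
have [| |t] := @IVT R (fun t => \det (F t)) 0 1 0 ler01.
  by apply: continuous_subspaceT => t; exact: (Smooth_cont sF I).
- rewrite /F scale0r add0r subr0 scale1r det1 scale1r subrr scale0r addr0.
  by rewrite ge_min detG orbT le_max ler01.
rewrite in_itv /= => /andP[t0 t1] /eqP; apply/negP; apply: posdef_det_neq0 => v v0.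
rewrite /F mulmxDr mulmxDl -!scalemxAr -!scalemxAl mulmx1 [X in 0 < X]mxE [X in X + _]mxE [X in _ + X]mxE.
have vv : 0 < (v *m v^T) 0 0.
  have [i vi] : exists i, v 0 i != 0.
    apply: contrapT => H; move/eqP : v0; apply; apply/rowP => i; rewrite mxE.
    by apply: contrapT => /eqP vi; apply: H; exists i.
  rewrite mxE (bigD1 i)//= ltr_pwDl//; last first.
    by apply: sumr_ge0 => j _; rewrite mxE -expr2 sqr_ge0.
  by rewrite mxE -expr2 lt_def sqr_ge0 sqrf_eq0 vi.
move: t0; rewrite le_eqVlt => /predU1P[<-|t0].
  by rewrite mul0r add0r subr0 mul1r.
by rewrite ltr_pwDl//; [rewrite mulr_gt0// Gp|rewrite mulr_ge0 ?subr_ge0// ltW].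
Qed.

Lemma Smooth_invmx {E : normedModType R} m (U : set E) (f : E -> 'M[R]_m) : open U ->
  (forall x, U x -> \det (f x) != 0) -> Smooth U f -> Smooth U (fun x => invmx (f x)).
Proof.
move=> oU f0 sf.
have : Smooth U (fun x => (\det (f x))^-1 *: \adj (f x)).
  apply: Smooth_scalemx => //; first by apply: SmoothV => //; exact: Smooth_det.
  apply/(Smooth_mxP _ oU) => i j.
  under eq_fun do rewrite mxE /cofactor.
  apply: SmoothM => //; first exact: Smooth_cst.
  apply: Smooth_det => //; apply/(Smooth_mxP _ oU) => a b.
  by under eq_fun do rewrite !mxE; exact: Smooth_mx_entry.
by apply: (Smooth_eq oU) => x Ux; rewrite /invmx unitmxE unitfE f0.
Qed.

Lemma Smooth_row {E : normedModType R} m (U : set E) (f : 'I_m -> E -> R) : open U ->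
  (forall k, Smooth U (f k)) -> Smooth U (fun x => \row_k f k x).
Proof.
by move=> oU sf; apply/(Smooth_mxP _ oU) => i j; under eq_fun do rewrite mxE.
Qed.

End posdef.

(** * Gradient, inner product and divergence in charts *)

Section riemannian_geometry.
Context {R : realType} {n : nat} {M : ptopologicalType} (A : riemannian R n M).
Implicit Types (c d : chart A) (X Y : chart A -> M -> 'rV[R]_n) (f h : M -> R) (U : set M).
Local Notation smth := (msmooth A setT).
Local Notation jac c d x := ('J (transition c d) (Defs.coord c x)).

Lemma metric_Smooth c : Smooth (img c) (metric c \o param c).
Proof. by split; case: A c => ? ? h1 h2 h3 h4 c; exact: h1. Qed.

Lemma metric_sym c x : dom c x -> (metric c x)^T = metric c x.
Proof. by case: A c => ? ? h1 h2 h3 h4 c; exact: h2. Qed.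

Lemma metric_posdef c x : dom c x -> posdef (metric c x).
Proof. by move=> cx v v0; case: A c cx => ? ? h1 h2 h3 h4 c cx; exact (h3 c x v cx v0). Qed.

Lemma metric_change c d x : dom c x -> dom d x ->
  metric c x = jac c d x *m metric d x *m (jac c d x)^T.
Proof. by case: A c d => ? ? h1 h2 h3 h4 c d; exact: h4. Qed.

Lemma metric_unit c x : dom c x -> metric c x \in unitmx.
Proof. by move=> cx; rewrite unitmxE unitfE posdef_det_neq0//; exact: metric_posdef. Qed.

(** Taking determinants in the transformation law of the metric gives invertibility without
    differentiating the inverse transition map. *)
Lemma jac_unit c d x : dom c x -> dom d x -> jac c d x \in unitmx.
Proof.
move=> cx dx; rewrite unitmxE unitfE; have := posdef_det_neq0 (metric_posdef cx).
by rewrite (metric_change cx dx) !det_mulmx !mulf_eq0 !negb_or => /andP[/andP[]].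
Qed.

Lemma vol_density_gt0 c x : dom c x -> 0 < vol_density c x.
Proof. by move=> cx; rewrite sqrtr_gt0 posdef_det_gt0//; exact: metric_posdef. Qed.

Lemma vol_density_Smooth c : Smooth (img c) (vol_density c \o param c).
Proof.
have oi := @open_img _ _ _ A c.
apply: (@Smooth_comp1 _ _ [set s | 0 < s] (img c) (@Num.sqrt R) (fun y => \det (metric c (param c y)))) => //.
- by move=> y cy; apply/posdef_det_gt0/metric_posdef; exact: dom_param.
- exact: Smooth_sqrt.
- by apply: Smooth_det => //; exact: metric_Smooth.
Qed.

Lemma metric_inv_Smooth c : Smooth (img c) (fun y => invmx (metric c (param c y))).
Proof.
apply: Smooth_invmx; [exact: open_img| |exact: metric_Smooth].
by move=> y cy; apply/posdef_det_neq0/metric_posdef; exact: dom_param.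
Qed.

Lemma partial_change U c d x f k : open U -> U x -> dom c x -> dom d x -> msmooth A U f ->
  partial c k f x = \sum_l jac c d x k l * partial d l f x.
Proof.
move=> oU Ux cx dx sf.
have oUd : open (U `&` dom d) by apply: openI => //; exact: open_dom.
have oW := open_coord_image c oUd.
have Wx : (Defs.coord c @` ((U `&` dom d) `&` dom c)) (Defs.coord c x) by exists x.
have E y : (Defs.coord c @` ((U `&` dom d) `&` dom c)) y ->
    (f \o param c) y = ((f \o param d) \o transition c d) y.
  by move=> [z [[Uz dz] cz] <-] /=; rewrite /transition/= !coordK.
rewrite /partial (derive_eq_on _ oW E Wx).
have oT := open_coord_image c (@open_dom _ _ _ A d).
have tS : Smooth (Defs.coord c @` (dom d `&` dom c)) (transition c d).
  by rewrite setIC; exact: transition_Smooth.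
have tx : (Defs.coord c @` (dom d `&` dom c)) (Defs.coord c x) by exists x.
have tE : transition c d (Defs.coord c x) = Defs.coord d x by rewrite /transition/= coordK.
have oD := open_coord_image d oU.
have Dx : (Defs.coord d @` (U `&` dom d)) (transition c d (Defs.coord c x)) by rewrite tE; exists x.
have sfd := msmoothP d sf.
have dt : differentiable (transition c d) (Defs.coord c x) by exact: Smooth_mx_differentiable oT tS tx.
have dh := Smooth_differentiable oD sfd Dx.
have dert := Smooth_derivable (v := delta_mx 0 k) tS tx.
rewrite (derivable_comp_rV dert dh).2 -(deriveE _ dh) (Smooth_deriveE _ oD sfd Dx).
apply: eq_bigr => l _; rewrite tE; congr (_ * _).
by rewrite (deriveEjacobian _ dt) -rowE mxE.
Qed.

Definition dpart c f x : 'rV[R]_n := \row_k partial c k f x.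

Lemma dpart_change U c d x f : open U -> U x -> dom c x -> dom d x -> msmooth A U f ->
  dpart c f x = dpart d f x *m (jac c d x)^T.
Proof.
move=> oU Ux cx dx sf; apply/rowP => k; rewrite !mxE (partial_change k oU Ux cx dx sf).
by apply: eq_bigr => l _; rewrite !mxE mulrC.
Qed.

(** Differentials transform by the transposed Jacobian and the metric by the Jacobian on both sides;
    multiplying by the metric and cancelling the invertible Jacobian leaves the contravariant
    rule. *)
Lemma grad_change U c d x f : open U -> U x -> dom c x -> dom d x -> msmooth A U f ->
  grad A f d x = grad A f c x *m jac c d x.
Proof.
move=> oU Ux cx dx sf.
have gc : grad A f c x *m metric c x = dpart c f x by rewrite mulmxKV// metric_unit.
have ju := jac_unit cx dx.
suff H : grad A f c x *m jac c d x *m metric d x = dpart d f x.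
  by rewrite {1}/grad -/(dpart d f x) -H mulmxK// metric_unit.
apply: (can_inj (mulmxK (_ : (jac c d x)^T \in unitmx))); first by rewrite unitmx_tr.
rewrite -(dpart_change oU Ux cx dx sf) -gc.
by rewrite (metric_change cx dx) !mulmxA.
Qed.

Lemma grad_vector_field f : smth f -> vector_field (grad A f).
Proof.
by move=> sf c d x cx dx; apply: (grad_change (U := setT)) => //; exact: openT.
Qed.

Lemma partial_Smooth U c k f : open U -> msmooth A U f ->
  Smooth (Defs.coord c @` (U `&` dom c)) (partial c k f \o param c).
Proof.
move=> oU sf; have oW := open_coord_image c oU.
apply: (Smooth_eq oW _ (Smooth_derive (delta_mx 0 k) (msmoothP c sf))).
by move=> _ [x [Ux cx] <-]; rewrite /partial /= coordK.
Qed.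

Lemma grad_Smooth c f : smth f -> Smooth (img c) (grad A f c \o param c).
Proof.
move=> sf; have oi := @open_img _ _ _ A c.
apply: Smooth_mulmx => //; last exact: metric_inv_Smooth.
apply: Smooth_row => // k; have := partial_Smooth c k (@openT M) sf.
by rewrite setTI.
Qed.

Lemma inner_chart X Y c x : vector_field X -> vector_field Y -> dom c x ->
  inner X Y x = (X c x *m metric c x *m (Y c x)^T) 0 0.
Proof.
move=> vX vY cx; rewrite /inner; set d := chart_at A x.
have dx : dom d x by exact: dom_chart_at.
rewrite (vX _ _ _ cx dx) (vY _ _ _ cx dx) (metric_change cx dx) trmx_mul.
by rewrite !mulmxA.
Qed.

Lemma inner_grad_chart X f c x : vector_field X -> smth f -> dom c x ->
  inner X (grad A f) x = \sum_k X c x 0 k * partial c k f x.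
Proof.
move=> vX sf cx; rewrite (inner_chart vX (grad_vector_field sf) cx) /grad trmx_mul.
rewrite trmx_inv (metric_sym cx) mulmxA mulmxK ?metric_unit// mxE.
by apply: eq_bigr => k _; rewrite !mxE.
Qed.

Lemma innerC X Y x : inner X Y x = inner Y X x.
Proof.
rewrite /inner; set c := chart_at A x.
rewrite -[in LHS](trmxK (_ *m _ *m _)) mxE !trmx_mul trmxK (metric_sym (dom_chart_at A x)).
by rewrite mulmxA.
Qed.

Lemma inner_ge0 X x : 0 <= inner X X x.
Proof.
rewrite /inner; set c := chart_at A x.
have [->|X0] := eqVneq (X c x) 0; first by rewrite !mul0mx mxE.
by apply/ltW/(metric_posdef (dom_chart_at A x)).
Qed.

Lemma innerDl X Y Z x : inner (fun c y => X c y + Y c y) Z x = inner X Z x + inner Y Z x.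
Proof. by rewrite /inner !mulmxDl mxE. Qed.

Lemma innerZl (a : R) X Y x : inner (fun c y => a *: X c y) Y x = a * inner X Y x.
Proof. by rewrite /inner -!scalemxAl mxE. Qed.

Lemma innerMl h X Y x : inner (fun c y => h y *: X c y) Y x = h x * inner X Y x.
Proof. by rewrite /inner -!scalemxAl mxE. Qed.

Lemma innerDr X Y Z x : inner Z (fun c y => X c y + Y c y) x = inner Z X x + inner Z Y x.
Proof. by rewrite innerC innerDl !(innerC _ Z). Qed.

Lemma innerMr h X Y x : inner Y (fun c y => h y *: X c y) x = h x * inner Y X x.
Proof. by rewrite innerC innerMl innerC. Qed.

(** The classical coordinate formula in an arbitrary chart, where [div] uses the preferred chart at
    x. Independence of the chart is deduced later from integration by parts instead of a computation
    with Jacobians. *)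
Definition divc c X (x : M) : R :=
  (vol_density c x)^-1 * \sum_(k < n) partial c k (fun y => vol_density c y * X c y 0 k) x.

Lemma divE X x : div X x = divc (chart_at A x) X x. Proof. by []. Qed.

Lemma flux_Smooth c X k : Smooth (img c) (X c \o param c) ->
  Smooth (img c) ((fun y => vol_density c y * X c y 0 k) \o param c).
Proof.
move=> sX; have oi := @open_img _ _ _ A c; apply: SmoothM => //; first exact: vol_density_Smooth.
exact: (Smooth_mx_entry 0 k oi sX).
Qed.

Lemma divc_Smooth c X : Smooth (img c) (X c \o param c) -> Smooth (img c) (divc c X \o param c).
Proof.
move=> sX; have oi := @open_img _ _ _ A c.
apply: SmoothM => //.
  apply: SmoothV => //; last exact: vol_density_Smooth.
  by move=> y cy; rewrite /= gt_eqF// vol_density_gt0//; exact: dom_param.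
apply: Smooth_sum => // k _.
apply: (Smooth_eq oi _ (Smooth_derive (delta_mx 0 k) (flux_Smooth k sX))).
by move=> y cy; rewrite /partial /= paramK.
Qed.

End riemannian_geometry.
Arguments dpart {R n M A} c f x.
Arguments divc {R n M A} c X x.

(** * Countable covers *)

Section topology_measure.
Context {R : realType} {M : ptopologicalType}.

(** Basic open sets are coded by natural numbers. Whenever the set coded by k lies in some U x with
    x in D, one such x is chosen as the k-th point; [x1] fills the remaining indices. *)
Lemma lindelof_in (D : set M) (U : M -> set M) (x1 : M) : @second_countable M ->
  D x1 -> (forall x, D x -> open (U x) /\ U x x) ->
  exists s : nat -> M, (forall k, D (s k)) /\ forall y, D y -> exists k, U (s k) y.
Proof.
move=> [B cB [oB bB]] Dx1 HU.
have /countable_injP[f finj] := cB.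
have H k : exists x, D x /\ ((exists V, [/\ B V, f V = k & exists2 x, D x & V `<=` U x]) ->
    exists V, [/\ B V, f V = k & V `<=` U x]).
  have [[V [BV fV [x Dx Vx]]]|nH] := pselect (exists V, [/\ B V, f V = k & exists2 x, D x & V `<=` U x]).
    by exists x; split=> // _; exists V.
  by exists x1.
exists (fun k => sval (cid (H k))); split=> [k|y Dy]; first by case: cid => x [].
have [oU Uy] := HU y Dy.
have [V [BV Vy] VU] := bB y _ (open_nbhs_nbhs (conj oU Uy)).
exists (f V); case: cid => x /= [_ Hx].
have [V' [BV' fV' V'x]] : exists V', [/\ B V', f V' = f V & V' `<=` U x].
  by apply: Hx; exists V; split=> //; exists y.
by apply: V'x; rewrite (finj V' V) ?inE.
Qed.

Lemma lindelof (U : M -> set M) : @second_countable M ->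
  (forall x, open (U x) /\ U x x) -> exists s : nat -> M, forall y, exists k, U (s k) y.
Proof.
move=> sc HU; have [s [_ Hs]] := @lindelof_in setT U point sc I (fun x _ => HU x).
by exists s => y; exact: Hs.
Qed.

Lemma ae_countable_cover d (T : measurableType d) (m : {measure set T -> \bar R})
    (F : nat -> set T) (P : T -> Prop) : \bigcup_k F k = setT ->
  (forall k, \forall x \ae m, F k x -> P x) -> \forall x \ae m, P x.
Proof.
move=> FT H; have : m.-negligible (\bigcup_k (~` [set x | F k x -> P x])).
  by apply: negligible_bigcup => k; exact: H.
apply: negligibleS => x /= nP.
have [k _ Fx] : (\bigcup_k F k) x by rewrite FT.
by exists k => //= H'; apply: nP; exact: H'.
Qed.

Lemma measurable_fun_countable_cover d1 d2 (T1 : measurableType d1) (T2 : measurableType d2)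
    (F : nat -> set T1) (f : T1 -> T2) : \bigcup_k F k = setT ->
  (forall k, measurable (F k)) -> (forall k, measurable_fun (F k) f) -> measurable_fun setT f.
Proof. by move=> <- mF mf; apply/measurable_fun_bigcup. Qed.

End topology_measure.

(** * The Riemannian measure *)

Section chart_measure.
Context {R : realType} {n : nat} {M : ptopologicalType} (A : weighted R n M).
Implicit Types (c d : chart A) (f h : M -> R) (U K : set M).
Local Notation smth := (msmooth A setT).
Local Notation lam := (lebesgue_tuple n : {sigma_finite_measure set (n.-tuple R) -> \bar R}).

Lemma vol_riemannian : is_riemannian_measure A (vol A).
Proof. by case: A. Qed.

Lemma weight_smth : smth (weight A).
Proof. by apply/smoothE; case: A. Qed.

Lemma weight_gt0 x : 0 < weight A x.
Proof. by case: A. Qed.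

Lemma mu_weight (B : set (borel M)) : measurable B ->
  mu A B = (\int[vol A]_(x in B) (weight A x)%:E)%E.
Proof. by case: A => ? ? ? ? ? ? ? H; exact: H. Qed.

Lemma smth_measurable f : smth f -> measurable_fun [set: borel M] f.
Proof.
by move=> sf; apply: (borel_measurable_fun (U := setT)) => [|x _]; [exact: openT|exact: (smooth_cont sf)].
Qed.

(** Made total by sending tuples outside the image of the chart to a fixed point, so that it is
    measurable on the whole space; [chart_density] vanishes there, so the default value never
    contributes to an integral. *)
Definition chart_map c (t : n.-tuple R) : M :=
  if rV_of_tuple t \in img c then param c (rV_of_tuple t) else point.

Definition chart_density c (t : n.-tuple R) : R :=
  if rV_of_tuple t \in img c then vol_density c (param c (rV_of_tuple t)) else 0.

Definition chart_tuples c : set (n.-tuple R) := @rV_of_tuple R n @^-1` img c.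

Lemma measurable_chart_tuples c : measurable (chart_tuples c).
Proof. by apply: measurable_rV_of_tuple; exact: open_img. Qed.

Lemma measurable_chart_map c : measurable_fun setT (chart_map c : n.-tuple R -> borel M).
Proof.
apply: borel_map => U oU.
have -> : chart_map c @^-1` U =
  (@rV_of_tuple R n @^-1` (img c `&` param c @^-1` U)) `|` (~` chart_tuples c `&` [set t | U point]).
  apply/seteqP; split=> t /=; rewrite /chart_map /chart_tuples; case: ifPn => [|]; rewrite ?inE ?notin_setE.
  - by move=> ct Ut; left; split.
  - by move=> ct Ut; right; split.
  - by move=> ct [[//]|[]].
  - by move=> ct [[//]|[]].
apply: measurableU.
  apply: measurable_rV_of_tuple; apply: open_preimage_cont => //; first exact: open_img.
  by move=> y; exact: param_cont.
apply: measurableI; first by apply: measurableC; exact: measurable_chart_tuples.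
have [Up|Up] := pselect (U point).
  by rewrite (_ : [set t | U point] = setT)//; apply/seteqP; split.
by rewrite (_ : [set t | U point] = set0)//; apply/seteqP; split.
Qed.

Lemma measurable_chart_density c : measurable_fun setT (chart_density c).
Proof.
have -> : chart_density c = (fun t => vol_density c (param c (rV_of_tuple t))) \_ (chart_tuples c).
  apply/funext => t; rewrite patchE /chart_density /chart_tuples.
  by congr (if _ then _ else _); apply/idP/idP; rewrite !inE.
apply/(measurable_restrictT _ (measurable_chart_tuples c)).
apply: (@measurable_comp_open R _ _ _ (@rV_of_tuple R n) (img c) (vol_density c \o param c)).
- exact: measurable_rV_of_tuple.
- exact: open_img.
- by move=> y cy; exact: (Smooth_cont (vol_density_Smooth c) cy).
Qed.

Lemma chart_density_ge0 c t : 0 <= chart_density c t.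
Proof. by rewrite /chart_density; case: ifP => // _; exact: sqrtr_ge0. Qed.

(** The property that characterises vol_g on Borel subsets of a chart domain is the hypothesis [m1E]
    of the density lemma, for the totalised chart map and density. *)
Lemma integral_vol_chart c (f : borel M -> \bar R) : measurable_fun (dom c : set (borel M)) f ->
  (\int[vol A]_(x in dom c) f x =
   \int[lam]_(t in chart_tuples c) (f (param c (rV_of_tuple t)) * (vol_density c (param c (rV_of_tuple t)))%:E))%E.
Proof.
move=> mf.
have mD : measurable (dom c : set (borel M)) by apply: borel_open; exact: open_dom.
rewrite (@integral_density _ _ (borel M) _ R (vol A) lam (dom c) (chart_map c) (chart_density c) mD _ _ _ _ f mf).
- rewrite integral_mkcond [RHS]integral_mkcond; apply: eq_integral => t _; rewrite !patchE.
  case: ifPn; rewrite ?inE ?notin_setE /=; case: ifPn; rewrite ?inE ?notin_setE /chart_tuples/= => ct dt.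
  + by rewrite /chart_map /chart_density mem_set.
  + by rewrite /chart_density memNset// mule0.
  + by exfalso; apply: dt; rewrite /chart_map mem_set//; exact: dom_param.
  + by [].
- exact: measurable_chart_map.
- by apply: measurable_funTS; exact: measurable_chart_density.
- exact: chart_density_ge0.
- move=> B mB BD; rewrite (vol_riemannian mB BD).
  suff E : (\int[lam]_(t in [set t | (Defs.coord c @` B) (rV_of_tuple t)])
      (vol_density c (param c (rV_of_tuple t)))%:E =
     \int[lam]_(t in chart_map c @^-1` B) (chart_density c t)%:E)%E by exact: E.
  rewrite integral_mkcond [RHS]integral_mkcond; apply: eq_integral => t _; rewrite !patchE.
  case: ifPn; rewrite ?inE ?notin_setE /=; case: ifPn; rewrite ?inE ?notin_setE /= => Bt cBt.
  + move: (cBt) => [x Bx xt]; rewrite /chart_density mem_set// -xt; exact/img_coord/BD.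
  + move: (cBt) => [x Bx xt]; exfalso; apply: Bt; rewrite /chart_map mem_set -xt.
      by rewrite coordK//; exact: BD.
    exact/img_coord/BD.
  + rewrite /chart_density; case: ifPn => //; rewrite inE => ct; exfalso; apply: cBt.
    by move: Bt; rewrite /chart_map mem_set// => Bt; exists (param c (rV_of_tuple t)) => //; rewrite paramK.
  + by [].
Qed.

Lemma integral_mu (f : borel M -> \bar R) : measurable_fun setT f ->
  (\int[mu A]_x f x = \int[vol A]_x (f x * (weight A x)%:E))%E.
Proof.
move=> mf; rewrite (@integral_density _ _ (borel M) (borel M) R (mu A) (vol A) setT id (weight A))//.
- by rewrite preimage_id; exact: (smth_measurable weight_smth).
- by move=> x; rewrite ltW// weight_gt0.
- by move=> B mB _; rewrite mu_weight.
Qed.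

(** The density is bounded on the compact coordinate image, which lies in a box of finite Lebesgue
    measure. *)
Lemma vol_chart_compact_fin c K : compact K -> K `<=` dom c -> (vol A K < +oo)%E.
Proof.
move=> cK Kc; have mK : measurable (K : set (borel M)).
  by apply: closed_borel; exact: (compact_closed_mfd A).
rewrite (vol_riemannian mK Kc).
have ccK : compact (Defs.coord c @` K).
  apply: continuous_compact => //; apply: continuous_in_subspaceT => x; rewrite inE => Kx.
  exact/coord_cont/Kc.
have Kimg : Defs.coord c @` K `<=` img c by move=> _ [x Kx <-]; exact/img_coord/Kc.
have [C C0 HC] := compact_cont_bounded ccK (fun y Ky => Smooth_cont (vol_density_Smooth c) (Kimg y Ky)).
have [a [_ Ha]] := compact_bounded ccK.
pose b := `|a| + 1; have b0 : 0 <= b by rewrite addr_ge0.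
have ab : a < b by rewrite (le_lt_trans (ler_norm _))// ltrDl.
have mS : measurable (@rV_of_tuple R n @^-1` (Defs.coord c @` K)).
  have oC : open (~` (Defs.coord c @` K)).
    by apply: closed_openC; apply: compact_closed => //; exact: norm_hausdorff.
  by rewrite -(setCK (Defs.coord c @` K)) preimage_setC; exact: (measurableC (measurable_rV_of_tuple oC)).
apply: (@le_lt_trans _ _ (\int[lam]_(t in @rV_of_tuple R n @^-1` (Defs.coord c @` K)) C%:E)%E).
  apply: ge0_le_integral => //.
  - by move=> t _; rewrite lee_fin; exact: sqrtr_ge0.
  - apply/measurable_EFinP; apply: (measurable_funS (measurable_chart_tuples c)).
      by move=> t /= /Kimg.
    apply: (@measurable_comp_open R _ _ _ (@rV_of_tuple R n) (img c) (vol_density c \o param c)).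
    + exact: measurable_rV_of_tuple.
    + exact: open_img.
    + by move=> y cy; exact: (Smooth_cont (vol_density_Smooth c) cy).
  - by move=> t /= Kt; rewrite lee_fin (le_trans (ler_norm _))//; exact: (HC _ Kt).
rewrite integral_cst//; apply: lte_mul_pinfty => //.
apply: le_lt_trans (lebesgue_tuple_box_fin n b); apply: le_measure; rewrite ?inE//.
  exact: measurable_tuple_box.
by move=> t /= Kt; apply/(rV_of_tuple_norm_le _ b0); exact: (Ha b ab _ Kt).
Qed.

Lemma compact_finite_cover (K : set M) (U : M -> set M) : compact K ->
  (forall x, open (U x) /\ U x x) -> exists s : seq M, forall y, K y -> exists2 x, x \in s & U x y.
Proof.
rewrite compact_cover => cK HU.
have [|x _|D' _ KD] := @cK M setT U; first by move=> x _; case: (HU x).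
  by exists x => //; case: (HU x).
exists (finmap.enum_fset D') => y /KD[x /= xD Uy]; by exists x.
Qed.

Lemma bump_nbhs (x0 : M) U : open U -> U x0 ->
  exists K, [/\ compact K, K `<=` U, K `<=` dom (chart_at A x0) & \forall x \near x0, K x].
Proof.
move=> oU Ux0; have [b [sb b01 [K [cK KU b0]] b1]] := bump_exists oU Ux0 (dom_chart_at A x0).
exists K; split=> //; [by move=> x /KU[]|by move=> x /KU[]|].
apply: filterS b1 => x bx; apply: contrapT => /b0 b0x.
by have := oner_neq0 R; rewrite -bx b0x eqxx.
Qed.

(** Each point has an open neighbourhood of finite volume, the interior of a compact set inside one
    chart, and finitely many of these cover K. *)
Lemma vol_compact_fin K : compact K -> (vol A K < +oo)%E.
Proof.
move=> cK.
have H x : exists U, [/\ open U, U x & (vol A U < +oo)%E].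
  have [L [cL _ Lc Lx]] := @bump_nbhs x setT openT I.
  exists L^°; split; [exact: open_interior|exact: Lx|].
  apply: le_lt_trans (vol_chart_compact_fin cL Lc); apply: le_measure; rewrite ?inE.
  - by apply: borel_open; exact: open_interior.
  - by apply: closed_borel; exact: (compact_closed_mfd A).
  - exact: interior_subset.
pose U x := sval (cid (H x)).
have HU x : [/\ open (U x), U x x & (vol A (U x) < +oo)%E] by rewrite /U; case: cid.
have [s Ks] := @compact_finite_cover K U cK (fun x => let: And3 a b _ := HU x in conj a b).
have mU x : measurable (U x : set (borel M)) by apply: borel_open; case: (HU x).
have mK : measurable (K : set (borel M)) by apply: closed_borel; exact: (compact_closed_mfd A).
apply: (@le_lt_trans _ _ (vol A (\big[setU/set0]_(x <- s) U x))).
  apply: le_measure; rewrite ?inE//; first exact: bigsetU_measurable.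
  move=> y /Ks[x xs Uy]; rewrite -bigcup_seq; by exists x.
elim: s {Ks} => [|x s ih]; first by rewrite big_nil measure0.
rewrite big_cons; apply: le_lt_trans (measureU2 _ _ _) _; [exact: mU|exact: bigsetU_measurable|].
by apply: lte_add_pinfty => //; case: (HU x).
Qed.

Lemma compact_borel K : compact K -> measurable (K : set (borel M)).
Proof. by move=> cK; apply: closed_borel; exact: (compact_closed_mfd A). Qed.

Lemma cpt_vol_integrable f K : measurable_fun [set: borel M] f -> compact K ->
  (exists C, forall x, K x -> `|f x| <= C) ->
  (forall x, ~ K x -> f x = 0) -> (vol A).-integrable setT (EFin \o f).
Proof.
move=> mf cK [C HC] f0; have mK := compact_borel cK.
have -> : EFin \o f = (EFin \o f) \_ K.
  by apply/funext => x; rewrite patchE; case: ifPn => //; rewrite notin_setE => /f0 /= ->.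
apply/(integrable_mkcond _ mK); apply: measurable_bounded_integrable => //.
- exact: vol_compact_fin.
- exact: measurable_funTS.
- exists C; split; [exact: num_real|]=> D CD x Kx /=.
  by rewrite (le_trans (HC x Kx))// ltW.
Qed.

Lemma cont_cpt_vol_integrable f K : continuous f -> compact K ->
  (forall x, ~ K x -> f x = 0) -> (vol A).-integrable setT (EFin \o f).
Proof.
move=> cf cK f0; apply: (cpt_vol_integrable _ cK) => //.
  by apply: (borel_measurable_fun (U := setT)) => [|x _]; [exact: openT|exact: cf].
by have [C _ HC] := compact_cont_bounded cK (fun x _ => cf x); exists C.
Qed.

(** The ball contains the closed cube of half-side r/2, whose measure is a product of positive
    lengths by induction on the dimension. *)
Lemma tuple_ball_gt0 (y : 'rV[R]_n) r : 0 < r ->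
  (0 < lam (@rV_of_tuple R n @^-1` ball y r))%E.
Proof.
move=> r0.
pose S k (w : 'rV[R]_k) : set (k.-tuple R) := [set t | forall i, `|tnth t i - w 0 i| <= r / 2].
suff H m (z : 'rV[R]_m) : (0 < lebesgue_tuple m (S m z))%E /\ measurable (S m z).
  have [H1 H2] := H n y; apply: lt_le_trans H1 _; apply: le_measure; rewrite ?inE//.
    by apply: measurable_rV_of_tuple; exact: ball_open.
  move=> t /= ty; rewrite -ball_normE /= distrC; apply: (@le_lt_trans _ _ (r / 2)).
    by apply: mx_norm_le => [|i j]; [rewrite divr_ge0// ltW|rewrite ord1 !mxE].
  by rewrite ltr_pdivrMr// ltr_pMr// ltr1n.
have mS k (w : 'rV[R]_k) : measurable (S k w).
  have -> : S k w =
      ~` (\bigcup_i ~` ((fun t : k.-tuple R => tnth t i) @^-1` `[w 0 i - r / 2, w 0 i + r / 2])).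
    rewrite setC_bigcup; under eq_bigcapr do rewrite setCK.
    apply/seteqP; split=> t /= H i; first by move=> _ /=; rewrite in_itv/= -ler_distlC distrC.
    by have := H i I; rewrite /= in_itv/= -ler_distlC distrC.
  apply: measurableC; apply: bigcup_countable_measurable; first exact: countableP.
  by move=> i _; apply: measurableC; rewrite -[X in measurable X]setTI; exact: measurable_tnth.
split=> //; elim: m z => [|m ih] z.
  rewrite /= diracE mem_set ?lte01//; by case.
rewrite /= /lebesgue_cons /pushforward.
have -> : @tcons R m @^-1` S m.+1 z =
   `[z 0 ord0 - r / 2, z 0 ord0 + r / 2] `*` S m (\row_j z 0 (lift ord0 j)).
  apply/seteqP; split=> -[x t] /=.
    move=> H; split; first by have := H ord0; rewrite in_itv/= -ler_distlC distrC.
    by move=> i; have := H (lift ord0 i); rewrite tnthS mxE.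
  move=> [xa H] i; case: (unliftP ord0 i) => [j ->|->]; first by rewrite tnthS; have := H j; rewrite mxE.
  by move: xa; rewrite in_itv/= -ler_distlC distrC.
rewrite product_measure1E//; last exact: mS.
apply: mule_gt0; last exact: ih.
have E : (0 < (@lebesgue_measure R) `[(z 0 ord0 - r / 2)%R, (z 0 ord0 + r / 2)%R]%classic)%E.
  rewrite lebesgue_measure_itv/= lte_fin ltrD2l gtrN ?divr_gt0// -EFinB lte_fin subr_gt0.
  by rewrite ltrD2l gtrN ?divr_gt0.
exact: E.
Qed.

(** A null open set would make the positive density vanish almost everywhere on its coordinate
    image, which contains a ball of positive measure. *)
Lemma vol_open_gt0 U x0 : open U -> U x0 -> (0 < vol A U)%E.
Proof.
move=> oU Ux0; pose c := chart_at A x0; have cx0 : dom c x0 by exact: dom_chart_at.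
have oUc : open (U `&` dom c) by apply: openI => //; exact: open_dom.
have mUc := borel_open oUc.
suff H : (0 < vol A (U `&` dom c))%E.
  by apply: lt_le_trans H _; apply: le_measure; rewrite ?inE//; exact: borel_open.
rewrite lt0e measure_ge0 andbT; apply/eqP => V0.
have oW := open_coord_image c oU.
have mW : measurable (@rV_of_tuple R n @^-1` (Defs.coord c @` (U `&` dom c))) by exact: measurable_rV_of_tuple.
have Wimg : Defs.coord c @` (U `&` dom c) `<=` img c by move=> _ [x [_ cx] <-]; exact: img_coord.
move: V0; rewrite (vol_riemannian mUc (@subIsetr _ _ _)) => V0.
have /(ae_eq_integral_abs lam mW) : (\int[lam]_(t in @rV_of_tuple R n @^-1` (Defs.coord c @` (U `&` dom c)))
    `|(vol_density c (param c (rV_of_tuple t)))%:E| = 0)%E.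
  rewrite -[RHS]V0; apply: eq_integral => t _; rewrite gee0_abs// lee_fin; exact: sqrtr_ge0.
move=> /(_ _)[|N [mN N0 HN]].
  apply/measurable_EFinP; apply: (@measurable_comp_open R _ _ _ (@rV_of_tuple R n) _ (vol_density c \o param c)) => //.
    exact: measurable_rV_of_tuple.
  by move=> y /Wimg cy; exact: (Smooth_cont (vol_density_Smooth c) cy).
have Wx0 : (Defs.coord c @` (U `&` dom c)) (Defs.coord c x0) by exists x0.
have /nbhs_ballP[r /= r0 rW] := open_nbhs_nbhs (conj oW Wx0).
have := tuple_ball_gt0 (Defs.coord c x0) r0; rewrite ltNge => /negP; apply.
rewrite -N0; apply: le_measure; rewrite ?inE//.
  by apply: measurable_rV_of_tuple; exact: ball_open.
move=> t /= /rW Wt; apply: HN => /= H; have := H Wt => -[] /eqP.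
by rewrite gt_eqF// vol_density_gt0//; apply: dom_param; exact: Wimg.
Qed.

(** If f were positive at x, it would exceed f(x)/2 on an open set, which has positive volume. *)
Lemma vol_ge0_eq0 f U : open U -> (forall x, U x -> {for x, continuous f}) ->
  (forall x, 0 <= f x) -> measurable_fun [set: borel M] f -> (\int[vol A]_x (f x)%:E = 0)%E ->
  forall x, U x -> f x = 0.
Proof.
move=> oU cf f0 mf I0 x Ux; apply/eqP; rewrite eq_le f0 andbT leNgt; apply/negP => fx0.
pose W := U `&` f @^-1` [set s | f x / 2 < s].
have oW : open W by apply: open_preimage_cont => //; exact: open_gt.
have Wx : W x by split=> //=; rewrite ltr_pdivrMr// ltr_pMr// ltr1n.
have := vol_open_gt0 oW Wx.
have /(ae_eq_integral_abs (vol A) measurableT) : (\int[vol A]_(x in setT) `|(f x)%:E| = 0)%E.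
  by rewrite -[RHS]I0; apply: eq_integral => y _; rewrite gee0_abs// lee_fin.
move=> /(_ _)[|N [mN N0 HN]]; first exact/measurable_EFinP.
rewrite ltNge => /negP; apply; rewrite -N0; apply: le_measure; rewrite ?inE//; first exact: borel_open.
move=> y [Uy /= fy]; apply: HN => /= /(_ I)[] fy0.
by move: fy; rewrite fy0 ltNge divr_ge0// ltW.
Qed.

End chart_measure.

(** * The divergence theorem *)

Section divergence_theorem.
Context {R : realType} {n : nat} {M : ptopologicalType} (A : weighted R n M).
Implicit Types (c d : chart A) (f h phi : M -> R) (U K : set M) (X Y : chart A -> M -> 'rV[R]_n).
Local Notation smth := (msmooth A setT).
Local Notation lam := (lebesgue_tuple n : {sigma_finite_measure set (n.-tuple R) -> \bar R}).

Lemma partial0_in c k K phi x : closed K -> (forall y, dom c y -> ~ K y -> phi y = 0) ->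
  dom c x -> ~ K x -> partial c k phi x = 0.
Proof.
move=> cK phi0 cx Kx; have oU : open (~` K) by exact: closed_openC.
rewrite /partial (derive_eq_on (g := cst 0) (U := Defs.coord c @` (~` K `&` dom c))).
- by rewrite derive_cst.
- exact: open_coord_image.
- by move=> _ [y [Ky cy] <-] /=; rewrite coordK// phi0.
- by exists x.
Qed.

(** The functions H_k = phi sqrt(det g) X^k, extended by 0, are smooth on all of R^n with compact
    support. The sum of D_k H_k is the integrand times the volume density, and each of its terms
    integrates to zero. *)
Lemma ibp_chart c X phi K : Smooth (img c) (X c \o param c) -> smth phi ->
  compact K -> K `<=` dom c -> (forall x, ~ K x -> phi x = 0) ->
  (\int[vol A]_(x in dom c) (phi x * divc c X x + \sum_k X c x 0 k * partial c k phi x)%R%:E = 0)%E.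
Proof.
move=> sX sphi cK Kc phi0.
have oi := @open_img _ _ _ A c; have od := @open_dom _ _ _ A c.
have sp := smooth_Smooth c sphi.
pose F k y := vol_density c (param c y) * X c (param c y) 0 k.
have sF k : Smooth (img c) (F k) := flux_Smooth k sX.
pose H k (y : 'rV[R]_n) := if y \in img c then phi (param c y) * F k y else 0.
have ccK : compact (Defs.coord c @` K).
  apply: continuous_compact => //; apply: continuous_in_subspaceT => x; rewrite inE => Kx.
  exact/coord_cont/Kc.
have oCK : open (~` (Defs.coord c @` K)).
  by apply: closed_openC; apply: compact_closed => //; exact: norm_hausdorff.
have cover : img c `|` ~` (Defs.coord c @` K) = setT.
  apply/seteqP; split=> // y _; have [[x Kx <-]|Ky] := pselect ((Defs.coord c @` K) y); last by right.
  by left; exact/img_coord/Kc.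
have H0 k y : ~ (Defs.coord c @` K) y -> H k y = 0.
  move=> Ky; rewrite /H; case: ifPn => //; rewrite inE => cy; rewrite phi0 ?mul0r// => Kx.
  by apply: Ky; exists (param c y) => //; rewrite paramK.
have HE k y : img c y -> phi (param c y) * F k y = H k y by move=> cy; rewrite /H mem_set.
have sH k : Smooth setT (H k).
  rewrite -cover; apply: SmoothU.
    by apply: (Smooth_eq oi (HE k)); exact: (SmoothM oi sp (sF k)).
  by apply: (Smooth_eq oCK _ (Smooth_cst _ 0)) => y Ky; rewrite H0.
have [C C0 HC] := compact_cont_bounded ccK (fun y _ => @norm_continuous _ _ y).
have HC' y : C < `|y| -> ~ (Defs.coord c @` K) y.
  move=> Cy Ky; have := HC y Ky; rewrite normr_id leNgt; exact/negP/negPn.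
have D0 k y : ~ (Defs.coord c @` K) y -> 'D_(delta_mx 0 k) (H k) y = 0.
  move=> Ky; rewrite (derive_eq_on _ oCK (g := cst 0))//; first by rewrite derive_cst.
  by move=> z; exact: H0.
have key y : img c y -> (phi (param c y) * divc c X (param c y) +
    \sum_k X c (param c y) 0 k * partial c k phi (param c y)) * vol_density c (param c y)
    = \sum_k 'D_(delta_mx 0 k) (H k) y.
  move=> cy; have v0 := vol_density_gt0 (dom_param cy).
  rewrite mulrDl mulr_suml /divc -mulrA [X in _ * X](_ : _ =
    \sum_(k < n) partial c k (fun z => vol_density c z * X c z 0 k) (param c y)); last first.
    by rewrite mulrC mulVKf ?gt_eqF.
  rewrite mulr_sumr -big_split /=; apply: eq_bigr => k _.
  rewrite -(derive_eq_on _ oi (HE k) cy).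
  have -> : (fun z => phi (param c z) * F k z) = (phi \o param c) * F k by apply/funext.
  rewrite deriveM; [|exact: Smooth_derivable sp cy|exact: Smooth_derivable (sF k) cy].
  rewrite /partial paramK// -!/(F k) /GRing.scale/=; congr (_ + _).
  by rewrite /F mulrAC [vol_density _ _ * _]mulrC; ring.
rewrite integral_vol_chart; last first.
  apply/measurable_EFinP; apply: borel_measurable_fun => // x cx.
  pose g x := phi x * divc c X x + \sum_k X c x 0 k * partial c k phi x.
  have sg : Smooth (img c) (g \o param c).
    apply: SmoothD => //.
      by apply: SmoothM => //; exact: (divc_Smooth sX).
    apply: Smooth_sum => // k _; apply: SmoothM => //; first exact: (Smooth_mx_entry 0 k oi sX).
    by have := partial_Smooth c k (@openT M) sphi; rewrite setTI.
  have gE z : dom c z -> (g \o param c \o Defs.coord c) z = g z by move=> cz /=; rewrite coordK.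
  apply: (continuous_eq_on od gE cx).
  by apply: continuous_comp; [exact: coord_cont|apply: (Smooth_cont sg); exact: img_coord].
transitivity (\int[lam]_t (\sum_k ('D_(delta_mx 0 k) (H k) (rV_of_tuple t))%:E))%E.
  rewrite integral_mkcond; apply: eq_integral => t _; rewrite patchE sumEFin.
  case: ifPn; rewrite ?inE ?notin_setE /chart_tuples/= => ct; first by rewrite -EFinM key.
  by rewrite big1// => k _; apply: D0 => -[x Kx xt]; apply: ct; rewrite -xt; exact/img_coord/Kc.
have sD k : Smooth setT ('D_(delta_mx 0 k) (H k)) by exact: Smooth_derive.
rewrite (@integral_sum _ _ _ lam _ measurableT 'I_n (fun k t => ('D_(delta_mx 0 k) (H k) (rV_of_tuple t))%:E)); last first.
  move=> k; have := @tuple_integrable _ _ ('D_(delta_mx 0 k) (H k)) C.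
  by apply => y; [exact: (Smooth_cont (sD k) I)|move=> Cy; exact/D0/HC'].
apply: big1 => k _; apply: (integral_derive_compact C0).
- by move=> y; exact: (Smooth_derivable (sH k) I).
- by move=> y; exact: (Smooth_cont (sD k) I).
- by move=> y Cy; exact/H0/HC'.
- by move=> y Cy; exact/D0/HC'.
Qed.

Definition smooth_field X := vector_field X /\ forall c, Smooth (img c) (X c \o param c).

Lemma smth_charts f : (forall c, Smooth (img c) (f \o param c)) -> smth f.
Proof. by move=> sf; split=> c; rewrite setTI; exact: sf. Qed.

Lemma smth_derivable c f x v : smth f -> dom c x -> derivable (f \o param c) (Defs.coord c x) v.
Proof. by move=> sf cx; exact: (Smooth_derivable (smooth_Smooth c sf) (img_coord cx)). Qed.

Lemma gradD f h c x : smth f -> smth h -> dom c x ->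
  grad A (fun y => f y + h y) c x = grad A f c x + grad A h c x.
Proof.
move=> sf sh cx; rewrite /grad -mulmxDl; congr (_ *m _); apply/rowP => k; rewrite !mxE /partial.
rewrite (_ : (fun y => f y + h y) \o param c = (f \o param c) + (h \o param c)); last by apply/funext.
by rewrite deriveD//; exact: smth_derivable.
Qed.

Lemma gradM f h c x : smth f -> smth h -> dom c x ->
  grad A (fun y => f y * h y) c x = f x *: grad A h c x + h x *: grad A f c x.
Proof.
move=> sf sh cx; rewrite /grad !scalemxAl -mulmxDl; congr (_ *m _); apply/rowP => k; rewrite !mxE /partial.
rewrite (_ : (fun y => f y * h y) \o param c = (f \o param c) * (h \o param c)); last by apply/funext.
by rewrite deriveM; [rewrite /= coordK|exact: smth_derivable|exact: smth_derivable].
Qed.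

Lemma grad_cst (a : R) c x : grad A (fun=> a) c x = 0.
Proof.
rewrite /grad (_ : \row_k _ = 0) ?mul0mx//; apply/rowP => k; rewrite !mxE /partial.
by rewrite (_ : (fun=> a) \o param c = cst a)// derive_cst.
Qed.

Lemma gradZ (a : R) f c x : smth f -> dom c x -> grad A (fun y => a * f y) c x = a *: grad A f c x.
Proof. by move=> sf cx; rewrite gradM ?grad_cst ?scaler0 ?addr0//; exact: msmooth_cst. Qed.

Lemma gradB f h c x : smth f -> smth h -> dom c x ->
  grad A (fun y => f y - h y) c x = grad A f c x - grad A h c x.
Proof.
move=> sf sh cx; rewrite (_ : (fun y => f y - h y) = (fun y => f y + -1 * h y)).
  by rewrite gradD// ?gradZ ?scaleN1r//; exact: (msmoothZ _ (@openT M)).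
by apply/funext => y; rewrite mulN1r.
Qed.

Lemma grad_comp1 (g : R -> R) f c x : Smooth setT g -> smth f -> dom c x ->
  grad A (fun y => g (f y)) c x = 'D_1 g (f x) *: grad A f c x.
Proof.
move=> sg sf cx; rewrite /grad !scalemxAl; congr (_ *m _); apply/rowP => k; rewrite !mxE /partial.
rewrite (_ : (fun y => g (f y)) \o param c = g \o (f \o param c)); last by [].
rewrite derive_comp1 ?coordK//; first by rewrite /= coordK.
- exact: smth_derivable.
- exact: (Smooth_derivable sg I).
Qed.

Lemma grad0_off K f c x : closed K -> (forall y, ~ K y -> f y = 0) -> dom c x -> ~ K x ->
  grad A f c x = 0.
Proof.
move=> cK f0 cx Kx; rewrite /grad (_ : \row_k _ = 0) ?mul0mx//; apply/rowP => k; rewrite !mxE.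
exact: (partial0_in k cK (fun y _ => f0 y) cx Kx).
Qed.

Lemma inner0l X Y x : X (chart_at A x) x = 0 -> inner X Y x = 0.
Proof. by move=> X0; rewrite /inner X0 !mul0mx mxE. Qed.

Lemma inner0r X Y x : Y (chart_at A x) x = 0 -> inner X Y x = 0.
Proof. by move=> Y0; rewrite innerC inner0l. Qed.

Lemma inner_grad_smth X f : smooth_field X -> smth f -> smth (inner X (grad A f)).
Proof.
move=> [vX sX] sf; apply: smth_charts => c; have oi := @open_img _ _ _ A c.
have : Smooth (img c) (fun y => \sum_k X c (param c y) 0 k * partial c k f (param c y)).
  apply: Smooth_sum => // k _; apply: SmoothM => //; first exact: (Smooth_mx_entry 0 k oi (sX c)).
  by have := partial_Smooth c k (@openT M) sf; rewrite setTI.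
apply: (Smooth_eq oi) => y cy /=.
by rewrite (inner_grad_chart vX sf (dom_param cy)).
Qed.

Lemma grad_field f : smth f -> smooth_field (grad A f).
Proof. by move=> sf; split; [exact: grad_vector_field|move=> c; exact: grad_Smooth]. Qed.

Lemma field_scale f X : smth f -> smooth_field X -> smooth_field (fun c x => f x *: X c x).
Proof.
move=> sf [vX sX]; split=> [c d x cx dx|c]; first by rewrite (vX _ _ _ cx dx) scalemxAl.
by apply: (Smooth_scalemx (@open_img _ _ _ A c)) => //; exact: smooth_Smooth.
Qed.

Lemma smth_cover_chart c K f : closed K -> K `<=` dom c -> (forall x, ~ K x -> f x = 0) ->
  Smooth (img c) (f \o param c) -> smth f.
Proof.
move=> cK Kc f0 sf; have oK : open (~` K) by exact: closed_openC.
apply: (smooth_cover (@open_dom _ _ _ A c) oK).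
- by apply/seteqP; split=> // x _; have [/Kc cx|Kx] := pselect (K x); [left|right].
- by apply: (@msmooth_chart _ _ _ A c _ f (@open_dom _ _ _ A c)) => //; exact: sf.
- by apply: (msmooth_eq oK _ (msmooth_cst A _ 0)) => x Kx; rewrite f0.
Qed.

Lemma smth_cpt_integrable f K : smth f -> compact K -> (forall x, ~ K x -> f x = 0) ->
  (vol A).-integrable setT (EFin \o f).
Proof. move=> sf cK f0; have cf := smooth_cont sf; exact: (@cont_cpt_vol_integrable _ _ _ A f K cf cK f0). Qed.

Lemma ibp_chart_global c X phi K : smooth_field X -> smth phi ->
  compact K -> K `<=` dom c -> (forall x, ~ K x -> phi x = 0) ->
  (vol A).-integrable setT (fun x => (phi x * divc c X x)%:E) /\
  (\int[vol A]_x (phi x * divc c X x + inner X (grad A phi) x)%R%:E = 0)%E.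
Proof.
move=> fX sphi cK Kc phi0; have [vX sX] := fX.
have clK : closed K by exact: (compact_closed_mfd A).
split.
  apply: (@smth_cpt_integrable (fun x => phi x * divc c X x) K) => //; last first.
    by move=> x Kx; rewrite phi0// mul0r.
  apply: (smth_cover_chart clK Kc) => [x Kx|]; first by rewrite phi0// mul0r.
  exact: (SmoothM (@open_img _ _ _ A c) (smooth_Smooth c sphi) (divc_Smooth (sX c))).
rewrite -(ibp_chart (sX c) sphi cK Kc phi0) [RHS]integral_mkcond; apply: eq_integral => x _.
rewrite patchE; case: ifPn; rewrite ?inE ?notin_setE => cx; first by rewrite (inner_grad_chart vX sphi cx).
have Kx : ~ K x by move=> /Kc.
rewrite phi0// mul0r add0r inner0r//; apply: (grad0_off clK phi0) => //; exact: dom_chart_at.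
Qed.

(** If the two expressions differed at x0, their difference would keep its sign on a neighbourhood.
    Integration by parts against a bump b supported there gives minus the integral of <X, grad b> in
    either chart, so the difference integrates to zero against b, a contradiction. *)
Lemma divc_chart c d X x0 : smooth_field X -> dom c x0 -> dom d x0 -> divc c X x0 = divc d X x0.
Proof.
move=> fX cx0 dx0; have [vX sX] := fX; apply: contrapT => /eqP; rewrite -subr_eq0 => delta0.
pose delta x := divc c X x - divc d X x; pose s0 := delta x0.
pose U0 := dom c `&` dom d.
have oU0 : open U0 by apply: openI; exact: open_dom.
have cdelta x : U0 x -> {for x, continuous delta}.
  move=> [cx dx].
  have cdiv e : dom e x -> {for x, continuous (divc e X)}.
    move=> ex; have gE z : dom e z -> (divc e X \o param e \o Defs.coord e) z = divc e X z.
      by move=> ez /=; rewrite coordK.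
    apply: (continuous_eq_on (@open_dom _ _ _ A e) gE ex).
    apply: continuous_comp; first exact: coord_cont.
    by apply: (Smooth_cont (divc_Smooth (sX e))); exact: img_coord.
  exact: (continuousB (cdiv c cx) (cdiv d dx)).
(* Multiplication by the value [s0] at x0 treats both signs at once. *)
pose U := U0 `&` (fun x => delta x * s0) @^-1` [set s | 0 < s].
have oU : open U.
  apply: (open_preimage_cont oU0 _ (@open_pos R)).
  by move=> x U0x; apply: (continuousM (cdelta x U0x)); exact: cst_continuous.
have Ux0 : U x0 by split=> //=; rewrite -expr2 lt_def sqr_ge0 sqrf_eq0 andbT.
have [b [sb b01 [K [cK KU b0]] b1]] := bump_exists oU Ux0 cx0.
have [ic Ic] := ibp_chart_global fX sb cK (fun x Kx => (KU x Kx).1.1.1) b0.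
have [id_ Id] := ibp_chart_global fX sb cK (fun x Kx => (KU x Kx).1.1.2) b0.
have clK : closed K by exact: (compact_closed_mfd A).
have ii : (vol A).-integrable setT (fun x => (inner X (grad A b) x)%:E).
  apply: (@smth_cpt_integrable _ K) => //; first exact: inner_grad_smth.
  by move=> x Kx; rewrite inner0r//; apply: (grad0_off clK b0) => //; exact: dom_chart_at.
have ibd : (vol A).-integrable setT (fun x => (b x * delta x)%:E).
  have -> : (fun x => (b x * delta x)%:E) = ((fun x => (b x * divc c X x)%:E) \- (fun x => (b x * divc d X x)%:E))%E.
    by apply/funext => x; rewrite -EFinB /delta mulrBr.
  exact: integrableB.
have Ibd : (\int[vol A]_x (b x * delta x * s0)%:E = 0)%E.
  under eq_integral do rewrite mulrC EFinM.
  rewrite integralZl//.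
  apply/eqP; rewrite mule_eq0; apply/orP; right; apply/eqP.
  pose F e x := (b x * divc e X x + inner X (grad A b) x)%R.
  have iF e : (vol A).-integrable setT (fun x => (b x * divc e X x)%:E) ->
      (vol A).-integrable setT (fun x => (F e x)%:E).
    move=> ie; have -> : (fun x => (F e x)%:E) = ((fun x => (b x * divc e X x)%:E) \+ (fun x => (inner X (grad A b) x)%:E))%E by [].
    exact: integrableD.
  have -> : (fun x => (b x * delta x)%:E) = ((fun x => (F c x)%:E) \- (fun x => (F d x)%:E))%E.
    by apply/funext => x; rewrite -EFinB /delta mulrBr; congr (_%:E); rewrite /F; ring.
  by rewrite (integralB measurableT (iF c ic) (iF d id_)) Ic Id sube0.
have bd0 : b x0 * delta x0 * s0 = 0.
  apply: (@vol_ge0_eq0 _ _ _ A (fun x => b x * delta x * s0) U) => //.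
  - move=> x [U0x _]; apply: continuousM; last exact: cst_continuous.
    by apply: continuousM; [exact: (smooth_cont sb)|exact: cdelta].
  - move=> x; have [Kx|Kx] := pselect (K x); last by rewrite b0// !mul0r.
    rewrite -mulrA mulr_ge0//; first by case/andP: (b01 x).
    by have [[_ /ltW]] := KU _ Kx.
  - apply: measurable_funM => //; apply/measurable_EFinP; exact: (measurable_int _ ibd).
have b1x : b x0 = 1 by exact: nbhs_singleton b1.
move: bd0; rewrite b1x mul1r => /eqP; rewrite mulf_eq0 orbb /s0; exact/negP.
Qed.

Lemma div_chart c X x : smooth_field X -> dom c x -> div X x = divc c X x.
Proof. by move=> fX cx; rewrite divE; apply: divc_chart => //; exact: dom_chart_at. Qed.

Lemma div_smth X : smooth_field X -> smth (div X).
Proof.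
move=> fX; apply: smth_charts => c; have oi := @open_img _ _ _ A c.
apply: (Smooth_eq oi _ (divc_Smooth (fX.2 c))) => y cy /=.
by rewrite (div_chart fX (dom_param cy)).
Qed.

Lemma flux_integrable X phi K : smooth_field X -> smth phi -> compact K -> (forall x, ~ K x -> phi x = 0) ->
  (vol A).-integrable setT (fun x => (phi x * div X x)%:E) /\
  (vol A).-integrable setT (fun x => (inner X (grad A phi) x)%:E).
Proof.
move=> fX sphi cK phi0; split.
  apply: (@smth_cpt_integrable _ K) => //; first exact: (msmoothM (@openT M) sphi (div_smth fX)).
  by move=> x Kx; rewrite phi0// mul0r.
apply: (@smth_cpt_integrable _ K) => //; first exact: inner_grad_smth.
move=> x Kx; rewrite inner0r//; apply: (grad0_off _ phi0) => //; last exact: dom_chart_at.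
exact: (compact_closed_mfd A).
Qed.

(** Instead of a partition of unity, the bumps of a finite cover of the support are split off one at
    a time: phi = b phi + (1 - b) phi. The first part lives in one chart; the second vanishes where
    b = 1, so the rest of the list still covers it. *)
Theorem divergence_theorem X phi K : smooth_field X -> smth phi -> compact K -> (forall x, ~ K x -> phi x = 0) ->
  (\int[vol A]_x (phi x * div X x + inner X (grad A phi) x)%R%:E = 0)%E.
Proof.
move=> fX sphi cK phi0.
have HB x0 : exists b, [/\ smth b, (exists L, [/\ compact L, L `<=` dom (chart_at A x0) &
    forall x, ~ L x -> b x = 0]) & \forall x \near x0, b x = 1].
  have [b [sb _ [L [cL LU b0]] b1]] := bump_exists (@openT M) I (dom_chart_at A x0).
  by exists b; split=> //; exists L; split=> // x /LU[].
pose b x0 := sval (cid (HB x0)).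
have Hb x0 : [/\ smth (b x0), (exists L, [/\ compact L, L `<=` dom (chart_at A x0) &
    forall x, ~ L x -> b x0 x = 0]) & \forall x \near x0, b x0 x = 1] by rewrite /b; case: cid.
have [s Ks] := @compact_finite_cover M K (fun x0 => [set x | b x0 x = 1]°) cK
  (fun x0 => conj (@open_interior _ _) (let: And3 _ _ h := Hb x0 in h)).
have : forall y, phi y != 0 -> exists2 x, x \in s & b x y = 1.
  move=> y phiy; have [/Ks[x xs bx]|/phi0 p0] := pselect (K y); last by rewrite p0 eqxx in phiy.
  by exists x => //; exact: interior_subset bx.
elim: s phi sphi phi0 {Ks} => [|x0 s ih] phi sphi phi0 Hs.
  have phiE x : phi x = 0 by apply/eqP; apply/negPn/negP => /Hs[].
  have c0 : closed (set0 : set M) by exact: closed0.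
  rewrite integral0_eq// => x _; rewrite phiE mul0r add0r inner0r//.
  by apply: (grad0_off c0 _ (dom_chart_at A x)) => // y _; exact: phiE.
have [sb [L [cL Lc bL]] _] := Hb x0.
have oT := @openT M.
have s1 : smth (fun x => b x0 x * phi x) by exact: msmoothM.
have s2 : smth (fun x => (1 - b x0 x) * phi x).
  by apply: msmoothM => //; apply: msmoothB => //; exact: msmooth_cst.
have z1 x : ~ K x -> b x0 x * phi x = 0 by move=> Kx; rewrite phi0// mulr0.
have z2 x : ~ K x -> (1 - b x0 x) * phi x = 0 by move=> Kx; rewrite phi0// mulr0.
have [i1 j1] := flux_integrable fX s1 cK z1.
have [i2 j2] := flux_integrable fX s2 cK z2.
have pE : phi = (fun x => b x0 x * phi x + (1 - b x0 x) * phi x).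
  by apply/funext => x; rewrite -mulrDl addrC subrK mul1r.
transitivity (\int[vol A]_x ((b x0 x * phi x * div X x + inner X (grad A (fun x => b x0 x * phi x)) x)%:E +
   ((1 - b x0 x) * phi x * div X x + inner X (grad A (fun x => (1 - b x0 x) * phi x)) x)%:E))%E.
  apply: eq_integral => x _; rewrite -EFinD; congr (_%:E).
  rewrite {1 2}pE {1}/inner gradD//; last exact: dom_chart_at.
  rewrite linearD/= mulmxDr mxE -!/(inner X _ x) mulrDl; ring.
rewrite integralD//; last 2 first.
- by under eq_fun do rewrite EFinD; exact: integrableD.
- by under eq_fun do rewrite EFinD; exact: integrableD.
rewrite (ih _ s2 z2) ?adde0; last first.
  move=> y; rewrite mulf_eq0 negb_or => /andP[b1 /Hs[x]].
  rewrite inE => /predU1P[-> b1'|xs bx]; first by rewrite b1' subrr eqxx in b1.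
  by exists x.
have z1L x : ~ L x -> b x0 x * phi x = 0 by move=> Lx; rewrite bL// mul0r.
have [_ <-] := ibp_chart_global fX s1 cL Lc z1L.
apply: eq_integral => x _; congr ((_ + _)%:E).
have [Lx|Lx] := pselect (L x); first by rewrite (div_chart fX (Lc _ Lx)).
by rewrite z1L// !mul0r.
Qed.

End divergence_theorem.

(** * Weak gradients and elliptic comparison *)

Section real_integrable.
Context d (T : measurableType d) (R : realType) (m : {measure set T -> \bar R}).
Implicit Types (f g h : T -> R).

Definition rint f : Prop := m.-integrable setT (EFin \o f).

Lemma rint_measurable f : rint f -> measurable_fun setT f.
Proof. by move=> /measurable_int/measurable_EFinP. Qed.

Lemma rint_abse f : measurable_fun setT f ->
  rint f <-> (\int[m]_x `|f x|%:E < +oo)%E.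
Proof.
move=> mf; split=> [/integrableP[_]//|fo]; apply/integrableP; split=> //.
exact/measurable_EFinP.
Qed.

Lemma rint_ge0 f : measurable_fun setT f -> (forall x, 0 <= f x) ->
  rint f <-> (\int[m]_x (f x)%:E < +oo)%E.
Proof.
move=> mf f0; rewrite rint_abse//.
by under eq_integral do rewrite ger0_norm//.
Qed.

Lemma rint_EFin f : rint f -> (\int[m]_x f x)%:E = (\int[m]_x (f x)%:E)%E.
Proof. by move=> rf; rewrite fineK//; exact: integrable_fin_num. Qed.

Lemma rintD f g : rint f -> rint g -> rint (fun x => f x + g x).
Proof.
move=> rf rg; rewrite /rint (_ : EFin \o _ = (EFin \o f) \+ (EFin \o g))%E//.
exact: integrableD.
Qed.

Lemma rintZ (a : R) f : rint f -> rint (fun x => a * f x).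
Proof.
move=> rf; rewrite /rint (_ : EFin \o _ = (fun x => a%:E * (f x)%:E))%E//.
exact: (integrableZl _ _ rf).
Qed.

Lemma rintB f g : rint f -> rint g -> rint (fun x => f x - g x).
Proof.
move=> rf rg; rewrite (_ : (fun x => f x - g x) = (fun x => f x + -1 * g x)).
  by apply: rintD => //; exact: rintZ.
by apply/funext => x; rewrite mulN1r.
Qed.

Lemma rintN f : rint f -> rint (fun x => - f x).
Proof. by move=> /(rintZ (-1)); under eq_fun do rewrite mulN1r. Qed.

Lemma rint0 : rint (fun=> 0).
Proof. exact: integrable0. Qed.

Lemma rint_le f g : measurable_fun setT f -> (forall x, `|f x| <= g x) -> rint g -> rint f.
Proof.
move=> mf fg; apply: le_integrable => //; first exact/measurable_EFinP.
by move=> x _ /=; rewrite lee_fin (le_trans (fg x))// ler_norm.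
Qed.

Lemma rint_ae f g : measurable_fun setT g -> (\forall x \ae m, f x = g x) -> rint f -> rint g.
Proof.
move=> mg fg rf; rewrite rint_abse//.
have -> : (\int[m]_x `|g x|%:E = \int[m]_x `|f x|%:E)%E; last first.
  by apply/rint_abse => //; exact: rint_measurable.
apply: ae_eq_integral => //.
- by apply/measurable_EFinP/measurableT_comp.
- by apply/measurable_EFinP/measurableT_comp => //; exact: rint_measurable.
- by apply: filterS fg => x /= -> _.
Qed.

Lemma IntD f g : rint f -> rint g -> \int[m]_x (f x + g x) = \int[m]_x f x + \int[m]_x g x.
Proof. by move=> rf rg; exact: RintegralD. Qed.

Lemma IntB f g : rint f -> rint g -> \int[m]_x (f x - g x) = \int[m]_x f x - \int[m]_x g x.
Proof. by move=> rf rg; exact: RintegralB. Qed.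

Lemma IntZ (a : R) f : rint f -> \int[m]_x (a * f x) = a * \int[m]_x f x.
Proof. by move=> rf; exact: RintegralZl. Qed.

Lemma IntN f : rint f -> \int[m]_x (- f x) = - \int[m]_x f x.
Proof. by move=> rf; rewrite -mulN1r -IntZ//; apply: eq_Rintegral => x _; rewrite mulN1r. Qed.

Lemma Int_ae f g : measurable_fun setT f -> measurable_fun setT g -> (\forall x \ae m, f x = g x) ->
  \int[m]_x f x = \int[m]_x g x.
Proof.
move=> mf mg fg; congr fine; apply: ae_eq_integral => //; [exact/measurable_EFinP..|].
by apply: filterS fg => x /= -> _.
Qed.

Lemma Int_ge0_ae f : rint f -> (\forall x \ae m, 0 <= f x) -> 0 <= \int[m]_x f x.
Proof.
move=> rf f0; have mf := rint_measurable rf.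
rewrite (@Int_ae f (fun x => `|f x|))//; last 2 first.
- exact: measurableT_comp.
- by apply: filterS f0 => x fx; rewrite ger0_norm.
by apply: Rintegral_ge0.
Qed.

Lemma le_Int_ae f g : rint f -> rint g -> (\forall x \ae m, f x <= g x) ->
  \int[m]_x f x <= \int[m]_x g x.
Proof.
move=> rf rg fg; rewrite -subr_ge0 -IntB//; apply: Int_ge0_ae; first exact: rintB.
by apply: filterS fg => x; rewrite subr_ge0.
Qed.

Lemma le_Int f g : rint f -> rint g -> (forall x, f x <= g x) -> \int[m]_x f x <= \int[m]_x g x.
Proof. by move=> rf rg fg; apply: le_Int_ae => //; exact: filterE. Qed.

Lemma Int_ge0 f : (forall x, 0 <= f x) -> 0 <= \int[m]_x f x.
Proof. by move=> f0; exact: Rintegral_ge0. Qed.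

Lemma Int0 : \int[m]_x (0 : R) = 0.
Proof. by rewrite /Rintegral integral0. Qed.

Lemma Int_eq0 f : rint f -> (\forall x \ae m, 0 <= f x) -> \int[m]_x f x = 0 -> \forall x \ae m, f x = 0.
Proof.
move=> rf f0 If; have mf := rint_measurable rf.
have /(ae_eq_integral_abs m measurableT) : (\int[m]_(x in setT) `|(f x)%:E| = 0)%E.
  have -> : (\int[m]_(x in setT) `|(f x)%:E| = \int[m]_x (f x)%:E)%E.
    apply: ae_eq_integral => //; [by apply: measurableT_comp => //; exact/measurable_EFinP|exact/measurable_EFinP|].
    by apply: filterS f0 => x fx _; rewrite gee0_abs.
  by rewrite -rint_EFin// If.
move=> H.
have := H (proj2 (measurable_EFinP _ _) mf).
by apply: filterS => x /(_ I)[].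
Qed.

Lemma dominated_Int (F : nat -> T -> R) f g : (forall k, measurable_fun setT (F k)) ->
  measurable_fun setT f -> (\forall x \ae m, F k x @[k --> \oo] --> f x) -> rint g ->
  (\forall x \ae m, forall k, `|F k x| <= g x) ->
  rint f /\ \int[m]_x F k x @[k --> \oo] --> \int[m]_x f x.
Proof.
move=> mF mf Ff rg Fg.
have cF : \forall x \ae m, [set: T] x -> (F k x)%:E @[k --> \oo] --> (f x)%:E.
  by apply: filterS Ff => x Fx _; apply: cvg_EFin => //; exact: nearW.
have gF : \forall x \ae m, forall k, [set: T] x -> (`|(F k x)%:E| <= (g x)%:E)%E.
  by apply: filterS Fg => x Fx k _; rewrite lee_fin.
have mF' k : measurable_fun setT (EFin \o F k) by exact/measurable_EFinP.
have mf' : measurable_fun setT (EFin \o f) by exact/measurable_EFinP.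
have [rf _ H] := dominated_convergence measurableT mF' mf' cF rg gF.
split=> //; apply: fine_cvg; rewrite rint_EFin//; exact: H.
Qed.

End real_integrable.

(** * Square-integrable functions *)

Section weighted_square_integrable.
Context d (T : measurableType d) (R : realType) (m : {measure set T -> \bar R}).
Variable r : T -> R.
Hypotheses (mr : measurable_fun setT r) (r0 : forall x, 0 <= r x).
Implicit Types (f g h : T -> R).

(** The predicate [L2] over an arbitrary measure space; the version on M is an instance by
    conversion. *)
Definition sqi f : Prop := measurable_fun setT f /\ (\int[m]_x (f x ^+ 2 * r x)%:E < +oo)%E.

Lemma sqi_rint f : sqi f -> rint m (fun x => f x ^+ 2 * r x).
Proof.
move=> [mf]; apply: (rint_ge0 _ _ _).2 => [|x]; last by rewrite mulr_ge0// sqr_ge0.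
by apply: measurable_funM => //; exact: measurable_funX.
Qed.

Lemma sqiP f : measurable_fun setT f -> rint m (fun x => f x ^+ 2 * r x) -> sqi f.
Proof.
move=> mf rf; split=> //; apply/(rint_ge0 _ _ _).1 => //; first exact: rint_measurable rf.
by move=> x; rewrite mulr_ge0// sqr_ge0.
Qed.

Lemma sqi_mul f g : sqi f -> sqi g -> rint m (fun x => f x * g x * r x).
Proof.
move=> sf sg; apply: (@rint_le _ _ _ _ _ (fun x => f x ^+ 2 * r x + g x ^+ 2 * r x)).
- by apply: measurable_funM => //; apply: measurable_funM; [exact: sf.1|exact: sg.1].
- move=> x; rewrite !normrM (ger0_norm (r0 x)) -mulrDl ler_wpM2r//.
  rewrite -(real_normK (num_real (f x))) -(real_normK (num_real (g x))).
  have := sqr_ge0 (`|f x| - `|g x|); have := normr_ge0 (f x); have := normr_ge0 (g x); nra.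
- by apply: rintD; exact: sqi_rint.
Qed.

Lemma sqiD f g : sqi f -> sqi g -> sqi (fun x => f x + g x).
Proof.
move=> sf sg; apply: sqiP; first exact: (measurable_funD sf.1 sg.1).
rewrite (_ : (fun x => _) = (fun x => (f x ^+ 2 * r x + 2 * (f x * g x * r x)) + g x ^+ 2 * r x)).
  by apply: rintD; [apply: rintD; [exact: sqi_rint|apply: rintZ; exact: sqi_mul]|exact: sqi_rint].
by apply/funext => x; ring.
Qed.

Lemma sqiZ (a : R) f : sqi f -> sqi (fun x => a * f x).
Proof.
move=> sf; apply: sqiP; first exact: (measurable_funM (measurable_cst a) sf.1).
rewrite (_ : (fun x => _) = (fun x => a ^+ 2 * (f x ^+ 2 * r x))).
  by apply: rintZ; exact: sqi_rint.
by apply/funext => x; ring.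
Qed.

Lemma sqiB f g : sqi f -> sqi g -> sqi (fun x => f x - g x).
Proof.
move=> sf /(sqiZ (-1)) sg; have := sqiD sf sg.
by under eq_fun do rewrite mulN1r.
Qed.

Lemma sqi0 : sqi (fun=> 0).
Proof. by apply: sqiP => //; under eq_fun do rewrite expr0n/= mul0r; exact: rint0. Qed.

Lemma sqi_le f g : measurable_fun setT f -> (forall x, `|f x| <= `|g x|) -> sqi g -> sqi f.
Proof.
move=> mf fg sg; apply: sqiP => //; apply: rint_le (sqi_rint sg).
  by apply: measurable_funM => //; exact: measurable_funX.
move=> x; rewrite ger0_norm; last by rewrite mulr_ge0// sqr_ge0.
rewrite ler_wpM2r//.
by rewrite -(real_normK (num_real (f x))) -(real_normK (num_real (g x))) ler_sqr ?nnegrE//.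
Qed.

End weighted_square_integrable.

(** * Test functions *)

Section test_functions.
Context {R : realType} {n : nat} {M : ptopologicalType} (A : weighted R n M).
Implicit Types (c d : chart A) (f h phi : M -> R) (U K : set M) (X Y Z : chart A -> M -> 'rV[R]_n).
Local Notation smth := (msmooth A setT).

Definition csmth f := smth f /\ exists2 K, compact K & forall x, ~ K x -> f x = 0.

Lemma csmthE f : smooth_cpt A f <-> csmth f.
Proof. by split=> -[sf H]; split=> //; apply/(smoothE A f). Qed.

Lemma csmthM f h : smth f -> csmth h -> csmth (fun x => f x * h x).
Proof.
move=> sf [sh [K cK h0]]; split; first exact: (msmoothM (@openT M)).
by exists K => // x Kx; rewrite h0// mulr0.
Qed.

Lemma csmthD f h : csmth f -> csmth h -> csmth (fun x => f x + h x).
Proof.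
move=> [sf [K cK f0]] [sh [L cL h0]]; split; first exact: (msmoothD (@openT M)).
exists (K `|` L); first exact: compactU.
by move=> x KLx; rewrite f0 ?h0 ?addr0// => ?; apply: KLx; [right|left].
Qed.

Lemma csmth0 : csmth (fun=> 0).
Proof. by split; [exact: msmooth_cst|exists set0 => //; exact: compact0]. Qed.

Lemma csmthZ (a : R) f : csmth f -> csmth (fun x => a * f x).
Proof. by apply: csmthM; exact: msmooth_cst. Qed.

Lemma csmthB f h : csmth f -> csmth h -> csmth (fun x => f x - h x).
Proof. by move=> cf /(csmthZ (-1)) /(csmthD cf); under eq_fun do rewrite mulN1r. Qed.

Lemma csmth_rint f : csmth f -> rint (vol A) f.
Proof. by move=> [sf [K cK f0]]; exact: (@smth_cpt_integrable _ _ _ A f K sf cK f0). Qed.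

Lemma csmth_measurable f : csmth f -> measurable_fun [set: borel M] f.
Proof. by move=> [sf _]; exact: (@smth_measurable _ _ _ A f sf). Qed.

Lemma csmth_bounded f : csmth f -> exists2 C, 0 <= C & forall x, `|f x| <= C.
Proof.
move=> [sf [K cK f0]]; have cf := smooth_cont sf.
have [C C0 HC] := @compact_cont_bounded R M K f cK (fun x _ => cf x).
exists C => // x; have [Kx|Kx] := pselect (K x); first exact: HC.
by rewrite f0// normr0.
Qed.

(** A Lindelof cover of U by the sets where bumps b_i equal 1 gives F_k = 1 - prod_(i < k) (1 -
    b_i), which at each point of U equals 1 from some k on. The case U = M later provides the
    cut-offs theta_k. *)
Lemma open_approx U : open U -> exists F : nat -> M -> R,
  [/\ forall k, csmth (F k), forall k x, 0 <= F k x <= 1 &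
      forall x, F k x @[k --> \oo] --> (\1_U x : R)].
Proof.
move=> oU; have [->|/set0P[x1 Ux1]] := eqVneq U set0.
  exists (fun _ _ => 0); split; [by move=> k; exact: csmth0|by move=> k x; rewrite lexx ler01|].
  by move=> x; rewrite indic0; exact: cvg_cst.
have HB x0 : U x0 -> exists b, [/\ csmth b, forall x, 0 <= b x <= 1, forall x, ~ U x -> b x = 0 &
    \forall x \near x0, b x = 1].
  move=> Ux0; have [b [sb b01 [L [cL LU b0]] b1]] := bump_exists oU Ux0 (dom_chart_at A x0).
  exists b; split=> //; first by split=> //; exists L.
  by move=> x Ux; apply: b0 => /LU[].
pose b x0 := if pselect (U x0) is left p then sval (cid (HB x0 p)) else fun=> 0.
have Hb x0 : U x0 -> [/\ csmth (b x0), forall x, 0 <= b x0 x <= 1, forall x, ~ U x -> b x0 x = 0 &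
    \forall x \near x0, b x0 x = 1].
  by move=> Ux0; rewrite /b; case: pselect => // p; case: cid.
have [s [Us Hs]] := @lindelof_in M U (fun x0 => [set x | b x0 x = 1]°) x1 (mfd_second_countable A) Ux1
  (fun x0 Ux0 => conj (@open_interior _ _) (let: And4 _ _ _ h := Hb x0 Ux0 in h)).
pose F k x := 1 - \prod_(i < k) (1 - b (s i) x).
have FS k : F k.+1 = (fun x => F k x + b (s k) x - F k x * b (s k) x).
  by apply/funext => x; rewrite /F big_ord_recr /=; ring.
exists F; split.
- elim=> [|k ih]; first by have := csmth0; rewrite /F; under [X in _ -> csmth X]eq_fun do rewrite big_ord0 subrr.
  have [cb _ _ _] := Hb _ (Us k); rewrite FS; apply: csmthB; first exact: csmthD.
  by apply: csmthM => //; exact: ih.1.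
- move=> k x; rewrite /F subr_ge0 lerBlDr lerDl.
  apply: (@big_ind _ (fun z : R => (z <= 1) && (0 <= z))) => [|a a'|i _]; first by rewrite ler01 lexx.
    by move=> /andP[a1 a0] /andP[b1 b0]; rewrite mulr_ge0// mulr_ile1.
  by have [_ /(_ x)/andP[b0 b1] _ _] := Hb _ (Us i); rewrite subr_ge0 b1 gerBl b0.
- move=> x; have [Ux|Ux] := pselect (U x); last first.
    rewrite indicE memNset//=; rewrite (_ : (fun k => F k x) = cst 0); first exact: cvg_cst.
    apply/funext => k; rewrite /F big1 ?subrr// => i _.
    by have [_ _ -> // _] := Hb _ (Us i); rewrite subr0.
  rewrite indicE mem_set//=; have [k /interior_subset/= bk] := Hs x Ux.
  apply: cvg_near_cst; exists k.+1 => // j /= kj.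
  by rewrite /F (bigD1 (Ordinal kj))//= bk subrr mul0r subr0.
Qed.

(** Dominated convergence along approximations of indicators shows that f has integral zero over
    every open set; open sets are stable under intersection, so a Dynkin system argument extends
    this to Borel sets. *)
Lemma vol_csmth_eq0 f : rint (vol A) f ->
  (forall phi, csmth phi -> \int[vol A]_x (f x * phi x) = 0) -> \forall x \ae vol A, f x = 0.
Proof.
move=> rf H; have mf := rint_measurable rf.
suff HP : forall S : set (borel M), measurable S -> (\int[vol A]_(x in S) (f x)%:E = 0)%E.
  have E0 : forall S : set (borel M), S `<=` setT -> measurable S ->
      (\int[vol A]_(x in S) (EFin \o f) x = \int[vol A]_(x in S) (cst 0%E) x)%E.
    by move=> S _ mS; rewrite integral0; exact: HP.
  have := @integral_ae_eq _ _ _ (vol A) setT measurableT (cst 0)%E (EFin \o f) rf (measurable_cst _) E0.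
  by apply: filterS => x /(_ I) [].
have iS (S : set (borel M)) : measurable S -> (vol A).-integrable S (EFin \o f).
  by move=> mS; apply: (integrableS _ _ _ rf).
have PO U : open U -> (\int[vol A]_(x in U) (f x)%:E = 0)%E.
  move=> oU; have mU := borel_open oU; have [F [cF F01 FU]] := open_approx oU.
  have mFU : measurable_fun setT (fun x : borel M => f x * \1_U x).
    by apply: measurable_funM => //; exact: measurable_indic.
  have cFU : \forall x \ae vol A, f x * F k x @[k --> \oo] --> f x * \1_U x.
    by apply: aeW => x; apply: cvgM; [exact: cvg_cst|exact: FU].
  have dF : \forall x \ae vol A, forall k, `|f x * F k x| <= `|f x|.
    apply: aeW => x k; have /andP[F0 F1] := F01 k x.
    by rewrite normrM (ger0_norm F0) ler_piMr.
  have [rfU HC] := dominated_Int (fun k => measurable_funM mf (csmth_measurable (cF k))) mFU cFU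
    (integrable_norm rf) dF.
  have I0 : \int[vol A]_x (f x * \1_U x) = 0.
    move: HC; rewrite (_ : (fun k => _) = cst 0); last by apply/funext => k; exact: H.
    by move=> /cvg_lim <-//; rewrite lim_cst.
  rewrite integral_mkcond -[RHS](congr1 EFin I0) rint_EFin//.
  apply: eq_integral => x _; rewrite patchE indicE; case: ifPn => xU; first by rewrite mulr1.
  by rewrite mulr0.
have PT : (\int[vol A]_(x in setT) (f x)%:E = 0)%E by apply: PO; exact: openT.
have := @dynkin_induction _ (borel M) (@open M) (fun S => (\int[vol A]_(x in S) (f x)%:E = 0)%E)
   erefl (@openI M) PT PO.
apply.
- move=> S mS IS; have mSC := measurableC mS.
  move: PT; rewrite -(setUv S) integral_setU_EFin//.
  + by rewrite IS add0e.
  + by rewrite setUv.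
  + by apply/disj_set2P; rewrite setICr.
- move=> F mF tF IF; rewrite (@integral_bigcup _ _ _ (vol A) F (EFin \o f) tF mF).
    by rewrite eseries0// => k _ _; exact: IF.
  by apply: iS; exact: bigcupT_measurable.
Qed.

End test_functions.

Section almost_everywhere.
Context d (T : measurableType d) (R : realType) (m : {measure set T -> \bar R}).
Implicit Types P Q S : T -> Prop.

Lemma aeS P Q : (forall x, P x -> Q x) -> (\forall x \ae m, P x) -> \forall x \ae m, Q x.
Proof. exact: filterS. Qed.

Lemma aeS2 P Q S : (forall x, P x -> Q x -> S x) -> (\forall x \ae m, P x) ->
  (\forall x \ae m, Q x) -> \forall x \ae m, S x.
Proof. exact: filterS2. Qed.

Lemma aeS3 P Q S P' : (forall x, P x -> Q x -> S x -> P' x) -> (\forall x \ae m, P x) ->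
  (\forall x \ae m, Q x) -> (\forall x \ae m, S x) -> \forall x \ae m, P' x.
Proof. exact: filterS3. Qed.

End almost_everywhere.

Lemma derive_coord {R : realType} n (v y : 'rV[R]_n) k : 'D_v (fun z : 'rV[R]_n => z 0 k) y = v 0 k.
Proof.
rewrite /derive; apply: cvg_lim => //; apply: cvg_near_cst; near=> h.
have h0 : h != 0 by near: h; exact: nbhs_dnbhs_neq.
by rewrite /= !mxE addrK /GRing.scale /= mulKf.
Unshelve. all: by end_near. Qed.

(** * Weak gradients *)

Section weak_gradient.
Context {R : realType} {n : nat} {M : ptopologicalType} (A : weighted R n M).
Implicit Types (c d : chart A) (f h w phi : M -> R) (U K : set M) (X Y Z : chart A -> M -> 'rV[R]_n).
Local Notation smth := (msmooth A setT).
Local Notation csmth := (csmth A).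
Local Notation wgrad_ := (@wgrad R n M A).
Local Notation L2_gradient_ := (@L2_gradient R n M A).

Lemma chart_cover : exists s : nat -> M, forall y, exists k, dom (chart_at A (s k)) y.
Proof.
exact: (@lindelof M (fun x => dom (chart_at A x)) (mfd_second_countable A)
  (fun x => conj (@open_dom _ _ _ A _) (dom_chart_at A x))).
Qed.

(** The weight is strictly positive, so an integral of it over a measurable set vanishes only on
    null sets. *)
Lemma ae_mu_vol (P : M -> Prop) : (\forall x \ae mu A, P x) <-> (\forall x \ae vol A, P x).
Proof.
have H (N : set (borel M)) : measurable N -> (vol A N = 0 <-> mu A N = 0)%E.
  move=> mN; rewrite mu_weight//.
  have mw : measurable_fun N (fun x : borel M => (weight A x)%:E).
    by have mw := smth_measurable (weight_smth A); exact/measurable_EFinP/measurable_funTS.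
  split=> [V0|I0].
    by rewrite null_set_integral//.
  have /(ae_eq_integral_abs (vol A) mN) : (\int[vol A]_(x in N) `|(weight A x)%:E| = 0)%E.
    by rewrite -[RHS]I0; apply: eq_integral => y _; rewrite gee0_abs// lee_fin ltW// weight_gt0.
  move=> /(_ mw)[L [mL L0 HL]]; apply/eqP; rewrite eq_le measure_ge0 andbT -L0.
  apply: le_measure; rewrite ?inE// => x Nx; apply: HL => /= /(_ Nx)[] /eqP.
  by rewrite gt_eqF// weight_gt0.
by split=> -[N [mN N0 PN]]; exists N; split=> //; exact/H.
Qed.

Lemma rint_mu f : measurable_fun [set: borel M] f ->
  rint (mu A) f <-> rint (vol A) (fun x => f x * weight A x).
Proof.
move=> mf; have mw := smth_measurable (weight_smth A).
rewrite !rint_abse//; last exact: measurable_funM.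
rewrite integral_mu; last by apply/measurable_EFinP/measurableT_comp.
have -> // : (\int[vol A]_x (`|f x|%:E * (weight A x)%:E) = \int[vol A]_x `|f x * weight A x|%:E)%E.
by apply: eq_integral => x _; rewrite normrM EFinM (ger0_norm (ltW (weight_gt0 A x))).
Qed.

Lemma Int_mu f : measurable_fun [set: borel M] f ->
  \int[mu A]_x f x = \int[vol A]_x (f x * weight A x).
Proof. by move=> mf; rewrite /Rintegral integral_mu//; exact/measurable_EFinP. Qed.

Definition mfield X := vector_field X /\
  forall c k, measurable_fun (dom c : set (borel M)) (fun x => X c x 0 k).

Lemma smooth_on_dom_measurable c (F : M -> R) : Smooth (img c) (F \o param c) ->
  measurable_fun (dom c : set (borel M)) F.
Proof.
move=> sF; have od := @open_dom _ _ _ A c; apply: borel_measurable_fun => // x cx.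
have FE z : dom c z -> (F \o param c \o Defs.coord c) z = F z by move=> cz /=; rewrite coordK.
apply: (continuous_eq_on od FE cx).
by apply: continuous_comp; [exact: coord_cont|apply: (Smooth_cont sF); exact: img_coord].
Qed.

Lemma smooth_mfield X : smooth_field X -> mfield X.
Proof.
move=> [vX sX]; split=> // c k; apply: smooth_on_dom_measurable.
exact: (Smooth_mx_entry 0 k (@open_img _ _ _ A c) (sX c)).
Qed.

Lemma vector_field_lin (a : R) X Y : vector_field X -> vector_field Y ->
  vector_field (fun c x => X c x + a *: Y c x).
Proof. by move=> vX vY c d x cx dx; rewrite (vX _ _ _ cx dx) (vY _ _ _ cx dx) mulmxDl scalemxAl. Qed.

Lemma mfield_lin (a : R) X Y : mfield X -> mfield Y -> mfield (fun c x => X c x + a *: Y c x).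
Proof.
move=> [vX mX] [vY mY]; split; first exact: vector_field_lin.
move=> c k; under eq_fun do rewrite !mxE.
by apply: measurable_funD => //; apply: measurable_funM.
Qed.

(** Fields are measurable chart by chart, so a countable cover by chart domains is needed to reach
    all of M. *)
Lemma inner_measurable X Y : mfield X -> mfield Y -> measurable_fun [set: borel M] (inner X Y).
Proof.
move=> [vX mX] [vY mY]; have [s Hs] := chart_cover.
apply: (@measurable_fun_countable_cover _ _ (borel M) _ (fun k => dom (chart_at A (s k)))).
- by apply/seteqP; split=> // x _; have [k sx] := Hs x; exists k.
- by move=> k; apply: borel_open; exact: open_dom.
move=> k; set c := chart_at A (s k).
apply: (@eq_measurable_fun _ _ (borel M) _ (dom c) (fun x => \sum_j \sum_i X c x 0 i * metric c x i j * Y c x 0 j)).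
  move=> x; rewrite inE => cx; rewrite (inner_chart vX vY cx) mxE; apply: eq_bigr => j _.
  by rewrite mxE [in RHS]mxE mulr_suml.
apply: measurable_sum => j; apply: measurable_sum => i.
apply: measurable_funM => //; apply: measurable_funM => //.
apply: smooth_on_dom_measurable.
exact: (Smooth_mx_entry i j (@open_img _ _ _ A c) (metric_Smooth c)).
Qed.

Lemma inner_le X Y x : `|inner X Y x| <= inner X X x + inner Y Y x.
Proof.
have H1 := inner_ge0 (fun c y => X c y + Y c y) x.
have H2 := inner_ge0 (fun c y => X c y + (-1) *: Y c y) x.
have P1 := inner_ge0 X x; have P2 := inner_ge0 Y x.
move: H1 H2; rewrite !innerDl !innerDr !innerZl (innerC X (fun c y => -1 *: Y c y)).
rewrite (innerC Y (fun c y => -1 *: Y c y)) !innerZl (innerC Y X) => H1 H2.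
by rewrite ler_norml; apply/andP; split; lra.
Qed.

Definition L2field X := mfield X /\ rint (mu A) (inner X X).

Lemma L2field_inner X Y : L2field X -> L2field Y -> rint (mu A) (inner X Y).
Proof.
move=> [mX iX] [mY iY]; apply: (rint_le (inner_measurable mX mY) (inner_le X Y)).
exact: rintD.
Qed.

Lemma inner_lin (a b : R) X Y X' Y' x :
  inner (fun c y => X c y + a *: Y c y) (fun c y => X' c y + b *: Y' c y) x =
  inner X X' x + b * inner X Y' x + a * inner Y X' x + a * b * inner Y Y' x.
Proof.
rewrite innerDl innerZl !innerDr !(innerMr (fun=> b)); ring.
Qed.

Lemma L2field_lin (a : R) X Y : L2field X -> L2field Y -> L2field (fun c x => X c x + a *: Y c x).
Proof.
move=> LX LY; split; first exact: (mfield_lin _ LX.1 LY.1).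
rewrite (_ : inner _ _ = fun x => ((inner X X x + a * inner X Y x) + a * inner Y X x) + a * a * inner Y Y x).
  by do 3 (apply: rintD; last by apply: rintZ; exact: L2field_inner); exact: LX.2.
by apply/funext => x; rewrite inner_lin.
Qed.

Lemma inner_smth X Y : smooth_field X -> smooth_field Y -> smth (inner X Y).
Proof.
move=> [vX sX] [vY sY]; apply: smth_charts => c; have oi := @open_img _ _ _ A c.
have sXm := Smooth_mulmx oi (sX c) (metric_Smooth c).
apply: (@Smooth_eq _ _ _ (img c) (fun y => \sum_k (X c (param c y) *m metric c (param c y)) 0 k * Y c (param c y) 0 k)) => //.
  move=> y cy /=; rewrite (inner_chart vX vY (dom_param cy)) mxE.
  by apply: eq_bigr => k _; rewrite [X in _ = _ * X]mxE.
apply: Smooth_sum => // k _; apply: SmoothM => //; first exact: (Smooth_mx_entry 0 k oi sXm).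
exact: (Smooth_mx_entry 0 k oi (sY c)).
Qed.

Definition cfield Y := smooth_field Y /\ exists2 K, compact K & forall c x, dom c x -> ~ K x -> Y c x = 0.

Lemma cfieldE Y : smooth_cpt_field Y <-> cfield Y.
Proof.
split=> [[vY sY HK]|[[vY sY] HK]]; split=> //.
by move=> c0; exact: ((SmoothE _ _).1 (sY c0)).
Qed.

Lemma cfield_div Y : cfield Y -> csmth (div Y).
Proof.
move=> [fY [K cK Y0]]; split; first exact: div_smth.
exists K => // x Kx; have clK : closed K by exact: (compact_closed_mfd A).
rewrite divE /divc big1 ?mulr0// => k _; apply: (partial0_in k clK _ (dom_chart_at A x) Kx).
by move=> y cy Ky; rewrite Y0// mxE mulr0.
Qed.

Lemma cfield_inner X Y : smooth_field X -> cfield Y -> csmth (inner X Y).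
Proof.
move=> fX [fY [K cK Y0]]; split; first exact: inner_smth.
by exists K => // x Kx; rewrite inner0r// Y0//; exact: dom_chart_at.
Qed.

Lemma cfield_scale f X : smth f -> cfield X -> cfield (fun c x => f x *: X c x).
Proof.
move=> sf [fX [K cK X0]]; split; first exact: field_scale.
by exists K => // c x cx Kx; rewrite X0// scaler0.
Qed.

Lemma csmth_scale f X : csmth f -> smooth_field X -> cfield (fun c x => f x *: X c x).
Proof.
move=> [sf [K cK f0]] fX; split; first exact: field_scale.
by exists K => // c x cx Kx; rewrite f0// scale0r.
Qed.

Lemma csmth_grad f : csmth f -> cfield (grad A f).
Proof.
move=> [sf [K cK f0]]; split; first exact: grad_field.
exists K => // c x cx Kx; apply: (grad0_off _ f0) => //; exact: (compact_closed_mfd A).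
Qed.

Lemma csmth_rint_mu f : csmth f -> rint (mu A) f.
Proof.
move=> cf; apply/rint_mu; first exact: csmth_measurable cf.
have := csmth_rint (csmthM (weight_smth A) cf).
by under eq_fun do rewrite mulrC.
Qed.

Lemma cfield_L2 Y : cfield Y -> L2field Y.
Proof.
move=> cY; split; first exact: (smooth_mfield cY.1).
by apply: csmth_rint_mu; exact: (cfield_inner cY.1 cY).
Qed.

Lemma smthV f : smth f -> (forall x, f x != 0) -> smth (fun x => (f x)^-1).
Proof.
move=> sf f0; exact: (msmooth_comp1 (@openT M) (fun x _ => f0 x) (@Smooth_inv R) sf).
Qed.

Lemma weightV_smth : smth (fun x => (weight A x)^-1).
Proof. by apply: smthV; [exact: weight_smth|move=> x; rewrite gt_eqF// weight_gt0]. Qed.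

(** The norm of fields refers to mu, while distributional gradients are tested against vol_g;
    dividing the test field by the weight converts one pairing into the other. *)
Lemma L2field_vol X Y : L2field X -> cfield Y -> rint (vol A) (inner X Y).
Proof.
move=> LX cY; have cY' := cfield_scale weightV_smth cY.
have := L2field_inner LX (cfield_L2 cY').
have mI := inner_measurable LX.1 (smooth_mfield cY'.1).
move=> /(rint_mu mI); congr (rint _ _); apply/funext => x.
by rewrite innerMr mulrC mulVKf// gt_eqF// weight_gt0.
Qed.

(** Near a point the coordinate functions times a bump are test functions psi_k, and <Z, grad psi_k>
    is the k-th component of Z where the bump equals 1. Testing with phi grad psi_k for all phi
    kills that component almost everywhere; countably many such neighbourhoods cover M. *)
Lemma weak_zero Z : L2field Z -> (forall Y, cfield Y -> \int[vol A]_x inner Z Y x = 0) ->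
  \forall x \ae vol A, forall c, dom c x -> Z c x = 0.
Proof.
move=> LZ HZ; have [vZ mZ] := LZ.1.
have loc x0 : exists U, [/\ open U, U x0 & \forall x \ae vol A, U x -> forall c, dom c x -> Z c x = 0].
  pose c := chart_at A x0; have cx0 : dom c x0 by exact: dom_chart_at.
  have [b [sb _ [K [cK KU b0]] b1]] := bump_exists (@openT M) I cx0.
  pose U := [set x | b x = 1]° `&` dom c.
  have oU : open U by apply: openI; [exact: open_interior|exact: open_dom].
  have Ux0 : U x0 by split.
  exists U; split=> //.
  pose psi k x := b x * Defs.coord c x 0 k.
  have cpsi k : csmth (psi k).
    have z x : ~ K x -> psi k x = 0 by move=> Kx; rewrite /psi b0// mul0r.
    split; last by exists K.
    have clK : closed K by exact: (compact_closed_mfd A).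
    apply: (smth_cover_chart clK (fun x Kx => (KU x Kx).2) z).
    have oi := @open_img _ _ _ A c.
    have : Smooth (img c) (fun y => b (param c y) * y 0 k).
      by apply: SmoothM => //; [exact: smooth_Smooth|exact: Smooth_coord].
    by apply: Smooth_eq => // y cy /=; rewrite /psi paramK.
  have zk k : \forall x \ae vol A, inner Z (grad A (psi k)) x = 0.
    apply: (@vol_csmth_eq0 _ _ _ A); first exact: (L2field_vol LZ (csmth_grad (cpsi k))).
    move=> phi cphi; rewrite -(HZ _ (csmth_scale cphi (grad_field (cpsi k).1))).
    by apply: eq_Rintegral => x _; rewrite innerMr mulrC.
  have : \forall x \ae vol A, forall k, inner Z (grad A (psi k)) x = 0.
    (* The finitely many indices are embedded in the natural numbers, with 0 elsewhere, in order to
       use the countable stability of almost everywhere statements. *)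
    pose F (j : nat) x := if insub j is Some k then inner Z (grad A (psi k)) x else 0.
    have : \forall x \ae vol A, forall j, F j x = 0.
      by apply: ae_foralln => j; rewrite /F; case: insub => [k|]; [exact: zk|exact: aeW].
    by apply: aeS => x Hx k; have := Hx (val k); rewrite /F valK.
  apply: aeS => x Hx Ux d dx; have cx : dom c x by case: Ux.
  suff Zc : Z c x = 0 by rewrite (vZ c d x cx dx) Zc mul0mx.
  apply/rowP => k; rewrite mxE -(Hx k) (inner_grad_chart vZ (cpsi k).1 cx).
  have pE l : partial c l (psi k) x = (l == k)%:R.
    have oW : open (Defs.coord c @` ([set x | b x = 1]° `&` dom c)).
      by apply: open_coord_image; exact: open_interior.
    rewrite /partial (@derive_eq_on _ _ _ _ _ (fun z : 'rV[R]_n => z 0 k) _ _ oW).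
    - by rewrite derive_coord mxE eqxx eq_sym.
    - move=> _ [z [/interior_subset/= bz cz] <-]; by rewrite /= coordK// /psi bz mul1r.
    - by exists x.
  rewrite (bigD1 k)//= big1 ?addr0 => [|l lk]; first by rewrite pE eqxx mulr1.
  by rewrite pE (negbTE lk) mulr0.
pose U x0 := sval (cid (loc x0)).
have HU x0 : [/\ open (U x0), U x0 x0 & \forall x \ae vol A, U x0 x -> forall c, dom c x -> Z c x = 0].
  by rewrite /U; case: cid.
have [s Hs] := lindelof (mfd_second_countable A) (fun x0 => let: And3 a b _ := HU x0 in conj a b).
apply: (@ae_countable_cover R _ (borel M) (vol A) (fun k => U (s k))).
  by apply/seteqP; split=> // x _; have [k sx] := Hs x; exists k.
by move=> k; case: (HU (s k)).
Qed.

Section weight_function.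
Variable w : M -> R.
Hypotheses (sw : smth w) (w0 : forall x, 0 < w x).

Lemma w_measurable : measurable_fun [set: borel M] w.
Proof. exact: (smth_measurable sw). Qed.

Lemma L2Z (a : R) f : L2 A w f -> L2 A w (fun x => a * f x).
Proof. exact: (@sqiZ _ (borel M) R (mu A) w w_measurable (fun x => ltW (w0 x)) a f). Qed.

Lemma L2D f h : L2 A w f -> L2 A w h -> L2 A w (fun x => f x + h x).
Proof. exact: (@sqiD _ (borel M) R (mu A) w w_measurable (fun x => ltW (w0 x)) f h). Qed.

Lemma L2B f h : L2 A w f -> L2 A w h -> L2 A w (fun x => f x - h x).
Proof. exact: (@sqiB _ (borel M) R (mu A) w w_measurable (fun x => ltW (w0 x)) f h). Qed.

Lemma csmth_sqi f : csmth f -> L2 A w f.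
Proof.
move=> cf; apply: (@sqiP _ (borel M) R (mu A) w (fun x => ltW (w0 x))); first exact: csmth_measurable cf.
apply: csmth_rint_mu; have := csmthM sw (csmthM cf.1 cf).
by under eq_fun do rewrite mulrC -expr2.
Qed.

(** Dividing the test function by the weight turns the product into a pairing in L^2(w mu). *)
Lemma L2_loc_rint_mu f phi : L2 A w f -> csmth phi -> rint (mu A) (fun x => f x * phi x).
Proof.
move=> Lf cphi; have swV : smth (fun x => (w x)^-1) by apply: smthV => // x; rewrite gt_eqF.
have := @sqi_mul _ (borel M) R (mu A) w w_measurable (fun x => ltW (w0 x)) _ _ Lf (csmth_sqi (csmthM swV cphi)).
congr (rint _ _); apply/funext => x; rewrite -!mulrA; congr (_ * _).
by rewrite mulrC -mulrA mulfV ?mulr1// gt_eqF.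
Qed.

Lemma L2_loc_rint_vol f phi : L2 A w f -> csmth phi -> rint (vol A) (fun x => f x * phi x).
Proof.
move=> Lf cphi; have := L2_loc_rint_mu Lf (csmthM weightV_smth cphi).
have mf : measurable_fun setT (fun x : borel M => f x * ((weight A x)^-1 * phi x)).
  apply: measurable_funM; first exact: Lf.1.
  exact: (csmth_measurable (csmthM weightV_smth cphi)).
move=> /(rint_mu mf); congr (rint _ _); apply/funext => x.
by rewrite -!mulrA; congr (_ * _); rewrite mulrC -mulrA mulfV ?mulr1// gt_eqF// weight_gt0.
Qed.

Lemma L2_gradient_L2field f X : L2_gradient_ f X -> L2field X.
Proof.
move=> [vX mX iX _]; have mX' : mfield X by [].
split=> //; apply/rint_ge0 => //; first exact: (inner_measurable mX' mX').
by move=> x; exact: inner_ge0.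
Qed.

Lemma L2_gradient_test f X Y : L2_gradient_ f X -> cfield Y ->
  \int[vol A]_x inner X Y x = - \int[vol A]_x (f x * div Y x).
Proof. by move=> [_ _ _ H] cY; apply: H; exact/cfieldE. Qed.

Lemma L2_gradientI f X : L2field X -> (forall Y, cfield Y ->
  \int[vol A]_x inner X Y x = - \int[vol A]_x (f x * div Y x)) -> L2_gradient_ f X.
Proof.
move=> [[vX mX] iX] H; split=> //; last by move=> Y /cfieldE; exact: H.
by have := (rint_ge0 _ (rint_measurable iX) (inner_ge0 X)).1 iX.
Qed.

Lemma L2_gradient_lin (a : R) f h X Y : L2 A w f -> L2 A w h -> L2_gradient_ f X -> L2_gradient_ h Y ->
  L2_gradient_ (fun x => f x + a * h x) (fun c x => X c x + a *: Y c x).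
Proof.
move=> Lf Lh gf gh; have LX := L2_gradient_L2field gf; have LY := L2_gradient_L2field gh.
apply: L2_gradientI => [|W cW]; first exact: L2field_lin.
have iX := L2field_vol LX cW; have iY := L2field_vol LY cW.
have jf := L2_loc_rint_vol Lf (cfield_div cW); have jh := L2_loc_rint_vol Lh (cfield_div cW).
transitivity (\int[vol A]_x (inner X W x + a * inner Y W x)).
  by apply: eq_Rintegral => x _; rewrite innerDl innerZl.
rewrite IntD//; last exact: rintZ.
rewrite IntZ// (L2_gradient_test gf cW) (L2_gradient_test gh cW).
transitivity (- \int[vol A]_x (f x * div W x + a * (h x * div W x))).
  by rewrite IntD ?IntZ//; [ring|exact: rintZ].
by congr (- _); apply: eq_Rintegral => x _; ring.
Qed.

Lemma csmth_L2_gradient phi : csmth phi -> L2_gradient_ phi (grad A phi).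
Proof.
move=> cphi; have [sphi [K cK phi0]] := cphi.
apply: L2_gradientI => [|Y cY]; first exact: (cfield_L2 (csmth_grad cphi)).
have [i1 i2] := flux_integrable cY.1 sphi cK phi0.
apply/eqP; rewrite -subr_eq0 opprK addrC; apply/eqP.
transitivity (\int[vol A]_x (phi x * div Y x + inner Y (grad A phi) x)).
  by rewrite IntD//; congr (_ + _); apply: eq_Rintegral => x _; rewrite innerC.
by rewrite /Rintegral (divergence_theorem cY.1 sphi cK phi0).
Qed.

Lemma wgradP f : (exists X, L2_gradient_ f X) -> L2_gradient_ f (wgrad_ f).
Proof. by move=> ex; have := xgetPex (fun _ _ => 0) ex. Qed.

(** [wgrad] selects a gradient by a choice operator, so nothing pointwise is known about it; this
    identifies it almost everywhere with any gradient that can be exhibited, such as the classical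
    one. *)
Lemma wgrad_unique f X : L2 A w f -> L2_gradient_ f X ->
  \forall x \ae mu A, forall c, dom c x -> wgrad_ f c x = X c x.
Proof.
move=> Lf gX; have gW := wgradP (ex_intro _ _ gX).
have LX := L2_gradient_L2field gX; have LW := L2_gradient_L2field gW.
have /ae_mu_vol : \forall x \ae vol A, forall c, dom c x -> wgrad_ f c x + (-1) *: X c x = 0.
  apply: (weak_zero (L2field_lin (-1) LW LX)) => Y cY.
  have iW := L2field_vol LW cY; have iX := L2field_vol LX cY.
  transitivity (\int[vol A]_x (inner (wgrad_ f) Y x + -1 * inner X Y x)).
    by apply: eq_Rintegral => x _; rewrite innerDl innerZl.
  rewrite IntD ?IntZ//; last exact: rintZ.
  by rewrite (L2_gradient_test gX cY) (L2_gradient_test gW cY); ring.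
by apply: aeS => x H c cx; apply/eqP; rewrite -subr_eq0 -scaleN1r; exact/eqP/H.
Qed.

Lemma inner_eq X X' Y Y' x : (forall c, dom c x -> X c x = X' c x) ->
  (forall c, dom c x -> Y c x = Y' c x) -> inner X Y x = inner X' Y' x.
Proof. by move=> HX HY; rewrite /inner HX ?HY//; exact: dom_chart_at. Qed.

Lemma wgrad_lin (a : R) f h X Y : L2 A w f -> L2 A w h -> L2_gradient_ f X -> L2_gradient_ h Y ->
  \forall x \ae mu A, forall c, dom c x -> wgrad_ (fun y => f y + a * h y) c x = X c x + a *: Y c x.
Proof.
move=> Lf Lh gf gh; apply: (wgrad_unique _ (L2_gradient_lin a Lf Lh gf gh)).
apply: (@sqiD _ (borel M) R (mu A) w w_measurable (fun x => ltW (w0 x))) => //.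
exact: L2Z.
Qed.

(** The approximating test function is f itself. The norm of f - f still needs an argument, because
    [wgrad] of the zero function is only known to vanish almost everywhere. *)
Lemma csmth_W10 f : csmth f -> W10 A w f.
Proof.
move=> cf; split; first by split; [exact: csmth_sqi|exists (grad A f); exact: csmth_L2_gradient].
move=> e e0; exists f; first exact/csmthE.
have gf := csmth_L2_gradient cf; have Lf := csmth_sqi cf.
have H := wgrad_lin (-1) Lf Lf gf gf.
have E : (fun x => f x - f x) = (fun x => f x + -1 * f x) by apply/funext => x; rewrite mulN1r.
rewrite /W1norm (_ : (\int[mu A]_x _)%E = 0%E); last first.
  have gW := wgradP (ex_intro _ _ (L2_gradient_lin (-1) Lf Lf gf gf)).
  have [_ iW] := L2_gradient_L2field gW.
  rewrite E -rint_EFin//; congr EFin; rewrite -(Int0 (mu A)).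
  apply: Int_ae => //; first exact: rint_measurable iW.
  apply: aeS H => x Hx; rewrite inner0l// Hx; last exact: dom_chart_at.
  by rewrite scaleN1r subrr.
rewrite add0e (_ : (\int[mu A]_x _)%E = 0%E); last first.
  by rewrite integral0_eq// => x _; rewrite subrr expr0n mul0r.
by rewrite sqrte0 lte_fin.
Qed.

Lemma flux_laplacian f x : weight A x * laplacian A f x = div (fun c y => weight A y *: grad A f c y) x.
Proof. by rewrite /laplacian mulVKf// gt_eqF// weight_gt0. Qed.

Lemma csmth_laplacian f : csmth f -> csmth (laplacian A f).
Proof.
move=> cf; apply: (csmthM weightV_smth); apply: cfield_div.
by apply: cfield_scale; [exact: weight_smth|exact: csmth_grad].
Qed.

Lemma laplacian_smth f : smth f -> smth (laplacian A f).
Proof.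
move=> sf; apply: (msmoothM (@openT M) weightV_smth); apply: div_smth.
by apply: field_scale; [exact: weight_smth|exact: grad_field].
Qed.

(** Inserting the test field Psi grad phi in the definition of the distributional gradient produces
    the weighted Laplacian of phi. *)
Lemma L2_gradient_grad f X phi : L2 A w f -> L2_gradient_ f X -> csmth phi ->
  \int[mu A]_x inner X (grad A phi) x = - \int[mu A]_x (f x * laplacian A phi x).
Proof.
move=> Lf gX cphi; have LX := L2_gradient_L2field gX; have cg := csmth_grad cphi.
have mf : measurable_fun [set: borel M] (inner X (grad A phi)).
  by apply: inner_measurable; [exact: LX.1|exact: (smooth_mfield cg.1)].
have cW := cfield_scale (weight_smth A) cg.
have -> : \int[mu A]_x inner X (grad A phi) x = \int[vol A]_x inner X (fun c y => weight A y *: grad A phi c y) x.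
  by rewrite Int_mu//; apply: eq_Rintegral => x _; rewrite innerMr mulrC.
rewrite (L2_gradient_test gX cW) Int_mu; last first.
  by apply: measurable_funM; [exact: Lf.1|exact: (csmth_measurable (csmth_laplacian cphi))].
by congr (- _); apply: eq_Rintegral => x _; rewrite -flux_laplacian; ring.
Qed.

End weight_function.

End weak_gradient.

(** A Chebyshev argument: the integral of the positive function r over B is dominated by arbitrarily
    small integrals, hence is zero. *)
Lemma ae_small d (T : measurableType d) (R : realType) (m : {measure set T -> \bar R})
    (B : set T) (r : T -> R) : measurable B -> measurable_fun setT r -> (forall x, 0 < r x) ->
  (forall e, 0 < e -> exists g, [/\ rint m g, forall x, 0 <= g x, forall x, B x -> r x <= g x &
     \int[m]_x g x <= e]) -> \forall x \ae m, ~ B x.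
Proof.
move=> mB mr r0 H; pose h x := \1_B x * r x : R.
have h0 x : 0 <= h x by rewrite /h indicE; case: (x \in B); rewrite ?mul1r ?mul0r// ltW.
have mh : measurable_fun setT h by apply: measurable_funM => //; exact: measurable_indic.
have hg g : (forall x, 0 <= g x) -> (forall x, B x -> r x <= g x) -> forall x, h x <= g x.
  move=> g0 Bg x; rewrite /h indicE; case: (boolP (x \in B)); rewrite ?inE => Bx; rewrite ?mul1r ?mul0r//.
  exact: Bg.
have rh : rint m h.
  have [g [rg g0 Bg _]] := H 1 ltr01; apply: (rint_le mh _ rg) => x.
  by rewrite ger0_norm//; exact: hg.
have I0 : \int[m]_x h x = 0.
  apply/eqP; rewrite eq_le Int_ge0// andbT; apply/ler_addgt0Pl => e e0; rewrite addr0.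
  have [g [rg g0 Bg Ig]] := H e e0; apply: le_trans Ig; apply: le_Int => //; exact: hg.
have := Int_eq0 rh (aeW _ h0) I0; apply: aeS => x hx Bx; move: hx.
by rewrite /h indicE mem_set//= mul1r => /eqP; rewrite gt_eqF.
Qed.

(** * The Schrodinger operator and the elliptic comparison principle *)

Section schrodinger_operator.
Context {R : realType} {n : nat} {M : ptopologicalType} (A : weighted R n M).
Implicit Types (c d : chart A) (f h u s phi eta : M -> R) (X Y Z : chart A -> M -> 'rV[R]_n).
Local Notation smth := (msmooth A setT).
Local Notation csmth := (csmth A).
Local Notation wgrad_ := (@wgrad R n M A).
Variables (rho V : M -> R).
Hypotheses (srho : smth rho) (sV : smth V) (rho0 : forall x, 0 < rho x) (V0 : forall x, 0 <= V x).
Local Notation schr := (schrodinger A rho V).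
Local Notation w := (fun x => rho x + V x).
Local Notation Int f := (\int[mu A]_x f x).

Let oT := @openT M.

Lemma sum_weight_smth : smth w. Proof. exact: msmoothD. Qed.

Lemma sum_weight_gt0 x : 0 < w x. Proof. by rewrite ltr_pwDl. Qed.

Lemma rhoV_smth : smth (fun x => (rho x)^-1).
Proof. by apply: smthV => // x; rewrite gt_eqF. Qed.

Lemma schr_smth f : smth f -> smth (schr f).
Proof.
move=> sf; apply: msmoothB => //; first by apply: msmoothM => //; [exact: rhoV_smth|exact: laplacian_smth].
by apply: msmoothM => //; apply: msmoothM => //; exact: rhoV_smth.
Qed.

Lemma schr_csmth f : csmth f -> csmth (schr f).
Proof.
move=> cf; apply: csmthB; first by apply: csmthM; [exact: rhoV_smth|exact: csmth_laplacian].
by apply: csmthM => //; apply: msmoothM => //; exact: rhoV_smth.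
Qed.

Lemma schr_rho f x : schr f x * rho x = laplacian A f x - V x * f x.
Proof. by rewrite /schrodinger; field; rewrite gt_eqF. Qed.

Lemma L2_sub f : L2 A w f -> L2 A rho f.
Proof.
move=> Lf; apply: (@sqiP _ (borel M) R (mu A) rho (fun x => ltW (rho0 x))); first exact: Lf.1.
have H := sqi_rint (@w_measurable _ _ _ A w sum_weight_smth) (fun x => ltW (sum_weight_gt0 x)) Lf.
apply: rint_le H.
  apply: measurable_funM; last exact: (smth_measurable srho).
  by apply: measurable_funX; exact: Lf.1.
move=> x; rewrite ger0_norm; last by rewrite mulr_ge0 ?sqr_ge0// ltW.
by rewrite ler_wpM2l ?sqr_ge0// lerDl.
Qed.

Lemma wgrad_csmth phi : csmth phi -> \forall x \ae mu A, forall c, dom c x -> wgrad_ phi c x = grad A phi c x.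
Proof.
move=> cphi; exact: (wgrad_unique
  (csmth_sqi sum_weight_smth sum_weight_gt0 cphi) (csmth_L2_gradient cphi)).
Qed.

Lemma Qform_csmth f phi : W1 A w f -> csmth phi ->
  Qform A V f phi = \int[mu A]_x inner (wgrad_ f) (grad A phi) x + \int[mu A]_x (f x * phi x * V x).
Proof.
move=> [Lf gf] cphi; rewrite /Qform; congr (_ + _).
have LX := L2_gradient_L2field (wgradP gf); have LP := cfield_L2 (csmth_grad cphi).
have LW := L2_gradient_L2field (wgradP (ex_intro _ _ (csmth_L2_gradient cphi))).
apply: Int_ae; [exact: inner_measurable LX.1 LW.1|exact: inner_measurable LX.1 LP.1|].
by apply: aeS (wgrad_csmth cphi) => x Hx; exact: inner_eq.
Qed.

Lemma QformC f h : Qform A V f h = Qform A V h f.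
Proof.
rewrite /Qform.
have -> : inner (wgrad_ f) (wgrad_ h) = inner (wgrad_ h) (wgrad_ f) by apply/funext => x; exact: innerC.
by have -> : (fun x => f x * h x * V x) = (fun x => h x * f x * V x) by apply/funext => x; rewrite (mulrC (f x)).
Qed.

Lemma csmth_Lop phi : csmth phi -> Lop A rho V phi (schr phi).
Proof.
move=> cphi; split; first exact: (csmth_W10 sum_weight_smth sum_weight_gt0).
  exact: (csmth_sqi srho rho0 (schr_csmth cphi)).
move=> h [Wh _]; have [Lh gh] := Wh.
rewrite QformC Qform_csmth// (L2_gradient_grad Lh (wgradP gh) cphi) /L2dot.
have i1 := L2_loc_rint_mu sum_weight_smth sum_weight_gt0 Lh (csmth_laplacian cphi).
have i2 := L2_loc_rint_mu sum_weight_smth sum_weight_gt0 Lh (csmthM sV cphi).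
rewrite -IntN// -[in RHS]IntN; last first.
  have := rintB i1 i2; congr (rint _ _); apply/funext => x.
  by rewrite -mulrBr -schr_rho; ring.
rewrite -IntD; [|exact: rintN|]; last by move: i2; congr (rint _ _); apply/funext => x; ring.
by apply: eq_Rintegral => x _; rewrite (mulrAC (schr phi x)) schr_rho; ring.
Qed.

Lemma green s psi : smth s -> csmth psi ->
  \int[mu A]_x inner (grad A s) (grad A psi) x = - \int[mu A]_x (psi x * laplacian A s x).
Proof.
move=> ss cpsi; have [spsi [K cK psi0]] := cpsi.
have fX : smooth_field (fun c y => weight A y *: grad A s c y).
  by apply: field_scale; [exact: weight_smth|exact: grad_field].
have [i1 i2] := flux_integrable fX spsi cK psi0.
have mI : measurable_fun [set: borel M] (inner (grad A s) (grad A psi)).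
  by apply: inner_measurable; apply: smooth_mfield; exact: grad_field.
have mL : measurable_fun [set: borel M] (fun x => psi x * laplacian A s x).
  apply: measurable_funM; [exact: smth_measurable spsi|exact: (smth_measurable (laplacian_smth ss))].
rewrite !Int_mu//; apply/eqP; rewrite -subr_eq0 opprK addrC; apply/eqP.
transitivity (\int[vol A]_x (psi x * div (fun c y => weight A y *: grad A s c y) x +
    inner (fun c y => weight A y *: grad A s c y) (grad A psi) x)); last first.
  by rewrite /Rintegral (divergence_theorem fX spsi cK psi0).
rewrite IntD//; congr (_ + _); apply: eq_Rintegral => x _; last by rewrite innerMl mulrC.
by rewrite -flux_laplacian; ring.
Qed.

(** The product of t = eta - s with the value flat(t) of the test function. It is the quantity that
    the energy estimate controls, and it is positive exactly where eta exceeds s. *)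
Definition gap (t : R) := t * flat t.

Lemma gap_ge0 t : 0 <= gap t.
Proof.
have [t0|t0] := leP t 0; first by rewrite /gap flat_le0// mulr0.
by rewrite mulr_ge0 ?flat_ge0// ltW.
Qed.

Lemma gap_gt0 t : 0 < t -> 0 < gap t.
Proof. by move=> t0; rewrite mulr_gt0// flat_gt0. Qed.

Lemma gap_le (s t : R) : 0 < s -> s <= t -> gap s <= gap t.
Proof. by move=> s0 st; rewrite ler_pM// ?flat_ge0 ?flat_le_mono// ltW. Qed.

(** Lets the error term (f - eta) psi be absorbed into half of the gap. *)
Lemma flat_sqr_gap t : flat t ^+ 2 <= gap t.
Proof.
have [t0|t0] := leP t 0; first by rewrite /gap flat_le0// expr0n mulr0.
by rewrite expr2 /gap ler_wpM2r ?flat_ge0// flat_le// ltW.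
Qed.

(* The test function flat(eta - s) with eta a smooth approximation of f avoids a chain rule for f. *)
Lemma comparison_energy (al e : R) f u s : 0 < al -> 0 < e -> Lop A rho V f u -> smth s -> (forall x, 0 <= s x) ->
  (\forall x \ae mu A, al * f x - u x <= al * s x - schr s x) ->
  exists eta, [/\ csmth eta, \int[mu A]_x ((f x - eta x) ^+ 2 * rho x) <= e ^+ 2,
    rint (mu A) (fun x => (f x - eta x) ^+ 2 * rho x), rint (mu A) (fun x => gap (eta x - s x) * rho x) &
    al * \int[mu A]_x (gap (eta x - s x) * rho x) <= 2 * (1 + al) * e ^+ 2].
Proof.
move=> al0 e0 [Wf Lu HQ] ss s0 Hineq; have [[Lf gf] dense] := Wf.
have [eta /csmthE ceta He] := dense e e0.
have sw := sum_weight_smth; have w0 := sum_weight_gt0.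
have Leta := csmth_sqi sw w0 ceta; have Lfe := L2B sw w0 Lf Leta.
have rw := sqi_rint (w_measurable sw) (fun x => ltW (w0 x)) Lfe.
have rr := sqi_rint (w_measurable srho) (fun x => ltW (rho0 x)) (L2_sub Lfe).
(* Off the support of eta the argument is - s <= 0; nonnegativity of s is what makes psi compactly
   supported. *)
pose psi x := flat (eta x - s x).
have cpsi : csmth psi.
  split; first by apply: (msmooth_comp1 oT (fun _ _ => I) (@Smooth_flat R setT (@openT R))); exact: (msmoothB oT ceta.1 ss).
  have [K cK eta0] := ceta.2; exists K => // x Kx.
  by rewrite /psi eta0// flat_le0// sub0r oppr_le0.
have psi0 x : 0 <= psi x by exact: flat_ge0.
have gradpsi c x : dom c x -> grad A psi c x = 'D_1 flat (eta x - s x) *: (grad A eta c x - grad A s c x).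
  move=> cx; rewrite (grad_comp1 (@Smooth_flat R setT (@openT R)) (msmoothB oT ceta.1 ss) cx).
  by rewrite gradB//; exact: ceta.1.
have gX := wgradP gf; have gE := csmth_L2_gradient ceta.
have LX := L2_gradient_L2field gX; have LP := cfield_L2 (csmth_grad cpsi).
pose D := wgrad_ (fun x => f x - eta x).
have DE : \forall x \ae mu A, forall c, dom c x -> D c x = wgrad_ f c x - grad A eta c x.
  have E : (fun x => f x - eta x) = (fun x => f x + -1 * eta x) by apply/funext => x; rewrite mulN1r.
  have := wgrad_lin sw w0 (-1) Lf Leta gX gE; rewrite /D E.
  by apply: aeS => x Hx c cx; rewrite Hx// scaleN1r.
have LD : L2field D.
  apply: (@L2_gradient_L2field _ _ _ A (fun x => f x - eta x)).
  have := L2_gradient_lin sw w0 (-1) Lf Leta gX gE => gD.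
  have E : (fun x => f x - eta x) = (fun x => f x + -1 * eta x) by apply/funext => x; rewrite mulN1r.
  by rewrite /D E; exact: wgradP (ex_intro _ _ gD).
have He2 : \int[mu A]_x inner D D x + \int[mu A]_x ((f x - eta x) ^+ 2 * w x) <= e ^+ 2.
  have a0 : 0 <= \int[mu A]_x inner D D x by apply: Int_ge0 => x; exact: inner_ge0.
  have b0 : 0 <= \int[mu A]_x ((f x - eta x) ^+ 2 * w x).
    by apply: Int_ge0 => x; rewrite mulr_ge0 ?sqr_ge0// ltW.
  move: He; rewrite /W1norm -/D -(rint_EFin LD.2) -(rint_EFin rw) -EFinD /= lte_fin => He.
  rewrite -[leLHS]sqr_sqrtr ?addr_ge0// ler_sqr ?nnegrE ?sqrtr_ge0 ?(ltW e0)//.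
  exact: ltW.
have I2 : \int[mu A]_x ((f x - eta x) ^+ 2 * w x) <= e ^+ 2.
  by apply: le_trans He2; rewrite lerDr; apply: Int_ge0 => x; exact: inner_ge0.
pose I x := inner (wgrad_ f) (grad A psi) x + f x * psi x * V x + u x * psi x * rho x.
have loc := L2_loc_rint_mu sw w0 Lf.
have iI1 := L2field_inner LX LP.
have iI2 : rint (mu A) (fun x => f x * psi x * V x).
  by have := loc _ (csmthM sV cpsi); congr (rint _ _); apply/funext => x; ring.
have iI3 : rint (mu A) (fun x => u x * psi x * rho x).
  by have := L2_loc_rint_mu srho rho0 Lu (csmthM srho cpsi); congr (rint _ _); apply/funext => x; ring.
have iI : rint (mu A) I by apply: rintD => //; exact: rintD.
have I0 : \int[mu A]_x I x = 0.
  have := HQ psi (csmth_W10 sw w0 cpsi); rewrite (Qform_csmth (conj Lf gf) cpsi) /L2dot => H.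
  by rewrite IntD ?IntD//; [rewrite H addNr|exact: rintD].
pose J x := inner (grad A s) (grad A psi) x + s x * psi x * V x + schr s x * psi x * rho x.
have iJ1 : rint (mu A) (inner (grad A s) (grad A psi)).
  by apply: csmth_rint_mu; apply: cfield_inner; [exact: grad_field|exact: csmth_grad].
have iJ2 : rint (mu A) (fun x => - (psi x * laplacian A s x)).
  apply: rintN; apply: csmth_rint_mu; have := csmthM (laplacian_smth ss) cpsi.
  by under eq_fun do rewrite mulrC.
have JE x : J x = inner (grad A s) (grad A psi) x - - (psi x * laplacian A s x).
  rewrite /J opprK -addrA; congr (_ + _).
  by rewrite (mulrAC (schr s x)) schr_rho; ring.
have iJ : rint (mu A) J by have := rintB iJ1 iJ2; congr (rint _ _); apply/funext => x; rewrite JE.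
have J0 : \int[mu A]_x J x = 0.
  transitivity (\int[mu A]_x (inner (grad A s) (grad A psi) x - - (psi x * laplacian A s x))).
    by apply: eq_Rintegral => x _; exact: JE.
  rewrite IntB// (green ss cpsi) IntN ?subrr//.
  by have := rintN iJ2; congr (rint _ _); apply/funext => x; rewrite opprK.
have gapE x : gap (eta x - s x) = (eta x - s x) * psi x by [].
have iG : rint (mu A) (fun x => gap (eta x - s x) * rho x).
  apply: csmth_rint_mu; have := csmthM (msmoothM oT srho (msmoothB oT ceta.1 ss)) cpsi.
  rewrite (_ : (fun x => gap (eta x - s x) * rho x) = (fun x => rho x * (eta x - s x) * psi x))//.
  by apply/funext => x; rewrite gapE; ring.
exists eta; split=> //.
  apply: le_trans I2; apply: le_Int => // x.
  by rewrite ler_wpM2l ?sqr_ge0// lerDl.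
(* Chosen so that (V + al rho) / 2 <= Kc (rho + V). *)
pose Kc := (1 + al) / 2.
have key : \forall x \ae mu A, al / 2 * (gap (eta x - s x) * rho x) -
    (inner D D x + Kc * ((f x - eta x) ^+ 2 * w x)) <= I x - J x.
  apply: aeS2 DE Hineq => x DEx Hx.
  set p := 'D_1 flat (eta x - s x).
  have [p0 p4] : 0 <= p /\ p <= 4 by have [_ /andP[]] := flat_derive (eta x - s x).
  pose E c y := grad A eta c y + (-1) *: grad A s c y.
  have gI : inner (wgrad_ f) (grad A psi) x - inner (grad A s) (grad A psi) x =
      p * (inner D E x + inner E E x).
    have EP c : dom c x -> grad A psi c x = p *: E c x by move=> cx; rewrite gradpsi// /E scaleN1r.
    have EX c : dom c x -> wgrad_ f c x = D c x + grad A eta c x by move=> cx; rewrite DEx// subrK.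
    rewrite (inner_eq (X' := fun c y => D c y + grad A eta c y) (Y' := fun c y => p *: E c y) EX EP).
    rewrite (inner_eq (X' := grad A s) (Y' := fun c y => p *: E c y) (fun _ _ => erefl) EP).
    rewrite !(innerMr (fun=> p)) innerDl.
    have -> : inner E E x = inner (grad A eta) E x + -1 * inner (grad A s) E x.
      by rewrite -innerZl -innerDl.
    ring.
  have dd0 : 0 <= inner D D x + 4 * (inner D E x + inner E E x).
    have := inner_ge0 (fun c y => D c y + 2 *: E c y) x.
    by rewrite inner_lin (innerC E D); lra.
  have d0 : 0 <= inner D D x by exact: inner_ge0.
  have sq : psi x ^+ 2 <= gap (eta x - s x) by exact: flat_sqr_gap.
  have g0 : 0 <= gap (eta x - s x) by exact: gap_ge0.
  have r0 := rho0 x; have v0 := V0 x; have ps0 := psi0 x.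
  (* From |D + 2 E|^2 >= 0 and 0 <= p <= 4, where grad psi = p E. *)
  have b1 : - inner D D x <= p * (inner D E x + inner E E x).
    have h1 : 0 <= p * (inner D D x + 4 * (inner D E x + inner E E x)) by exact: mulr_ge0.
    have h2 : 0 <= (4 - p) * inner D D x by rewrite mulr_ge0// subr_ge0.
    lra.
  (* Young's inequality for (f - eta) psi, followed by psi^2 <= gap. *)
  have b2 : gap (eta x - s x) / 2 - (f x - eta x) ^+ 2 / 2 <= (f x - s x) * psi x.
    have := sqr_ge0 (f x - eta x + psi x); rewrite gapE in sq *; nra.
  have b3 : al * (f x - s x) * (psi x * rho x) <= (u x - schr s x) * (psi x * rho x).
    by rewrite ler_wpM2r ?mulr_ge0 ?(ltW r0)//; lra.
  have b4 : (gap (eta x - s x) / 2 - (f x - eta x) ^+ 2 / 2) * (V x + al * rho x) <=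
      (f x - s x) * psi x * (V x + al * rho x).
    by rewrite ler_wpM2r// addr_ge0// mulr_ge0// ltW.
  have b5 : 0 <= gap (eta x - s x) * V x by exact: mulr_ge0.
  have b6 : 0 <= (f x - eta x) ^+ 2 * (rho x + al * V x).
    by rewrite mulr_ge0 ?sqr_ge0// addr_ge0 ?(ltW r0)// mulr_ge0// ltW.
  have -> : I x - J x = p * (inner D E x + inner E E x) + (f x - s x) * psi x * V x +
      (u x - schr s x) * (psi x * rho x) by rewrite -gI /I /J; ring.
  rewrite /Kc; lra.
have H := le_Int_ae (rintB (rintZ (al / 2) iG) (rintD LD.2 (rintZ Kc rw))) (rintB iI iJ) key.
move: H; rewrite (IntB iI iJ) I0 J0 subr0 (IntB (rintZ (al / 2) iG) (rintD LD.2 (rintZ Kc rw))).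
rewrite IntZ// IntD; [|exact: LD.2|exact: rintZ].
rewrite IntZ// => H.
have K1 : 1 <= 2 * Kc by rewrite /Kc mulrC divfK ?pnatr_eq0// lerDl ltW.
have ID0 : 0 <= \int[mu A]_x inner D D x by apply: Int_ge0 => x; exact: inner_ge0.
have If0 : 0 <= \int[mu A]_x ((f x - eta x) ^+ 2 * w x).
  by apply: Int_ge0 => x; rewrite mulr_ge0 ?sqr_ge0// ltW.
have e20 : 0 <= e ^+ 2 by exact: sqr_ge0.
rewrite /Kc in H; nra.
Qed.

(** Where f - s > 2 d, either f - eta >= d or eta - s > d. The energy estimate bounds both
    alternatives by a multiple of e^2 with e free, so the set is null for every d = 1/(k+1). *)
Lemma elliptic_comparison (al : R) f u s : 0 < al -> Lop A rho V f u -> smth s -> (forall x, 0 <= s x) ->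
  (\forall x \ae mu A, al * f x - u x <= al * s x - schr s x) ->
  \forall x \ae mu A, f x <= s x.
Proof.
move=> al0 Lfu ss s0 Hineq; have [[[Lf _] _] _ _] := Lfu.
have mf : measurable_fun [set: borel M] f := Lf.1.
have ms : measurable_fun [set: borel M] s by exact: smth_measurable ss.
have small (k : nat) : \forall x \ae mu A, ~ (2 * k.+1%:R^-1 < f x - s x).
  pose d : R := k.+1%:R^-1; have d0 : 0 < d by rewrite invr_gt0.
  have mB : measurable [set x : borel M | 2 * d < f x - s x].
    have mfs : measurable_fun [set: borel M] (fun x => f x - s x) by exact: measurable_funB.
    have := mfs measurableT _ (measurable_itv `]2 * d, +oo[); rewrite setTI.
    by congr measurable; apply/seteqP; split=> x /=; rewrite in_itv/= andbT.
  apply: (@ae_small _ (borel M) R (mu A) [set x | 2 * d < f x - s x] rho mB) => //.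
    exact: smth_measurable srho.
  move=> e e0; have gd0 : 0 < gap d by exact: gap_gt0.
  (* The two terms are the Chebyshev constants of the alternatives f - eta >= d and eta - s > d,
     with the bounds of the energy estimate. *)
  pose C := (d ^+ 2)^-1 + (gap d)^-1 * (2 * (1 + al) / al).
  have C0 : 0 < C by rewrite addr_gt0 ?invr_gt0 ?exprn_gt0// mulr_gt0 ?invr_gt0// divr_gt0// mulr_gt0// addr_gt0.
  have e'0 : 0 < Num.sqrt (e / C) by rewrite sqrtr_gt0 divr_gt0.
  have [eta [ceta I1 r1 r2 I2]] := comparison_energy al0 e'0 Lfu ss s0 Hineq.
  have r1' := rintZ (d ^+ 2)^-1 r1; have r2' := rintZ (gap d)^-1 r2.
  exists (fun x => (d ^+ 2)^-1 * ((f x - eta x) ^+ 2 * rho x) + (gap d)^-1 * (gap (eta x - s x) * rho x)).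
  have n1 x : 0 <= (d ^+ 2)^-1 * ((f x - eta x) ^+ 2 * rho x).
    by apply: mulr_ge0; [rewrite invr_ge0 sqr_ge0|rewrite mulr_ge0 ?sqr_ge0// ltW].
  have n2 x : 0 <= (gap d)^-1 * (gap (eta x - s x) * rho x).
    by apply: mulr_ge0; [rewrite invr_ge0 ltW|apply: mulr_ge0; [exact: gap_ge0|exact: ltW]].
  split.
  - exact: rintD.
  - by move=> x; exact: addr_ge0.
  - move=> x /= Bx; have [fe|fe] := leP d (f x - eta x).
      rewrite ler_wpDr// mulrA ler_peMl ?(ltW (rho0 x))// ler_pdivlMl ?exprn_gt0// mulr1.
      by rewrite ler_sqr ?nnegrE// ?(ltW d0)// (le_trans _ fe)// ltW.
    rewrite ler_wpDl// mulrA ler_peMl ?(ltW (rho0 x))// ler_pdivlMl// mulr1 gap_le//.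
    lra.
  - rewrite IntD// !IntZ//; move: I1 I2; rewrite sqr_sqrtr ?divr_ge0 ?(ltW e0) ?(ltW C0)// => I1 I2.
    have -> : e = (d ^+ 2)^-1 * (e / C) + (gap d)^-1 * (2 * (1 + al) / al * (e / C)).
      rewrite [X in _ + X]mulrA -mulrDl -/C mulrC divfK// gt_eqF//.
    rewrite lerD// ler_wpM2l ?invr_ge0 ?sqr_ge0 ?(ltW gd0)//.
    rewrite [leRHS](_ : _ = al^-1 * (2 * (1 + al) * (e / C))); last by ring.
    by rewrite ler_pdivlMl.
have : \forall x \ae mu A, forall k : nat, ~ (2 * k.+1%:R^-1 < f x - s x) by exact: ae_foralln.
apply: aeS => x Hx; rewrite leNgt -subr_gt0; apply/negP => fs.
have fs2 : 0 < (f x - s x) / 2 by rewrite divr_gt0.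
have [k] := ltr_add_invr fs2; rewrite add0r => Hk.
by apply: (Hx k); rewrite mulrC -ltr_pdivlMr.
Qed.

End schrodinger_operator.

Lemma equal_steps {R : realType} (t dl : R) : 0 <= t -> 0 < dl ->
  exists (N : nat) (k : R), [/\ 0 <= k, k < dl & N%:R * k = t].
Proof.
move=> t0 dl0; have tdl : 0 <= t / dl by rewrite divr_ge0// ltW.
pose N := (Num.truncn (t / dl)).+1; have N0 : (0 : R) < N%:R by rewrite ltr0n.
exists N, (t / N%:R); split.
- by rewrite divr_ge0// ltW.
- rewrite ltr_pdivrMr// mulrC -ltr_pdivrMr//.
  by have /andP[_] := truncn_itv tdl.
- by rewrite mulrC divfK// gt_eqF.
Qed.

(** The errors of N equal steps add up to at most a multiple of t times a tolerance that is
    arbitrary. This replaces differentiation for functions of time that are not known to be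
    differentiable. *)
Lemma telescope {R : realType} (f : R -> R) (t : R) : 0 <= t ->
  (forall e, 0 < e -> exists2 dl, 0 < dl & forall s k, 0 <= s -> 0 <= k -> k < dl -> s + k <= t ->
     f (s + k) <= f s + e * k) -> f t <= f 0.
Proof.
move=> t0 H; apply/ler_addgt0Pl => e e0.
have e1 : 0 < e / (t + 1) by rewrite divr_gt0// ltr_wpDl.
have [dl dl0 Hd] := H _ e1.
have [N [k [k0 kd tE]]] := equal_steps t0 dl0.
have step j : (j <= N)%N -> f (j%:R * k) <= f 0 + e / (t + 1) * (j%:R * k).
  elim: j => [|j ih] jN; first by rewrite !mul0r mulr0 addr0.
  have jk : j%:R * k + k = j.+1%:R * k by rewrite -[in RHS]natr1 mulrDl mul1r.
  have j0 : 0 <= j%:R * k by rewrite mulr_ge0.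
  have jt : j.+1%:R * k <= t by rewrite -[leRHS]tE ler_wpM2r// ler_nat.
  have := Hd (j%:R * k) k j0 k0 kd; rewrite jk => /(_ jt).
  have := ih (ltnW jN); rewrite -[in X in _ -> _ -> _ <= X]jk mulrDr; lra.
have := step N (leqnn N); rewrite tE => /le_trans; apply.
rewrite addrC lerD2r -mulrA ger_pMr// mulrC ler_pdivrMr ?ltr_wpDl// mul1r.
by rewrite lerDl.
Qed.

(** * Semigroups in a Hilbert space *)

Section inner_product_space.
Context {R : realType} {E : lmodType R}.
Variable dot : E -> E -> R.

Record inner_product : Prop := InnerProduct {
  dotC : forall x y, dot x y = dot y x;
  dotDl : forall x y z, dot (x + y) z = dot x z + dot y z;
  dotZl : forall a x z, dot (a *: x) z = a * dot x z;
  dot_gt0 : forall x, x != 0 -> 0 < dot x x }.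

Hypothesis ip : inner_product.
Definition nrm x := Num.sqrt (dot x x).

Lemma dot0l z : dot 0 z = 0.
Proof. by rewrite -(scale0r 0) (dotZl ip) mul0r. Qed.
Lemma dot0r z : dot z 0 = 0. Proof. by rewrite (dotC ip) dot0l. Qed.
Lemma dotNl x z : dot (- x) z = - dot x z.
Proof. by rewrite -scaleN1r (dotZl ip) mulN1r. Qed.
Lemma dotBl x y z : dot (x - y) z = dot x z - dot y z.
Proof. by rewrite (dotDl ip) dotNl. Qed.
Lemma dotDr x y z : dot z (x + y) = dot z x + dot z y.
Proof. by rewrite (dotC ip) (dotDl ip) !(dotC ip z). Qed.
Lemma dotBr x y z : dot z (x - y) = dot z x - dot z y.
Proof. by rewrite (dotC ip) dotBl !(dotC ip z). Qed.
Lemma dotZr a x z : dot z (a *: x) = a * dot z x.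
Proof. by rewrite (dotC ip) (dotZl ip) (dotC ip z). Qed.

Lemma dot_ge0 x : 0 <= dot x x.
Proof. by have [->|x0] := eqVneq x 0; [rewrite dot0l|rewrite ltW// (dot_gt0 ip)]. Qed.

Lemma nrm_ge0 x : 0 <= nrm x. Proof. exact: sqrtr_ge0. Qed.
Lemma nrm_sqr x : nrm x ^+ 2 = dot x x. Proof. by rewrite sqr_sqrtr// dot_ge0. Qed.

Lemma nrm0 : nrm 0 = 0. Proof. by rewrite /nrm dot0l sqrtr0. Qed.

Lemma nrm_eq0 x : nrm x <= 0 -> x = 0.
Proof.
move=> nx; apply/eqP/negPn/negP => x0; have := dot_gt0 ip x0.
by rewrite -nrm_sqr (_ : nrm x = 0) ?expr0n ?ltxx//; apply/eqP; rewrite eq_le nx nrm_ge0.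
Qed.

Lemma nrmZ a x : nrm (a *: x) = `|a| * nrm x.
Proof. by rewrite /nrm (dotZl ip) dotZr mulrA -expr2 sqrtrM ?sqr_ge0// sqrtr_sqr. Qed.

Lemma nrmN x : nrm (- x) = nrm x.
Proof. by rewrite -scaleN1r nrmZ normrN normr1 mul1r. Qed.

Lemma nrmC x y : nrm (x - y) = nrm (y - x).
Proof. by rewrite -nrmN opprB. Qed.

Lemma cauchy_schwarz x y : `|dot x y| <= nrm x * nrm y.
Proof.
have [->|y0] := eqVneq y 0; first by rewrite dot0r normr0 nrm0 mulr0.
have yy := dot_gt0 ip y0.
have := dot_ge0 (dot y y *: x - dot x y *: y).
rewrite dotBl !dotBr !(dotZl ip) !dotZr (dotC ip y x) => H.
have H2 : 0 <= dot y y * (dot x x * dot y y - dot x y ^+ 2) by move: H; congr (0 <= _); ring.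
have {H2} : dot x y ^+ 2 <= dot x x * dot y y by rewrite pmulr_rge0 ?subr_ge0 in H2.
rewrite -!nrm_sqr -exprMn -real_normK ?num_real// ler_sqr// nnegrE ?normr_ge0//.
by rewrite mulr_ge0 ?nrm_ge0.
Qed.

Lemma nrmD x y : nrm (x + y) <= nrm x + nrm y.
Proof.
rewrite -ler_sqr ?nnegrE ?addr_ge0 ?nrm_ge0// nrm_sqr (dotDl ip) !dotDr (dotC ip y x).
have := cauchy_schwarz x y; rewrite ler_norml => /andP[_].
by rewrite sqrrD !nrm_sqr mulr2n; lra.
Qed.

Lemma nrmB x y : nrm (x - y) <= nrm x + nrm y.
Proof. by rewrite (le_trans (nrmD _ _))// nrmN. Qed.

Lemma nrm_dual x C : 0 <= C -> (forall y, dot x y <= C * nrm y) -> nrm x <= C.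
Proof.
move=> C0 H; have := H x; rewrite -nrm_sqr expr2.
have [x0|x0] := leP (nrm x) 0; first by rewrite (le_trans x0).
by rewrite ler_pM2r.
Qed.

Lemma dot_ext x x' : (forall y, dot x y = dot x' y) -> x = x'.
Proof.
move=> H; apply/eqP; rewrite -subr_eq0; apply/eqP/nrm_eq0/nrm_dual => // y.
by rewrite dotBl H subrr mul0r.
Qed.

Ltac vec := apply: dot_ext => ?; rewrite ?(dotDl ip, dotBl, dotNl, dotZl ip); ring.

Lemma nrm_tri z x y : nrm (x - y) <= nrm (x - z) + nrm (z - y).
Proof. by rewrite (_ : x - y = (x - z) + (z - y)); [exact: nrmD|vec]. Qed.

(** Completeness is formulated for sequences with geometrically small increments; all limits taken
    later are of this kind, and it spares a subsequence argument in L^2. *)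
Definition complete_ip := forall x_ : nat -> E, (forall k, nrm (x_ k.+1 - x_ k) <= 2^-1 ^+ k) ->
  exists x, forall e, 0 < e -> exists N, forall k, (N <= k)%N -> nrm (x_ k - x) <= e.

(* Uniform right derivative: each increment over [s, s + k] is k g(s) up to e k. *)
Definition uder (g Phi : R -> E) (t : R) := forall e, 0 < e -> exists2 dl, 0 < dl &
  forall s k, 0 <= s -> 0 <= k -> k < dl -> s + k <= t -> nrm (Phi (s + k) - Phi s - k *: g s) <= e * k.

(** Over a step of length k the norm of the difference of the two curves grows by at most e k, so by
    [telescope] it does not grow at all. *)
Lemma uder_unique g Phi Psi t : 0 <= t -> uder g Phi t -> uder g Psi t ->
  Phi t - Phi 0 = Psi t - Psi 0.
Proof.
move=> t0 HP HQ; apply/eqP; rewrite -subr_eq0; apply/eqP/nrm_eq0.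
pose f s := nrm (Phi s - Phi 0 - (Psi s - Psi 0)).
suff H : f t <= f 0 by move: H; rewrite /f !subrr nrm0.
apply: (telescope t0) => e e0; have e2 : 0 < e / 2 by rewrite divr_gt0.
have [d1 d10 H1] := HP _ e2; have [d2 d20 H2] := HQ _ e2.
exists (Num.min d1 d2); first by rewrite lt_min d10.
move=> s k s0 k0; rewrite lt_min => /andP[k1 k2] skt.
have h1 := H1 s k s0 k0 k1 skt; have h2 := H2 s k s0 k0 k2 skt.
rewrite /f (_ : Phi (s + k) - _ - _ = (Phi s - Phi 0 - (Psi s - Psi 0)) +
   ((Phi (s + k) - Phi s - k *: g s) - (Psi (s + k) - Psi s - k *: g s))).
  by apply: le_trans (nrmD _ _) _; rewrite lerD2l (le_trans (nrmB _ _))//; lra.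
by vec.
Qed.

Lemma uder_lin (a : R) g Phi h Psi t : uder g Phi t -> uder h Psi t ->
  uder (fun s => g s + a *: h s) (fun s => Phi s + a *: Psi s) t.
Proof.
move=> HP HQ e e0; have e2 : 0 < e / 2 by rewrite divr_gt0.
have a1 : 0 < `|a| + 1 by rewrite ltr_wpDl.
have [d1 d10 H1] := HP _ e2; have [d2 d20 H2] := HQ _ (divr_gt0 e2 a1).
exists (Num.min d1 d2); first by rewrite lt_min d10.
move=> s k s0 k0; rewrite lt_min => /andP[k1 k2] skt.
have h1 := H1 s k s0 k0 k1 skt; have h2 := H2 s k s0 k0 k2 skt.
rewrite (_ : _ - _ - _ = (Phi (s + k) - Phi s - k *: g s) + a *: (Psi (s + k) - Psi s - k *: h s)); last by vec.
apply: le_trans (nrmD _ _) _; rewrite nrmZ.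
have : `|a| * nrm (Psi (s + k) - Psi s - k *: h s) <= (`|a| + 1) * (e / 2 / (`|a| + 1) * k).
  by rewrite ler_pM ?nrm_ge0// lerDl.
by rewrite mulrA (mulrC (`|a| + 1)) divfK ?gt_eqF//; lra.
Qed.

Lemma uder_map (L : E -> E) C g Phi t : (forall a x y, L (a *: x + y) = a *: L x + L y) ->
  (forall x, nrm (L x) <= C * nrm x) -> uder g Phi t -> uder (fun s => L (g s)) (fun s => L (Phi s)) t.
Proof.
move=> Llin LC HP e e0; have C1 : 0 < `|C| + 1 by rewrite ltr_wpDl.
have [d1 d10 H1] := HP _ (divr_gt0 e0 C1); exists d1 => // s k s0 k0 k1 skt.
have h1 := H1 s k s0 k0 k1 skt.
have -> : L (Phi (s + k)) - L (Phi s) - k *: L (g s) = L (Phi (s + k) - Phi s - k *: g s).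
  have -> : Phi (s + k) - Phi s - k *: g s = (- k) *: g s + ((-1) *: Phi s + Phi (s + k)) by vec.
  by rewrite !Llin; vec.
apply: le_trans (LC _) _; apply: (@le_trans _ _ ((`|C| + 1) * (e / (`|C| + 1) * k))).
  apply: (le_trans (ler_wpM2r (nrm_ge0 _) (_ : C <= `|C| + 1))); last by rewrite ler_wpM2l// ltW.
  by rewrite (le_trans (ler_norm C))// lerDl.
by rewrite mulrA (mulrC (`|C| + 1)) divfK// gt_eqF.
Qed.

End inner_product_space.

(** * Strongly continuous semigroups with symmetric dissipative generator *)

Section abstract_semigroup.
Context {R : realType} {E : lmodType R}.
Variable dot : E -> E -> R.
Hypothesis ip : inner_product dot.
Local Notation nrm := (nrm dot).
Hypothesis cip : complete_ip dot.
Variables (T : R -> E -> E) (Lr : E -> E -> Prop) (J : R -> E -> E).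

Record semigroup_ax : Prop := SemigroupAx {
  T_lin : forall t a x y, 0 <= t -> T t (a *: x + y) = a *: T t x + T t y;
  T_bd : forall t, 0 <= t -> exists C, forall x, nrm (T t x) <= C * nrm x;
  T_id : forall x, T 0 x = x;
  T_add : forall s t x, 0 <= s -> 0 <= t -> T (s + t) x = T s (T t x);
  T_cont : forall x e, 0 < e -> exists2 dl, 0 < dl & forall t, 0 < t -> t < dl -> nrm (T t x - x) <= e;
  T_gen : forall x y, Lr x y <-> forall e, 0 < e -> exists2 dl, 0 < dl &
    forall t, 0 < t -> t < dl -> nrm (t^-1 *: (T t x - x) - y) <= e }.

Hypothesis ax : semigroup_ax.

Local Ltac vec := apply: (dot_ext ip) => ?; rewrite ?(dotDl ip, dotBl ip, dotNl ip, dotZl ip); ring.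

Lemma T_0 t : 0 <= t -> T t 0 = 0.
Proof.
move=> t0; have := T_lin ax (-1) 0 0 t0; rewrite scaler0 addr0 => H.
by rewrite H scaleN1r addNr.
Qed.
Lemma T_D t x y : 0 <= t -> T t (x + y) = T t x + T t y.
Proof. by move=> t0; have := T_lin ax 1 x y t0; rewrite !scale1r. Qed.
Lemma T_Z t a x : 0 <= t -> T t (a *: x) = a *: T t x.
Proof. by move=> t0; have := T_lin ax a x 0 t0; rewrite T_0// !addr0. Qed.
Lemma T_B t x y : 0 <= t -> T t (x - y) = T t x - T t y.
Proof. by move=> t0; rewrite T_D// -scaleN1r T_Z// scaleN1r. Qed.

(* One step of the gliding hump: x moves by a small amount so that some T_h x becomes large. *)
Lemma hump_step : (forall (C dl : R), 0 < C -> 0 < dl -> exists h z, [/\ 0 < h, h <= dl & C * nrm z < nrm (T h z)]) ->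
  forall (k : nat) (xB : E * R), 0 < xB.2 -> exists r : R * (E * R),
  [/\ 0 < r.1 /\ r.1 <= k.+1%:R^-1, nrm (r.2.1 - xB.1) <= 2^-1 ^+ k / xB.2, k%:R <= nrm (T r.1 r.2.1),
      xB.2 <= r.2.2 & forall z, nrm (T r.1 z) <= r.2.2 * nrm z].
Proof.
move=> H k [x B] /= B0; pose e := 2^-1 ^+ k / B.
have e0 : 0 < e by rewrite divr_gt0// exprn_gt0// invr_gt0.
have C0 : 0 < (2 * k%:R + 1) / e by rewrite divr_gt0// ltr_wpDl// mulr_ge0.
have [h [z [h0 hk Tz]]] := H _ k.+1%:R^-1 C0 (ltac:(by rewrite invr_gt0)).
have [C HC] := T_bd ax (ltW h0).
have HB w : nrm (T h w) <= Num.max B C * nrm w.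
  by rewrite (le_trans (HC w))// ler_wpM2r ?nrm_ge0// le_max lexx orbT.
have z0 : 0 < nrm z.
  rewrite lt_def nrm_ge0 andbT; apply/negP => /eqP z0; move: Tz; rewrite z0 mulr0.
  by have := HC z; rewrite z0 mulr0 => ? ?; lra.
pose xi := (e / nrm z) *: z.
have nxi : nrm xi = e by rewrite (nrmZ ip) gtr0_norm ?divr_gt0// divfK// gt_eqF.
have Txi : 2 * k%:R < nrm (T h xi).
  rewrite T_Z ?(ltW h0)// (nrmZ ip) gtr0_norm ?divr_gt0// -ltr_pdivrMl ?divr_gt0//.
  apply: le_lt_trans Tz.
  have -> : (e / nrm z)^-1 * (2 * k%:R) = 2 * k%:R / e * nrm z by field; rewrite !gt_eqF.
  by rewrite ler_wpM2r ?(ltW z0)// ler_wpM2r ?invr_ge0 ?(ltW e0)// lerDl.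
have [kx|kx] := leP k%:R (nrm (T h x)).
  exists (h, (x, Num.max B C)); split=> //=; first by rewrite subrr (nrm0 ip) ltW.
  by rewrite le_max lexx.
exists (h, (x + xi, Num.max B C)); split=> //=.
- by rewrite addrC addKr nxi.
- have := nrmB ip (T h (x + xi)) (T h x); rewrite T_D ?(ltW h0)// addrAC subrr add0r; lra.
- by rewrite le_max lexx.
Qed.

(** The axioms bound each T_t separately; a bound uniform near 0 is a uniform boundedness statement.
    If it failed, the humps would converge fast to some x with |T_(h_k) x| unbounded along h_k -> 0,
    contradicting strong continuity at 0. *)
Lemma local_bound : exists C dl : R, [/\ 0 < C, 0 < dl & forall h z, 0 < h -> h <= dl -> nrm (T h z) <= C * nrm z].
Proof.
apply: contrapT => nH.
have H C dl : 0 < C -> 0 < dl -> exists h z, [/\ 0 < h, h <= dl & C * nrm z < nrm (T h z)].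
  move=> C0 dl0; apply: contrapT => nH'; apply: nH; exists C, dl; split=> // h z h0 hd.
  by rewrite leNgt; apply/negP => lt; apply: nH'; exists h, z.
have step := hump_step H.
(* The state consists of the current vector and a number B_k that bounds the operators used so far;
   later moves have size at most 2^-k / B_k, so they change earlier humps by a bounded amount
   only. *)
pose S := {xB : E * R | 0 < xB.2}.
pose nxt k (s : S) : R * (E * R) := sval (cid (step k (sval s) (svalP s))).
have nxtP k (s : S) := svalP (cid (step k (sval s) (svalP s))).
have pos k (s : S) : 0 < (nxt k s).2.2.
  by have [_ _ _ h _] := nxtP k s; apply: lt_le_trans h; exact: (svalP s).
pose st := fix st k : S := if k is j.+1 then exist _ (nxt j (st j)).2 (pos j (st j)) else exist _ (0, 1) ltr01.
pose x_ k := (sval (st k)).1; pose B_ k := (sval (st k)).2; pose h_ k := (nxt k (st k)).1.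
have P k : [/\ 0 < h_ k /\ h_ k <= k.+1%:R^-1, nrm (x_ k.+1 - x_ k) <= 2^-1 ^+ k / B_ k, k%:R <= nrm (T (h_ k) (x_ k.+1)),
    B_ k <= B_ k.+1 & forall z, nrm (T (h_ k) z) <= B_ k.+1 * nrm z] by exact: nxtP.
have B1 k : 1 <= B_ k.
  by elim: k => [|k ih]; [rewrite /B_/=|have [_ _ _ h _] := P k; exact: le_trans h].
have Bmono k j : B_ k <= B_ (k + j)%N.
  by elim: j => [|j ih]; rewrite ?addn0// addnS; have [_ _ _ h _] := P (k + j)%N; exact: le_trans h.
have [|x Hx] := cip (x_ := x_).
  move=> k; have [_ h _ _ _] := P k; apply: le_trans h _.
  by rewrite ler_pdivrMr ?(lt_le_trans ltr01)// ler_peMr// exprn_ge0// invr_ge0.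
have tail k j : nrm (x_ (k + j)%N - x_ k) <= 2 * (1 - 2^-1 ^+ j) * 2^-1 ^+ k / B_ k.
  elim: j => [|j ih]; first by rewrite addn0 subrr (nrm0 ip) expr0 subrr mulr0 !mul0r.
  rewrite addnS; have [_ h _ _ _] := P (k + j)%N.
  apply: le_trans (nrm_tri ip (x_ (k + j)%N) _ _) _.
  have Bk : 0 < B_ k by apply: lt_le_trans (B1 k).
  have h' : nrm (x_ (k + j).+1 - x_ (k + j)%N) <= 2^-1 ^+ (k + j) / B_ k.
    apply: le_trans h _; rewrite ler_wpM2l ?exprn_ge0 ?invr_ge0// lef_pV2 ?posrE//.
    exact: lt_le_trans (B1 _).
  apply: le_trans (lerD h' ih) _; rewrite -mulrDl ler_pM2r ?invr_gt0// exprD exprS.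
  by rewrite le_eqVlt; apply/orP; left; apply/eqP; field.
have [dl dl0 Hdl] := T_cont ax x ltr01.
(* Near time 0 one has |T_(h_k) x| <= |x| + 1, and the remaining moves change the k-th hump by at
   most 3, which makes 4. The index k is taken beyond D and so that h_k < dl. *)
pose D := nrm x + 4; have D0 : 0 <= D by rewrite addr_ge0 ?nrm_ge0.
pose k := (Num.truncn (D + dl^-1)).+1.
have Dk : D + dl^-1 < k%:R by apply: truncnS_gt.
have dlV : 0 < dl^-1 by rewrite invr_gt0.
have [[hk0 hk1] _ hT _ hB] := P k.
have hd : h_ k < dl.
  apply: le_lt_trans hk1 _; rewrite invf_plt ?posrE//; apply: le_lt_trans (_ : k%:R < _).
    by lra.
  by rewrite ltr_nat.
have Bk1 : 0 < B_ k.+1 by apply: lt_le_trans (B1 _).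
have xx : nrm (x - x_ k.+1) <= 3 / B_ k.+1.
  have [N HN] := Hx (1 / B_ k.+1) (divr_gt0 ltr01 Bk1).
  have h1 := tail k.+1 N; have h2 := HN (k.+1 + N)%N (leq_addl _ _).
  apply: le_trans (nrm_tri ip (x_ (k.+1 + N)%N) _ _) _; rewrite (nrmC ip) in h2.
  have h3 : 2 * (1 - 2^-1 ^+ N) * 2^-1 ^+ k.+1 / B_ k.+1 <= 2 / B_ k.+1.
    rewrite ler_wpM2r ?invr_ge0 ?(ltW Bk1)//.
    have q01 m : 0 <= (2^-1 ^+ m : R) <= 1.
      by rewrite exprn_ge0 ?invr_ge0//= exprn_ile1 ?invr_ge0// invf_le1// ler1n.
    by have /andP[? ?] := q01 N; have /andP[? ?] := q01 k.+1; nra.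
  have -> : 3 / B_ k.+1 = 1 / B_ k.+1 + 2 / B_ k.+1 by rewrite -mulrDl.
  exact: lerD h2 (le_trans h1 h3).
have g1 : nrm (T (h_ k) (x - x_ k.+1)) <= 3.
  apply: le_trans (hB _) _; apply: le_trans (ler_wpM2l (ltW Bk1) xx) _.
  by rewrite mulrC divfK// gt_eqF.
have g2 := Hdl _ hk0 hd; have g3 := nrmD ip (T (h_ k) x - x) x; rewrite subrK in g3.
have g4 := nrmB ip (T (h_ k) x) (T (h_ k) (x - x_ k.+1)).
have TE : T (h_ k) x - T (h_ k) (x - x_ k.+1) = T (h_ k) (x_ k.+1).
  by rewrite T_B ?(ltW hk0)//; vec.
rewrite TE in g4; have : k%:R <= D by rewrite /D; lra.
by rewrite leNgt; move=> /negP; apply; apply: lt_trans Dk; rewrite ltrDl.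
Qed.

(** The local bound is iterated along the semigroup law, with C >= 1 so that its powers increase. *)
Lemma T_bound t : exists2 C, 1 <= C & forall s z, 0 <= s -> s <= t -> nrm (T s z) <= C * nrm z.
Proof.
have [C' [dl [C0 dl0 HC']]] := local_bound.
pose C := Num.max C' 1; have C1 : 1 <= C by rewrite le_max lexx orbT.
have HC h z : 0 <= h -> h <= dl -> nrm (T h z) <= C * nrm z.
  rewrite le_eqVlt => /predU1P[<- _|h0 hd]; first by rewrite (T_id ax) ler_peMl ?nrm_ge0.
  by rewrite (le_trans (HC' h z h0 hd))// ler_wpM2r ?nrm_ge0// le_max lexx.
have H (N : nat) s z : 0 <= s -> s <= N%:R * dl -> nrm (T s z) <= C ^+ N * nrm z.
  elim: N s z => [|N ih] s z s0.
    by rewrite mul0r => s0'; rewrite (_ : s = 0) ?(T_id ax) ?expr0 ?mul1r//; apply/eqP; rewrite eq_le s0'.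
  move=> sN; have [sd|sd] := leP s dl.
    apply: le_trans (HC s z s0 sd) _; rewrite ler_wpM2r ?nrm_ge0// exprS ler_peMr ?(le_trans ler01)//.
    exact: exprn_ege1.
  have -> : s = dl + (s - dl) by rewrite addrC subrK.
  rewrite (T_add ax) ?(ltW dl0)//; last by rewrite subr_ge0 ltW.
  apply: le_trans (HC _ _ (ltW dl0) (lexx _)) _; rewrite exprS -mulrA ler_wpM2l ?(le_trans ler01)//.
  apply: ih; first by rewrite subr_ge0 ltW.
  by rewrite lerBlDr -[X in _ <= _ + X]mul1r -mulrDl natr1.
pose N := (Num.truncn (t / dl)).+1.
exists (C ^+ N); first exact: exprn_ege1.
move=> s z s0 st; apply: H => //; apply: (le_trans st).
by rewrite -ler_pdivrMr// ltW//; exact: truncnS_gt.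
Qed.

(** By the semigroup law the increment is T_r applied to T_(s-r) x - x, so the uniform bound turns
    continuity at 0 into uniform continuity on [0, t]. *)
Lemma T_osc x t e : 0 < e -> exists2 dl, 0 < dl & forall r s, 0 <= r -> r <= s -> s <= t -> s - r < dl ->
  nrm (T s x - T r x) <= e.
Proof.
move=> e0; have [C C1 HC] := T_bound t; have C0 : 0 < C by apply: lt_le_trans C1.
have [dl dl0 Hd] := T_cont ax x (divr_gt0 e0 C0); exists dl => // r s r0 rs st sr.
have -> : T s x - T r x = T r (T (s - r) x - x).
  by rewrite T_B// -(T_add ax) ?subr_ge0// (addrC r) subrK.
apply: le_trans (HC _ _ r0 (le_trans rs st)) _; rewrite mulrC -ler_pdivlMr//.
move: rs; rewrite le_eqVlt => /predU1P[->|rs]; last by apply: Hd; rewrite ?subr_gt0.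
by rewrite subrr (T_id ax) subrr (nrm0 ip) divr_ge0// ltW.
Qed.

Lemma uder_T x y t : Lr x y -> uder dot (fun s => T s y) (fun s => T s x) t.
Proof.
move=> /(T_gen ax) H e e0; have [C C1 HC] := T_bound t; have C0 : 0 < C by apply: lt_le_trans C1.
have [dl dl0 Hd] := H _ (divr_gt0 e0 C0); exists dl => // s k s0; rewrite le_eqVlt => /predU1P[<- _ _|k0 kd skt].
  by rewrite addr0 subrr scale0r subrr (nrm0 ip) mulr0.
have -> : T (s + k) x - T s x - k *: T s y = T s (k *: (k^-1 *: (T k x - x) - y)).
  by rewrite scalerBr scalerA divff ?gt_eqF// scale1r !T_B// T_Z// (T_add ax) ?(ltW k0).
apply: le_trans (HC _ _ s0 _) _; first by rewrite (le_trans _ skt)// lerDl ltW.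
rewrite (nrmZ ip) gtr0_norm// mulrCA mulrC ler_pM2r// mulrC -ler_pdivlMr//.
exact: Hd.
Qed.

(** The absolute value extends the orbit to negative times, so that continuity can be stated on the
    whole line. *)
Definition orbit_dot x y (s : R) := dot (T `|s| x) y.
Definition orbit_int x y (t : R) := \int[@lebesgue_measure R]_(s in `[0, t]) orbit_dot x y s.

Lemma dot_cs_le x y C : 0 <= C -> nrm x <= C -> `|dot x y| <= C * nrm y.
Proof. by move=> C0 xC; apply: le_trans (cauchy_schwarz ip _ _) _; rewrite ler_wpM2r ?nrm_ge0. Qed.

Lemma orbit_dot_cont x y : continuous (orbit_dot x y).
Proof.
move=> s0; apply/cvgrPdist_le => e e0 /=.
have y1 : 0 < nrm y + 1 by rewrite ltr_wpDl ?nrm_ge0.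
have ey : 0 < e / (nrm y + 1) by rewrite divr_gt0.
have [dl dl0 Hd] := T_osc x (`|s0| + 1) ey.
near=> s.
have sd : `|s0 - s| < dl by near: s; apply: cvgr_dist_lt => //; exact: cvg_id.
have s1 : `|s0 - s| < 1 by near: s; apply: cvgr_dist_lt => //; exact: cvg_id.
have ds : `| `|s0| - `|s| | <= `|s0 - s| by exact: ler_dist_dist.
have sb : `|s| <= `|s0| + 1.
  by move: ds; rewrite ler_norml => /andP[? _]; have := ltW s1; lra.
have H : nrm (T `|s0| x - T `|s| x) <= e / (nrm y + 1).
  have [ss|ss] := leP `|s0| `|s|.
    rewrite (nrmC ip); apply: Hd => //; apply: le_lt_trans sd; apply: le_trans ds.
    by rewrite distrC ler_norm.
  apply: Hd => //; [exact: ltW|by rewrite lerDl|].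
  by apply: le_lt_trans sd; apply: le_trans ds; rewrite ler_norm.
rewrite /orbit_dot -(dotBl ip); apply: le_trans (dot_cs_le y (ltW ey) H) _.
by rewrite -mulrA ger_pMr// mulrC ler_pdivrMr// mul1r lerDl.
Unshelve. all: by end_near. Qed.

Lemma orbit_int0 x y : orbit_int x y 0 = 0.
Proof. by rewrite /orbit_int set_itv1 Rintegral_set1. Qed.

Lemma orbit_int_incr x y s k m e : 0 <= s -> 0 <= k ->
  (forall c, s <= c -> c <= s + k -> `|orbit_dot x y c - m| <= e) ->
  `|orbit_int x y (s + k) - orbit_int x y s - k * m| <= e * k.
Proof.
move=> s0 k0 H; have ssk : s <= s + k by rewrite lerDl.
have cf t : {for t, continuous (orbit_dot x y)} by exact: orbit_dot_cont.
have ii a b := @itv_continuous_integrable _ a b _ (fun t _ => cf t).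
have -> : orbit_int x y (s + k) - orbit_int x y s = \int[@lebesgue_measure R]_(c in `[s, s + k]) orbit_dot x y c.
  rewrite /orbit_int Rintegral_itvB//.
    by rewrite Rintegral_itv_obnd_cbnd//; apply: integrableS (ii s (s + k)) => //; exact: subset_itv_oc_cc.
have -> : k * m = \int[@lebesgue_measure R]_(c in `[s, s + k]) m.
  rewrite Rintegral_cst//= lebesgue_measure_itv /= lte_fin; case: ltP => [_|ks] /=.
    by rewrite [s + k]addrC addrK mulrC.
  by rewrite mulr0 (_ : k = 0) ?mul0r//; apply/eqP; rewrite eq_le k0 andbT -(gerDl s).
rewrite -RintegralB_itv//; last by move=> t _; exact: cst_continuous.
apply: le_trans (norm_Rintegral_itv_le (c := e) ssk _ _) _.
- by move=> t _; apply: (continuousB (cf t)); exact: cst_continuous.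
- by move=> t /andP[st tsk]; exact: H.
- by rewrite [s + k]addrC addrK mulrC.
Qed.

Lemma orbit_dotE x y s : 0 <= s -> orbit_dot x y s = dot (T s x) y.
Proof. by move=> s0; rewrite /orbit_dot ger0_norm. Qed.

Lemma orbit_int_step x t e : 0 < e -> exists2 dl, 0 < dl & forall s k y, 0 <= s -> 0 <= k -> k < dl -> s + k <= t ->
  `|orbit_int x y (s + k) - orbit_int x y s - k * dot (T s x) y| <= e * nrm y * k.
Proof.
move=> e0; have [dl dl0 Hd] := T_osc x t e0; exists dl => // s k y s0 k0 kd skt.
apply: orbit_int_incr => // c sc csk; rewrite orbit_dotE ?(le_trans s0)// -(dotBl ip).
apply: dot_cs_le; first exact: ltW.
by apply: Hd => //; [exact: le_trans csk skt|rewrite (le_lt_trans _ kd)// lerBlDl].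
Qed.

Lemma riemann_sum x t e : 0 <= t -> 0 < e -> exists S, forall y, `|dot S y - orbit_int x y t| <= e * nrm y.
Proof.
move=> t0 e0; have t1 : 0 < t + 1 by rewrite ltr_wpDl.
have [dl dl0 Hd] := orbit_int_step x t (divr_gt0 e0 t1).
have [N [k [k0 kd tE]]] := equal_steps t0 dl0.
have step j : (j <= N)%N -> exists S, forall y, `|dot S y - orbit_int x y (j%:R * k)| <= e / (t + 1) * nrm y * (j%:R * k).
  elim: j => [|j ih] jN; first by exists 0 => y; rewrite (dot0l ip) !mul0r orbit_int0 subrr normr0 mulr0.
  have [S HS] := ih (ltnW jN); exists (S + k *: T (j%:R * k) x) => y.
  have jk : j.+1%:R * k = j%:R * k + k by rewrite -natr1 mulrDl mul1r.
  have j0 : 0 <= j%:R * k by rewrite mulr_ge0.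
  have jt : j%:R * k + k <= t by rewrite -jk -tE ler_wpM2r// ler_nat.
  have h1 := HS y; have h2 := Hd _ _ y j0 k0 kd jt.
  rewrite jk (dotDl ip) (dotZl ip) [X in `|X|](_ : _ = (dot S y - orbit_int x y (j%:R * k)) -
    (orbit_int x y (j%:R * k + k) - orbit_int x y (j%:R * k) - k * dot (T (j%:R * k) x) y)); last by ring.
  by apply: le_trans (ler_normB _ _) _; rewrite mulrDr; exact: lerD.
have [S HS] := step N (leqnn N); rewrite tE in HS; exists S => y; apply: le_trans (HS y) _.
rewrite mulrAC ler_wpM2r ?nrm_ge0// -mulrA ger_pMr// mulrC ler_pdivrMr// mul1r.
by rewrite lerDl.
Qed.

(** Riemann sums with error 2^-k / 2 have increments at most 2^-k; their limit represents the weak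
    integral, without a representation theorem for functionals. *)
Lemma orbit_int_repr x t : 0 <= t -> exists i, forall y, dot i y = orbit_int x y t.
Proof.
move=> t0; have e0 k : 0 < (2^-1 ^+ k / 2 : R) by rewrite divr_gt0// exprn_gt0// invr_gt0.
pose S k := sval (cid (riemann_sum x t0 (e0 k))).
have HS k y : `|dot (S k) y - orbit_int x y t| <= 2^-1 ^+ k / 2 * nrm y by exact: (svalP (cid (riemann_sum x t0 (e0 k))) y).
have [|i Hi] := cip (x_ := S).
  move=> k; apply: (nrm_dual ip); first by rewrite exprn_ge0// invr_ge0.
  move=> y; rewrite (dotBl ip); have := HS k y; have := HS k.+1 y; rewrite exprS.
  have q0 : 0 <= (2^-1 ^+ k : R) by rewrite exprn_ge0// invr_ge0.
  have := mulr_ge0 q0 (nrm_ge0 dot y).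
  by rewrite !ler_norml => ? /andP[? ?] /andP[? ?]; lra.
exists i => y; apply/eqP; rewrite -subr_eq0 -normr_le0; apply/ler_addgt0Pl => e e1; rewrite addr0.
have y1 : 0 < nrm y + 1 by rewrite ltr_wpDl ?nrm_ge0.
have e2 : 0 < e / 2 / (nrm y + 1) by rewrite !divr_gt0.
have [N1 HN1] := Hi _ e2.
have [N2 HN2] : exists N, forall k, (N <= k)%N -> (2^-1 ^+ k : R) <= e / 2 / (nrm y + 1).
  have : (2^-1 ^+ k : R) @[k --> \oo] --> (0 : R).
    by apply: cvg_expr; rewrite ger0_norm ?invr_ge0// invf_lt1// ltr1n.
  move=> /cvgrPdist_le/(_ _ e2)[N _ HN]; exists N => k Nk; have := HN k Nk.
  by rewrite sub0r normrN ger0_norm// exprn_ge0// invr_ge0.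
pose k := maxn N1 N2; have h1 := HN1 k (leq_maxl _ _); have h2 := HN2 k (leq_maxr _ _).
have h3 := HS k y; have h4 := dot_cs_le y (ltW e2) h1; rewrite (dotBl ip) in h4.
have ey : e / 2 / (nrm y + 1) * nrm y <= e / 2.
  by rewrite -mulrA ger_pMr ?divr_gt0// mulrC ler_pdivrMr// mul1r lerDl.
have h5 : 2^-1 ^+ k / 2 * nrm y <= e / 2 / (nrm y + 1) * nrm y.
  by rewrite ler_wpM2r ?nrm_ge0//; have q0 : 0 <= (2^-1 ^+ k : R); [rewrite exprn_ge0// invr_ge0|lra].
move: h3 h4; rewrite !ler_norml => /andP[? ?] /andP[? ?]; apply/andP; split; lra.
Qed.

Definition Tint (t : R) (x : E) : E := if pselect (0 <= t) is left t0 then sval (cid (orbit_int_repr x t0)) else 0.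

Lemma TintE t x y : 0 <= t -> dot (Tint t x) y = orbit_int x y t.
Proof. by move=> t0; rewrite /Tint; case: pselect => // t0'; case: cid. Qed.

Lemma Tint0 x : Tint 0 x = 0.
Proof. by apply: (dot_ext ip) => y; rewrite TintE// orbit_int0 (dot0l ip). Qed.

Lemma uder_Tint x t : uder dot (fun s => T s x) (fun s => Tint s x) t.
Proof.
move=> e e0; have [dl dl0 Hd] := orbit_int_step x t e0; exists dl => // s k s0 k0 kd skt.
apply: (nrm_dual ip); first by rewrite mulr_ge0// ltW.
move=> y; have := Hd s k y s0 k0 kd skt; rewrite mulrAC ler_norml => /andP[_].
by rewrite !(dotBl ip) (dotZl ip) !TintE// addr_ge0.
Qed.

Lemma uder_eq (g h Phi Psi : R -> E) t : (forall s, 0 <= s -> s <= t -> g s = h s) ->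
  (forall s, 0 <= s -> s <= t -> Phi s = Psi s) -> uder dot g Phi t -> uder dot h Psi t.
Proof.
move=> gh PP H e e0; have [dl dl0 Hd] := H e e0; exists dl => // s k s0 k0 kd skt.
have st : s <= t by rewrite (le_trans _ skt)// lerDl.
by rewrite -gh// -!PP//; [exact: Hd|exact: addr_ge0].
Qed.

Lemma uder_shift (g Phi : R -> E) t r : 0 <= r -> uder dot g Phi (t + r) ->
  uder dot (fun s => g (s + r)) (fun s => Phi (s + r)) t.
Proof.
move=> r0 H e e0; have [dl dl0 Hd] := H e e0; exists dl => // s k s0 k0 kd skt.
rewrite (addrAC s k r); apply: Hd => //; first exact: addr_ge0.
by rewrite (addrAC s r k) lerD2r.
Qed.

(** As functions of t both sides vanish at 0 and have the uniform right derivative T_(t+r) x.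
    Commutation with T_s and linearity of the integral follow in the same way. *)
Lemma T_Tint r t x : 0 <= r -> 0 <= t -> T r (Tint t x) = Tint (t + r) x - Tint r x.
Proof.
move=> r0 t0; have [C HC] := T_bd ax r0.
have H1 := uder_map ip (fun a x y => T_lin ax a x y r0) HC (@uder_Tint x t).
have H2 : uder dot (fun s => T r (T s x)) (fun s => Tint (s + r) x) t.
  apply: uder_eq (uder_shift r0 (@uder_Tint x (t + r))) => // s s0 _.
  by rewrite addrC (T_add ax).
by have := uder_unique ip t0 H1 H2; rewrite Tint0 T_0// subr0 add0r.
Qed.

Lemma T_TintC s t x : 0 <= s -> 0 <= t -> T s (Tint t x) = Tint t (T s x).
Proof.
move=> s0 t0; have [C HC] := T_bd ax s0.
have H1 := uder_map ip (fun a x y => T_lin ax a x y s0) HC (@uder_Tint x t).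
have H2 : uder dot (fun r => T s (T r x)) (fun r => Tint r (T s x)) t.
  apply: uder_eq (@uder_Tint (T s x) t) => // r r0 _.
  by rewrite -!(T_add ax)// addrC.
by have := uder_unique ip t0 H1 H2; rewrite !Tint0 T_0// !subr0.
Qed.

Lemma Tint_lin a x y t : 0 <= t -> Tint t (y + a *: x) = Tint t y + a *: Tint t x.
Proof.
move=> t0; have H1 := uder_lin ip a (@uder_Tint y t) (@uder_Tint x t).
have H2 : uder dot (fun s => T s y + a *: T s x) (fun s => Tint s (y + a *: x)) t.
  apply: uder_eq (@uder_Tint (y + a *: x) t) => // s s0 _.
  by rewrite addrC (T_lin ax)// addrC.
by have := uder_unique ip t0 H1 H2; rewrite !Tint0 scaler0 addr0 !subr0.
Qed.

(** Shifting the integral by r and dividing by r leaves two short averages, one near time h and one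
    near 0. These integrals are the elements that make the domain dense. *)
Lemma Tint_dom h x : 0 <= h -> Lr (Tint h x) (T h x - x).
Proof.
move=> h0; apply/(T_gen ax) => e e0; have e2 : 0 < e / 2 by rewrite divr_gt0.
have [dl dl0 Hd] := @uder_Tint x (h + 1) _ e2.
exists (Num.min dl 1); first by rewrite lt_min dl0 ltr01.
move=> r r0; rewrite lt_min => /andP[rd r1].
have h1 := Hd h r h0 (ltW r0) rd (lerD (lexx h) (ltW r1)).
have h2 := Hd 0 r (lexx _) (ltW r0) rd (lerD h0 (ltW r1)).
rewrite Tint0 add0r subr0 (T_id ax) in h2.
rewrite T_Tint ?(ltW r0)//.
have -> : r^-1 *: (Tint (h + r) x - Tint r x - Tint h x) - (T h x - x) =
    r^-1 *: ((Tint (h + r) x - Tint h x - r *: T h x) - (Tint r x - r *: x)).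
  rewrite !scalerBr !scalerA mulVf ?gt_eqF// !scale1r; vec.
rewrite (nrmZ ip) gtr0_norm ?invr_gt0// ler_pdivrMl//.
by apply: le_trans (nrmB ip _ _) _; lra.
Qed.

Lemma Tint_avg x e : 0 < e -> exists2 dl, 0 < dl & forall k, 0 <= k -> k < dl -> nrm (Tint k x - k *: x) <= e * k.
Proof.
move=> e0; have [dl dl0 Hd] := @uder_Tint x 1 _ e0; exists (Num.min dl 1); first by rewrite lt_min dl0 ltr01.
move=> k k0; rewrite lt_min => /andP[kd k1].
have := Hd 0 k (lexx _) k0 kd; rewrite add0r Tint0 subr0 (T_id ax); apply; exact: ltW.
Qed.

Lemma Lr_lin a x y x' y' : Lr x y -> Lr x' y' -> Lr (a *: x + x') (a *: y + y').
Proof.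
move=> /(T_gen ax) H /(T_gen ax) H'; apply/(T_gen ax) => e e0; have e2 : 0 < e / 2 by rewrite divr_gt0.
have a1 : 0 < `|a| + 1 by rewrite ltr_wpDl.
have [d1 d10 H1] := H _ (divr_gt0 e2 a1); have [d2 d20 H2] := H' _ e2.
exists (Num.min d1 d2); first by rewrite lt_min d10.
move=> t t0; rewrite lt_min => /andP[t1 t2]; have h1 := H1 t t0 t1; have h2 := H2 t t0 t2.
rewrite (T_lin ax) ?(ltW t0)//.
have -> : t^-1 *: (a *: T t x + T t x' - (a *: x + x')) - (a *: y + y') =
   a *: (t^-1 *: (T t x - x) - y) + (t^-1 *: (T t x' - x') - y') by vec.
apply: le_trans (nrmD ip _ _) _; rewrite (nrmZ ip).
have : `|a| * nrm (t^-1 *: (T t x - x) - y) <= (`|a| + 1) * (e / 2 / (`|a| + 1)).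
  by rewrite ler_pM ?nrm_ge0// lerDl.
by rewrite (mulrC (`|a| + 1)) divfK ?gt_eqF//; lra.
Qed.

Lemma Lr0 : Lr 0 0.
Proof.
apply/(T_gen ax) => e e0; exists 1 => // t t0 _.
by rewrite T_0 ?(ltW t0)// !subr0 scaler0 (nrm0 ip) ltW.
Qed.

Lemma Lr_Z a x y : Lr x y -> Lr (a *: x) (a *: y).
Proof. by move=> H; have := Lr_lin a H Lr0; rewrite !addr0. Qed.

Lemma Lr_B x y x' y' : Lr x y -> Lr x' y' -> Lr (x - x') (y - y').
Proof. by move=> H H'; have := Lr_lin (-1) H' H; rewrite !scaleN1r !(addrC (- _)). Qed.

Lemma Lr_T s x y : 0 <= s -> Lr x y -> Lr (T s x) (T s y).
Proof.
move=> s0 /(T_gen ax) H; apply/(T_gen ax) => e e0; have [C C1 HC] := T_bound s.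
have C0 : 0 < C by apply: lt_le_trans C1.
have [dl dl0 Hd] := H _ (divr_gt0 e0 C0); exists dl => // t t0 td.
have -> : t^-1 *: (T t (T s x) - T s x) - T s y = T s (t^-1 *: (T t x - x) - y).
  by rewrite T_B// T_Z// T_B// -!(T_add ax) ?(ltW t0)// (addrC s).
by apply: le_trans (HC _ _ s0 (lexx _)) _; rewrite mulrC -ler_pdivlMr//; exact: Hd.
Qed.

Lemma Tint_Lr x y t : 0 <= t -> Lr x y -> T t x - x = Tint t y.
Proof.
move=> t0 H; have := uder_unique ip t0 (uder_T t H) (@uder_Tint y t).
by rewrite (T_id ax) Tint0 subr0.
Qed.

Lemma Lr_dense x e : 0 < e -> exists p q, Lr p q /\ nrm (p - x) <= e.
Proof.
move=> e0; have [dl dl0 Hd] := Tint_avg x e0; pose k := dl / 2.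
have k0 : 0 < k by rewrite divr_gt0.
exists (k^-1 *: Tint k x), (k^-1 *: (T k x - x)); split; first by apply: Lr_Z; apply: Tint_dom; exact: ltW.
have -> : k^-1 *: Tint k x - x = k^-1 *: (Tint k x - k *: x).
  by rewrite scalerBr scalerA mulVf ?gt_eqF// scale1r.
rewrite (nrmZ ip) gtr0_norm ?invr_gt0// ler_pdivrMl// mulrC; apply: Hd; first exact: ltW.
by rewrite /k ltr_pdivrMr// ltr_pMr// ltr1n.
Qed.

Record resolvent_ax : Prop := ResolventAx {
  J_res : forall h x, 0 < h -> exists2 y, Lr (J h x) y & J h x - h *: y = x;
  Lr_dissip : forall x y, Lr x y -> dot x y <= 0;
  Lr_sym : forall x y x' y', Lr x y -> Lr x' y' -> dot y x' = dot x y' }.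

Hypothesis rx : resolvent_ax.

(** Dissipativity makes 1 - h L injective, so any solution of the resolvent equation is the one
    given by J. *)
Lemma J_unique h p q : 0 < h -> Lr p q -> p = J h (p - h *: q).
Proof.
move=> h0 H; have [y Hy Ey] := J_res rx (p - h *: q) h0.
have HB := Lr_B H Hy; have D := Lr_dissip rx HB.
apply/eqP; rewrite -subr_eq0; apply/eqP; apply/eqP/negPn/negP => p0.
have := dot_gt0 ip p0; have {1}-> : p - J h (p - h *: q) = h *: (q - y).
  by move/eqP: Ey; rewrite subr_eq => /eqP ->; vec.
by rewrite (dotZl ip) (dotC ip) ltNge pmulr_rle0 ?D.
Qed.

Lemma J_lin h a x y : 0 < h -> J h (a *: x + y) = a *: J h x + J h y.
Proof.
move=> h0; have [x' Hx Ex] := J_res rx x h0; have [y' Hy Ey] := J_res rx y h0.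
rewrite [RHS](J_unique h0 (Lr_lin a Hx Hy)); congr (J h _).
by rewrite -[in LHS]Ex -[in LHS]Ey; vec.
Qed.

Lemma J_contraction h x : 0 < h -> nrm (J h x) <= nrm x.
Proof.
move=> h0; have [y Hy Ey] := J_res rx x h0; have D := Lr_dissip rx Hy.
have : dot (J h x) (J h x) <= dot x (J h x).
  have -> : dot x (J h x) = dot (J h x) (J h x) - h * dot y (J h x) by rewrite -(dotZl ip) -(dotBl ip) Ey.
  by rewrite lerDl oppr_ge0 (dotC ip) pmulr_rle0.
rewrite -(nrm_sqr ip) expr2 => /le_trans/(_ (ler_norm _))/le_trans/(_ (cauchy_schwarz ip _ _)).
have [->|n0] := eqVneq (nrm (J h x)) 0; first by rewrite nrm_ge0.
by rewrite ler_pM2r// lt_def n0 nrm_ge0.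
Qed.

Lemma J_0 h : 0 < h -> J h 0 = 0.
Proof. by move=> h0; apply: (nrm_eq0 ip); rewrite (le_trans (J_contraction _ h0))// (nrm0 ip). Qed.

Lemma J_Z h a x : 0 < h -> J h (a *: x) = a *: J h x.
Proof. by move=> h0; have := J_lin a x 0 h0; rewrite J_0// !addr0. Qed.

Lemma J_D h x y : 0 < h -> J h (x + y) = J h x + J h y.
Proof. by move=> h0; have := J_lin 1 x y h0; rewrite !scale1r. Qed.

Lemma J_T h s x : 0 < h -> 0 <= s -> T s (J h x) = J h (T s x).
Proof.
move=> h0 s0; have [y Hy Ey] := J_res rx x h0.
rewrite (J_unique h0 (Lr_T s0 Hy)); congr (J h _).
by rewrite -T_Z// -T_B// Ey.
Qed.

(** On the domain J_h p - p = h J_h (L p), which is of order h; contractivity of J and density of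
    the domain do the rest. *)
Lemma J_to_id x e : 0 < e -> exists2 dl, 0 < dl & forall h, 0 < h -> h < dl -> nrm (J h x - x) <= e.
Proof.
move=> e0; have e3 : 0 < e / 3 by rewrite divr_gt0.
have [p [q [H Hp]]] := Lr_dense x e3; have q1 : 0 < nrm q + 1 by rewrite ltr_wpDl ?nrm_ge0.
exists (e / 3 / (nrm q + 1)); first by rewrite divr_gt0.
move=> h h0 hd; have Jp : J h p - p = h *: J h q.
  by rewrite [X in _ - X](J_unique h0 H) -scaleN1r -J_Z// -J_D// -J_Z//; congr (J h _); vec.
have n1 : nrm (J h p - p) <= e / 3.
  rewrite Jp (nrmZ ip) gtr0_norm//; apply: le_trans (ler_wpM2l (ltW h0) (J_contraction _ h0)) _.
  apply: (@le_trans _ _ (h * (nrm q + 1))); first by rewrite ler_pM2l// lerDl.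
  by rewrite -ler_pdivlMr// ltW.
have n2 : nrm (J h (x - p)) <= e / 3 by apply: le_trans (J_contraction _ h0) _; rewrite (nrmC ip).
have -> : J h x - x = J h (x - p) + (J h p - p) + (p - x).
  have -> : J h x = J h (x - p) + J h p by rewrite -J_D// subrK.
  by vec.
apply: le_trans (nrmD ip _ _) _; have := nrmD ip (J h (x - p)) (J h p - p); lra.
Qed.

(** The curve g(s) = T_s x + int_0^s T_r v dr solves g' = L g + v, and J_k (g(s) + k v) is its
    implicit Euler step. For x in the domain the two differ by at most e k, uniformly in s, so a
    1-Lipschitz functional that does not increase under Euler steps does not increase along g.
    Density removes the restriction on x. *)
Lemma invariance (d : E -> R) v x t : 0 <= t -> (forall x y, d x <= d y + nrm (x - y)) ->
  (forall h x, 0 < h -> d (J h (x + h *: v)) <= d x) -> d (T t x + Tint t v) <= d x.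
Proof.
move=> t0 d1 dJ; have [C C1 HC] := T_bound t; have C0 : 0 < C by apply: lt_le_trans C1.
have dom_case p q : Lr p q -> d (T t p + Tint t v) <= d p.
  move=> Hpq; pose g s := T s p + Tint s v; pose z := q + v.
  have g0 : d (g 0) = d p by rewrite /g (T_id ax) Tint0 addr0.
  rewrite -g0; apply: (@telescope R (fun s => d (g s)) t t0) => e e0.
  have e2 : 0 < e / 2 / C by rewrite !divr_gt0.
  have [d1' d10 H1] := Tint_avg z e2; have [d2 d20 H2] := J_to_id z e2.
  exists (Num.min d1' d2); first by rewrite lt_min d10.
  move=> s k s0; rewrite le_eqVlt => /predU1P[<- _ _|k0]; first by rewrite addr0 mulr0 addr0.
  rewrite lt_min => /andP[k1 k2] skt.
  have st : s <= t by rewrite (le_trans _ skt)// lerDl ltW.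
  have Lg : Lr (g s) (T s q + (T s v - v)).
    by have := Lr_lin 1 (Lr_T s0 Hpq) (Tint_dom v s0); rewrite !scale1r.
  have kE : T s q + (T s v - v) = T s z - v by rewrite T_D//; vec.
  rewrite kE in Lg.
  have Eg : g (s + k) = g s + Tint k (T s z).
    have h1 : T k (g s) - g s = Tint k (T s z - v) := Tint_Lr (ltW k0) Lg.
    have h2 : g (s + k) = T k (g s) + Tint k v.
      rewrite /g T_D ?(ltW k0)// T_Tint ?(ltW k0)// -(T_add ax) ?(ltW k0)// (addrC k); vec.
    have h3 : Tint k (T s z - v) + Tint k v = Tint k (T s z).
      by have := Tint_lin 1 v (T s z - v) (ltW k0); rewrite !scale1r subrK.
    by rewrite h2 -h3 -h1; vec.
  have EJ : J k (g s + k *: v) = g s + k *: J k (T s z).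
    have -> : g s + k *: v = (g s - k *: (T s z - v)) + k *: T s z by vec.
    by rewrite J_D// -(J_unique k0 Lg) J_Z.
  have TintT : Tint k (T s z) = T s (Tint k z) by rewrite T_TintC// ltW.
  apply: le_trans (d1 _ (J k (g s + k *: v))) _; apply: lerD; first exact: dJ.
  (* Both points are g(s) + k T_s z up to small errors, and z = L p + v does not depend on s; this
     is the source of uniformity in s. *)
  have -> : g (s + k) - J k (g s + k *: v) = T s ((Tint k z - k *: z) - k *: (J k z - z)).
    by rewrite Eg EJ TintT -J_T// !T_B// !T_Z// T_B//; vec.
  apply: le_trans (HC _ _ s0 st) _; rewrite mulrC -ler_pdivlMr//.
  apply: le_trans (nrmB ip _ _) _; rewrite (nrmZ ip) gtr0_norm//.
  have h1 := H1 k (ltW k0) k1; have h2 := ler_wpM2l (ltW k0) (H2 k k0 k2).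
  have -> : e * k / C = e / 2 / C * k + k * (e / 2 / C) by field; rewrite gt_eqF.
  exact: lerD.
apply/ler_addgt0Pl => e e0; have C2 : 0 < C + 1 by rewrite ltr_wpDl// ltW.
have [p [q [Hpq Hp]]] := Lr_dense x (divr_gt0 e0 C2).
have h1 := dom_case p q Hpq; have h2 := d1 p x.
have h3 := d1 (T t x + Tint t v) (T t p + Tint t v).
have h4 : nrm (T t x + Tint t v - (T t p + Tint t v)) <= C * nrm (p - x).
  have -> : T t x + Tint t v - (T t p + Tint t v) = T t (x - p) by rewrite T_B//; vec.
  by rewrite (nrmC ip p); exact: HC.
have h5 : (C + 1) * nrm (p - x) <= e by rewrite mulrC -ler_pdivlMr.
lra.
Qed.

Lemma T_contraction t x : 0 <= t -> nrm (T t x) <= nrm x.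
Proof.
move=> t0; have := @invariance nrm 0 x t t0; rewrite (_ : Tint t 0 = 0).
  rewrite addr0; apply.
  - by move=> y z; rewrite -{1}(subrK z y) addrC; exact: nrmD.
  - by move=> h y h0; rewrite scaler0 addr0; exact: J_contraction.
have := Tint_Lr t0 Lr0; by rewrite T_0// subrr.
Qed.

(** For p, p' in the domain the increments of s -> <T_s p, T_(t-s) p'> are at most e k by symmetry
    of the generator; taking both signs [sg] shows that the function is constant, and density
    concludes. *)
Lemma T_sym t x y : 0 <= t -> dot (T t x) y = dot x (T t y).
Proof.
move=> t0.
have dom_case (sg : R) p q p' q' : `|sg| = 1 -> Lr p q -> Lr p' q' -> sg * dot (T t p) p' <= sg * dot p (T t p').
  move=> sg1 Hp Hp'; pose f s := sg * dot (T s p) (T (t - s) p').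
  suff : f t <= f 0 by rewrite /f subrr subr0 !(T_id ax).
  apply: (telescope t0) => e e0.
  have B0 : 0 < nrm p + nrm p' + 1 by rewrite ltr_wpDl// addr_ge0 ?nrm_ge0.
  have e1 := divr_gt0 e0 B0.
  have [d1 d10 H1] := uder_T t Hp e1; have [d2 d20 H2] := uder_T t Hp' e1.
  exists (Num.min d1 d2); first by rewrite lt_min d10.
  move=> s k s0 k0; rewrite lt_min => /andP[k1 k2] skt.
  have r0 : 0 <= t - (s + k) by rewrite subr_ge0.
  have h1 := H1 s k s0 k0 k1 skt.
  have rkE : t - (s + k) + k = t - s by ring.
  have h2 : nrm (T (t - s) p' - T (t - (s + k)) p' - k *: T (t - (s + k)) q') <= e / (nrm p + nrm p' + 1) * k.
    by have := H2 (t - (s + k)) k r0 k0 k2; rewrite rkE; apply; rewrite gerBl.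
  have sym := Lr_sym rx (Lr_T s0 Hp) (Lr_T r0 Hp').
  set P := T (t - (s + k)) p' in h2 sym *; set Q := T (t - (s + k)) q' in h2 sym *.
  have E1 : f (s + k) - f s = sg * (dot (T (s + k) p - T s p - k *: T s q) P - dot (T s p) (T (t - s) p' - P - k *: Q)).
    rewrite /f -/P !(dotBl ip) !(dotBr ip) (dotZl ip) (dotZr ip) sym; ring.
  have nP : nrm P <= nrm p' by exact: T_contraction.
  have nS : nrm (T s p) <= nrm p by exact: T_contraction.
  have ek0 : 0 <= e / (nrm p + nrm p' + 1) * k by rewrite mulr_ge0// ltW.
  have c1 := dot_cs_le P ek0 h1.
  have c2 : `|dot (T s p) (T (t - s) p' - P - k *: Q)| <= nrm p * (e / (nrm p + nrm p' + 1) * k).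
    apply: le_trans (cauchy_schwarz ip _ _) _; apply: ler_pM; rewrite ?nrm_ge0//.
  have c3 : e / (nrm p + nrm p' + 1) * k * nrm P <= e / (nrm p + nrm p' + 1) * k * nrm p' by rewrite ler_wpM2l.
  have c4 : (nrm p + nrm p') * (e / (nrm p + nrm p' + 1) * k) <= e * k.
    rewrite mulrA ler_wpM2r// mulrCA ger_pMr// ler_pdivrMr// mul1r lerDl//.
  rewrite -lerBlDl E1; apply: le_trans (ler_norm _) _; rewrite normrM sg1 mul1r.
  by apply: le_trans (ler_normB _ _) _; lra.
pose B x y := dot (T t x) y - dot x (T t y).
have BB a b : `|B a b| <= 2 * nrm a * nrm b.
  apply: le_trans (ler_normB _ _) _; have h1 := dot_cs_le b (nrm_ge0 dot a) (T_contraction a t0).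
  have h2 := cauchy_schwarz ip a (T t b).
  have h3 : nrm a * nrm (T t b) <= nrm a * nrm b by rewrite ler_wpM2l ?nrm_ge0// T_contraction.
  lra.
have B0 (b c : R) : 0 <= c -> (forall e, 0 < e -> `|b| <= c * e) -> b = 0.
  move=> c0 H; apply/eqP; rewrite -normr_le0; apply/ler_addgt0Pl => e e0; rewrite addr0.
  have c1 : 0 < c + 1 by rewrite ltr_wpDl.
  apply: le_trans (H _ (divr_gt0 e0 c1)) _.
  by rewrite mulrCA ger_pMr// ler_pdivrMr// mul1r lerDl.
have Bdom p q y' : Lr p q -> B p y' = 0.
  move=> Hp; apply: (B0 _ (2 * nrm p)) => [|e e0]; first by rewrite mulr_ge0 ?nrm_ge0.
  have [p' [q' [Hp' Hn]]] := Lr_dense y' e0.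
  have Bp : B p p' = 0.
    have := dom_case 1 _ _ _ _ (normr1 _) Hp Hp'; have := dom_case (-1) _ _ _ _ (normrN1 _) Hp Hp'.
    by rewrite /B; lra.
  have -> : B p y' = B p (y' - p') + B p p' by rewrite /B T_B// !(dotBr ip); ring.
  rewrite Bp addr0; apply: le_trans (BB _ _) _; rewrite ler_wpM2l ?mulr_ge0 ?nrm_ge0//.
  by rewrite (nrmC ip).
apply/eqP; rewrite -subr_eq0; apply/eqP; rewrite -/(B x y).
apply: (B0 _ (2 * nrm y)) => [|e e0]; first by rewrite mulr_ge0 ?nrm_ge0.
have [p [q [Hp Hn]]] := Lr_dense x e0.
have -> : B x y = B (x - p) y + B p y by rewrite /B T_B// !(dotBl ip); ring.
rewrite (Bdom _ _ _ Hp) addr0; apply: le_trans (BB _ _) _.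
by rewrite mulrAC ler_wpM2l ?mulr_ge0 ?nrm_ge0// (nrmC ip).
Qed.

Lemma Tint_sym t x y : 0 <= t -> dot (Tint t x) y = dot x (Tint t y).
Proof.
move=> t0; rewrite TintE// (dotC ip x) TintE//; apply: eq_Rintegral => s _.
by rewrite /orbit_dot T_sym// (dotC ip).
Qed.

End abstract_semigroup.

(* Bundled with its properties so that the classes below form a canonical lmodType. *)
Record posweight d (T : measurableType d) (R : realType) := Posweight {
  pw :> T -> R;
  pw_measurable : measurable_fun setT pw;
  pw_gt0 : forall x, 0 < pw x }.

(** * L^2 as a complete inner product space *)

Section L2_space.
Context d (T : measurableType d) (R : realType) (m : {measure set T -> \bar R}).
Variable r : posweight T R.
Let mr : measurable_fun setT r := pw_measurable r.
Let rpos : forall x, 0 < r x := pw_gt0 r.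
Let r0 x : 0 <= r x. Proof. exact: ltW. Qed.
Local Notation sq := (sqi m r).
Implicit Types f g h : T -> R.

Definition wdot f h : R := \int[m]_x (f x * h x * r x).

Lemma wdotC f h : wdot f h = wdot h f.
Proof. by apply: eq_Rintegral => x _; rewrite (mulrC (f x)). Qed.

Lemma wdot_lin (a : R) f g h : sq f -> sq g -> sq h ->
  wdot (fun x => a * f x + g x) h = a * wdot f h + wdot g h.
Proof.
move=> sf sg sh; have i1 := sqi_mul mr r0 sf sh; have i2 := sqi_mul mr r0 sg sh.
transitivity (\int[m]_x (a * (f x * h x * r x) + g x * h x * r x)).
  by apply: eq_Rintegral => x _; ring.
by rewrite IntD ?IntZ//; exact: rintZ.
Qed.

Lemma wdot_ae f g h : sq f -> sq g -> sq h -> (\forall x \ae m, f x = g x) -> wdot f h = wdot g h.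
Proof.
move=> sf sg sh fg; apply: Int_ae.
- exact: rint_measurable (sqi_mul mr r0 sf sh).
- exact: rint_measurable (sqi_mul mr r0 sg sh).
- by apply: aeS fg => x ->.
Qed.

Lemma wdot_ge0 f : 0 <= wdot f f.
Proof. by apply: Int_ge0 => x; rewrite mulr_ge0// -expr2 sqr_ge0. Qed.

Lemma wdot_eq0 f : sq f -> wdot f f = 0 -> \forall x \ae m, f x = 0.
Proof.
move=> sf f0; have := Int_eq0 (sqi_mul mr r0 sf sf).
move=> /(_ (aeW _ _) f0); set H := (X in (X -> _) -> _).
have h : H by move=> x; rewrite mulr_ge0// -expr2 sqr_ge0.
move=> /(_ h); apply: aeS => x /eqP; rewrite -expr2 mulf_eq0 (gt_eqF (rpos x)) orbF sqrf_eq0.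
by move/eqP.
Qed.

(** A class modulo almost everywhere equality is represented by the functional h -> <f, h>, which
    depends on f only up to null sets and determines it up to null sets. The vector space structure
    is then inherited from a space of functions, with no quotient to form. *)
Definition sq_functional f : (T -> R) -> R^o := fun h => if pselect (sq h) is left _ then wdot f h else 0.

Definition is_class : {pred (T -> R) -> R^o} := fun l => `[< exists2 f, sq f & l = sq_functional f >].

Lemma is_class_submod : submod_closed is_class.
Proof.
split.
  apply/asboolP; exists (fun=> 0); first exact: sqi0.
  apply/funext => h; rewrite /sq_functional; case: pselect => // sh.
  by rewrite /wdot (_ : (fun x => 0 * h x * r x) = (fun=> 0)) ?Int0//; apply/funext => x; rewrite !mul0r.
move=> a l l' /asboolP[f sf ->] /asboolP[g sg ->]; apply/asboolP.
exists (fun x => a * f x + g x); first by apply: sqiD => //; exact: sqiZ.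
apply/funext => h; rewrite /sq_functional /=.
have -> : (a *: (fun h0 : T -> R => if pselect (sq h0) is left _ then wdot f h0 else 0 : R^o) +
  (fun h0 => if pselect (sq h0) is left _ then wdot g h0 else 0)) h =
  a * (if pselect (sq h) is left _ then wdot f h else 0) + (if pselect (sq h) is left _ then wdot g h else 0) by [].
by case: pselect => sh; [rewrite wdot_lin|rewrite mulr0 addr0].
Qed.

HB.instance Definition _ := GRing.isSubmodClosed.Build R ((T -> R) -> R^o) is_class is_class_submod.

Definition L2class := {l : (T -> R) -> R^o | l \in is_class}.
HB.instance Definition _ := Choice.on L2class.
HB.instance Definition _ := SubType.on L2class.
HB.instance Definition _ := [SubChoice_isSubLmodule of L2class by <:].

Lemma class_repr (l : L2class) : exists2 f, sq f & sval l = sq_functional f.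
Proof. by have /asboolP := svalP l. Qed.

Definition repr (l : L2class) : T -> R := sval (cid2 (class_repr l)).

Lemma repr_sq l : sq (repr l).
Proof. by rewrite /repr; case: cid2. Qed.

Lemma reprE l : sval l = sq_functional (repr l).
Proof. by rewrite /repr; case: cid2. Qed.

Lemma sq_functional_class f : sq f -> sq_functional f \in is_class.
Proof. by move=> sf; apply/asboolP; exists f. Qed.

Definition cls f : L2class := 
  if pselect (sq f) is left sf then exist (fun l => l \in is_class) _ (sq_functional_class sf) else 0.

Definition ldot (l l' : L2class) : R := sval l (repr l').

Lemma cls_val f : sq f -> sval (cls f) = sq_functional f.
Proof. by move=> sf; rewrite /cls; case: pselect. Qed.

Lemma sq_functionalE f h : sq h -> sq_functional f h = wdot f h.
Proof. by move=> sh; rewrite /sq_functional; case: pselect. Qed.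

Lemma ldot_repr l l' : ldot l l' = wdot (repr l) (repr l').
Proof. by rewrite /ldot reprE sq_functionalE//; exact: repr_sq. Qed.

Lemma cls_repr l : cls (repr l) = l.
Proof. by apply: val_inj => /=; rewrite cls_val -?reprE//; exact: repr_sq. Qed.

Lemma ldot_clsl f l : sq f -> ldot (cls f) l = wdot f (repr l).
Proof. by move=> sf; rewrite /ldot cls_val// sq_functionalE//; exact: repr_sq. Qed.

Lemma ldot_cls f h : sq f -> sq h -> ldot (cls f) (cls h) = wdot f h.
Proof.
move=> sf sh; rewrite ldot_clsl// wdotC -(sq_functionalE _ sf) -reprE cls_val// sq_functionalE//.
exact: wdotC.
Qed.

Lemma cls_lin a f g : sq f -> sq g -> cls (fun x => a * f x + g x) = a *: cls f + cls g.
Proof.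
move=> sf sg; have sfg : sq (fun x => a * f x + g x) by apply: sqiD => //; exact: sqiZ.
apply: val_inj => /=; rewrite cls_val//; apply/funext => h.
rewrite [RHS](_ : _ = a * sval (cls f) h + sval (cls g) h)//.
rewrite !cls_val// /sq_functional; case: pselect => sh; first by rewrite wdot_lin.
by rewrite mulr0 addr0.
Qed.

Lemma repr_cls f : sq f -> \forall x \ae m, repr (cls f) x = f x.
Proof.
move=> sf; have sr := repr_sq (cls f); have sB := sqiB mr r0 sr sf.
have : wdot (fun x => repr (cls f) x - f x) (fun x => repr (cls f) x - f x) = 0.
  have E : (fun x => repr (cls f) x - f x) = (fun x => -1 * f x + repr (cls f) x) by apply/funext => x; ring.
  rewrite {1}E wdot_lin//.
  have -> : wdot (repr (cls f)) (fun x => repr (cls f) x - f x) = wdot f (fun x => repr (cls f) x - f x).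
    by rewrite -(sq_functionalE _ sB) -reprE cls_val// sq_functionalE.
  by rewrite mulN1r addNr.
by move=> /(wdot_eq0 sB); apply: aeS => x /eqP; rewrite subr_eq0 => /eqP.
Qed.

Lemma cls_eq f g : sq f -> sq g -> (\forall x \ae m, f x = g x) -> cls f = cls g.
Proof.
move=> sf sg fg; apply: val_inj => /=; rewrite !cls_val//; apply/funext => h.
by rewrite /sq_functional; case: pselect => // sh; exact: wdot_ae.
Qed.

Lemma cls_inj f g : sq f -> sq g -> cls f = cls g -> \forall x \ae m, f x = g x.
Proof.
move=> sf sg fg; have := repr_cls sf; have := repr_cls sg; rewrite fg.
by apply: aeS2 => x -> ->.
Qed.

Lemma ldot_ip : inner_product ldot.
Proof.
split.
- by move=> l l'; rewrite !ldot_repr wdotC.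
- by move=> x y z; rewrite /ldot.
- by move=> a x z; rewrite /ldot.
- move=> l l0; rewrite ldot_repr lt_def wdot_ge0 andbT; apply: contra l0 => /eqP H.
  have sr := repr_sq l; rewrite -(cls_repr l); apply/eqP; apply: val_inj => /=.
  rewrite cls_val//; apply/funext => h; rewrite /sq_functional; case: pselect => // sh.
  rewrite (@wdot_ae _ (fun=> 0))//; last 2 first.
  + exact: sqi0.
  + exact: wdot_eq0 sr H.
  rewrite /wdot (_ : (fun x => 0 * h x * r x) = (fun=> 0)) ?Int0//.
  by apply/funext => x; rewrite !mul0r.
Qed.

Lemma nrm_cls f : sq f -> nrm ldot (cls f) = Num.sqrt (\int[m]_x (f x ^+ 2 * r x)).
Proof. by move=> sf; rewrite /nrm ldot_cls. Qed.

Lemma cls_B f g : sq f -> sq g -> cls (fun x => f x - g x) = cls f - cls g.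
Proof.
move=> sf sg; have -> : (fun x => f x - g x) = (fun x => -1 * g x + f x) by apply/funext => x; ring.
by rewrite cls_lin// scaleN1r addrC.
Qed.

(** Riesz-Fischer: fast increments make the representatives converge almost everywhere, and Fatou's
    lemma turns this into convergence in norm. *)
Lemma L2_complete : complete_ip ldot.
Proof.
move=> l_ Hl; pose f k := repr (l_ k).
have sf k : sq (f k) by exact: repr_sq.
have sB k j : sq (fun x => f k x - f j x) by exact: sqiB.
have nB k j : nrm ldot (l_ k - l_ j) ^+ 2 = \int[m]_x ((f k x - f j x) ^+ 2 * r x).
  have -> : l_ k - l_ j = cls (fun x => f k x - f j x) by rewrite cls_B// /f !cls_repr.
  rewrite nrm_cls// sqr_sqrtr//.
  by apply: Int_ge0 => x; rewrite mulr_ge0 ?sqr_ge0.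
(* The weighted squares of the increments integrate to at most 4^-k; the factor 2^k leaves them
   summable and is strong enough to bound the increments pointwise. *)
pose D k x := 2 ^+ k * ((f k.+1 x - f k x) ^+ 2 * r x).
have D0 k x : 0 <= D k x by rewrite mulr_ge0 ?exprn_ge0// mulr_ge0 ?sqr_ge0.
have rD k : rint m (D k) by apply: rintZ; exact: (sqi_rint mr r0 (sB k.+1 k)).
have ID k : (\int[m]_x (D k x)%:E <= (2^-1 ^+ k)%:E)%E.
  rewrite -(rint_EFin (rD k)) lee_fin IntZ; last exact: (sqi_rint mr r0 (sB k.+1 k)).
  rewrite -nB; have := Hl k; rewrite -(ler_sqr (nrm_ge0 _ _)) ?nnegrE ?exprn_ge0 ?invr_ge0// => H.
  have h2 : (0 : R) <= 2 ^+ k by rewrite exprn_ge0.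
  apply: le_trans (ler_wpM2l h2 H) _.
  by rewrite expr2 mulrA -exprMn divff ?pnatr_eq0// expr1n mul1r.
have cvg_f : \forall x \ae m, cvgn (fun k => f k x).
  have mD k : measurable_fun setT (EFin \o D k) by apply/measurable_EFinP; exact: rint_measurable.
  have IS : (\int[m]_x (\sum_(0 <= k <oo) (D k x)%:E) < +oo)%E.
    rewrite (integral_nneseries _ measurableT)//; last by move=> k x _; rewrite lee_fin.
    apply: (@le_lt_trans _ _ (\sum_(0 <= k <oo) (2^-1 ^+ k)%:E)%E).
      by apply: lee_nneseries => k *; first [exact: ID|apply: integral_ge0 => x _; rewrite lee_fin].
    apply: (@le_lt_trans _ _ 2%:E); last exact: ltry.
    apply: lime_le; first by apply: is_cvg_nneseries => k _ _; rewrite lee_fin exprn_ge0// invr_ge0.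
    apply: nearW => j; rewrite sumEFin lee_fin.
    have -> : \sum_(0 <= k < j) 2^-1 ^+ k = 2 * (1 - 2^-1 ^+ j) :> R.
      elim: j => [|j ih]; first by rewrite big_nil expr0 subrr mulr0.
      by rewrite big_nat_recr//= ih exprS; field.
    by rewrite ger_pMr// gerBl exprn_ge0// invr_ge0.
  have mS : measurable_fun setT (fun x => \sum_(0 <= k <oo) (D k x)%:E)%E.
    by apply: ge0_emeasurable_sum => k *; [rewrite lee_fin|exact: mD].
  have S0 x : (0 <= \sum_(0 <= k <oo) (D k x)%:E)%E by apply: nneseries_ge0 => k _ _; rewrite lee_fin.
  have iS : m.-integrable setT (fun x => \sum_(0 <= k <oo) (D k x)%:E)%E.
    by apply/integrableP; split=> //; under eq_integral do rewrite gee0_abs//.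
  have := integrable_ae measurableT iS; apply: aeS => x /(_ I) Sx.
  pose C := fine (\sum_(0 <= k <oo) (D k x)%:E)%E.
  have SC j : \sum_(0 <= k < j) D k x <= C.
    rewrite -lee_fin -sumEFin /C fineK//; apply: nneseries_lim_ge => k _ _; by rewrite lee_fin.
  pose dk k := f k.+1 x - f k x.
  (* This is a <= 2^-k + 2^k a^2, so summability of the D_k at a point gives absolute convergence of
     the increments there. *)
  have dkb k : `|dk k| <= 2^-1 ^+ k + (r x)^-1 * D k x.
    have q0 : (0 : R) < 2 ^+ k by rewrite exprn_gt0.
    have -> : (r x)^-1 * D k x = 2 ^+ k * dk k ^+ 2 by rewrite /D /dk; field; rewrite gt_eqF.
    rewrite exprVn -(real_normK (num_real (dk k))) -(ler_pM2l q0) mulrDr divff ?gt_eqF//.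
    have := sqr_ge0 (2 ^+ k * `|dk k| - 1); have := mulr_ge0 (ltW q0) (normr_ge0 (dk k)); nra.
  have : cvgn [normed series dk].
    have sE j : [normed series dk] j = \sum_(0 <= k < j) `|dk k| by [].
    apply: nondecreasing_is_cvgn.
      by apply/nondecreasing_seqP => j; rewrite !sE big_nat_recr//= lerDl.
    exists (2 + (r x)^-1 * C) => _ [j _ <-]; rewrite sE.
    apply: (le_trans (ler_sum _ (fun k _ => dkb k))); rewrite big_split /= -mulr_sumr lerD//.
      have -> : \sum_(0 <= k < j) 2^-1 ^+ k = 2 * (1 - 2^-1 ^+ j) :> R.
        elim: j => [|j ih]; first by rewrite big_nil expr0 subrr mulr0.
        by rewrite big_nat_recr//= ih exprS; field.
      by rewrite ger_pMr// gerBl exprn_ge0// invr_ge0.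
    by rewrite ler_wpM2l ?invr_ge0.
  move=> /normed_cvg/cvg_ex[/= l Hl'].
  apply/cvg_ex; exists (f 0 x + l).
  have -> : (fun k => f k x) = (fun k => f 0 x + series dk k).
    apply/funext => k; rewrite /series /= /dk telescope_sumr// addrC subrK//.
  by apply: cvgD => //; exact: cvg_cst.
have mf k : measurable_fun setT (f k) by exact: (sf k).1.
(* The upper limit is measurable everywhere and agrees with the limit wherever the sequence
   converges. *)
pose F x := fine (limn_esup (fun k => (f k x)%:E)).
have mF : measurable_fun setT F.
  apply: (measurableT_comp (fine_measurable measurableT)).
  by apply: measurable_fun_limn_esup => k; exact/measurable_EFinP.
have fF : \forall x \ae m, f k x @[k --> \oo] --> F x.
  apply: aeS cvg_f => x /cvg_ex[/= l Hl'].
  have cl : (f k x)%:E @[k --> \oo] --> l%:E by apply: cvg_EFin => //; exact: nearW.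
  by rewrite /F (cvg_limn_einf_sup cl).2.
have tail k j : nrm ldot (l_ (k + j)%N - l_ k) <= 2 * 2^-1 ^+ k.
  suff : nrm ldot (l_ (k + j)%N - l_ k) <= 2 * (1 - 2^-1 ^+ j) * 2^-1 ^+ k.
    move=> /le_trans; apply.
    have q0 i : 0 <= (2^-1 ^+ i : R) by rewrite exprn_ge0// invr_ge0.
    by have := q0 k; have := q0 j; nra.
  elim: j => [|j ih]; first by rewrite addn0 subrr (nrm0 ldot_ip) expr0 subrr mulr0 !mul0r.
  rewrite addnS; apply: le_trans (nrm_tri ldot_ip (l_ (k + j)%N) _ _) _.
  apply: le_trans (lerD (Hl _) ih) _; rewrite exprD exprS.
  by rewrite le_eqVlt; apply/orP; left; apply/eqP; field.
have key k : (\int[m]_x ((F x - f k x) ^+ 2 * r x)%:E <= ((2 * 2^-1 ^+ k) ^+ 2)%:E)%E.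
  pose g j x := ((f (k + j)%N x - f k x) ^+ 2 * r x)%:E.
  have mg j : measurable_fun setT (g j).
    by apply/measurable_EFinP; exact: rint_measurable (sqi_rint mr r0 (sB (k + j)%N k)).
  have g0 j x : [set: T] x -> (0 <= g j x)%E by move=> _; rewrite lee_fin mulr_ge0 ?sqr_ge0.
  have -> : (\int[m]_x ((F x - f k x) ^+ 2 * r x)%:E = \int[m]_x limn_einf (g ^~ x))%E.
    apply: ae_eq_integral => //.
    - apply/measurable_EFinP; apply: measurable_funM => //; apply: measurable_funX.
      exact: measurable_funB.
    - rewrite /limn_einf; apply: measurableT_comp; first exact: oppe_measurable.
      by apply: measurable_fun_limn_esup => j; apply: measurableT_comp; [exact: oppe_measurable|exact: mg].
    - apply: aeS fF => x Fx _.
      have cg : g j x @[j --> \oo] --> ((F x - f k x) ^+ 2 * r x)%:E.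
        apply: cvg_EFin; first exact: nearW.
        have cf : f (k + j)%N x @[j --> \oo] --> F x.
          by have := Fx; rewrite -(cvg_shiftn k); under eq_fun do rewrite addnC.
        have cB : f (k + j)%N x - f k x @[j --> \oo] --> F x - f k x by apply: cvgB => //; exact: cvg_cst.
        by apply: cvgM; [exact: (cvgM cB cB)|exact: cvg_cst].
      by rewrite (cvg_limn_einf_sup cg).1.
  apply: le_trans (fatou m measurableT mg g0) _.
  rewrite limn_einf_lim; apply: lime_le; first exact: is_cvg_einfs.
  apply: nearW => j; apply: (@le_trans _ _ (\int[m]_x g j x)%E).
    by apply: ereal_inf_lbound; exists j => /=.
  rewrite /g -(rint_EFin (sqi_rint mr r0 (sB _ _))) lee_fin -nB.
  have q0 : (0 : R) <= 2 * 2^-1 ^+ k by rewrite mulr_ge0// exprn_ge0// invr_ge0.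
  by rewrite ler_sqr ?nnegrE ?nrm_ge0//; exact: tail.
have sFk k : sq (fun x => F x - f k x).
  by split; [exact: measurable_funB|apply: le_lt_trans (key k) _; exact: ltry].
have sF : sq F.
  have := sqiD mr r0 (sFk 0%N) (sf 0%N); congr (sqi _ _ _).
  by apply/funext => x; rewrite subrK.
exists (cls F) => e e0.
have [N HN] : exists N, forall k, (N <= k)%N -> (2^-1 ^+ k : R) <= e / 2.
  have : (2^-1 ^+ k : R) @[k --> \oo] --> (0 : R).
    by apply: cvg_expr; rewrite ger0_norm ?invr_ge0// invf_lt1// ltr1n.
  move=> /cvgrPdist_le/(_ _ (divr_gt0 e0 (ltr0Sn _ 1)))[N _ HN]; exists N => k Nk; have := HN k Nk.
  by rewrite sub0r normrN ger0_norm// exprn_ge0// invr_ge0.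
exists N => k Nk; rewrite (nrmC ldot_ip).
have -> : cls F - l_ k = cls (fun x => F x - f k x) by rewrite cls_B// /f !cls_repr.
have q0 : (0 : R) <= 2 * 2^-1 ^+ k by rewrite mulr_ge0// exprn_ge0// invr_ge0.
rewrite nrm_cls//; apply: (@le_trans _ _ (2 * 2^-1 ^+ k)); last by have := HN k Nk; lra.
rewrite -[leRHS]ger0_norm// -sqrtr_sqr ler_wsqrtr//.
by rewrite -lee_fin (rint_EFin (sqi_rint mr r0 (sFk k))); exact: key.
Qed.

End L2_space.

Lemma cvg_right0 {R : realType} (F : R -> \bar R) (g : R -> R) :
  (forall t, 0 < t -> F t = (g t)%:E) -> (forall t, 0 <= g t) ->
  (F t @[t --> 0^'+] --> 0%E) <->
  (forall e, 0 < e -> exists2 dl, 0 < dl & forall t, 0 < t -> t < dl -> g t <= e).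
Proof.
move=> Fg g0; have E : F t @[t --> (0:R)^'+] = (g t)%:E @[t --> (0:R)^'+].
  apply/seteqP; split=> S /= [e e0 H]; exists e => // t /= te t0.
    by rewrite -Fg//; exact: H.
  by rewrite Fg//; exact: H.
rewrite E; split=> [H e e0|H].
  have : (fine \o (fun t => (g t)%:E)) t @[t --> (0:R)^'+] --> (0 : R) by apply: fine_cvg; exact: H.
  move=> /cvgrPdist_le/(_ _ e0)[dl /= dl0 Hd]; exists dl => // t t0 td.
  have := Hd t; rewrite /= sub0r normrN gtr0_norm// => /(_ td t0).
  by rewrite sub0r normrN ger0_norm.
apply: cvg_EFin; first exact: nearW.
apply/cvgrPdist_le => e e0; have [dl dl0 Hd] := H e e0; exists dl => // t /=.
rewrite sub0r normrN => td t0; rewrite sub0r normrN ger0_norm//; apply: Hd => //.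
by rewrite gtr0_norm in td.
Qed.

(** * The semigroup and the resolvent on L^2(M, rho mu) *)

Section weighted_semigroup.
Context {R : realType} {n : nat} {M : ptopologicalType} (A : weighted R n M).
Implicit Types (f h u v : M -> R).
Local Notation smth := (msmooth A setT).
Variables (rho V : M -> R).
Hypotheses (srho : smth rho) (sV : smth V) (rho0 : forall x, 0 < rho x) (V0 : forall x, 0 <= V x).
Variables (T G : R -> (M -> R) -> M -> R).
Hypotheses (TP : is_semigroup A rho V T) (GP : is_resolvent A rho V G).
Local Notation LL := (L2 A rho).
Local Notation schr := (schrodinger A rho V).

Definition rho_weight := @Posweight _ (borel M) R rho (smth_measurable srho) rho0.
Local Notation r := rho_weight.
Local Notation C := (@cls _ (borel M) R (mu A) r).
Local Notation E := (L2class (mu A) r).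
Local Notation ld := (@ldot _ (borel M) R (mu A) r).
Local Notation nrm := (nrm ld).
Let ip : inner_product ld := ldot_ip (mu A) r.
Let cip : complete_ip ld := @L2_complete _ (borel M) R (mu A) r.

Lemma LL_repr (l : E) : LL (repr l). Proof. exact: repr_sq. Qed.

Lemma LLZ (a : R) f : LL f -> LL (fun x => a * f x). Proof. exact: L2Z. Qed.
Lemma LLD f h : LL f -> LL h -> LL (fun x => f x + h x). Proof. exact: L2D. Qed.
Lemma LLB f h : LL f -> LL h -> LL (fun x => f x - h x). Proof. exact: L2B. Qed.
Lemma LL_le f h : measurable_fun [set: borel M] f -> (forall x, `|f x| <= `|h x|) -> LL h -> LL f.
Proof. exact: (@sqi_le _ (borel M) R (mu A) rho (smth_measurable srho) (fun x => ltW (rho0 x))). Qed.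

Lemma C_lin (a : R) f h : LL f -> LL h -> C (fun x => a * f x + h x) = a *: C f + C h.
Proof. by move=> Lf Lh; exact: (@cls_lin _ (borel M) R (mu A) r a f h Lf Lh). Qed.
Lemma LL0 : LL (fun=> 0).
Proof. exact: (@sqi0 _ (borel M) R (mu A) rho (fun x => ltW (rho0 x))). Qed.
Lemma C_0 : C (fun=> 0) = 0.
Proof.
have := C_lin 1 LL0 LL0; rewrite (_ : (fun x => _) = (fun=> 0)); last by apply/funext => x; rewrite mulr0 addr0.
by rewrite scale1r -[LHS]addr0 => /addrI/esym.
Qed.
Lemma C_Z (a : R) f : LL f -> C (fun x => a * f x) = a *: C f.
Proof.
move=> Lf; have := C_lin a Lf LL0; rewrite C_0 addr0 => <-; congr (cls _ _ _).
by apply/funext => x; rewrite addr0.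
Qed.
Lemma C_B f h : LL f -> LL h -> C (fun x => f x - h x) = C f - C h.
Proof. by move=> Lf Lh; exact: (@cls_B _ (borel M) R (mu A) r f h Lf Lh). Qed.
Lemma C_D f h : LL f -> LL h -> C (fun x => f x + h x) = C f + C h.
Proof. by move=> Lf Lh; have := C_lin 1 Lf Lh; rewrite scale1r; under eq_fun do rewrite mul1r. Qed.
Lemma C_eq f h : LL f -> LL h -> (\forall x \ae mu A, f x = h x) -> C f = C h.
Proof. by move=> Lf Lh; exact: (@cls_eq _ (borel M) R (mu A) r f h Lf Lh). Qed.
Lemma C_inj f h : LL f -> LL h -> C f = C h -> \forall x \ae mu A, f x = h x.
Proof. by move=> Lf Lh; exact: (@cls_inj _ (borel M) R (mu A) r f h Lf Lh). Qed.
Lemma C_dot f h : LL f -> LL h -> ld (C f) (C h) = L2dot A rho f h.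
Proof. by move=> Lf Lh; exact: (@ldot_cls _ (borel M) R (mu A) r f h Lf Lh). Qed.
Lemma C_repr (l : E) : C (repr l) = l. Proof. exact: cls_repr. Qed.
Lemma repr_C f : LL f -> \forall x \ae mu A, repr (C f) x = f x.
Proof. by move=> Lf; exact: (@repr_cls _ (borel M) R (mu A) r f Lf). Qed.

Lemma L2norm_nrm f : LL f -> L2norm A rho f = (nrm (C f))%:E.
Proof.
move=> Lf; rewrite /L2norm.
have i := @sqi_rint _ (borel M) R (mu A) rho (smth_measurable srho) (fun x => ltW (rho0 x)) _ Lf.
by rewrite -(rint_EFin i) (@nrm_cls _ (borel M) R (mu A) r f Lf).
Qed.

(** The axioms let [T t] act on functions without saying directly that null sets are respected;
    boundedness applied to the difference gives this. *)
Lemma T_ae t f h : 0 <= t -> LL f -> LL h -> (\forall x \ae mu A, f x = h x) ->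
  \forall x \ae mu A, T t f x = T t h x.
Proof.
move=> t0 Lf Lh fh; have LT g Lg := @semigroup_L2 _ _ _ _ _ _ _ TP t g t0 Lg.
have [K HK] := semigroup_bounded TP t0.
have LB := LLB Lf Lh; have := HK _ LB; rewrite !L2norm_nrm//; last exact: LT.
have -> : C (fun x => f x - h x) = 0 by rewrite C_B// (C_eq Lf Lh fh) subrr.
rewrite (nrm0 ip) mule0 lee_fin => /(nrm_eq0 ip) CT.
have Tl := semigroup_linear TP (-1) t0 Lh Lf.
have E : (fun x => f x - h x) = (fun x => -1 * h x + f x) by apply/funext => x; ring.
have L0 := LL0.
have T0 : \forall x \ae mu A, T t (fun x => f x - h x) x = 0.
  apply: (C_inj (LT _ LB) L0); rewrite CT; have := C_Z 0 Lf; rewrite scale0r.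
  by under eq_fun do rewrite mul0r.
rewrite E in T0; apply: aeS2 T0 Tl => x -> /esym/eqP; rewrite mulN1r addrC subr_eq0 => /eqP.
by [].
Qed.

Definition Tl t (l : E) : E := C (T t (repr l)).
(** This is (1 - h L)^-1, written through G_alpha with alpha = 1/h. *)
Definition Jl (h : R) (l : E) : E := C (fun x => h^-1 * G h^-1 (repr l) x).
(** Taken to be the generator of the semigroup on classes, so that the corresponding axiom holds by
    definition; [Lop_Lr] identifies it with the operator of the form. *)
Definition Lrl (x y : E) := forall e, 0 < e -> exists2 dl, 0 < dl &
    forall t, 0 < t -> t < dl -> nrm (t^-1 *: (Tl t x - x) - y) <= e.

Lemma LT t f : 0 <= t -> LL f -> LL (T t f).
Proof. by move=> t0; exact: (semigroup_L2 TP t0). Qed.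

Lemma Tl_C t f : 0 <= t -> LL f -> Tl t (C f) = C (T t f).
Proof.
move=> t0 Lf; have Lr := LL_repr (C f); apply: C_eq; [exact: LT|exact: LT|].
by apply: T_ae => //; exact: repr_C.
Qed.

Lemma sg_ax : semigroup_ax ld Tl Lrl.
Proof.
split=> //.
- move=> t a x y t0; have Lx := LL_repr x; have Ly := LL_repr y.
  rewrite -{1}(C_repr x) -{1}(C_repr y) -C_lin// Tl_C//; last by apply: LLD => //; exact: LLZ.
  rewrite /Tl -C_lin; [|exact: LT|exact: LT]; apply: C_eq.
  + by apply: LT => //; apply: LLD => //; exact: LLZ.
  + by apply: LLD; [apply: LLZ|]; exact: LT.
  + exact: (semigroup_linear TP).
- move=> t t0; have [K HK] := semigroup_bounded TP t0; exists K => x.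
  have Lx := LL_repr x; have := HK _ Lx; rewrite !L2norm_nrm//; last exact: LT.
  by rewrite C_repr -EFinM lee_fin.
- move=> x; have Lx := LL_repr x; rewrite -[RHS]C_repr; apply: C_eq => //; first exact: LT.
  exact: (semigroup0 TP).
- move=> s t x s0 t0; have Lx := LL_repr x; rewrite -{2}(C_repr x) Tl_C// Tl_C//; last exact: LT.
  apply: C_eq; [by apply: LT => //; exact: addr_ge0|by apply: LT => //; exact: LT|].
  exact: (semigroupD TP).
- move=> x; have Lx := LL_repr x; have := semigroup_continuous TP Lx.
  move=> /(cvg_right0 (g := fun t => nrm (Tl t x - x))); apply.
    by move=> t t0; rewrite L2norm_nrm ?C_B ?C_repr//; [exact: LT (ltW t0) Lx|apply: LLB => //; exact: LT (ltW t0) Lx].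
  by move=> t; exact: nrm_ge0.
Qed.

Lemma Lop_Lr f u : LL f -> LL u -> Lop A rho V f u <-> Lrl (C f) (C u).
Proof.
move=> Lf Lu; rewrite -(semigroup_generator TP Lf Lu).
apply: (cvg_right0 (g := fun t => nrm (t^-1 *: (Tl t (C f) - C f) - C u))) => [t t0|t]; last exact: nrm_ge0.
have LTf := LT (ltW t0) Lf; have LB := LLB LTf Lf; have LZ := LLZ t^-1 LB.
by rewrite (L2norm_nrm (LLB LZ Lu)) (C_B LZ Lu) (C_Z _ LB) (C_B LTf Lf) (Tl_C (ltW t0) Lf).
Qed.

Lemma Lop_L2 f u : Lop A rho V f u -> LL f /\ LL u.
Proof. by move=> [[[Lf _] _] Lu _]; split=> //; exact: (L2_sub srho sV rho0 V0 Lf). Qed.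

Lemma Lop_lin (a : R) f u f' u' : Lop A rho V f u -> Lop A rho V f' u' ->
  Lop A rho V (fun x => a * f x + f' x) (fun x => a * u x + u' x).
Proof.
move=> Hf Hf'; have [Lf Lu] := Lop_L2 Hf; have [Lf' Lu'] := Lop_L2 Hf'.
apply/(Lop_Lr (LLD (LLZ a Lf) Lf') (LLD (LLZ a Lu) Lu')); rewrite !C_lin//.
by apply: (Lr_lin ip sg_ax a); apply/Lop_Lr.
Qed.

Lemma Lop_Z (a : R) f u : Lop A rho V f u -> Lop A rho V (fun x => a * f x) (fun x => a * u x).
Proof.
move=> Hf; have [Lf Lu] := Lop_L2 Hf; apply/(Lop_Lr (LLZ a Lf) (LLZ a Lu)); rewrite !C_Z//.
by apply: (Lr_Z ip sg_ax a); apply/Lop_Lr.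
Qed.

Lemma Lop_W10 (l l' : E) : Lrl l l' -> Lop A rho V (repr l) (repr l').
Proof. by move=> H; apply/(Lop_Lr (LL_repr l) (LL_repr l')); rewrite !C_repr. Qed.

Lemma Jf_prop (al : R) f : 0 < al -> LL f -> exists2 u, Lop A rho V (G al f) u &
  (\forall x \ae mu A, al * G al f x - u x = f x).
Proof. by move=> al0 Lf; exact: GP. Qed.

(** Dissipativity is nonnegativity of the form Q, and symmetry of L is symmetry of Q. *)
Lemma rs_ax : resolvent_ax ld Lrl Jl.
Proof.
split.
- move=> h x h0; have hV : 0 < h^-1 by rewrite invr_gt0.
  have Lx := LL_repr x; have [u Hu Eu] := Jf_prop hV Lx; have [LG Lu] := Lop_L2 Hu.
  exists (C (fun y => h^-1 * u y)); first by apply/Lop_Lr; [exact: LLZ|exact: LLZ|exact: Lop_Z].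
  rewrite /Jl (C_Z _ Lu) scalerA divff ?gt_eqF// scale1r -C_B//; last exact: LLZ.
  by rewrite -[RHS]C_repr; apply: C_eq => //; apply: LLB => //; exact: LLZ.
- move=> x y /Lop_W10[Wx Ly HQ]; rewrite (ldot_repr x y) wdotC.
  have -> : wdot (mu A) r (repr y) (repr x) = - Qform A V (repr x) (repr x) by rewrite (HQ _ Wx) opprK.
  rewrite oppr_le0 /Qform addr_ge0//; first by apply: Int_ge0 => z; exact: inner_ge0.
  by apply: Int_ge0 => z; rewrite mulr_ge0// -expr2 sqr_ge0.
- move=> x y x' y' /Lop_W10[Wx Ly HQ] /Lop_W10[Wx' Ly' HQ'].
  rewrite (ldot_repr y x') (ldot_repr x y') (@wdotC _ (borel M) R (mu A) r (repr x)).
  have h1 := HQ _ Wx'; have h2 := HQ' _ Wx; rewrite QformC h2 in h1.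
  exact: esym (oppr_inj h1).
Qed.

Local Notation Ti := (Tint ip cip sg_ax).
Local Notation It := (time_integral A rho T).

Lemma L2dotC f h : L2dot A rho f h = L2dot A rho h f. Proof. exact: (@wdotC _ (borel M) R (mu A) r). Qed.

(** [time_integral] is a choice among the L^2 functions that represent the weak integral; the
    abstract integral of the orbit shows that there is one. *)
Lemma It_spec t f : 0 <= t -> LL f -> LL (It t f) /\ forall h, LL h ->
    L2dot A rho (It t f) h = \int[@lebesgue_measure R]_(s in `[0, t]) L2dot A rho (T s f) h.
Proof.
move=> t0 Lf; pose P : set (M -> R) := [set u | LL u /\ forall h, LL h ->
  L2dot A rho u h = \int[@lebesgue_measure R]_(s in `[0, t]) L2dot A rho (T s f) h].
suff ex : exists u, P u by exact: (xgetPex (cst 0) ex).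
exists (repr (Ti t (C f))); split=> [|h Lh]; first exact: LL_repr.
 rewrite -(C_dot (LL_repr _) Lh) C_repr (TintE ip cip sg_ax)//; apply: eq_Rintegral => s.
rewrite inE/= in_itv/= => /andP[s0 st].
by rewrite /orbit_dot ger0_norm// Tl_C// C_dot//; exact: LT.
Qed.

Lemma LIt t f : 0 <= t -> LL f -> LL (It t f).
Proof. by move=> t0 Lf; case: (It_spec t0 Lf). Qed.

Lemma It_C t f : 0 <= t -> LL f -> C (It t f) = Ti t (C f).
Proof.
move=> t0 Lf; apply: (dot_ext ip) => l; have [LI HI] := It_spec t0 Lf.
rewrite -(C_repr l) (C_dot LI (LL_repr l)) HI; last exact: LL_repr.
rewrite (TintE ip cip sg_ax)//; apply: eq_Rintegral => s; rewrite inE/= in_itv/= => /andP[s0 st].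
by rewrite /orbit_dot ger0_norm// Tl_C// C_dot//; [exact: LT|exact: LL_repr].
Qed.

Lemma T_symm t f h : 0 <= t -> LL f -> LL h -> L2dot A rho (T t f) h = L2dot A rho f (T t h).
Proof.
move=> t0 Lf Lh; rewrite -(C_dot (LT t0 Lf) Lh) -(C_dot Lf (LT t0 Lh)) -!Tl_C//.
exact: (T_sym ip cip sg_ax rs_ax).
Qed.

Lemma It_symm t f h : 0 <= t -> LL f -> LL h -> L2dot A rho (It t f) h = L2dot A rho f (It t h).
Proof.
move=> t0 Lf Lh; have E1 := C_dot (LIt t0 Lf) Lh; have E2 := C_dot Lf (LIt t0 Lh).
rewrite (It_C t0 Lf) in E1; rewrite (It_C t0 Lh) in E2.
exact: etrans (esym E1) (etrans (Tint_sym ip cip sg_ax rs_ax _ _ t0) E2).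
Qed.

Lemma T_Lop t f u : 0 <= t -> Lop A rho V f u -> \forall x \ae mu A, T t f x - f x = It t u x.
Proof.
move=> t0 H; have [Lf Lu] := Lop_L2 H; have LTf := LT t0 Lf; have LIu := LIt t0 Lu.
apply: (C_inj (LLB LTf Lf) LIu); rewrite C_B// It_C// -Tl_C//.
by apply: (Tint_Lr ip cip sg_ax t0); apply/Lop_Lr.
Qed.

Lemma It_avg f h e : LL f -> LL h -> 0 < e -> exists2 dl, 0 < dl &
  forall k, 0 <= k -> k < dl -> `|L2dot A rho (It k f) h - k * L2dot A rho f h| <= e * k.
Proof.
move=> Lf Lh e0; have N1 : 0 < nrm (C h) + 1 by rewrite ltr_wpDl ?nrm_ge0.
have [dl dl0 Hd] := Tint_avg ip cip sg_ax (C f) (divr_gt0 e0 N1); exists dl => // k k0 kd.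
rewrite -(C_dot (LIt k0 Lf) Lh) -(C_dot Lf Lh) It_C// -(dotZl ip) -(dotBl ip).
apply: le_trans (cauchy_schwarz ip _ _) _.
apply: le_trans (ler_wpM2r (nrm_ge0 _ _) (Hd k k0 kd)) _.
rewrite mulrAC ler_wpM2r// -mulrA ger_pMr// mulrC ler_pdivrMr// mul1r lerDl//.
Qed.

Lemma T_dot_cont f h : LL f -> LL h -> continuous (fun s : R => L2dot A rho (T `|s| f) h).
Proof.
move=> Lf Lh; have : continuous (orbit_dot ld Tl (C f) (C h)) by exact: (orbit_dot_cont ip cip sg_ax).
rewrite (_ : orbit_dot _ _ _ _ = (fun s : R => L2dot A rho (T `|s| f) h))//.
by apply/funext => s; rewrite /orbit_dot Tl_C// C_dot//; exact: LT.
Qed.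

Definition Jf (h : R) f : M -> R := fun x => h^-1 * G h^-1 f x.

Lemma LG al f : 0 < al -> LL f -> LL (G al f).
Proof. by move=> al0 Lf; have [u Hu _] := Jf_prop al0 Lf; case: (Lop_L2 Hu). Qed.

Lemma LJf (h : R) f : 0 < h -> LL f -> LL (Jf h f).
Proof. by move=> h0 Lf; apply: LLZ; apply: LG => //; rewrite invr_gt0. Qed.

Lemma Jf_C (h : R) f : 0 < h -> LL f -> C (Jf h f) = Jl h (C f).
Proof.
move=> h0 Lf; have hV : 0 < h^-1 by rewrite invr_gt0.
have [u Hu Eu] := Jf_prop hV Lf; have [LGf Lu] := Lop_L2 Hu.
have Z : Lrl (C (Jf h f)) (C (fun y => h^-1 * u y)).
  by apply/Lop_Lr; [exact: LJf|exact: LLZ|exact: Lop_Z].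
rewrite (J_unique ip sg_ax rs_ax h0 Z); congr (Jl h _).
rewrite (C_Z _ Lu) scalerA divff ?gt_eqF// scale1r -C_B//; last exact: LJf.
by apply: C_eq => //; apply: LLB => //; exact: LJf.
Qed.

Lemma G_symm al f h : 0 < al -> LL f -> LL h -> L2dot A rho (G al f) h = L2dot A rho f (G al h).
Proof.
move=> al0 Lf Lh; have [u Hu Eu] := Jf_prop al0 Lf; have [v Hv Ev] := Jf_prop al0 Lh.
have [LGf Lu] := Lop_L2 Hu; have [LGh Lv] := Lop_L2 Hv.
have Ef : C f = al *: C (G al f) - C u.
  by rewrite -C_Z// -C_B//; [apply: C_eq => //; [apply: LLB => //; exact: LLZ|apply: aeS Eu => x ->]|exact: LLZ].
have Eh : C h = al *: C (G al h) - C v.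
  by rewrite -C_Z// -C_B//; [apply: C_eq => //; [apply: LLB => //; exact: LLZ|apply: aeS Ev => x ->]|exact: LLZ].
have sym := Lr_sym rs_ax ((Lop_Lr LGf Lu).1 Hu) ((Lop_Lr LGh Lv).1 Hv).
rewrite -(C_dot LGf Lh) -(C_dot Lf LGh) Eh {1}Ef (dotBl ip) (dotBr ip) (dotZl ip) (dotZr ip) sym.
by [].
Qed.

Lemma schr1 x : schr (fun=> 1) x = - (V x / rho x).
Proof.
rewrite /schrodinger /laplacian divE /divc big1 ?mulr0 ?sub0r ?mulr1 ?(mulrC (V x))// => k _.
rewrite /partial (_ : _ \o _ = cst 0) ?derive_cst//; apply/funext => y /=.
by rewrite grad_cst scaler0 mxE mulr0.
Qed.

Lemma schr0 x : schr (fun=> 0) x = 0.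
Proof.
rewrite /schrodinger /laplacian divE /divc big1 ?mulr0 ?subr0// => k _.
rewrite /partial (_ : _ \o _ = cst 0) ?derive_cst//; apply/funext => y /=.
by rewrite grad_cst scaler0 mxE mulr0.
Qed.

(** Comparison of - G f with the supersolution s = 0. *)
Lemma G_pos al f : 0 < al -> LL f -> (\forall x \ae mu A, 0 <= f x) -> \forall x \ae mu A, 0 <= G al f x.
Proof.
move=> al0 Lf f0; have [u Hu Eu] := Jf_prop al0 Lf.
have H := elliptic_comparison srho sV rho0 V0 al0 (Lop_Z (-1) Hu) (msmooth_cst A setT 0) (fun=> lexx 0).
have : \forall x \ae mu A, -1 * G al f x <= 0.
  by apply: H; apply: aeS2 Eu f0 => x Ex fx; rewrite schr0; lra.
by apply: aeS => x; lra.
Qed.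

(** The differential expression maps 1 to - V / rho, so s = 1 has the source alpha + V / rho, which
    dominates the source alpha f + v of the left-hand side; elliptic comparison applies. *)
Lemma G_le1 al f v : 0 < al -> LL f -> LL v -> (\forall x \ae mu A, f x <= 1) -> (\forall x \ae mu A, v x <= V x / rho x) ->
  \forall x \ae mu A, al * G al f x + G al v x <= 1.
Proof.
move=> al0 Lf Lv f1 v1; have [u Hu Eu] := Jf_prop al0 Lf; have [u' Hu' Eu'] := Jf_prop al0 Lv.
have H := elliptic_comparison srho sV rho0 V0 al0 (Lop_lin al Hu Hu') (msmooth_cst A setT 1) (fun=> ler01).
apply: H; have := aeS2 (fun x p q => conj p q) Eu Eu'; apply: aeS3 f1 v1 => x fx vx [Ex Ex'].
rewrite schr1; have := ler_wpM2l (ltW al0) fx; have : al * (al * G al f x) = al * (f x + u x) by rewrite -Ex; ring.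
lra.
Qed.

Lemma nrm_le f h : LL f -> LL h -> (\forall x \ae mu A, `|f x| <= `|h x|) -> nrm (C f) <= nrm (C h).
Proof.
move=> Lf Lh fh; rewrite (@nrm_cls _ (borel M) R (mu A) r f Lf) (@nrm_cls _ (borel M) R (mu A) r h Lh) ler_wsqrtr//.
have i g Lg := @sqi_rint _ (borel M) R (mu A) rho (smth_measurable srho) (fun x => ltW (rho0 x)) g Lg.
apply: le_Int_ae; [exact: i|exact: i|]; apply: aeS fh => x fhx; rewrite ler_wpM2r ?(ltW (rho0 x))//.
by rewrite -(real_normK (num_real (f x))) -(real_normK (num_real (h x))) ler_sqr ?nnegrE.
Qed.

(* phi measures the distance to the convex set {phi = 0} of values. *)
Lemma invariant_values (phi : R -> R) v : continuous phi -> phi 0 = 0 -> (forall s, 0 <= phi s) ->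
  (forall s s', `|phi s - phi s'| <= `|s - s'|) -> LL v ->
  (forall (h : R) f, 0 < h -> LL f -> \forall x \ae mu A, phi (Jf h (fun y => f y + h * v y) x) <= Jf h (phi \o f) x) ->
  forall t f, 0 <= t -> LL f -> (\forall x \ae mu A, phi (f x) = 0) ->
  \forall x \ae mu A, phi (T t f x + It t v x) = 0.
Proof.
move=> cphi phi0 phi_ge0 phi_lip Lv HJ t f t0 Lf phif.
have mphi : measurable_fun setT phi by exact: continuous_measurable_fun.
have Lphi g : LL g -> LL (phi \o g).
  move=> Lg; apply: (LL_le _ _ Lg); first by apply: measurableT_comp => //; exact: Lg.1.
  by move=> x; have := phi_lip (g x) 0; rewrite phi0 !subr0.
pose d (l : E) := nrm (C (phi \o repr l)).
have dC g : LL g -> d (C g) = nrm (C (phi \o g)).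
  move=> Lg; rewrite /d; congr nrm; apply: C_eq; [exact/Lphi/LL_repr|exact: Lphi|].
  by apply: aeS (repr_C Lg) => x /= ->.
have LI := LIt t0 Lv; have LTf := LT t0 Lf; have LTI := LLD LTf LI.
have d1 x y : d x <= d y + nrm (x - y).
  have Lx := LL_repr x; have Ly := LL_repr y; have LB := LLB Lx Ly.
  rewrite -{2}(C_repr x) -{2}(C_repr y) -C_B//.
  have Lab : LL (fun z => `|repr x z - repr y z|).
    by apply: (LL_le _ _ LB); [apply: measurableT_comp => //; exact: LB.1|move=> z; rewrite normr_id].
  apply: (@le_trans _ _ (nrm (C (fun z => (phi \o repr y) z + `|repr x z - repr y z|)))).
    apply: nrm_le; [exact: Lphi|by apply: LLD => //; exact: Lphi|].
    apply: aeW => z /=; rewrite ger0_norm// ger0_norm ?addr_ge0//.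
    by have := phi_lip (repr x z) (repr y z); rewrite ler_norml => /andP[_]; rewrite lerBlDl.
  rewrite C_D//; last exact: Lphi.
  apply: le_trans (nrmD ip _ _) _; rewrite lerD2l; apply: nrm_le => //.
  by apply: aeW => z; rewrite normr_id.
have dJ (h : R) (x : E) : 0 < h -> d (Jl h (x + h *: C v)) <= d x.
  move=> h0; have Lx := LL_repr x; have Lxv := LLD Lx (LLZ h Lv).
  have -> : x + h *: C v = C (fun y => repr x y + h * v y) by rewrite C_D ?C_Z ?C_repr//; exact: LLZ.
  rewrite -Jf_C// dC; last exact: LJf.
  apply: (@le_trans _ _ (nrm (C (Jf h (phi \o repr x))))).
    apply: nrm_le; [by apply: Lphi; exact: LJf|by apply: LJf => //; exact: Lphi|].
    by apply: aeS (HJ h _ h0 Lx) => z Hz; rewrite /= ger0_norm// ger0_norm// (le_trans _ Hz).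
  by rewrite Jf_C//; [exact: (J_contraction ip rs_ax)|exact: Lphi].
have := @invariance _ _ _ ip cip _ _ _ sg_ax rs_ax d (C v) (C f) t t0 d1 dJ.
rewrite Tl_C// -It_C// -C_D// !dC//.
have -> : C (phi \o f) = 0 by rewrite -C_0; apply: C_eq => //; [exact: Lphi|exact: LL0].
rewrite (nrm0 ip) => /(nrm_eq0 ip); rewrite -C_0 => H.
exact: (C_inj (Lphi _ LTI) LL0 H).
Qed.

Lemma Jf_lin (h a : R) f g : 0 < h -> LL f -> LL g ->
  \forall x \ae mu A, Jf h (fun y => a * f y + g y) x = a * Jf h f x + Jf h g x.
Proof.
move=> h0 Lf Lg; have La := LLZ a Lf; have Lfg := LLD La Lg.
have LJ1 := LJf h0 Lf; have LJ2 := LJf h0 Lg; have LJ3 := LJf h0 Lfg.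
apply: (C_inj LJ3 (LLD (LLZ a LJ1) LJ2)).
by rewrite (Jf_C h0 Lfg) (C_lin _ Lf Lg) (C_lin _ LJ1 LJ2) (Jf_C h0 Lf) (Jf_C h0 Lg) (J_lin ip sg_ax rs_ax _ _ _ h0).
Qed.

Lemma Jf_pos (h : R) f : 0 < h -> LL f -> (\forall x \ae mu A, 0 <= f x) -> \forall x \ae mu A, 0 <= Jf h f x.
Proof.
move=> h0 Lf f0; have hV : 0 < h^-1 by rewrite invr_gt0.
by apply: aeS (G_pos hV Lf f0) => x Gx; rewrite mulr_ge0// ltW.
Qed.

Lemma max0_lip (a b : R) : `|Num.max a 0 - Num.max b 0| <= `|a - b|.
Proof.
case: (leP a 0) => a0; case: (leP b 0) => b0; rewrite ?subrr ?normr0// ?subr0 ?sub0r ?normrN.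
- by rewrite gtr0_norm// ler0_norm ?opprB ?lerDl ?oppr_ge0// subr_le0 (le_trans a0)// ltW.
- by rewrite gtr0_norm// ger0_norm ?lerDl ?oppr_ge0// subr_ge0 (le_trans b0)// ltW.
Qed.

Lemma LL_comp (phi : R -> R) f : continuous phi -> phi 0 = 0 -> (forall s s', `|phi s - phi s'| <= `|s - s'|) ->
  LL f -> LL (phi \o f).
Proof.
move=> cphi phi0 lip Lf; apply: (LL_le _ _ Lf).
  by apply: measurableT_comp; [exact: continuous_measurable_fun|exact: Lf.1].
by move=> x; have := lip (f x) 0; rewrite phi0 !subr0.
Qed.

(** This and [excess] are the distances of a real number to the half-lines [0, oo) and (-oo, 1]. *)
Definition negpart (s : R) := Num.max (- s) 0.
Definition excess (s : R) := Num.max (s - 1) 0.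

Lemma negpart_lip s s' : `|negpart s - negpart s'| <= `|s - s'|.
Proof. by apply: le_trans (max0_lip _ _) _; rewrite -opprD normrN. Qed.

Lemma excess_lip s s' : `|excess s - excess s'| <= `|s - s'|.
Proof. by apply: le_trans (max0_lip _ _) _; rewrite opprB addrA subrK. Qed.

Lemma lip_continuous (phi : R -> R) : (forall s s', `|phi s - phi s'| <= `|s - s'|) -> continuous phi.
Proof.
move=> lip s; apply/cvgrPdist_lt => e e0; near=> t; apply: le_lt_trans (lip _ _) _.
by near: t; apply: cvgr_dist_lt => //; exact: cvg_id.
Unshelve. all: by end_near. Qed.

Lemma negpart0 : negpart 0 = 0. Proof. by rewrite /negpart oppr0 maxxx. Qed.
Lemma negpart_ge0 s : 0 <= negpart s. Proof. by rewrite /negpart le_max lexx orbT. Qed.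
Lemma excess0 : excess 0 = 0. Proof. by rewrite /excess sub0r max_r// oppr_le0. Qed.
Lemma excess_ge0 s : 0 <= excess s. Proof. by rewrite /excess le_max lexx orbT. Qed.

Lemma negpart_eq0 s : negpart s = 0 <-> 0 <= s.
Proof.
split=> [|s0]; last by rewrite /negpart max_r// oppr_le0.
by rewrite -[X in _ -> is_true (0 <= X)]opprK oppr_ge0 => <-; rewrite /negpart le_max lexx.
Qed.

Lemma excess_eq0 s : excess s = 0 <-> s <= 1.
Proof.
split=> [|s0]; last by rewrite /excess max_r// subr_le0.
by rewrite -subr_le0 => <-; rewrite /excess le_max lexx.
Qed.

Lemma It0 t : 0 <= t -> \forall x \ae mu A, It t (fun=> 0) x = 0.
Proof.
move=> t0; apply: (C_inj (LIt t0 LL0) LL0); rewrite (It_C t0 LL0) C_0.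
by have := Tint_lin ip cip sg_ax (-1) 0 0 t0; rewrite scaler0 addr0 scaleN1r subrr.
Qed.

(** Since g + g^- >= 0, positivity and linearity of the resolvent give (J g)^- <= J (g^-), the
    inequality required by the invariance principle. *)
Lemma T_pos t f : 0 <= t -> LL f -> (\forall x \ae mu A, 0 <= f x) -> \forall x \ae mu A, 0 <= T t f x.
Proof.
move=> t0 Lf f0.
have H : \forall x \ae mu A, negpart (T t f x + It t (fun=> 0) x) = 0.
  apply: (invariant_values (lip_continuous negpart_lip) negpart0 negpart_ge0 negpart_lip LL0) => //.
    move=> h g h0 Lg; have Ln := LL_comp (lip_continuous negpart_lip) negpart0 negpart_lip Lg.
    have -> : (fun y => g y + h * 0) = g by apply/funext => y; rewrite mulr0 addr0.
    have Lgn := LLD (LLZ 1 Lg) Ln.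
    have gn0 : \forall x \ae mu A, 0 <= 1 * g x + (negpart \o g) x.
      by apply: aeW => x; rewrite /= mul1r addrC -[X in _ + X]opprK subr_ge0 /negpart le_max lexx.
    have n0 : \forall x \ae mu A, 0 <= (negpart \o g) x by apply: aeW => x; exact: negpart_ge0.
    have P1 := Jf_pos h0 Lgn gn0; have P2 := Jf_pos h0 Ln n0; have E := Jf_lin 1 h0 Lg Ln.
    apply: aeS3 P1 P2 E => x p1 p2 Ex; rewrite Ex mul1r in p1.
    by rewrite /negpart ge_max p2 andbT; lra.
  by apply: aeS f0 => x; exact: (negpart_eq0 _).2.
by apply: aeS2 H (It0 t0) => x Hx Ix; rewrite Ix addr0 in Hx; exact: (negpart_eq0 _).1.
Qed.

Lemma TI_le1 t f v : 0 <= t -> LL f -> LL v -> (\forall x \ae mu A, f x <= 1) -> (\forall x \ae mu A, v x <= V x / rho x) ->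
  \forall x \ae mu A, T t f x + It t v x <= 1.
Proof.
move=> t0 Lf Lv f1 v1.
have H : \forall x \ae mu A, excess (T t f x + It t v x) = 0.
  apply: (invariant_values (lip_continuous excess_lip) excess0 excess_ge0 excess_lip Lv) => //.
    move=> h g h0 Lg; have hV : 0 < h^-1 by rewrite invr_gt0.
    have Le := LL_comp (lip_continuous excess_lip) excess0 excess_lip Lg.
    have Lge := LLB Lg Le.
    have ge1 : \forall x \ae mu A, g x - (excess \o g) x <= 1.
      by apply: aeW => x /=; rewrite lerBlDr -lerBlDl /excess le_max lexx.
    have P1 := G_le1 hV Lge Lv ge1 v1.
    have e0 : \forall x \ae mu A, 0 <= (excess \o g) x by apply: aeW => x; exact: excess_ge0.
    have P2 := Jf_pos h0 Le e0.
    have E1 := Jf_lin 1 h0 Le (LLD (LLZ h Lv) Lge).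
    have E2 := Jf_lin h h0 Lv Lge.
    (* The resolvent bound applies to the last summand: g minus its excess over 1 is at most 1, and
       h v supplies the potential term. *)
    have -> : (fun y => g y + h * v y) = (fun y => 1 * (excess \o g) y + (h * v y + (g y - (excess \o g) y))).
      by apply/funext => y; ring.
    have E12 := aeS2 (fun x p q => conj p q) E1 E2.
    apply: aeS3 P1 P2 E12 => x p1 p2 [Ex1 Ex2].
    rewrite /excess ge_max p2 andbT Ex1 Ex2 mul1r [in X in _ + (X + _)]/Jf mulrA divff ?gt_eqF// mul1r.
    by rewrite [in X in _ + (_ + X)]/Jf; lra.
  by apply: aeS f1 => x; exact: (excess_eq0 _).2.
by apply: aeS H => x; exact: (excess_eq0 _).1.
Qed.

(** Pairing with its own negative part gives minus the squared norm of that part, yet the pairing is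
    an integral over s of nonnegative numbers because each T_s preserves positivity. *)
Lemma It_pos t v : 0 <= t -> LL v -> (\forall x \ae mu A, 0 <= v x) -> \forall x \ae mu A, 0 <= It t v x.
Proof.
move=> t0 Lv v0; have [LI HI] := It_spec t0 Lv.
have Ln := LL_comp (lip_continuous negpart_lip) negpart0 negpart_lip LI.
have h1 : 0 <= L2dot A rho (It t v) (negpart \o It t v).
  rewrite HI//; apply: Rintegral_ge0 => s /=; rewrite in_itv/= => /andP[s0 st].
  apply: Int_ge0_ae; first exact: (sqi_mul (smth_measurable srho) (fun x => ltW (rho0 x)) (LT s0 Lv) Ln).
  apply: aeS (T_pos s0 Lv v0) => x Tx.
  by apply: mulr_ge0; [apply: mulr_ge0 => //; exact: negpart_ge0|exact: ltW].
have h2 : @wdot _ (borel M) R (mu A) r (negpart \o It t v) (negpart \o It t v) = 0.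
  apply/eqP; rewrite eq_le (@wdot_ge0 _ (borel M) R (mu A) r) andbT.
  have -> : @wdot _ (borel M) R (mu A) r (negpart \o It t v) (negpart \o It t v) = - L2dot A rho (It t v) (negpart \o It t v).
    rewrite /L2dot -IntN; last exact: (sqi_mul (smth_measurable srho) (fun x => ltW (rho0 x)) LI Ln).
    apply: eq_Rintegral => x _ /=; rewrite -!mulNr; congr (_ * _).
    by rewrite /negpart; case: (leP (- It t v x) 0) => _; rewrite ?mulr0.
  by rewrite oppr_le0.
have := @wdot_eq0 _ (borel M) R (mu A) r _ Ln h2; apply: aeS => x.
exact: (negpart_eq0 _).1.
Qed.

End weighted_semigroup.

(** * Duality *)

Section laplacian_calculus.
Context {R : realType} {n : nat} {M : ptopologicalType} (A : weighted R n M).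
Implicit Types (c d : chart A) (f h u s phi : M -> R) (K : set M) (X Y Z : chart A -> M -> 'rV[R]_n).
Local Notation smth := (msmooth A setT).
Local Notation csmth := (csmth A).
Let oT := @openT M.

Lemma div_eq X Y x : (forall c y, dom c y -> X c y = Y c y) -> div X x = div Y x.
Proof.
move=> XY; rewrite !divE; set c := chart_at A x; congr (_ * _); apply: eq_bigr => k _.
apply: (derive_eq_on _ (@open_img _ _ _ A c)) => [y cy|] /=; last exact/img_coord/dom_chart_at.
by rewrite XY//; exact: dom_param.
Qed.

Lemma flux_derivable c X x (k : 'I_n) (v : 'rV[R]_n) : smooth_field X -> dom c x ->
  derivable ((fun y => vol_density c y * X c y 0 k) \o param c) (Defs.coord c x) v.
Proof. by move=> fX cx; exact: (Smooth_derivable (flux_Smooth k (fX.2 c)) (img_coord cx)). Qed.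

Lemma div_scale f X x : smth f -> smooth_field X ->
  div (fun c y => f y *: X c y) x = f x * div X x + inner X (grad A f) x.
Proof.
move=> sf fX; rewrite !divE; set c := chart_at A x; have cx : dom c x := dom_chart_at A x.
have v0 := vol_density_gt0 cx.
have vn : vol_density c x != 0 by rewrite gt_eqF.
rewrite (inner_grad_chart fX.1 sf cx) /divc mulrCA -[X in _ = _ + X](mulKf vn) -mulrDr; congr (_ * _).
rewrite !mulr_sumr -big_split /=; apply: eq_bigr => k _; rewrite /partial.
rewrite (_ : (fun y => vol_density c y * (f y *: X c y) 0 k) \o param c =
    (f \o param c) * ((fun y => vol_density c y * X c y 0 k) \o param c)); last first.
  by apply/funext => y; rewrite /= mxE mulrCA.
rewrite deriveM; [|exact: smth_derivable|exact: flux_derivable].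
by rewrite /= coordK// /GRing.scale/= mulrA.
Qed.

Lemma div_lin (a : R) X Y x : smooth_field X -> smooth_field Y ->
  div (fun c y => X c y + a *: Y c y) x = div X x + a * div Y x.
Proof.
move=> fX fY; rewrite !divE; set c := chart_at A x; have cx : dom c x := dom_chart_at A x.
rewrite /divc mulrCA -mulrDr; congr (_ * _).
rewrite mulr_sumr -big_split /=; apply: eq_bigr => k _; rewrite /partial.
rewrite (_ : (fun y => vol_density c y * (X c y + a *: Y c y) 0 k) \o param c =
    ((fun y => vol_density c y * X c y 0 k) \o param c) + a *: ((fun y => vol_density c y * Y c y 0 k) \o param c)); last first.
  by apply/funext => y; rewrite /= !mxE mulrDr; congr (_ + _); rewrite mulrCA.
have dX := @flux_derivable c X x k (delta_mx 0 k) fX cx; have dY := @flux_derivable c Y x k (delta_mx 0 k) fY cx.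
rewrite (deriveD dX (derivableZ dY)).
by rewrite deriveZ.
Qed.

Lemma flux_field f : smth f -> smooth_field (fun c y => weight A y *: grad A f c y).
Proof. by move=> sf; apply: field_scale; [exact: weight_smth|exact: grad_field]. Qed.

Lemma laplacian_lin (a : R) f h x : smth f -> smth h ->
  laplacian A (fun y => f y + a * h y) x = laplacian A f x + a * laplacian A h x.
Proof.
move=> sf sh; rewrite /laplacian.
rewrite (div_eq (Y := fun c y => weight A y *: grad A f c y + a *: (weight A y *: grad A h c y))).
  rewrite (div_lin a x (flux_field sf) (flux_field sh)).
  by move: (weight A x) (div _ x) (div _ x) => *; rewrite mulrDr mulrCA.
move=> c y cy; rewrite gradD//; last exact: msmoothZ.
by rewrite gradZ// scalerDr !scalerA (mulrC a).
Qed.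

Lemma laplacian_sqr f x : smth f ->
  laplacian A (fun y => f y * f y) x = 2 * f x * laplacian A f x + 2 * inner (grad A f) (grad A f) x.
Proof.
move=> sf; rewrite {1}/laplacian; have s2f : smth (fun y => 2 * f y) by exact: msmoothZ.
rewrite (div_eq (Y := fun c y => (2 * f y) *: (weight A y *: grad A f c y))); last first.
  by move=> c y cy; rewrite gradM// -mulr2n -scaler_nat !scalerA; congr (_ *: _); ring.
rewrite (div_scale _ s2f (flux_field sf)) -flux_laplacian.
have -> : inner (fun c y => weight A y *: grad A f c y) (grad A (fun y => 2 * f y)) x =
    2 * (weight A x * inner (grad A f) (grad A f) x).
  rewrite innerMl (inner_eq (Y' := fun c y => 2 *: grad A f c y) (fun _ _ => erefl)).
    by rewrite (innerMr (fun=> 2)); ring.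
  by move=> c cx; rewrite gradZ.
by field; rewrite gt_eqF// weight_gt0.
Qed.

Lemma cutoff (K : set M) : compact K -> exists chi U, [/\ csmth chi, open U, K `<=` U & forall x, U x -> chi x = 1].
Proof.
move=> cK.
have HB (x0 : M) : exists b, csmth b /\ \forall x \near x0, b x = 1.
  have [b [sb _ [L [cL LU b0]] b1]] := bump_exists oT (I : setT x0) (dom_chart_at A x0).
  by exists b; split=> //; split=> //; exists L.
pose b x0 := sval (cid (HB x0)).
have Hb x0 : csmth (b x0) /\ \forall x \near x0, b x0 x = 1 by rewrite /b; case: cid.
have [s Ks] := @compact_finite_cover M K (fun x0 => [set x | b x0 x = 1]°) cK
  (fun x0 => conj (@open_interior _ _) (Hb x0).2).
exists (fun x => 1 - \prod_(x0 <- s) (1 - b x0 x)), (\bigcup_(x0 in [set` s]) [set x | b x0 x = 1]°); split.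
- elim: s {Ks} => [|x0 s ih].
    by have := csmth0 A; under [X in _ -> _ X]eq_fun do rewrite big_nil subrr.
  have E x : 1 - \prod_(x1 <- x0 :: s) (1 - b x1 x) =
      (1 - \prod_(x1 <- s) (1 - b x1 x)) + b x0 x - (1 - \prod_(x1 <- s) (1 - b x1 x)) * b x0 x.
    by rewrite big_cons; ring.
  under [X in _ X]eq_fun do rewrite E.
  have cb := (Hb x0).1; apply: csmthB; first exact: csmthD.
  by apply: csmthM => //; exact: ih.1.
- by apply: bigcup_open => x0 _; exact: open_interior.
- by move=> x /Ks[x0 x0s bx]; exists x0.
- move=> x [x0 /= x0s /interior_subset/= bx]; rewrite (big_rem x0)//= bx subrr mul0r subr0//.
Qed.

(** Only phi has compact support. Replacing f by f chi, with chi = 1 near that support, changes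
    neither integrand and makes both applications of Green's formula legitimate. *)
Lemma green_sym f phi : smth f -> csmth phi ->
  \int[mu A]_x (f x * laplacian A phi x) = \int[mu A]_x (phi x * laplacian A f x).
Proof.
move=> sf cphi; have [sphi [K cK phi0]] := cphi.
have clK : closed K by exact: (compact_closed_mfd A).
have [chi [U [cchi oU KU chi1]]] := cutoff cK.
have cf : csmth (fun x => f x * chi x) by exact: csmthM.
have h1 := green sphi cf; have h2 := green sf cphi.
have grad_eq x : K x -> forall c, dom c x -> grad A (fun x => f x * chi x) c x = grad A f c x.
  move=> Kx c cx; rewrite /grad; congr (_ *m _); apply/rowP => k; rewrite !mxE /partial.
  have oW := open_coord_image c oU.
  apply: (derive_eq_on _ oW) => [_ [y [Uy cy] <-]|]; first by rewrite /= coordK// chi1// mulr1.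
  by exists x => //; split=> //; exact: KU.
have E1 : \int[mu A]_x (f x * chi x * laplacian A phi x) = \int[mu A]_x (f x * laplacian A phi x).
  apply: eq_Rintegral => x _; have [Kx|Kx] := pselect (K x); first by rewrite (chi1 _ (KU _ Kx)) mulr1.
  suff -> : laplacian A phi x = 0 by rewrite !mulr0.
  rewrite /laplacian divE /divc big1 ?mulr0// => k _.
  apply: (partial0_in k clK _ (dom_chart_at A x) Kx) => y cy Ky.
  by rewrite (grad0_off clK phi0 cy Ky) scaler0 mxE mulr0.
have E2 : \int[mu A]_x inner (grad A phi) (grad A (fun x => f x * chi x)) x =
    \int[mu A]_x inner (grad A f) (grad A phi) x.
  apply: eq_Rintegral => x _; rewrite innerC; have [Kx|Kx] := pselect (K x).
    by apply: inner_eq => // c cx; exact: grad_eq.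
  by rewrite !inner0r//; apply: (grad0_off clK phi0) => //; exact: dom_chart_at.
apply: etrans (esym E1) _; apply: oppr_inj; apply: etrans (esym h1) _; apply: etrans h2.
exact: E2.
Qed.

(** If f were negative at x0, a bump supported in the open set where f < 0 would give a negative
    integral, since the measure charges open sets. *)
Lemma test_ge0 f : continuous f -> (forall phi, csmth phi -> (forall x, 0 <= phi x) -> 0 <= \int[mu A]_x (f x * phi x)) ->
  forall x, 0 <= f x.
Proof.
move=> cf H x0; rewrite leNgt; apply/negP => f0.
pose U := setT `&` f @^-1` [set t | t < 0].
have oU : open U by apply: (open_preimage_cont oT) => [x _|]; [exact: cf|exact: open_lt].
have Ux0 : U x0 by [].
have [b [sb b01 [L [cL LU b0]] b1]] := bump_exists oU Ux0 (dom_chart_at A x0).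
have cb : csmth b by split=> //; exists L.
have bge x : 0 <= b x by case/andP: (b01 x).
have mf : measurable_fun [set: borel M] f.
  by apply: (borel_measurable_fun (U := setT)) => // x _; exact: cf.
have fb0 x : f x * b x <= 0.
  have [Lx|Lx] := pselect (L x); last by rewrite b0// mulr0.
  by have [[_ /= /ltW fx] _] := LU x Lx; rewrite mulr_le0_ge0.
have cfb : continuous (fun x => f x * b x * weight A x).
  move=> x; have : {for x, continuous (fun x => f x * b x * weight A x)}; last by [].
  apply: continuousM; last exact: (smooth_cont (weight_smth A)).
  by apply: continuousM; [exact: cf|exact: (smooth_cont sb)].
have ib : rint (vol A) (fun x => f x * b x * weight A x).
  apply: (@cont_cpt_vol_integrable _ _ _ A (fun x => f x * b x * weight A x) L) => //.
  by move=> x Lx; rewrite b0// mulr0 mul0r.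
have mfb : measurable_fun [set: borel M] (fun x => f x * b x).
  by apply: measurable_funM => //; exact: (csmth_measurable cb).
have Ib := H b cb bge; rewrite Int_mu// in Ib.
have I0 : (\int[vol A]_x (- (f x * b x * weight A x))%:E = 0)%E.
  have := rint_EFin (rintN ib); rewrite IntN// => <-.
  rewrite (_ : \int[vol A]_x (f x * b x * weight A x) = 0) ?oppr0//.
  apply/eqP; rewrite eq_le Ib andbT -oppr_ge0 -IntN//; apply: Int_ge0 => x.
  by rewrite oppr_ge0 mulr_le0_ge0 ?(ltW (weight_gt0 A x)).
have bx0 : b x0 = 1 by exact: nbhs_singleton b1.
have cF x : setT x -> {for x, continuous (fun x => - (f x * b x * weight A x))}.
  by move=> _; apply: continuousN; exact: cfb.
have Fge x : 0 <= - (f x * b x * weight A x).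
  by rewrite oppr_ge0 mulr_le0_ge0 ?(ltW (weight_gt0 A x)).
have mF : measurable_fun [set: borel M] (fun x => - (f x * b x * weight A x)).
  exact: (rint_measurable (rintN ib)).
have := vol_ge0_eq0 oT cF Fge mF I0 I (x := x0).
rewrite bx0 mulr1 => /eqP; rewrite oppr_eq0 mulf_eq0 (lt_eqF f0)/= gt_eqF//.
exact: weight_gt0.
Qed.

End laplacian_calculus.

Lemma cvg_eq_seq {R : realType} (u v : nat -> R) (l : R) : (forall k, u k = v k) ->
  u k @[k --> \oo] --> l -> v k @[k --> \oo] --> l.
Proof. by move=> uv; rewrite (_ : u = v)//; exact/funext. Qed.

Section fatou_rint.
Context {d} {T : measurableType d} {R : realType} (m : {measure set T -> \bar R}).

Lemma rint_norm (f : T -> R) : rint m f -> rint m (fun x => `|f x|).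
Proof. exact: integrable_abse. Qed.

Lemma fatou_rint (F : nat -> T -> R) (f : T -> R) (B : R) : (forall k, rint m (F k)) -> (forall k x, 0 <= F k x) ->
  measurable_fun setT f -> (forall x, F k x @[k --> \oo] --> f x) ->
  (forall k, \int[m]_x F k x <= B) -> rint m f.
Proof.
move=> rF F0 mf Ff FB.
have f0 x : 0 <= f x by apply: (cvgr_to_ge (Ff x)); exact: nearW.
rewrite (rint_ge0 _ mf f0); apply: (@le_lt_trans _ _ (B%:E)%E); last exact: ltry.
have mF k : measurable_fun setT (EFin \o F k) by exact/measurable_EFinP/(rint_measurable (rF k)).
have := fatou m measurableT mF (fun k x _ => F0 k x).
rewrite (_ : (fun x => limn_einf _) = EFin \o f); last first.
  apply/funext => x; have Fx : (F k x)%:E @[k --> \oo] --> (f x)%:E.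
    by apply: cvg_EFin; [exact: nearW|exact: Ff].
  exact: (cvg_limn_einf_sup Fx).1.
move=> /le_trans; apply; rewrite limn_einf_lim; apply: lime_le; first exact: is_cvg_einfs.
apply: nearW => k; apply: (@le_trans _ _ (\int[m]_x (EFin \o F k) x)%E).
  by apply: ereal_inf_lbound; exists k => //=.
by rewrite -(rint_EFin (rF k)) lee_fin.
Qed.

End fatou_rint.

(** * Duality for a pair of positivity preserving operators *)

Section dual_pair.
Context {R : realType} {n : nat} {M : ptopologicalType} (A : weighted R n M).
Implicit Types (f h u v phi : M -> R).
Local Notation smth := (msmooth A setT).
Local Notation csmth := (csmth A).
Variables (rho V : M -> R).
Hypotheses (srho : smth rho) (sV : smth V) (rho0 : forall x, 0 < rho x) (V0 : forall x, 0 <= V x).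
Local Notation LL := (L2 A rho).
Local Notation dot := (L2dot A rho).
Let mrho : measurable_fun [set: borel M] rho := smth_measurable srho.
Let mV : measurable_fun [set: borel M] V := smth_measurable sV.
Let rho_ge0 x := ltW (rho0 x).

Definition theta : nat -> M -> R := sval (cid (open_approx A (@openT M))).
Definition theta_pot k x := theta k x * (V x / rho x).

Lemma theta_csmth k : csmth (theta k).
Proof. by rewrite /theta; case: cid => F []. Qed.

Lemma theta01 k x : 0 <= theta k x <= 1.
Proof. by rewrite /theta; case: cid => F []. Qed.

Lemma theta_cvg x : theta k x @[k --> \oo] --> (1 : R).
Proof. by rewrite /theta; case: cid => F [_ _] /= /(_ x); rewrite indicT. Qed.

Lemma pot_ge0 x : 0 <= V x / rho x.
Proof. by rewrite divr_ge0. Qed.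

Lemma theta_pot_csmth k : csmth (theta_pot k).
Proof.
have sp : smth (fun x => V x / rho x).
  exact: (msmoothM (@openT M) sV (rhoV_smth srho rho0)).
by have := csmthM sp (theta_csmth k); under eq_fun do rewrite mulrC.
Qed.

Lemma theta_pot_bounds k x : 0 <= theta_pot k x <= V x / rho x.
Proof.
have /andP[t0 t1] := theta01 k x; have p0 := pot_ge0 x.
by rewrite mulr_ge0//= ler_piMl.
Qed.

Lemma csmth_LL f : csmth f -> LL f. Proof. exact: csmth_sqi. Qed.

Lemma dot_rint f h : LL f -> LL h -> rint (mu A) (fun x => f x * h x * rho x).
Proof. exact: (@sqi_mul _ (borel M) R (mu A) rho mrho rho_ge0). Qed.

Lemma L2dotZl (a : R) f h : LL f -> LL h -> dot (fun x => a * f x) h = a * dot f h.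
Proof.
move=> Lf Lh; rewrite /L2dot -IntZ; last exact: dot_rint.
by congr (Rintegral _ _ _); apply/funext => x; rewrite !mulrA.
Qed.

Lemma L2dotDl f f' h : LL f -> LL f' -> LL h -> dot (fun x => f x + f' x) h = dot f h + dot f' h.
Proof.
move=> Lf Lf' Lh; rewrite /L2dot -IntD; [|exact: dot_rint..].
by congr (Rintegral _ _ _); apply/funext => x; rewrite !mulrDl.
Qed.

Lemma L2dotBr f h h' : LL f -> LL h -> LL h' -> dot f (fun x => h x - h' x) = dot f h - dot f h'.
Proof.
move=> Lf Lh Lh'; rewrite /L2dot -IntB; [|exact: dot_rint..].
by congr (Rintegral _ _ _); apply/funext => x; rewrite mulrBr mulrBl.
Qed.

Variables (S1 S2 : (M -> R) -> M -> R) (c : R).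
Hypotheses (c0 : 0 < c) (LS1 : forall f, LL f -> LL (S1 f)) (LS2 : forall f, LL f -> LL (S2 f)).
Hypotheses (S1_pos : forall f, LL f -> (\forall x \ae mu A, 0 <= f x) -> \forall x \ae mu A, 0 <= S1 f x).
Hypotheses (S2_pos : forall f, LL f -> (\forall x \ae mu A, 0 <= f x) -> \forall x \ae mu A, 0 <= S2 f x).
Hypotheses (S1_sym : forall f h, LL f -> LL h -> dot (S1 f) h = dot f (S1 h)).
Hypotheses (S2_sym : forall f h, LL f -> LL h -> dot (S2 f) h = dot f (S2 h)).
Hypothesis S_le1 : forall f v, LL f -> LL v -> (\forall x \ae mu A, f x <= 1) ->
  (\forall x \ae mu A, v x <= V x / rho x) -> \forall x \ae mu A, c * S1 f x + S2 v x <= 1.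

(** The operators S1, S2 and the constant c stand for T_t, int_0^t T_s ds and 1 in the case of H,
    and for G_alpha, G_alpha and alpha in the case of N. *)
Lemma pair_dot f v phi : LL f -> LL v -> LL phi ->
  dot (fun x => c * S1 f x + S2 v x) phi = c * dot f (S1 phi) + dot v (S2 phi).
Proof.
move=> Lf Lv Lp; have L1 := LS1 Lf; have L2 := LS2 Lv.
rewrite L2dotDl//; last exact: L2Z.
by rewrite L2dotZl// S1_sym// S2_sym.
Qed.

Lemma pair_dot_le f v phi : LL f -> LL v -> LL phi -> rint (mu A) (fun x => phi x * rho x) ->
  (\forall x \ae mu A, 0 <= phi x) -> (\forall x \ae mu A, f x <= 1) ->
  (\forall x \ae mu A, v x <= V x / rho x) ->
  c * dot f (S1 phi) + dot v (S2 phi) <= \int[mu A]_x (phi x * rho x).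
Proof.
move=> Lf Lv Lp rp p0 f1 v1; rewrite -pair_dot//; apply: le_Int_ae => //.
  by apply: dot_rint => //; apply: L2D => //; [apply: L2Z => //; exact: LS1|exact: LS2].
apply: aeS2 (S_le1 Lf Lv f1 v1) p0 => x sx px; rewrite ler_wpM2r//; last by rewrite ler_piMl.
Qed.

(** The bound of the pairing by the integral of phi rho is uniform in the cut-offs theta_k, so
    Fatou's lemma gives integrability of both images, the second one against V. *)
Lemma pair_L1 phi : LL phi -> rint (mu A) (fun x => phi x * rho x) -> (\forall x \ae mu A, 0 <= phi x) ->
  rint (mu A) (fun x => S1 phi x * rho x) /\ rint (mu A) (fun x => V x * S2 phi x).
Proof.
move=> Lp rp p0; have L1 := LS1 Lp; have L2 := LS2 Lp.
have P1 := S1_pos Lp p0; have P2 := S2_pos Lp p0.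
have Lt k : LL (theta k) := csmth_LL (theta_csmth k).
have Lv k : LL (theta_pot k) := csmth_LL (theta_pot_csmth k).
have d1 k : 0 <= dot (theta k) (S1 phi).
  apply: Int_ge0_ae; first exact: dot_rint.
  by apply: aeS P1 => x px; have /andP[? _] := theta01 k x; rewrite !mulr_ge0.
have d2 k : 0 <= dot (theta_pot k) (S2 phi).
  apply: Int_ge0_ae; first exact: dot_rint.
  by apply: aeS P2 => x px; have /andP[t0 _] := theta_pot_bounds k x; rewrite (mulr_ge0 (mulr_ge0 t0 px)).
have B k : c * dot (theta k) (S1 phi) + dot (theta_pot k) (S2 phi) <= \int[mu A]_x (phi x * rho x).
  by apply: pair_dot_le => //; apply: aeW => x;
    [have /andP[] := theta01 k x|have /andP[] := theta_pot_bounds k x].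
have mS1 : measurable_fun [set: borel M] (S1 phi) := L1.1.
have mS2 : measurable_fun [set: borel M] (S2 phi) := L2.1.
have mt k : measurable_fun [set: borel M] (theta k) := csmth_measurable (theta_csmth k).
have m1 : measurable_fun [set: borel M] (fun x => S1 phi x * rho x) by exact: measurable_funM.
have m2 : measurable_fun [set: borel M] (fun x => V x * S2 phi x) by exact: measurable_funM.
have E1 k : \forall x \ae mu A, theta k x * S1 phi x * rho x = theta k x * `|S1 phi x * rho x|.
  by apply: aeS P1 => x px; rewrite ger0_norm ?mulr_ge0// mulrA.
have E2 k : \forall x \ae mu A, theta_pot k x * S2 phi x * rho x = theta k x * `|V x * S2 phi x|.
  apply: aeS P2 => x px; rewrite ger0_norm ?mulr_ge0// /theta_pot.
  by field; rewrite gt_eqF.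
have n1 : measurable_fun [set: borel M] (fun x => `|S1 phi x * rho x|) by exact: measurableT_comp.
have n2 : measurable_fun [set: borel M] (fun x => `|V x * S2 phi x|) by exact: measurableT_comp.
have q1 k : measurable_fun [set: borel M] (fun x => theta k x * `|S1 phi x * rho x|) by exact: measurable_funM.
have q2 k : measurable_fun [set: borel M] (fun x => theta k x * `|V x * S2 phi x|) by exact: measurable_funM.
have r1 k := rint_ae (q1 k) (E1 k) (dot_rint (Lt k) L1).
have r2 k := rint_ae (q2 k) (E2 k) (dot_rint (Lv k) L2).
have cv (g : M -> R) x : theta k x * g x @[k --> \oo] --> g x.
  by rewrite -[X in _ --> X]mul1r; apply: cvgM; [exact: theta_cvg|exact: cvg_cst].
have t0 k x : 0 <= theta k x by have /andP[] := theta01 k x.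
have b1 k : \int[mu A]_x (theta k x * `|S1 phi x * rho x|) <= c^-1 * \int[mu A]_x (phi x * rho x).
  rewrite -(Int_ae _ _ (E1 k)); [|exact: (rint_measurable (dot_rint (Lt k) L1))|exact: q1].
  by rewrite mulrC ler_pdivlMr// mulrC; apply: le_trans (B k); rewrite lerDl; exact: d2.
have b2 k : \int[mu A]_x (theta k x * `|V x * S2 phi x|) <= \int[mu A]_x (phi x * rho x).
  rewrite -(Int_ae _ _ (E2 k)); [|exact: (rint_measurable (dot_rint (Lv k) L2))|exact: q2].
  by apply: le_trans (B k); rewrite lerDr; apply: mulr_ge0; [exact: ltW|exact: d1].
have H1 := fatou_rint r1 (fun k x => mulr_ge0 (t0 k x) (normr_ge0 _)) n1 (cv _) b1.
have H2 := fatou_rint r2 (fun k x => mulr_ge0 (t0 k x) (normr_ge0 _)) n2 (cv _) b2.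
by split; [apply: rint_le m1 _ H1|apply: rint_le m2 _ H2].
Qed.

(** An increasing sequence stays below its limit; since the limit function is real-valued,
    convergence of extended reals becomes convergence of reals. *)
Lemma Lplus_ext_bounds S g F : Lplus_ext A rho S (fun x => (g x)%:E) F ->
  exists fk : nat -> M -> R, [/\ forall k, LL (fk k), forall k, \forall x \ae mu A, 0 <= fk k x,
    forall k, \forall x \ae mu A, fk k x <= g x, \forall x \ae mu A, fk k x @[k --> \oo] --> g x &
    \forall x \ae mu A, (S (fk k) x)%:E @[k --> \oo] --> F x].
Proof.
move=> [fk [Lf mono fg SF]]; exists fk.
have fg' : \forall x \ae mu A, fk k x @[k --> \oo] --> g x.
  apply: aeS fg => x H.
  have := fine_cvg H; exact.
split=> // k; first by apply: aeS (mono k) => x /andP[].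
have := aeS2 (fun x p q => conj p q) (ae_foralln mono) fg'; apply: aeS => x [mx gx].
have nd : nondecreasing_seq (fk ^~ x) by apply/nondecreasing_seqP => j; have /andP[] := mx j.
rewrite -(cvg_lim (@Rhausdorff R) gx); apply: (nondecreasing_cvgn_le nd).
by apply/cvg_ex; exists (g x).
Qed.

Variables (K : M -> R) (F1 F2 : M -> \bar R).
Hypotheses (mK : measurable_fun [set: borel M] K) (HF1 : Lplus_ext A rho S1 (cst 1%E) F1)
  (HF2 : Lplus_ext A rho S2 (fun x => (V x / rho x)%:E) F2)
  (HK : \forall x \ae mu A, (K x)%:E = (c%:E * F1 x + F2 x)%E).

(** Gathers what the two extensions provide: L^2 functions below 1 and V / rho whose combined images
    lie in [0, 1] and converge to K. The sum of extended reals is harmless because all terms are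
    nonnegative. *)
Lemma pair_approx : exists f g : nat -> M -> R,
  [/\ forall k, LL (f k) /\ LL (g k),
      (\forall x \ae mu A, forall k, `|f k x| <= 1) /\ (\forall x \ae mu A, forall k, `|g k x| <= V x / rho x),
      (\forall x \ae mu A, f k x @[k --> \oo] --> (1 : R)) /\
      (\forall x \ae mu A, g k x @[k --> \oo] --> V x / rho x),
      \forall x \ae mu A, forall k, 0 <= c * S1 (f k) x + S2 (g k) x <= 1 &
      \forall x \ae mu A, (c * S1 (f k) x + S2 (g k) x) @[k --> \oo] --> K x].
Proof.
have [f [Lf f0 f1 fcv Sf]] := Lplus_ext_bounds (g := cst 1) HF1.
have [g [Lg g0 g1 gcv Sg]] := Lplus_ext_bounds HF2.
have Sf0 : \forall x \ae mu A, forall k, 0 <= S1 (f k) x by apply: ae_foralln => k; exact: S1_pos.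
have Sg0 : \forall x \ae mu A, forall k, 0 <= S2 (g k) x by apply: ae_foralln => k; exact: S2_pos.
exists f, g; split => //.
- split; apply: ae_foralln => k; first by apply: aeS2 (f0 k) (f1 k) => x ? ?; rewrite ger0_norm.
  by apply: aeS2 (g0 k) (g1 k) => x ? ?; rewrite ger0_norm.
- apply: ae_foralln => k; apply: aeS3 Sf0 Sg0 (S_le1 (Lf k) (Lg k) (f1 k) (g1 k)) => x p q ->.
  by rewrite andbT addr_ge0// mulr_ge0// ltW.
have := aeS3 (fun x p q r => conj p (conj q r)) Sf Sg HK; apply: aeS3 Sf0 Sg0 => x p q [cf [cg Kx]].
have F1x : (0 <= F1 x)%E by apply: (cvge_ge _ cf); apply: nearW => k; rewrite lee_fin.
have F2x : (0 <= F2 x)%E by apply: (cvge_ge _ cg); apply: nearW => k; rewrite lee_fin.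
have cF : (c%:E * (S1 (f k) x)%:E)%E @[k --> \oo] --> (c%:E * F1 x)%E by apply: cvgeZl.
have : ((c%:E * (S1 (f k) x)%:E) + (S2 (g k) x)%:E)%E @[k --> \oo] --> (c%:E * F1 x + F2 x)%E.
  by apply: cvgeD => //; apply: ge0_adde_def; rewrite inE// mule_ge0// lee_fin ltW.
by rewrite -Kx => /fine_cvg.
Qed.

Lemma pair_K01 : \forall x \ae mu A, 0 <= K x <= 1.
Proof.
have [f [g [_ _ _ h01 hK]]] := pair_approx; apply: aeS2 h01 hK => x h H.
by apply/andP; split; [apply: (cvgr_to_ge H)|apply: (cvgr_to_le H)]; apply: nearW => k; have /andP[] := h k.
Qed.

Lemma theta_Int_cvg g : rint (mu A) g -> \int[mu A]_x (theta k x * g x) @[k --> \oo] --> \int[mu A]_x g x.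
Proof.
move=> rg; have mg : measurable_fun [set: borel M] g := rint_measurable rg.
have mt k : measurable_fun [set: borel M] (theta k) := csmth_measurable (theta_csmth k).
have ng : rint (mu A) (fun x => `|g x|).
  exact: rint_norm.
have mtg k : measurable_fun [set: borel M] (fun x => theta k x * g x) by exact: measurable_funM.
have cv : \forall x \ae mu A, theta k x * g x @[k --> \oo] --> g x.
  apply: aeW => x; rewrite -[X in _ --> X]mul1r; apply: cvgM; [exact: theta_cvg|exact: cvg_cst].
have bd : \forall x \ae mu A, forall k, `|theta k x * g x| <= `|g x|.
  by apply: aeW => x k; have /andP[t0 t1] := theta01 k x; rewrite normrM ler_piMl// ger0_norm.
exact: (@dominated_Int _ (borel M) R (mu A) _ _ _ mtg mg cv ng bd).2.
Qed.

Lemma theta_dot_cvg u : rint (mu A) (fun x => u x * rho x) ->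
  dot (theta k) u @[k --> \oo] --> \int[mu A]_x (u x * rho x).
Proof.
move=> /theta_Int_cvg; apply: cvg_eq_seq => k; rewrite /L2dot.
by congr (Rintegral _ _ _); apply/funext => x; rewrite mulrA.
Qed.

Lemma theta_pot_dot_cvg u : rint (mu A) (fun x => V x * u x) ->
  dot (theta_pot k) u @[k --> \oo] --> \int[mu A]_x (V x * u x).
Proof.
move=> /theta_Int_cvg; apply: cvg_eq_seq => k; rewrite /L2dot.
by congr (Rintegral _ _ _); apply/funext => x; rewrite /theta_pot; field; rewrite gt_eqF.
Qed.

(** Two approximations of the pair (1, V / rho) are compared: the unknown sequences behind the
    extensions, along which the pairing tends to the integral of K phi rho, and the cut-offs
    theta_k. By dominated convergence both lead to c int S1 phi rho + int V S2 phi. *)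
Lemma pair_limit_pos phi : LL phi -> rint (mu A) (fun x => phi x * rho x) -> (\forall x \ae mu A, 0 <= phi x) ->
  rint (mu A) (fun x => K x * phi x * rho x) /\
  c * dot (theta k) (S1 phi) + dot (theta_pot k) (S2 phi) @[k --> \oo] --> \int[mu A]_x (K x * phi x * rho x).
Proof.
move=> Lp rp p0; have [r1 r2] := pair_L1 Lp rp p0.
have L1 := LS1 Lp; have L2 := LS2 Lp.
have [f [g [Lfg [bf bg] [cf cg] h01 hK]]] := pair_approx.
have Lh k : LL (fun x => c * S1 (f k) x + S2 (g k) x).
  have [Lf Lg] := Lfg k; apply: L2D => //; last exact: LS2.
  by apply: L2Z => //; exact: LS1.
have np : rint (mu A) (fun x => `|phi x * rho x|).
  exact: rint_norm.
have [rK limK] : rint (mu A) (fun x => K x * phi x * rho x) /\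
    dot (fun x => c * S1 (f k) x + S2 (g k) x) phi @[k --> \oo] --> \int[mu A]_x (K x * phi x * rho x).
  apply: (@dominated_Int _ (borel M) R (mu A) (fun k x => (c * S1 (f k) x + S2 (g k) x) * phi x * rho x)
    (fun x => K x * phi x * rho x) (fun x => `|phi x * rho x|)) => //.
  - by move=> k; exact: (rint_measurable (dot_rint (Lh k) Lp)).
  - by apply: measurable_funM => //; apply: measurable_funM => //; exact: Lp.1.
  - apply: aeS hK => x hKx; apply: cvgM; last exact: cvg_cst.
    by apply: cvgM; [exact: hKx|exact: cvg_cst].
  - apply: aeS h01 => x hx k; have /andP[h0 h1] := hx k.
    by rewrite -mulrA normrM ler_piMl// ger0_norm.
split=> //.
have l1 := theta_dot_cvg r1; have l2 := theta_pot_dot_cvg r2.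
have n1 : rint (mu A) (fun x => `|S1 phi x * rho x|) by exact: rint_norm.
have n2 : rint (mu A) (fun x => `|V x * S2 phi x|) by exact: rint_norm.
have k1 : dot (f k) (S1 phi) @[k --> \oo] --> \int[mu A]_x (S1 phi x * rho x).
  apply: (@dominated_Int _ (borel M) R (mu A) (fun k x => f k x * S1 phi x * rho x)
    (fun x => S1 phi x * rho x) (fun x => `|S1 phi x * rho x|) _ _ _ n1 _).2.
  - by move=> k; exact: (rint_measurable (dot_rint (Lfg k).1 L1)).
  - exact: (rint_measurable r1).
  - apply: aeS cf => x cfx; rewrite (_ : S1 phi x * rho x = 1 * S1 phi x * rho x); last by rewrite mul1r.
    by apply: cvgM; [apply: cvgM; [exact: cfx|exact: cvg_cst]|exact: cvg_cst].
  - by apply: aeS bf => x bx k; rewrite -mulrA normrM ler_piMl.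
have k2 : dot (g k) (S2 phi) @[k --> \oo] --> \int[mu A]_x (V x * S2 phi x).
  apply: (@dominated_Int _ (borel M) R (mu A) (fun k x => g k x * S2 phi x * rho x)
    (fun x => V x * S2 phi x) (fun x => `|V x * S2 phi x|) _ _ _ n2 _).2.
  - by move=> k; exact: (rint_measurable (dot_rint (Lfg k).2 L2)).
  - exact: (rint_measurable r2).
  - apply: aeS cg => x cgx.
    rewrite (_ : V x * S2 phi x = V x / rho x * S2 phi x * rho x); last by field; rewrite gt_eqF.
    apply: cvgM; last exact: cvg_cst.
    by apply: cvgM; [exact: cgx|exact: cvg_cst].
  - apply: aeS bg => x bx k; rewrite !normrM (ger0_norm (V0 x)) (gtr0_norm (rho0 x)).
    by rewrite mulrAC ler_wpM2r// -ler_pdivlMr.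
have e1 : c * dot (theta k) (S1 phi) + dot (theta_pot k) (S2 phi) @[k --> \oo] -->
    c * \int[mu A]_x (S1 phi x * rho x) + \int[mu A]_x (V x * S2 phi x).
  by apply: cvgD => //; apply: cvgM => //; exact: cvg_cst.
have e2 : c * dot (f k) (S1 phi) + dot (g k) (S2 phi) @[k --> \oo] -->
    c * \int[mu A]_x (S1 phi x * rho x) + \int[mu A]_x (V x * S2 phi x).
  by apply: cvgD => //; apply: cvgM => //; exact: cvg_cst.
have e3 : c * dot (f k) (S1 phi) + dot (g k) (S2 phi) @[k --> \oo] --> \int[mu A]_x (K x * phi x * rho x).
  apply: cvg_eq_seq limK => k; have [Lf Lg] := Lfg k.
  exact: pair_dot.
by have <- := cvg_unique (@Rhausdorff R) e2 e3.
Qed.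

Lemma pair_limit phi : LL phi -> rint (mu A) (fun x => phi x * rho x) ->
  c * dot (theta k) (S1 phi) + dot (theta_pot k) (S2 phi) @[k --> \oo] --> \int[mu A]_x (K x * phi x * rho x).
Proof.
(* Here phi = |phi| - (|phi| - phi) is a difference of two nonnegative functions. *)
move=> Lp rp; pose p1 x := `|phi x|; pose p2 x := p1 x - phi x.
have mp : measurable_fun [set: borel M] phi := Lp.1.
have Lp1 : LL p1.
  apply: (@sqi_le _ (borel M) R (mu A) rho mrho rho_ge0 _ _ _ _ Lp); first exact: measurableT_comp.
  by move=> x; rewrite normr_id.
have Lp2 : LL p2 by exact: L2B.
have rp1 : rint (mu A) (fun x => p1 x * rho x).
  apply: rint_le (rint_norm rp) => //.
    by apply: measurable_funM => //; exact: Lp1.1.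
  by move=> x; rewrite !normrM normr_id.
have rp2 : rint (mu A) (fun x => p2 x * rho x).
  by have := rintB rp1 rp; under eq_fun do rewrite -mulrBl.
have p1_ge0 : \forall x \ae mu A, 0 <= p1 x by apply: aeW => x; exact: normr_ge0.
have p2_ge0 : \forall x \ae mu A, 0 <= p2 x by apply: aeW => x; rewrite subr_ge0 ler_norm.
have [rK1 l1] := pair_limit_pos Lp1 rp1 p1_ge0.
have [rK2 l2] := pair_limit_pos Lp2 rp2 p2_ge0.
have L := cvgB l1 l2; rewrite -(IntB rK1 rK2) in L.
rewrite (_ : (fun x => K x * p1 x * rho x - K x * p2 x * rho x) = (fun x => K x * phi x * rho x)) in L; last first.
  by apply/funext => x; rewrite /p2; ring.
apply: (@cvg_eq_seq _ (fun k => (c * dot (theta k) (S1 p1) + dot (theta_pot k) (S2 p1)) -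
  (c * dot (theta k) (S1 p2) + dot (theta_pot k) (S2 p2)))) => [k|]; last exact: L.
have Lt : LL (theta k) := csmth_LL (theta_csmth k).
have Lv : LL (theta_pot k) := csmth_LL (theta_pot_csmth k).
have Lk : LL (fun x => c * S1 (theta k) x + S2 (theta_pot k) x).
  by apply: L2D => //; [apply: L2Z => //; exact: LS1|exact: LS2].
rewrite -!pair_dot// -(L2dotBr Lk Lp1 Lp2); congr (L2dot _ _ _ _); apply/funext => x.
by rewrite /p2; ring.
Qed.

End dual_pair.

(** * Smooth functions of time and space *)

Section time_slices.
Context {R : realType} {E : normedModType R}.
Implicit Types (W : set (R * E)) (f : R * E -> R).

Lemma open_timeX (P : set R) (U : set E) : open P -> open U -> open [set p : R * E | P p.1 /\ U p.2].
Proof.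
move=> oP oU; rewrite (_ : [set p | _] = fst @^-1` P `&` snd @^-1` U)//.
by apply: openI; apply: open_comp => // x _; [exact: cvg_fst|exact: cvg_snd].
Qed.

Lemma continuous_slice2 f t x :
  {for (t, x), continuous f} -> {for x, continuous (fun y => f (t, y))}.
Proof.
move=> cf; apply: (@continuous_comp _ _ _ (fun y => (t, y)) f) => //.
move=> A [[P Q] /= [Pt Qx] PQ]; rewrite /= nbhs_simpl /=.
by apply: filterS Qx => s Qs; apply: PQ; split=> //; exact: nbhs_singleton.
Qed.

Lemma Smooth_slice W f t (U : set E) : open U -> (forall y, U y -> W (t, y)) -> Smooth W f ->
  Smooth U (fun y => f (t, y)).
Proof.
move=> oU UW sf.
apply: (@Smooth_derive_family R E R U (fun h => exists2 g, Smooth W g & h = fun y => g (t, y))) => //;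
  last by exists f.
move=> _ [g sg ->]; split.
- by move=> x Ux; apply: continuous_slice2; exact: (Smooth_cont sg (UW _ Ux)).
- by move=> x v Ux; have [] := slice_growth (Smooth_derivable (v := (0, v)) sg (UW _ Ux)).
- move=> v; exists (fun y => 'D_(0, v) g (t, y)); last first.
    by move=> y Uy; have [_ ->] := slice_growth (Smooth_derivable (v := (0, v)) sg (UW _ Uy)).
  by exists ('D_(0, v) g) => //; exact: Smooth_derive.
Qed.

Lemma slice1_growth f t x : derivable f (t, x) (1, 0) ->
  derivable (fun s => f (s, x)) t 1 /\ 'D_1 (fun s => f (s, x)) t = 'D_(1, 0) f (t, x).
Proof.
rewrite /derivable /derive.
suff -> : (fun h : R => h^-1 *: (((fun s => f (s, x)) \o shift t) (h *: 1) - f (t, x))) =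
  (fun h : R => h^-1 *: ((f \o shift (t, x)) (h *: (1, 0)) - f (t, x))) by [].
apply/funext => h /=; congr (_ *: (f _ - _)).
by apply: injective_projections => //=; rewrite scaler0 add0r.
Qed.

End time_slices.

Section time_functions.
Context {R : realType} {n : nat} {M : ptopologicalType} (A : weighted R n M).
Implicit Types (u : R -> M -> R) (K : set M).
Local Notation smth := (msmooth A setT).
Local Notation tdom c := [set p : R * 'rV[R]_n | 0 < p.1 /\ img (c : chart A) p.2].
Local Notation pull u c := (fun p : R * 'rV[R]_n => u p.1 (param (c : chart A) p.2)).

Inductive tsmooth u : Prop := TSmooth of forall c, Smooth (tdom c) (pull u c).

Lemma tsmoothE u : smooth_pos_time A u <-> tsmooth u.
Proof. by split=> [su|[su] c]; [split=> c; split; exact: su|have [] := su c]. Qed.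

Lemma open_tdom c : open (tdom c).
Proof. exact: (@open_timeX R 'rV[R]_n [set s | 0 < s] (img c) (@open_pos R) (@open_img _ _ _ A c)). Qed.

Lemma tsmooth_eq u v : (forall t x, 0 < t -> u t x = v t x) -> tsmooth u -> tsmooth v.
Proof.
move=> uv [su]; split=> c; apply: Smooth_eq (su c); first exact: open_tdom.
by move=> p [p0 _] /=; exact: uv.
Qed.

Lemma tsmoothD u v : tsmooth u -> tsmooth v -> tsmooth (fun t x => u t x + v t x).
Proof. by move=> [su] [sv]; split=> c; exact: (SmoothD (@open_tdom c) (su c) (sv c)). Qed.

Lemma tsmoothM u v : tsmooth u -> tsmooth v -> tsmooth (fun t x => u t x * v t x).
Proof. by move=> [su] [sv]; split=> c; exact: (SmoothM (@open_tdom c) (su c) (sv c)). Qed.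

Lemma tsmooth_time (h : R -> R) : Smooth setT h -> tsmooth (fun t _ => h t).
Proof.
move=> sh; split=> c; apply: (@Smooth_comp1 _ _ setT _ h fst) => //; first exact: open_tdom.
by apply: Smooth_linear; [exact: open_tdom|move=> p; exact: cvg_fst].
Qed.

Lemma tsmooth_cst (a : R) : tsmooth (fun _ _ => a).
Proof. exact: (tsmooth_time (@Smooth_cst _ _ _ setT a)). Qed.

Lemma tslice u t : tsmooth u -> 0 < t -> smth (u t).
Proof.
move=> [su] t0; apply/smoothE => c; apply/SmoothE.
apply: (Smooth_slice (W := tdom c) (f := pull u c) (t := t)) => //; exact: open_img.
Qed.

Lemma tderivable u t x : tsmooth u -> 0 < t ->
  derivable (u ^~ x) t 1 /\
  forall c, dom c x -> (u ^~ x)^`()%classic t = 'D_(1, 0) (pull u c) (t, Defs.coord c x).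
Proof.
move=> [su] t0; have H c (cx : dom c x) : derivable (u ^~ x) t 1 /\
    (u ^~ x)^`()%classic t = 'D_(1, 0) (pull u c) (t, Defs.coord c x).
  have Wp : tdom c (t, Defs.coord c x) by split=> //; exact: img_coord.
  have [dr e] := slice1_growth (Smooth_derivable (v := (1 : R, 0 : 'rV[R]_n)) (su c) Wp).
  have E : (fun s => u (s, Defs.coord c x).1 (param c (s, Defs.coord c x).2)) = u ^~ x.
    by apply/funext => s /=; rewrite coordK.
  by rewrite E in dr e; rewrite derive1E.
by split; [case: (H _ (dom_chart_at A x))|move=> c cx; case: (H c cx)].
Qed.

Lemma tderive u : tsmooth u -> tsmooth (fun t x => (u ^~ x)^`()%classic t).
Proof.
move=> su; split=> c; have [/(_ c) suc] := su.
apply: (@Smooth_eq _ _ _ (tdom c) ('D_(1, 0) (pull u c)) _ (@open_tdom c) _ (@Smooth_derive _ _ _ _ _ (1 : R, 0 : 'rV[R]_n) suc)).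
move=> -[t y] [/= t0 [x cx <-]].
rewrite coordK//; have [_ /(_ c cx) ->] := tderivable x su t0.
by [].
Qed.

Lemma tcont u t x : tsmooth u -> 0 < t -> {for (t, x), continuous (fun p : R * M => u p.1 p.2)}.
Proof.
move=> [su] t0; pose c := chart_at A x; have cx : dom c x := dom_chart_at A x.
have cp : {for (t, x), continuous (fun p : R * M => pull u c (p.1, Defs.coord c p.2))}.
  apply: (@continuous_comp _ _ _ (fun p : R * M => (p.1, Defs.coord c p.2)) (pull u c)).
    have c2 : (fun p : R * M => Defs.coord c p.2) @ (t, x) --> Defs.coord c x.
      by apply: (@cvg_comp _ _ _ snd (Defs.coord c)); [exact: cvg_snd|exact: coord_cont].
    have c1 : (fun p : R * M => p.1) @ (t, x) --> t by exact: cvg_fst.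
    exact: (cvg_pair c1 c2).
  by apply: (Smooth_cont (su c)); split=> //; exact: img_coord.
have oD : open [set p : R * M | dom c p.2].
  by rewrite (_ : [set p | _] = snd @^-1` dom c)//; apply: open_comp => [p _|]; [exact: cvg_snd|exact: open_dom].
by apply: (continuous_eq_on oD _ _ cp) => // -[s y] /= cy; rewrite coordK.
Qed.

Lemma tcont_time u t x : tsmooth u -> 0 < t -> {for t, continuous (u ^~ x)}.
Proof.
move=> su t0; have [d _] := tderivable x su t0.
by apply: differentiable_continuous; exact/derivable1_diffP.
Qed.

Lemma tbounded u (a b : R) K : tsmooth u -> 0 < a -> compact K ->
  exists2 C : R, 0 < C & forall t x, a <= t <= b -> K x -> `|u t x| <= C.
Proof.
move=> su a0 cK; have cS : compact (`[a, b]%classic `*` K).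
  by apply: compact_setX => //; exact: segment_compact.
have cu : {within `[a, b]%classic `*` K, continuous (fun p : R * M => u p.1 p.2)}.
  apply: continuous_in_subspaceT => -[t x]; rewrite inE => -[/=]; rewrite in_itv/= => /andP[ta _] _.
  by apply: tcont => //; exact: lt_le_trans ta.
have := continuous_compact cu cS => /compact_bounded[C [_ HC]].
exists (`|C| + 1) => [|t x tab Kx]; first by rewrite ltr_wpDl.
apply: (HC (`|C| + 1)); first by rewrite (le_lt_trans (ler_norm _))// ltrDl.
by exists (t, x) => //; split=> //=; rewrite in_itv.
Qed.

Lemma tlipschitz u (a b : R) K : tsmooth u -> 0 < a -> compact K ->
  exists2 C : R, 0 < C & forall s t x, a <= s -> s <= t -> t <= b -> K x -> `|u t x - u s x| <= C * (t - s).
Proof.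
move=> su a0 cK; have [C C0 HC] := tbounded b (tderive su) a0 cK; exists C => // s t x sa st tb Kx.
move: st; rewrite le_eqVlt => /predU1P[->|st]; first by rewrite !subrr normr0 mulr0.
have der r : s <= r -> is_derive r 1 (u ^~ x) ((u ^~ x)^`()%classic r).
  move=> sr; have r0 : 0 < r by apply: lt_le_trans a0 (le_trans sa sr).
  by rewrite derive1E; apply/derivableP; case: (tderivable x su r0).
have cts : {within `[s, t]%classic, continuous (u ^~ x)}.
  apply: continuous_in_subspaceT => r; rewrite inE/= in_itv/= => /andP[sr _].
  by apply: tcont_time => //; apply: lt_le_trans a0 (le_trans sa sr).
have der' r : r \in `]s, t[ -> is_derive r 1 (u ^~ x) ((u ^~ x)^`()%classic r).
  by rewrite in_itv/= => /andP[/ltW sr _]; exact: der.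
have [r] := MVT st der' cts; rewrite in_itv/= => /andP[sr rt] ->.
have st0 : 0 < t - s by rewrite subr_gt0.
rewrite normrM (gtr0_norm st0) ler_wpM2r ?(ltW st0)//; apply: HC => //.
by rewrite (le_trans sa (ltW sr)) (le_trans (ltW rt) tb).
Qed.

End time_functions.

(** * Time averages *)

Section time_average.
Context {R : realType} {n : nat} {M : ptopologicalType} (A : weighted R n M).
Local Notation smth := (msmooth A setT).
Local Notation leb := (@lebesgue_measure R).
Local Notation tdom c := [set p : R * 'rV[R]_n | 0 < p.1 /\ img (c : chart A) p.2].
Local Notation pull w c := (fun p : R * 'rV[R]_n => w p.1 (param (c : chart A) p.2)).
Local Notation e_ k := (delta_mx 0 k : 'rV[R]_n).

Lemma Rintegral_sum_itv (a b : R) (I : Type) (r : seq I) (f : I -> R -> R) :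
  (forall i t, a <= t <= b -> {for t, continuous (f i)}) ->
  \int[leb]_(t in `[a, b]) (\sum_(i <- r) f i t) = \sum_(i <- r) \int[leb]_(t in `[a, b]) f i t.
Proof.
move=> cf; have is_ (s : seq I) : leb.-integrable `[a, b] (EFin \o (fun t => \sum_(i <- s) f i t)).
  apply: itv_continuous_integrable => t tab; elim: s => [|i s ih].
    rewrite (_ : (fun _ => _) = cst 0); first exact: cst_continuous.
    by apply/funext => q; rewrite big_nil.
  rewrite (_ : (fun _ => _) = (fun t => f i t + \sum_(j <- s) f j t)); last by apply/funext => q; rewrite big_cons.
  by apply: continuousD => //; exact: cf.
elim: r => [|i r ih].
  by rewrite big_nil; under eq_Rintegral do rewrite big_nil; rewrite Rintegral_cst//= mul0r.
rewrite big_cons -ih -RintegralD//; last exact: itv_continuous_integrable (cf i).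
by apply: eq_Rintegral => t _; rewrite big_cons.
Qed.

(** The coefficients sqrt(det g) Psi g^lk of the Laplacian in divergence form; they do not depend on
    time and pass through time integrals. *)
Definition lap_coef (c : chart A) (l k : 'I_n) (y : 'rV[R]_n) : R :=
  vol_density c (param c y) * weight A (param c y) * invmx (metric c (param c y)) l k.

Lemma lap_coef_Smooth c l k : Smooth (img c) (lap_coef c l k).
Proof.
have oi := @open_img _ _ _ A c; apply: (SmoothM oi); last exact: (Smooth_mx_entry _ _ oi (metric_inv_Smooth c)).
by apply: (SmoothM oi); [exact: vol_density_Smooth|exact: (smooth_Smooth c (weight_smth A))].
Qed.

Lemma laplacian_chart u x (c := chart_at A x) : laplacian A u x = (weight A x)^-1 * ((vol_density c x)^-1 *
  \sum_k 'D_(e_ k) (fun y => \sum_l lap_coef c l k y * 'D_(e_ l) (u \o param c) y) (Defs.coord c x)).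
Proof.
rewrite /laplacian divE; congr (_ * (_ * _)); apply: eq_bigr => k _.
apply: (derive_eq_on _ (@open_img _ _ _ A c)) => [_ [y cy <-]|]; last exact/img_coord/dom_chart_at.
rewrite /= mxE mxE mulr_sumr mulr_sumr; apply: eq_bigr => l _.
by rewrite mxE /partial /lap_coef !coordK//; ring.
Qed.

Variables (w : R -> M -> R) (a b : R).
Hypotheses (sw : tsmooth A w) (a0 : 0 < a) (ab : a <= b).
Local Notation g := (fun x : M => \int[leb]_(t in `[a, b]) w t x).
Let in_tdom c t y : a <= t <= b -> img c y -> tdom c (t, y).
Proof. by move=> /andP[ta _] cy; split=> //=; exact: lt_le_trans ta. Qed.

Lemma tint_smth : smth g.
Proof.
apply: smth_charts => c; have [/(_ c) sc] := sw.
exact: (@Smooth_param_integral _ _ a b (img c) (tdom c) (pull w c) ab (@open_img _ _ _ A c) (fun t y => @in_tdom c t y) sc).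
Qed.

Lemma derive_tint c (W : R * 'rV[R]_n -> R) y (v : 'rV[R]_n) : Smooth (tdom c) W -> img c y ->
  'D_v (fun y => \int[leb]_(t in `[a, b]) W (t, y)) y = \int[leb]_(t in `[a, b]) 'D_(0, v) W (t, y).
Proof.
move=> sW cy; apply: (derive_param_integral ab _).2.
have : \forall z \near y, img c z by apply: open_nbhs_nbhs; split=> //; exact: open_img.
apply: filterS => z cz t tab; have Wt := in_tdom tab cz; split.
- exact: (Smooth_cont sW Wt).
- exact: (Smooth_derivable sW Wt).
- exact: (Smooth_cont (Smooth_derive _ sW) Wt).
Qed.

(** In coordinates the Laplacian is a sum of derivatives of the fluxes [W k], which are smooth in
    (t, y). Differentiation under the integral sign is used once for the inner and once for the
    outer derivative. *)
Lemma laplacian_tint x : leb.-integrable `[a, b] (EFin \o (fun t => laplacian A (w t) x)) /\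
  laplacian A g x = \int[leb]_(t in `[a, b]) laplacian A (w t) x.
Proof.
set c := chart_at A x; have cx : dom c x := dom_chart_at A x; have yx := img_coord cx.
have [/(_ c) sc] := sw; have oW := @open_tdom _ _ _ A c; have oi := @open_img _ _ _ A c.
pose W k p := \sum_l lap_coef c l k p.2 * 'D_(0 : R, e_ l) (pull w c) p.
have sB l k : Smooth (tdom c) (fun p => lap_coef c l k p.2 * 'D_(0 : R, e_ l) (pull w c) p).
  apply: (SmoothM oW); last exact: Smooth_derive.
  have s2 : Smooth (tdom c) (snd : R * 'rV[R]_n -> 'rV[R]_n).
    by apply: (@Smooth_linear _ _ _ _ snd) => //; move=> p; exact: cvg_snd.
  exact: (@Smooth_comp_rV _ _ _ (img c) (tdom c) (lap_coef c l k) snd oW oi (fun p hp => hp.2) (lap_coef_Smooth c l k) s2).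
have sW k : Smooth (tdom c) (W k).
  exact: (@Smooth_sum _ _ _ _ _ _ (fun l p => lap_coef c l k p.2 * 'D_(0 : R, e_ l) (pull w c) p) oW (fun l _ => sB l k)).
have ct (f : R * 'rV[R]_n -> R) y : Smooth (tdom c) f -> img c y -> forall t, a <= t <= b -> {for t, continuous (fun s => f (s, y))}.
  by move=> sf cy t tab; apply: continuous_slice1; exact: (Smooth_cont sf (in_tdom tab cy)).
have E1 k : 'D_(e_ k) (fun y => \sum_l lap_coef c l k y * 'D_(e_ l) (g \o param c) y) (Defs.coord c x) =
    \int[leb]_(t in `[a, b]) 'D_(0, e_ k) (W k) (t, Defs.coord c x).
  rewrite -(derive_tint _ (sW k) yx); apply: (derive_eq_on _ oi) => // y cy.
  rewrite /W Rintegral_sum_itv; last first.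
    by move=> l t tab; exact: (ct _ y (sB l k) cy t tab).
  apply: eq_bigr => l _; apply: etrans (congr1 _ (derive_tint (W := pull w c) (e_ l) sc cy)) _.
  have iD : leb.-integrable `[a, b] (EFin \o (fun t => 'D_(0 : R, e_ l) (pull w c) (t, y))).
    by apply: itv_continuous_integrable; apply: (ct ('D_(0 : R, e_ l) (pull w c))) => //; exact: Smooth_derive.
  have EZ := RintegralZl (mu := leb) (lap_coef c l k y) (@measurable_itv R `[a, b]) iD.
  apply: etrans (esym EZ) _; exact: eq_Rintegral.
have iS : leb.-integrable `[a, b] (EFin \o (fun t => \sum_k 'D_(0, e_ k) (W k) (t, Defs.coord c x))).
  apply: itv_continuous_integrable; apply: (ct (fun p => \sum_k 'D_(0, e_ k) (W k) p)) => //.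
  exact: (@Smooth_sum _ _ _ _ _ _ (fun k => 'D_(0 : R, e_ k) (W k)) oW (fun k _ => Smooth_derive _ (sW k))).
have EL t : a <= t <= b -> (weight A x)^-1 * ((vol_density c x)^-1 * \sum_k 'D_(0, e_ k) (W k) (t, Defs.coord c x)) = laplacian A (w t) x.
  move=> tab; apply: etrans _ (esym (laplacian_chart (w t) x)).
  do 2 apply: (f_equal ( *%R _)); apply: eq_bigr => k _.
  have Wt := in_tdom tab yx.
  rewrite -(slice_growth (Smooth_derivable (v := (0 : R, e_ k)) (sW k) Wt)).2; apply: (derive_eq_on _ oi) => // y cy.
  apply: eq_bigr => l _; congr (_ * _).
  by rewrite -(slice_growth (Smooth_derivable (v := (0 : R, e_ l)) sc (in_tdom tab cy))).2.
have iL : leb.-integrable `[a, b] (EFin \o (fun t => (weight A x)^-1 * ((vol_density c x)^-1 * \sum_k 'D_(0, e_ k) (W k) (t, Defs.coord c x)))).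
  apply: itv_continuous_integrable; apply: (ct (fun p => (weight A x)^-1 * ((vol_density c x)^-1 * \sum_k 'D_(0, e_ k) (W k) p))) => //.
  apply: (SmoothM oW (Smooth_cst _ _)); apply: (SmoothM oW (Smooth_cst _ _)).
  exact: (@Smooth_sum _ _ _ _ _ _ (fun k => 'D_(0 : R, e_ k) (W k)) oW (fun k _ => Smooth_derive _ (sW k))).
split.
  apply: eq_integrable iL => // t; rewrite inE/= in_itv/= => tab; rewrite /= EL//.
rewrite laplacian_chart -/c.
under eq_bigr do rewrite E1.
rewrite -Rintegral_sum_itv; last by move=> k t tab; apply: (ct ('D_(0, e_ k) (W k))) => //; exact: Smooth_derive.
rewrite mulrA -RintegralZl//; apply: eq_Rintegral => t; rewrite inE/= in_itv/= => tab.
by rewrite -mulrA EL.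
Qed.

Lemma tint_derive x : a < b -> \int[leb]_(t in `[a, b]) (w ^~ x)^`()%classic t = w b x - w a x.
Proof.
move=> ab'; have d (t : R) : 0 < t -> derivable (w ^~ x) t 1 by move=> t0; case: (tderivable x sw t0).
have b0 := lt_le_trans a0 ab.
have cd (t : R) : 0 < t -> {for t, continuous (w ^~ x)} by move=> t0; exact: (tcont_time sw t0).
rewrite /Rintegral (@continuous_FTC2 _ _ (w ^~ x)) //.
- by apply: continuous_in_subspaceT => t; rewrite inE/= in_itv/= => /andP[ta _];
    apply: (tcont_time (x := x) (tderive sw)); exact: lt_le_trans ta.
- split.
  + by move=> t; rewrite in_itv/= => /andP[ta _]; apply: d; exact: lt_trans ta.
  + by apply: cvg_at_right_filter; exact: cd.
  + by apply: cvg_at_left_filter; exact: cd.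
Qed.

End time_average.

Lemma int_increment {R : realType} (g : R -> R) (s t c K : R) : continuous g -> 0 <= s <= t ->
  (forall r, s <= r <= t -> `|g r - c| <= K) ->
  `|\int[@lebesgue_measure R]_(r in `[0, t]) g r - \int[@lebesgue_measure R]_(r in `[0, s]) g r - (t - s) * c| <=
  (t - s) * K.
Proof.
move=> cg /andP[s0 st] gK.
have i a b : (@lebesgue_measure R).-integrable `[a, b] (EFin \o g) by apply: itv_continuous_integrable => r _; exact: cg.
rewrite (Rintegral_itvB (i 0 t)) ?bnd_simp// Rintegral_itv_obnd_cbnd; last first.
  by apply: (integrableS _ _ _ (i s t)) => //; exact: subset_itv_oc_cc.
have -> : (t - s) * c = \int[@lebesgue_measure R]_(r in `[s, t]) c.
  by rewrite Rintegral_cst//= lebesgue_measure_itv/= lte_fin; case: ltgtP st => //= [_ _|-> _]; rewrite mulrC ?subrr.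
rewrite -RintegralB_itv => [|r _|r _]; [|exact: cg|exact: cst_continuous].
apply: norm_Rintegral_itv_le => // r _.
by apply: continuousB; [exact: cg|exact: cst_continuous].
Qed.

(** * The functions H and N *)

Section heat_and_resolvent_of_one.
Context {R : realType} {n : nat} {M : ptopologicalType} (A : weighted R n M).
Implicit Types (f h u v phi : M -> R).
Local Notation smth := (msmooth A setT).
Local Notation csmth := (csmth A).
Variables (rho V : M -> R).
Hypotheses (srho : smth rho) (sV : smth V) (rho0 : forall x, 0 < rho x) (V0 : forall x, 0 <= V x).
Variables (T G : R -> (M -> R) -> M -> R) (H N : R -> M -> R).
Hypotheses (TP : is_semigroup A rho V T) (GP : is_resolvent A rho V G)
  (HP : is_H A rho V T H) (NP : is_N A rho V G N).
Local Notation LL := (L2 A rho).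
Local Notation dot := (L2dot A rho).
Local Notation schr := (schrodinger A rho V).
Local Notation It := (time_integral A rho T).
Local Notation r1 phi := (rint (mu A) (fun x => phi x * rho x)).
Local Notation th := (theta A).
Local Notation leb := (@lebesgue_measure R).
Local Notation thV := (theta_pot A rho V).
Let Lc f : csmth f -> LL f := @csmth_LL _ _ _ A rho srho rho0 f.
Let LTs t f : 0 <= t -> LL f -> LL (T t f) := @LT _ _ _ A rho V T TP t f.
Let LIs t f : 0 <= t -> LL f -> LL (It t f) := @LIt _ _ _ A rho V srho rho0 T TP t f.
Let LGs al f : 0 < al -> LL f -> LL (G al f) := @LG _ _ _ A rho V srho sV rho0 V0 G GP al f.
Let Lth k : LL (th k) := Lc (theta_csmth A k).
Let LthV k : LL (thV k) := Lc (theta_pot_csmth srho sV rho0 k).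
Let dC f h : dot f h = dot h f := L2dotC srho rho0 f h.
Let mrho : measurable_fun [set: borel M] rho := smth_measurable srho.
Let mV : measurable_fun [set: borel M] V := smth_measurable sV.

Lemma dot_ae f f' h : LL f -> LL f' -> LL h -> (\forall x \ae mu A, f x = f' x) -> dot f h = dot f' h.
Proof.
move=> Lf Lf' Lh E; apply: (@Int_ae _ (borel M)).
- exact: (rint_measurable (dot_rint srho rho0 Lf Lh)).
- exact: (rint_measurable (dot_rint srho rho0 Lf' Lh)).
- by apply: aeS E => x ->.
Qed.

Lemma dot_le f f' h : LL f -> LL f' -> LL h -> (\forall x \ae mu A, f x <= f' x) ->
  (\forall x \ae mu A, 0 <= h x) -> dot f h <= dot f' h.
Proof.
move=> Lf Lf' Lh E h0; apply: le_Int_ae; [exact: dot_rint|exact: dot_rint|].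
by apply: aeS2 E h0 => x fx hx; apply: ler_wpM2r; [exact/ltW|exact: ler_wpM2r].
Qed.

Lemma csmth_r1 phi : csmth phi -> r1 phi.
Proof. by move=> cp; have := csmth_rint_mu (csmthM srho cp); under eq_fun do rewrite mulrC. Qed.

Lemma csmth_rV phi : csmth phi -> rint (mu A) (fun x => V x * phi x).
Proof. by move=> cp; exact: csmth_rint_mu (csmthM sV cp). Qed.

Lemma heat_pair_le1 t f v : 0 <= t -> LL f -> LL v -> (\forall x \ae mu A, f x <= 1) ->
  (\forall x \ae mu A, v x <= V x / rho x) -> \forall x \ae mu A, 1 * T t f x + It t v x <= 1.
Proof.
by move=> t0 Lf Lv f1 v1; apply: aeS (TI_le1 srho sV rho0 V0 TP GP t0 Lf Lv f1 v1) => x; rewrite mul1r.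
Qed.

Lemma heat_dot t f v phi : 0 <= t -> LL f -> LL v -> LL phi ->
  dot (fun x => 1 * T t f x + It t v x) phi = dot f (T t phi) + dot v (It t phi).
Proof.
move=> t0 Lf Lv Lp; rewrite -[X in X + _]mul1r.
exact: (@pair_dot _ _ _ A rho srho rho0 (T t) (It t) 1 (fun f => LTs t0) (fun f => LIs t0)
  (fun f h => T_symm srho sV rho0 V0 TP GP t0) (fun f h => It_symm srho sV rho0 V0 TP GP t0) _ _ _ Lf Lv Lp).
Qed.

(** By symmetry this is the pairing of phi with T_t theta_k + int_0^t T_s (theta_k V / rho) ds, a
    function with values in [0, 1]; hence a bound that does not depend on k. *)
Lemma heat_dot_bound k t phi : 0 <= t -> LL phi -> r1 phi ->
  `|dot (T t phi) (th k) + dot (It t phi) (thV k)| <= \int[mu A]_x `|phi x * rho x|.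
Proof.
move=> t0 Lp rp; rewrite (dC (T t phi)) (dC (It t phi)) -heat_dot//; set kk := fun x => _.
have Lk : LL kk by apply: L2D; [exact: srho|exact: rho0|apply: L2Z => //; exact: LTs|exact: LIs].
have k1 : \forall x \ae mu A, kk x <= 1.
  by apply: heat_pair_le1 => //; apply: aeW => x; [case/andP: (theta01 A k x)|case/andP: (theta_pot_bounds A rho0 V0 k x)].
have k0 : \forall x \ae mu A, 0 <= kk x.
  have a1 : \forall x \ae mu A, 0 <= T t (th k) x.
    by apply: (T_pos srho sV rho0 V0 TP GP) => //; apply: aeW => x; case/andP: (theta01 A k x).
  have a2 : \forall x \ae mu A, 0 <= It t (thV k) x.
    by apply: (It_pos srho sV rho0 V0 TP GP) => //; apply: aeW => x; case/andP: (theta_pot_bounds A rho0 V0 k x).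
  by apply: aeS2 a1 a2 => x p q; rewrite /kk mul1r addr_ge0.
have rk := dot_rint srho rho0 Lk Lp; have np := rint_norm rp.
have kb : \forall x \ae mu A, `|kk x * phi x * rho x| <= `|phi x * rho x|.
  by apply: aeS2 k0 k1 => x p q; rewrite -mulrA normrM ler_piMl// ger0_norm.
rewrite ler_norml -IntN//; apply/andP; split; apply: le_Int_ae => //; try exact: rintN.
  by apply: aeS kb => x; rewrite ler_norml => /andP[].
by apply: aeS kb => x; rewrite ler_norml => /andP[].
Qed.

(* The time derivative of <T_t f, theta_k> + <int_0^t T_s f ds, theta_k V/rho>; its bounds are uniform
   in k. The absolute value makes it continuous on all of R. *)
Definition wflow k f (t : R) := dot (T `|t| (schr f)) (th k) + dot (T `|t| f) (thV k).

Lemma wflow_cont k f : csmth f -> continuous (wflow k f).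
Proof.
move=> cf t; rewrite /wflow; apply: (@continuousD _ _ _ (fun t : R => dot (T `|t| (schr f)) (th k)) (fun t : R => dot (T `|t| f) (thV k))).
  by apply: (T_dot_cont srho rho0 TP) => //; apply: Lc; exact: schr_csmth.
by apply: (T_dot_cont srho rho0 TP) => //; exact: Lc.
Qed.

Lemma T_dot_schr f h t : 0 <= t -> csmth f -> LL h -> dot (T t f) h = dot f h + dot (It t (schr f)) h.
Proof.
move=> t0 cf Lh; have Lf := Lc cf; have Ls := Lc (schr_csmth srho sV rho0 cf).
have LI := LIs t0 Ls; have LTf := LTs t0 Lf; rewrite -(L2dotDl srho rho0 Lf LI Lh).
apply: dot_ae => //; first exact: L2D.
by apply: aeS (T_Lop srho sV rho0 V0 TP t0 (csmth_Lop srho sV rho0 V0 cf)) => x <-; rewrite addrC subrK.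
Qed.

Lemma It_dot f h t : 0 <= t -> LL f -> LL h ->
  dot (It t f) h = \int[@lebesgue_measure R]_(s in `[0, t]) dot (T `|s| f) h.
Proof.
move=> t0 Lf Lh; have [_ HI] := It_spec srho rho0 TP t0 Lf; rewrite (HI _ Lh); apply: eq_Rintegral => s.
by rewrite inE/= in_itv/= => /andP[s0 _]; rewrite ger0_norm.
Qed.

Lemma wflow_int k f t : 0 <= t -> csmth f ->
  wflow k f t = wflow k f 0 + \int[@lebesgue_measure R]_(s in `[0, t]) wflow k (schr f) s.
Proof.
move=> t0 cf; have cs := schr_csmth srho sV rho0 cf; have css := schr_csmth srho sV rho0 cs.
have i (g h : M -> R) (s : R) : csmth g -> LL h -> (@lebesgue_measure R).-integrable `[0, s] (EFin \o (fun r => dot (T `|r| g) h)).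
  by move=> cg Lh; apply: itv_continuous_integrable => r _; exact: (T_dot_cont srho rho0 TP (Lc cg) Lh).
have E s : 0 <= s -> wflow k f s = dot (schr f) (th k) + dot f (thV k) +
    \int[@lebesgue_measure R]_(r in `[0, s]) wflow k (schr f) r.
  move=> s0; rewrite {1}/wflow (ger0_norm s0) (T_dot_schr s0 cs (Lth k)) (T_dot_schr s0 cf (LthV k)) addrACA.
  apply: etrans (f_equal2 +%R erefl (f_equal2 +%R (It_dot s0 (Lc css) (Lth k)) (It_dot s0 (Lc cs) (LthV k)))) _.
  by congr (_ + _); apply/esym/RintegralD => //; exact: i.
by rewrite (E t t0) (E 0 (lexx 0)) set_itv1 Rintegral_set1 addr0.
Qed.

Definition wbound f := \int[mu A]_x `|schr f x * rho x| + \int[mu A]_x `|V x * f x|.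

(** Expanding T_t f = f + int_0^t T_s (L f) ds in the second pairing leaves the expression bounded
    by [heat_dot_bound] for L f, plus <f, theta_k V / rho>, which is at most the integral of |V
    f|. *)
Lemma wflow_bound k f t : 0 <= t -> csmth f -> `|wflow k f t| <= wbound f.
Proof.
move=> t0 cf; have cs := schr_csmth srho sV rho0 cf.
rewrite /wflow (ger0_norm t0) (T_dot_schr t0 cf (LthV k)) addrCA addrC; apply: le_trans (ler_normD _ _) _.
apply: lerD; first by apply: heat_dot_bound => //; [exact: Lc|exact: csmth_r1].
have rf := csmth_rV cf; have nf := rint_norm rf.
have E : dot f (thV k) = \int[mu A]_x (theta A k x * (V x * f x)).
  by congr (Rintegral _ _ _); apply/funext => x; rewrite /theta_pot; field; rewrite gt_eqF.
have rt : rint (mu A) (fun x => theta A k x * (V x * f x)).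
  exact: csmth_rint_mu (csmthM (theta_csmth A k).1 (csmthM sV cf)).
have b x : `|theta A k x * (V x * f x)| <= `|V x * f x|.
  by have /andP[p q] := theta01 A k x; rewrite normrM ler_piMl// ger0_norm.
rewrite E ler_norml -IntN//; apply/andP; split; apply: le_Int => //; try exact: rintN.
  by move=> x; have := b x; rewrite ler_norml => /andP[].
by move=> x; have := b x; rewrite ler_norml => /andP[].
Qed.

(** A Taylor estimate: the derivative [wflow k f] changes by an integral of [wflow k (schr f)],
    which is bounded uniformly in k, so the remainder is quadratic in t - s with a constant that
    survives k -> oo. *)
Lemma heat_dot_increment k f s t : 0 <= s <= t -> csmth f ->
  `|(dot (T t f) (th k) + dot (It t f) (thV k)) - (dot (T s f) (th k) + dot (It s f) (thV k)) -
    (t - s) * wflow k f s| <= (t - s) * ((t - s) * wbound (schr f)).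
Proof.
move=> /andP[s0 st] cf; have t0 := le_trans s0 st; have cs := schr_csmth srho sV rho0 cf.
have E r : 0 <= r -> dot (T r f) (th k) + dot (It r f) (thV k) =
    dot f (th k) + \int[@lebesgue_measure R]_(q in `[0, r]) wflow k f q.
  move=> r0; rewrite (T_dot_schr r0 cf (Lth k)).
  apply: etrans (f_equal2 +%R (f_equal2 +%R erefl (It_dot r0 (Lc cs) (Lth k))) (It_dot r0 (Lc cf) (LthV k))) _.
  rewrite -addrA -RintegralD//.
  - by apply: itv_continuous_integrable => q _; apply: (T_dot_cont srho rho0 TP) => //; exact: Lc.
  - by apply: itv_continuous_integrable => q _; apply: (T_dot_cont srho rho0 TP) => //; exact: Lc.
rewrite !E// opprD addrACA subrr add0r; apply: int_increment; [exact: wflow_cont|by rewrite s0|].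
move=> r /andP[sr rt]; have r0 := le_trans s0 sr.
rewrite (wflow_int k r0 cf) (wflow_int k s0 cf) opprD addrACA subrr add0r.
have := @int_increment R (wflow k (schr f)) s r 0 (wbound (schr f)) (wflow_cont (k := k) cs).
rewrite mulr0 subr0 s0 sr => /(_ isT) incr; apply: (le_trans (incr _)).
  by move=> q /andP[sq qr]; rewrite subr0; apply: wflow_bound => //; exact: le_trans sq.
rewrite ler_wpM2r ?lerD2r//; apply: le_trans (wflow_bound 0 (lexx 0) cs); exact: normr_ge0.
Qed.

(** The set where f > h is open and null, and nonempty open sets have positive measure. *)
Lemma ae_le_continuous f h : continuous f -> continuous h -> (\forall x \ae mu A, f x <= h x) ->
  forall x, f x <= h x.
Proof.
move=> cf ch /ae_mu_vol[B [mB B0 fB]] x; rewrite leNgt; apply/negP => hf.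
pose U := setT `&` (fun x => f x - h x) @^-1` [set s | 0 < s].
have oU : open U.
  apply: (open_preimage_cont (@openT M)) => [y _|]; last exact: open_gt.
  by apply: continuousB; [exact: cf|exact: ch].
have Ux : U x by split=> //=; rewrite subr_gt0.
have := vol_open_gt0 A oU Ux; rewrite ltNge => /negP; apply; rewrite -B0.
apply: le_measure; rewrite ?inE//; first exact: borel_open.
by move=> y [_ /= fy]; apply: fB => /=; rewrite leNgt -subr_gt0 fy.
Qed.

Let Tp t f : 0 <= t -> LL f -> (\forall x \ae mu A, 0 <= f x) -> \forall x \ae mu A, 0 <= T t f x :=
  @T_pos _ _ _ A rho V srho sV rho0 V0 T G TP GP t f.
Let Ip t f : 0 <= t -> LL f -> (\forall x \ae mu A, 0 <= f x) -> \forall x \ae mu A, 0 <= It t f x :=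
  @It_pos _ _ _ A rho V srho sV rho0 V0 T G TP GP t f.
Let Gp al f : 0 < al -> LL f -> (\forall x \ae mu A, 0 <= f x) -> \forall x \ae mu A, 0 <= G al f x :=
  @G_pos _ _ _ A rho V srho sV rho0 V0 T G TP GP al f.
Let Ts t f h : 0 <= t -> LL f -> LL h -> dot (T t f) h = dot f (T t h) :=
  @T_symm _ _ _ A rho V srho sV rho0 V0 T G TP GP t f h.
Let Is t f h : 0 <= t -> LL f -> LL h -> dot (It t f) h = dot f (It t h) :=
  @It_symm _ _ _ A rho V srho sV rho0 V0 T G TP GP t f h.
Let Gs al f h : 0 < al -> LL f -> LL h -> dot (G al f) h = dot f (G al h) :=
  @G_symm _ _ _ A rho V srho sV rho0 V0 T G TP GP al f h.
Let T1 t f v : 0 <= t -> LL f -> LL v -> (\forall x \ae mu A, f x <= 1) ->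
  (\forall x \ae mu A, v x <= V x / rho x) -> \forall x \ae mu A, 1 * T t f x + It t v x <= 1 :=
  @heat_pair_le1 t f v.
Let G1 al f v : 0 < al -> LL f -> LL v -> (\forall x \ae mu A, f x <= 1) ->
  (\forall x \ae mu A, v x <= V x / rho x) -> \forall x \ae mu A, al * G al f x + G al v x <= 1 :=
  @G_le1 _ _ _ A rho V srho sV rho0 V0 T G TP GP al f v.

Let aeM (P : M -> Prop) : (forall x, P x) -> \forall x \ae mu A, P x.
Proof. by move=> p; apply: aeW => x; exact: p. Qed.

Lemma H_tsmooth : tsmooth A H. Proof. exact/tsmoothE/HP.1. Qed.
Lemma H_smth t : 0 < t -> smth (H t). Proof. exact: (tslice H_tsmooth). Qed.
Lemma N_smth al : 0 < al -> smth (N al). Proof. by move=> al0; apply/smoothE; case: (NP al0). Qed.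

Lemma H_bounds t x : 0 < t -> 0 <= H t x <= 1.
Proof.
move=> t0; have t0' := ltW t0; have [F1 [F2 [HF1 HF2 HE]]] := HP.2 t t0.
have HE' : \forall x \ae mu A, (H t x)%:E = (1%:E * F1 x + F2 x)%E by apply: aeS HE => y ->; rewrite mul1e.
have K := pair_K01 ltr01 (fun f => Tp t0') (fun f => Ip t0') (fun f v => T1 t0') HF1 HF2 HE'.
have cH := smooth_cont (H_smth t0); have cc (a : R) : continuous (fun _ : M => a) by move=> ?; exact: cst_continuous.
rewrite (ae_le_continuous (cc 0) cH) ?(ae_le_continuous cH (cc 1))//; by apply: aeS K => y /andP[].
Qed.

Lemma N_bounds al x : 0 < al -> 0 <= N al x <= 1.
Proof.
move=> al0; have [_ [F1 [F2 [HF1 HF2 HE]]]] := NP al0.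
have K := pair_K01 al0 (fun f => Gp al0) (fun f => Gp al0) (fun f v => G1 al0) HF1 HF2 HE.
have cN := smooth_cont (N_smth al0); have cc (a : R) : continuous (fun _ : M => a) by move=> ?; exact: cst_continuous.
rewrite (ae_le_continuous (cc 0) cN) ?(ae_le_continuous cN (cc 1))//; by apply: aeS K => y /andP[].
Qed.

Lemma H_cvg t phi : 0 < t -> LL phi -> r1 phi ->
  dot (T t phi) (th k) + dot (It t phi) (thV k) @[k --> \oo] --> \int[mu A]_x (H t x * phi x * rho x).
Proof.
move=> t0 Lp rp; have t0' := ltW t0; have [F1 [F2 [HF1 HF2 HE]]] := HP.2 t t0.
have HE' : \forall x \ae mu A, (H t x)%:E = (1%:E * F1 x + F2 x)%E by apply: aeS HE => y ->; rewrite mul1e.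
have mH : measurable_fun [set: borel M] (H t) := smth_measurable (H_smth t0).
have := pair_limit srho sV rho0 V0 ltr01 (fun f => LTs t0') (fun f => LIs t0') (fun f => Tp t0') (fun f => Ip t0')
  (fun f h => Ts t0') (fun f h => Is t0') (fun f v => T1 t0') mH HF1 HF2 HE' Lp rp.
by apply: cvg_eq_seq => k; rewrite mul1r (dC (th k)) (dC (thV k)).
Qed.

Lemma N_cvg al phi : 0 < al -> LL phi -> r1 phi ->
  al * dot (th k) (G al phi) + dot (thV k) (G al phi) @[k --> \oo] --> \int[mu A]_x (N al x * phi x * rho x).
Proof.
move=> al0 Lp rp; have [_ [F1 [F2 [HF1 HF2 HE]]]] := NP al0.
have mN : measurable_fun [set: borel M] (N al) := smth_measurable (N_smth al0).
exact: (pair_limit srho sV rho0 V0 al0 (fun f => LGs al0) (fun f => LGs al0) (fun f => Gp al0) (fun f => Gp al0)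
  (fun f h => Gs al0) (fun f h => Gs al0) (fun f v => G1 al0) mN HF1 HF2 HE Lp rp).
Qed.

Lemma test_eq0 F : smth F -> (forall phi, csmth phi -> \int[mu A]_x (F x * phi x) = 0) -> forall x, F x = 0.
Proof.
move=> sF F0 x.
have cF := smooth_cont sF.
have Fge : 0 <= F x.
  by apply: (test_ge0 cF) => phi cp _; exact: (eq_ind_r (fun z => 0 <= z) (lexx 0) (F0 phi cp)).
have Fle : 0 <= - F x.
  apply: (@test_ge0 _ _ _ A (fun y => - F y)) => [y|phi cp _]; first by apply: continuousN; exact: cF.
  have -> : (fun y => - F y * phi y) = (fun y => - (F y * phi y)) by apply/funext => y; rewrite mulNr.
  by rewrite (IntN (csmth_rint_mu (csmthM sF cp))) (F0 phi cp) oppr0.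
by apply/eqP; rewrite eq_le Fge -oppr_ge0 Fle.
Qed.

(** Comparison with s = 0, applied to both differences of the two solutions. *)
Lemma resolvent_unique al f u g : 0 < al -> Lop A rho V f u -> LL g -> (\forall x \ae mu A, al * f x - u x = g x) ->
  \forall x \ae mu A, G al g x = f x.
Proof.
move=> al0 Lfu Lg fg; have [u' Lu' Eu'] := Jf_prop GP al0 Lg.
have cmp h v : Lop A rho V h v -> (\forall x \ae mu A, al * h x - v x = 0) -> \forall x \ae mu A, h x <= 0.
  move=> Lhv hv; apply: (elliptic_comparison srho sV rho0 V0 al0 Lhv (msmooth_cst A setT 0)) => //.
  by apply: aeS hv => x ->; rewrite schr0 mulr0 subr0.
have L1 := Lop_lin srho sV rho0 V0 TP (-1) Lfu Lu'.
have L2 := Lop_lin srho sV rho0 V0 TP (-1) Lu' Lfu.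
have c1 : \forall x \ae mu A, -1 * f x + G al g x <= 0.
  by apply: cmp L1 _; apply: aeS2 fg Eu' => x p q; lra.
have c2 : \forall x \ae mu A, -1 * G al g x + f x <= 0.
  by apply: cmp L2 _; apply: aeS2 fg Eu' => x p q; lra.
by apply: aeS2 c1 c2 => x p q; apply/eqP; rewrite eq_le; apply/andP; split; lra.
Qed.

Local Notation hint t phi := (\int[mu A]_x (H t x * phi x * rho x)).

(** The estimate for fixed k has a constant independent of k; the limit identifies the derivative as
    the pairing with L phi plus the integral of V phi. *)
Lemma H_increment phi : csmth phi -> exists C : R, forall s t, 0 < s -> s <= t ->
  `|hint t phi - hint s phi - (t - s) * (hint s (schr phi) + \int[mu A]_x (V x * phi x))| <= (t - s) * ((t - s) * C).
Proof.
move=> cp; have cs := schr_csmth srho sV rho0 cp; exists (wbound (schr phi)) => s t s0 st.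
have t0 := lt_le_trans s0 st; have Lp := Lc cp; have Ls := Lc cs.
have lt := H_cvg t0 Lp (csmth_r1 cp); have ls := H_cvg s0 Lp (csmth_r1 cp).
have lw := H_cvg s0 Ls (csmth_r1 cs); have lv := theta_pot_dot_cvg rho0 (csmth_rV cp).
have lf : wflow k phi s @[k --> \oo] --> hint s (schr phi) + \int[mu A]_x (V x * phi x).
  have L := cvgD lw lv; apply: (@cvg_eq_seq _ (fun k => dot (T s (schr phi)) (th k) + dot (It s (schr phi)) (thV k) +
    dot (thV k) phi)) => [k|]; last exact: L.
  rewrite /wflow (ger0_norm (ltW s0)) (T_dot_schr (ltW s0) cp (LthV k)) (dC (thV k) phi).
  by rewrite -!addrA [X in _ + X]addrC.
have L : (dot (T t phi) (th k) + dot (It t phi) (thV k)) - (dot (T s phi) (th k) + dot (It s phi) (thV k)) -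
    (t - s) * wflow k phi s @[k --> \oo] -->
    hint t phi - hint s phi - (t - s) * (hint s (schr phi) + \int[mu A]_x (V x * phi x)).
  by apply: cvgB; [apply: cvgB|apply: cvgM => //; exact: cvg_cst].
apply: (cvgr_to_le (cvg_norm L)); apply: nearW => k.
by apply: (heat_dot_increment) => //; rewrite (ltW s0).
Qed.

Local Notation dtH := (fun t x => (H ^~ x)^`()%classic t).

(** Difference quotients of H along the steps 1/(k+1) converge under the integral because H is
    Lipschitz in time on the support of phi; the same quotients are evaluated by [H_increment]. *)
Lemma H_weak_derivative phi s : csmth phi -> 0 < s ->
  \int[mu A]_x (dtH s x * phi x * rho x) = hint s (schr phi) + \int[mu A]_x (V x * phi x).
Proof.
move=> cp s0; have [C HC] := H_increment cp.
have [sphi [K cK phi0]] := cp.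
have [Lip L0 HL] := tlipschitz (s + 1) H_tsmooth s0 cK.
pose d (k : nat) : R := k.+1%:R^-1.
have d0 k : 0 < d k by rewrite invr_gt0.
have d1 k : d k <= 1 by rewrite invf_le1 ?ler1n.
have cd : d k @[k --> \oo] --> (0 : R) by exact: cvg_harmonic.
pose q k x := (d k)^-1 * (H (s + d k) x - H s x).
have sd k : 0 < s + d k by rewrite addr_gt0.
have mq k : smth (q k).
  exact: (msmoothZ _ (@openT M) (msmoothB (@openT M) (H_smth (sd k)) (H_smth s0))).
have np := rint_norm (csmth_r1 cp).
have [_ lim1] : rint (mu A) (fun x => dtH s x * phi x * rho x) /\
    \int[mu A]_x (q k x * phi x * rho x) @[k --> \oo] --> \int[mu A]_x (dtH s x * phi x * rho x).
  have ct (f : M -> R) : smth f -> csmth (fun x => f x * phi x * rho x).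
    by move=> sf; have := csmthM srho (csmthM sf cp); under eq_fun do rewrite mulrC.
  apply: (@dominated_Int _ (borel M) R (mu A) _ _ (fun x => Lip * `|phi x * rho x|)).
  - by move=> k; exact: csmth_measurable (ct _ (mq k)).
  - exact: csmth_measurable (ct _ (tslice (tderive H_tsmooth) s0)).
  - apply: aeW => x; apply: cvgM; last exact: cvg_cst.
    apply: cvgM; last exact: cvg_cst.
    have [dH _] := tderivable x H_tsmooth s0.
    have cd' : d k @[k --> \oo] --> (0 : R)^'.
      move=> P HP0; have [K0 _ HK] := cd _ HP0; exists K0 => // k /HK; apply.
      by rewrite /= gt_eqF.
    have lim : (fun e : R => e^-1 *: (((H ^~ x) \o shift s) (e *: 1) - H s x)) @ (0 : R)^' --> 'D_1 (H ^~ x) s by exact: dH.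
    rewrite derive1E; have := cvg_comp _ _ cd' lim; apply: cvg_eq_seq => k.
    rewrite /q /=; congr (_ * (H _ x - _)).
    by rewrite addrC /GRing.scale/= mulr1.
  - exact: rintZ.
  - apply: aeW => x k; rewrite -mulrA normrM; have [Kx|Kx] := pselect (K x).
      rewrite ler_wpM2r// /q normrM gtr0_norm ?invr_gt0// ler_pdivrMl// mulrC.
      have Ed : s + d k - s = d k by ring.
      have := HL s (s + d k) x (lexx s) _ _ Kx; rewrite Ed; apply => //.
        by rewrite lerDl ltW.
      by rewrite lerD2l.
    by rewrite phi0// mul0r normr0 !mulr0.
set L := hint s (schr phi) + _.
have lim2 : \int[mu A]_x (q k x * phi x * rho x) @[k --> \oo] --> L.
  apply/cvgrPdist_le => e e0.
  have cC : d k * C @[k --> \oo] --> (0 : R) by rewrite -(mul0r C); apply: cvgM => //; exact: cvg_cst.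
  move/cvgrPdist_le/(_ _ e0) : cC; apply: filterS => k; rewrite sub0r normrN => dC'.
  have rH t : 0 < t -> rint (mu A) (fun x => H t x * phi x * rho x).
    move=> t0; apply: csmth_rint_mu; have := csmthM srho (csmthM (H_smth t0) cp).
    by under eq_fun do rewrite mulrC.
  have E : \int[mu A]_x (q k x * phi x * rho x) = (d k)^-1 * (hint (s + d k) phi - hint s phi).
    rewrite -(IntB (rH _ (sd k)) (rH _ s0)) -IntZ; last exact: rintB (rH _ (sd k)) (rH _ s0).
    by congr (Rintegral _ _ _); apply/funext => x; rewrite /q; ring.
  have := HC s (s + d k) s0; rewrite lerDl (ltW (d0 k)) => /(_ isT).
  have -> : s + d k - s = d k by ring.
  rewrite -/L => Hk.
  rewrite E distrC -(mulKf (lt0r_neq0 (d0 k)) L) -mulrBr normrM gtr0_norm ?invr_gt0//.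
  by rewrite ler_pdivrMl//; apply: le_trans Hk _; rewrite ler_wpM2l ?(ltW (d0 k))//; apply: le_trans (ler_norm _) dC'.
exact: (cvg_unique (@Rhausdorff R) lim1 lim2).
Qed.

(** Once the Laplacian has been moved from phi to H, the weak identity says that the smooth
    difference of the two sides has zero integral against every test function. *)
Lemma H_equation s x : 0 < s -> rho x * dtH s x = laplacian A (H s) x - V x * H s x + V x.
Proof.
move=> s0; pose F y := rho y * dtH s y - (laplacian A (H s) y - V y * H s y + V y).
have sH := H_smth s0; have sd : smth (dtH s) := tslice (tderive H_tsmooth) s0.
have sF : smth F.
  apply: msmoothB; [exact: openT|exact: msmoothM (@openT M) srho sd|].
  apply: msmoothD; [exact: openT|apply: msmoothB; [exact: openT|exact: laplacian_smth|exact: msmoothM (@openT M) sV sH]|exact: sV].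
have F0 phi : csmth phi -> \int[mu A]_x (F x * phi x) = 0.
  move=> cp; have cs := schr_csmth srho sV rho0 cp; have W := H_weak_derivative cp s0.
  have i1 := csmth_rint_mu (csmthM (msmoothM (@openT M) srho sd) cp).
  have i2 := csmth_rint_mu (csmthM (laplacian_smth sH) cp).
  have i3 := csmth_rint_mu (csmthM (msmoothM (@openT M) sV sH) cp).
  have i4 := csmth_rint_mu (csmthM sV cp).
  have i5 := csmth_rint_mu (csmthM sH (csmth_laplacian cp)).
  have E1 : \int[mu A]_x (dtH s x * phi x * rho x) = \int[mu A]_x (rho x * dtH s x * phi x).
    by congr (Rintegral _ _ _); apply/funext => y; ring.
  have E2 : hint s (schr phi) = \int[mu A]_x (laplacian A (H s) x * phi x) - \int[mu A]_x (V x * H s x * phi x).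
    transitivity (\int[mu A]_x (H s x * laplacian A phi x) - \int[mu A]_x (V x * H s x * phi x)).
      rewrite -(IntB i5 i3); congr (Rintegral _ _ _); apply/funext => y.
      by rewrite -mulrA (schr_rho A V rho0); ring.
    rewrite (green_sym sH cp); congr (_ - _); congr (Rintegral _ _ _); apply/funext => y.
    by rewrite mulrC.
  rewrite E1 E2 in W.
  have -> : (fun x => F x * phi x) = (fun x => rho x * dtH s x * phi x - (laplacian A (H s) x * phi x - V x * H s x * phi x + V x * phi x)).
    by apply/funext => y; rewrite /F; ring.
  have i23 := rintB i2 i3.
  rewrite (IntB i1 (rintD i23 i4)) (IntD i23 i4) (IntB i2 i3).
  by rewrite W subrr.
by apply/eqP; rewrite -subr_eq0; apply/eqP; exact: (test_eq0 sF F0).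
Qed.

(** The bound T_t g <= 1 for g = - f / C <= 1, multiplied by - C. *)
Lemma T_lower t f (C : R) : 0 <= t -> 0 < C -> LL f -> (\forall x \ae mu A, - C <= f x) ->
  \forall x \ae mu A, - C <= T t f x.
Proof.
move=> t0 C0 Lf fC; have L0 : LL (fun=> 0) := LL0 A rho0.
(* The summand 0 has the shape in which linearity of the semigroup is stated. *)
have Lg : LL (fun x => - C^-1 * f x + 0) := LLD srho rho0 (LLZ srho rho0 (- C^-1) Lf) L0.
have g1 : \forall x \ae mu A, - C^-1 * f x + 0 <= 1.
  by apply: aeS fC => x fx; rewrite addr0 mulNr lerNl ler_pdivlMl// mulrN1.
have lin := semigroup_linear TP (- C^-1) t0 Lf L0.
have lin0 := semigroup_linear TP (-1) t0 L0 L0.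
have E0 : (fun=> -1 * 0 + 0) = (fun _ : M => 0 : R) by apply/funext => x; rewrite mulr0 addr0.
rewrite E0 in lin0.
have bound := aeS2 (fun x p q => conj p q) (TI_le1 srho sV rho0 V0 TP GP t0 Lg L0 g1 (aeM (pot_ge0 rho0 V0)))
  (It0 srho rho0 TP t0).
apply: aeS3 lin lin0 bound => x Ex E0x [le1 I0]; move: le1; rewrite Ex I0 addr0.
have -> : T t (fun=> 0) x = 0 by lra.
by rewrite addr0 mulNr lerNl ler_pdivlMl// mulrN1.
Qed.

(** Heuristically H_t >= T_t tau = tau + int_0^t T_s (L tau) ds >= tau - C t. The inequality is
    proved after pairing with nonnegative test functions, since H is accessible through such
    pairings. *)
Lemma H_lower t tau : 0 < t -> csmth tau -> (forall x, 0 <= tau x <= 1) ->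
  forall C : R, 0 < C -> (forall x, - C <= schr tau x) -> forall x, tau x - C * t <= H t x.
Proof.
move=> t0 ctau tau01 C C0 sC x; have t0' := ltW t0; have Ltau := Lc ctau.
have cs := schr_csmth srho sV rho0 ctau; have Ls := Lc cs.
have key phi : csmth phi -> (forall x, 0 <= phi x) ->
    dot tau phi - C * t * \int[mu A]_x (phi x * rho x) <= hint t phi.
  move=> cp p0; have Lp := Lc cp; have rp := csmth_r1 cp.
  have LTp := LTs t0' Lp; have LIp := LIs t0' Lp.
  have Tp0 : \forall x \ae mu A, 0 <= T t phi x by apply: Tp => //; exact: aeW.
  have Ip0 : \forall x \ae mu A, 0 <= It t phi x by apply: Ip => //; exact: aeW.
  apply: (@le_trans _ _ (dot tau (T t phi))); last first.
    apply: (ler_cvg_to (theta_Int_cvg (dot_rint srho rho0 Ltau LTp)) (H_cvg t0 Lp rp)); apply: nearW => k.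
    have -> : \int[mu A]_y (theta A k y * (tau y * T t phi y * rho y)) = dot (fun y => theta A k y * tau y) (T t phi).
      by congr (Rintegral _ _ _); apply/funext => y; rewrite !mulrA.
    have Ltt : LL (fun y => theta A k y * tau y) by exact: Lc (csmthM (theta_csmth A k).1 ctau).
    have le1 : dot (fun y => theta A k y * tau y) (T t phi) <= dot (th k) (T t phi).
      apply: (dot_le) => //; apply: aeW => y.
      by have /andP[a _] := theta01 A k y; have /andP[_ b] := tau01 y; rewrite ler_piMr.
    rewrite (dC (T t phi)); apply: le_trans le1 _; rewrite lerDl; apply: Int_ge0_ae; first exact: dot_rint.
    by apply: aeS Ip0 => y Iy; have /andP[a _] := theta_pot_bounds A rho0 V0 k y; apply: mulr_ge0;
      [exact: mulr_ge0|exact: ltW].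
  rewrite -(Ts t0' Ltau Lp) (T_dot_schr t0' ctau Lp) lerD2l.
  rewrite (It_dot t0' Ls Lp) -subr_ge0 opprK.
  set c := \int[mu A]_x (phi x * rho x).
  have -> : C * t * c = \int[@lebesgue_measure R]_(s in `[0, t]) (C * c).
    by rewrite Rintegral_cst//= lebesgue_measure_itv/= lte_fin t0 /= subr0; ring.
  have cT := T_dot_cont srho rho0 TP Ls Lp.
  have iT : (@lebesgue_measure R).-integrable `[0, t] (EFin \o (fun s => dot (T `|s| (schr tau)) phi)).
    by apply: itv_continuous_integrable => s _; exact: cT.
  have ic : (@lebesgue_measure R).-integrable `[0, t] (EFin \o (fun=> C * c)).
    by apply: itv_continuous_integrable => s _; exact: cst_continuous.
  rewrite -(RintegralD _ iT ic)//; apply: Rintegral_ge0 => s _.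
  have LTw := LTs (normr_ge0 s) Ls; have low := T_lower (normr_ge0 s) C0 Ls (aeM sC).
  have -> : dot (T `|s| (schr tau)) phi + C * c = \int[mu A]_y ((T `|s| (schr tau) y + C) * (phi y * rho y)).
    rewrite /c -(IntZ C rp) -(IntD (dot_rint srho rho0 LTw Lp) (rintZ C rp)).
    by congr (Rintegral _ _ _); apply/funext => y; ring.
  apply: Int_ge0_ae.
    have := rintD (dot_rint srho rho0 LTw Lp) (rintZ C rp); congr (rint _ _); apply/funext => y; ring.
  by apply: aeS low => y ly; apply: mulr_ge0; [rewrite -lerBlDr sub0r|exact: mulr_ge0 (p0 y) (ltW (rho0 y))].
pose F y := (H t y - (tau y - C * t)) * rho y.
have sF : smth F.
  apply: msmoothM; [exact: openT| |exact: srho]; apply: msmoothB; [exact: openT|exact: H_smth|].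
  by apply: msmoothB; [exact: openT|exact: ctau.1|exact: msmooth_cst].
have : 0 <= F x.
  apply: (test_ge0 (smooth_cont sF)) => phi cp p0; have := key phi cp p0; rewrite -subr_ge0 => K0.
  have rp := csmth_r1 cp; have Lp := Lc cp.
  have rH : rint (mu A) (fun y => H t y * phi y * rho y).
    by have := csmth_rint_mu (csmthM srho (csmthM (H_smth t0) cp)); under eq_fun do rewrite mulrC.
  have rt := dot_rint srho rho0 Ltau Lp; have rc := rintZ (C * t) rp.
  have -> : (fun y => F y * phi y) = (fun y => H t y * phi y * rho y - (tau y * phi y * rho y - C * t * (phi y * rho y))).
    by apply/funext => y; rewrite /F; ring.
  by rewrite (IntB rH (rintB rt rc)) (IntB rt rc) (IntZ _ rp).
by rewrite /F pmulr_lge0// subr_ge0.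
Qed.

(** * The defect 1 - H as a solution of the heat equation *)

Definition heat_defect (t : R) (x : M) : R := if 0 < t then 1 - H t x else 0.

Lemma heat_defect_bounds t x : 0 <= heat_defect t x <= 1.
Proof.
rewrite /heat_defect; case: ifP => t0; last by rewrite lexx ler01.
by have /andP[h0 h1] := H_bounds x t0; rewrite subr_ge0 h1 lerBlDr lerDl.
Qed.

Lemma heat_defect_tsmooth : tsmooth A heat_defect.
Proof.
have s1 := tsmoothM (tsmooth_cst A (-1)) H_tsmooth.
apply: tsmooth_eq (tsmoothD (tsmooth_cst A 1) s1) => t x t0.
by rewrite /heat_defect t0 mulN1r.
Qed.

(** At time 0 a bump equal to 1 near x gives 1 - H_s <= C s there, so the extension by 0 is
    continuous. *)
Lemma heat_defect_continuous : {within [set p : R * M | 0 <= p.1], continuous (fun p => heat_defect p.1 p.2)}.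
Proof.
apply/subspace_continuousP => -[t x] /= t_ge0.
move: t_ge0; rewrite le_eqVlt => /predU1P[<-|t0]; last first.
  have C1 : (fun p : R * M => heat_defect p.1 p.2) @ (t, x) --> heat_defect t x.
    have C2 := @tcont _ _ _ A heat_defect t x heat_defect_tsmooth t0; exact: C2.
  exact: cvg_within_filter.
have [b [sb b01 [L [cL LU b0]] b1]] := bump_exists (@openT M) (I : setT x) (dom_chart_at A x).
have cb : csmth b by split=> //; exists L.
have [C0 C0_ge0 HC] := csmth_bounded (schr_csmth srho sV rho0 cb).
(* The lower bound for H asks for a strictly positive constant, and the bound C0 may be 0. *)
pose C := C0 + 1; have C_gt0 : 0 < C by rewrite ltr_wpDl.
have low s y : 0 < s -> b y - C * s <= H s y.
  move=> s0; apply: H_lower => // z; have := HC z; rewrite ler_norml => /andP[+ _].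
  by apply: le_trans; rewrite lerN2 lerDl.
have e0 : heat_defect 0 x = 0 by rewrite /heat_defect ltxx.
suff : (fun p : R * M => heat_defect p.1 p.2) @ within [set p | 0 <= p.1] (nbhs ((0 : R), x)) --> heat_defect 0 x by [].
rewrite e0; apply/cvgrPdist_le => e e_gt0.
have eC : 0 < e / C by rewrite divr_gt0.
exists ([set s : R | `|0 - s| < e / C], [set y | b y = 1]).
  by split=> //=; exists (e / C).
move=> [s y] [/= se by1] s_ge0; rewrite sub0r normrN.
have /andP[h0 _] := heat_defect_bounds s y; rewrite ger0_norm// /heat_defect; case: ifP => s0; last exact: ltW.
have := low s y s0; rewrite by1; rewrite sub0r normrN gtr0_norm// ltr_pdivlMr// mulrC in se.
lra.
Qed.

Lemma heat_defect_equation t x : 0 < t -> heat_op A rho V heat_defect t x = 0.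
Proof.
move=> t0; rewrite /heat_op.
have sH := H_smth t0.
have -> : (heat_defect ^~ x)^`()%classic t = - dtH t x.
  rewrite !derive1E (@derive_eq_on _ _ _ [set s : R | 0 < s] _ (fun s => 1 - H s x) _ _ open_pos _ t0); last first.
    by move=> s s0; rewrite /heat_defect s0.
  have [dH _] := tderivable x H_tsmooth t0.
  by rewrite deriveB//= derive_cst sub0r.
have -> : schr (heat_defect t) x = - (V x / rho x) - schr (H t) x.
  have -> : heat_defect t = (fun y => 1 + (-1) * H t y) by apply/funext => y; rewrite /heat_defect t0 mulN1r.
  rewrite {1}/schrodinger (laplacian_lin (-1) x (msmooth_cst A setT 1) sH).
  have E1 := schr1 A rho V x; rewrite /schrodinger in E1 *.
  move: (laplacian A (fun=> 1) x) (laplacian A (H t) x) E1 => p q <-.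
  by rewrite mulrDr; ring.
have := H_equation x t0; rewrite -/(dtH t x) => HE.
have r0 := rho0 x; have rn : rho x != 0 by rewrite gt_eqF.
apply: (mulfI rn); rewrite mulr0 mulrBr mulrN HE /schrodinger; field.
exact: rn.
Qed.

Lemma H_defect_heat : nontrivial_pos_time (fun t x => 1 - H t x) ->
  exists u : R -> M -> R,
    [/\ nontrivial_pos_time u, smooth_pos_time A u, bounded_continuous u,
        forall t x, 0 < t -> heat_op A rho V u t x = 0 & forall x, u 0 x = 0].
Proof.
move=> [t [t0 [x Hx]]]; exists heat_defect; split.
- by exists t; split=> //; exists x; rewrite /heat_defect t0.
- exact/tsmoothE/heat_defect_tsmooth.
- split; first exact: heat_defect_continuous.
  by exists 1 => s y _; have /andP[h0 h1] := heat_defect_bounds s y; rewrite ger0_norm.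
- by move=> s y s0; exact: heat_defect_equation.
- by move=> y; rewrite /heat_defect ltxx.
Qed.

(** The test function w = (alpha - L) phi satisfies G_alpha w = phi, so the limit formula for N
    tested with w is the weak form of (alpha - L) N = alpha + V / rho; Green's formula and
    continuity make it pointwise. *)
Lemma N_equation al x : 0 < al -> rho x * (al * N al x - schr (N al) x) = al * rho x + V x.
Proof.
move=> al0; pose F y := rho y * (al * N al y - schr (N al) y) - (al * rho y + V y).
have sN := N_smth al0; have ss : smth (schr (N al)) := schr_smth srho sV rho0 sN.
have sD : smth (fun y => al * N al y - schr (N al) y).
  by apply: msmoothB; [exact: openT|exact: (msmoothZ _ (@openT M) sN)|exact: ss].
have sE : smth (fun y => al * rho y + V y).
  by apply: msmoothD; [exact: openT|exact: (msmoothZ _ (@openT M) srho)|exact: sV].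
have sF : smth F by apply: msmoothB; [exact: openT|exact: (msmoothM (@openT M) srho sD)|exact: sE].
have F0 phi : csmth phi -> \int[mu A]_x (F x * phi x) = 0.
  move=> cp; have cs := schr_csmth srho sV rho0 cp; have Lp := Lc cp; have Ls := Lc cs.
  have cw : csmth (fun y => al * phi y - schr phi y) by apply: csmthB => //; exact: csmthZ.
  have Lw := Lc cw; have rw := csmth_r1 cw; have rp := csmth_r1 cp; have rV := csmth_rV cp.
  have lim := N_cvg al0 Lw rw.
  have Gw : \forall x \ae mu A, G al (fun y => al * phi y - schr phi y) x = phi x.
    apply: (resolvent_unique al0 (csmth_Lop srho sV rho0 V0 cp) Lw); exact: aeM.
  have l1 := theta_dot_cvg rp; have l2 := theta_pot_dot_cvg rho0 rV.
  have lim2 : al * dot (th k) (G al (fun y => al * phi y - schr phi y)) + dot (thV k) (G al (fun y => al * phi y - schr phi y))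
      @[k --> \oo] --> al * \int[mu A]_x (phi x * rho x) + \int[mu A]_x (V x * phi x).
    apply: (@cvg_eq_seq _ (fun k => al * dot (th k) phi + dot (thV k) phi)) => [k|].
      have LGw := LGs al0 Lw.
      by rewrite !(dC _ (G al _)) (dot_ae LGw Lp (Lth k) Gw) (dot_ae LGw Lp (LthV k) Gw) (dC phi) (dC phi).
    by apply: cvgD => //; apply: cvgM => //; exact: cvg_cst.
  have E := cvg_unique (@Rhausdorff R) lim lim2.
  have i1 := csmth_rint_mu (csmthM (msmoothM (@openT M) srho sD) cp).
  have i2 := csmth_rint_mu (csmthM sE cp).
  have i5 := csmth_rint_mu (csmthM sN (csmth_laplacian cp)).
  have i6 := csmth_rint_mu (csmthM (laplacian_smth sN) cp).
  have i7 : rint (mu A) (fun y => (al * rho y + V y) * N al y * phi y).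
    by have := csmth_rint_mu (csmthM (msmoothM (@openT M) sE sN) cp).
  have E1 : \int[mu A]_x (N al x * (al * phi x - schr phi x) * rho x) = \int[mu A]_x (rho x * (al * N al x - schr (N al) x) * phi x).
    transitivity (\int[mu A]_x ((al * rho x + V x) * N al x * phi x) - \int[mu A]_x (N al x * laplacian A phi x)).
      rewrite -(IntB i7 i5); congr (Rintegral _ _ _); apply/funext => y.
      by rewrite -mulrA mulrBl (schr_rho A V rho0); ring.
    rewrite (green_sym sN cp).
    transitivity (\int[mu A]_x ((al * rho x + V x) * N al x * phi x) - \int[mu A]_x (laplacian A (N al) x * phi x)).
      by congr (_ - _); congr (Rintegral _ _ _); apply/funext => y; rewrite mulrC.
    rewrite -(IntB i7 i6); congr (Rintegral _ _ _); apply/funext => y.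
    by rewrite [X in _ = X * _]mulrC mulrBl (schr_rho A V rho0); ring.
  have E2 : \int[mu A]_x ((al * rho x + V x) * phi x) = al * \int[mu A]_x (phi x * rho x) + \int[mu A]_x (V x * phi x).
    by rewrite -(IntZ al rp) -(IntD (rintZ al rp) rV); congr (Rintegral _ _ _); apply/funext => y; ring.
  have -> : (fun x => F x * phi x) = (fun x => rho x * (al * N al x - schr (N al) x) * phi x - (al * rho x + V x) * phi x).
    by apply/funext => y; rewrite /F mulrBl.
  by rewrite (IntB i1 i2) -E1 E2 E subrr.
by apply/eqP; rewrite -subr_eq0; apply/eqP; exact: (test_eq0 sF F0).
Qed.

Lemma schr_lin (a : R) f h x : smth f -> smth h -> schr (fun y => f y + a * h y) x = schr f x + a * schr h x.
Proof. by move=> sf sh; rewrite /schrodinger laplacian_lin//; move: (laplacian A f x) (laplacian A h x) => p q; ring. Qed.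

(** Expanding the square produces the term 2 |grad f|^2 / rho, which is dropped; of the potential
    terms, one copy of V f^2 / rho remains. *)
Lemma schr_sqr_ge f x : smth f -> 2 * f x * schr f x + V x / rho x * (f x * f x) <= schr (fun y => f y * f y) x.
Proof.
move=> sf; rewrite /schrodinger laplacian_sqr//; have g0 := inner_ge0 (grad A f) x.
move: (laplacian A f x) (inner (grad A f) (grad A f) x) g0 => p q q0; rewrite -subr_ge0.
have -> : (rho x)^-1 * (2 * f x * p + 2 * q) - (rho x)^-1 * V x * (f x * f x) -
  (2 * f x * ((rho x)^-1 * p - (rho x)^-1 * V x * f x) + V x / rho x * (f x * f x)) = 2 * ((rho x)^-1 * q) by ring.
by rewrite mulr_ge0// mulr_ge0// invr_ge0 ltW.
Qed.

Lemma N_defect_eigenfunction al : 0 < al -> nontrivial (fun x => 1 - N al x) ->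
  exists g : M -> R, [/\ nontrivial g, bounded g, smooth A g & forall x, al * g x - schr g x = 0].
Proof.
move=> al0 nt; have sN := N_smth al0.
have sg : smth (fun x => 1 - N al x) by apply: msmoothB; [exact: openT|exact: msmooth_cst|exact: sN].
exists (fun x => 1 - N al x); split=> // [||x].
- exists 1 => x; have /andP[n0 n1] := N_bounds x al0.
  by rewrite ger0_norm ?subr_ge0// lerBlDr lerDl.
- exact/smoothE.
have -> : schr (fun x => 1 - N al x) x = - (V x / rho x) + -1 * schr (N al) x.
  have -> : (fun x => 1 - N al x) = (fun y => 1 + -1 * N al y) by apply/funext => y; rewrite mulN1r.
  by rewrite (schr_lin (-1) x (msmooth_cst A setT 1) sN) schr1.
have NE := N_equation x al0.
have rn : rho x != 0 by rewrite gt_eqF.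
apply: (mulfI rn); rewrite mulr0; move: (schr (N al) x) NE => p NE.
have -> : rho x * (al * (1 - N al x) - (- (V x / rho x) + -1 * p)) = al * rho x + V x - rho x * (al * N al x - p) by field.
by rewrite NE subrr.
Qed.

Lemma eigenfunction_subsolution al g : 0 < al -> smth g -> (forall x, al * g x - schr g x = 0) ->
  forall x, al * (g x * g x) - schr (fun y => g y * g y) x <= 0.
Proof.
move=> al0 sg gE x; have := schr_sqr_ge x sg; have -> : schr g x = al * g x by have := gE x; lra.
move=> Hs; rewrite subr_le0; apply: le_trans Hs; rewrite -subr_ge0.
have -> : 2 * g x * (al * g x) + V x / rho x * (g x * g x) - al * (g x * g x) = (al + V x / rho x) * (g x * g x) by ring.
by apply: mulr_ge0; [rewrite addr_ge0 ?(ltW al0) ?(pot_ge0 rho0 V0)|rewrite -expr2 sqr_ge0].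
Qed.

(** For nonnegative phi both images under G are integrable, so the limit in the duality formula can
    be evaluated. *)
Lemma N_int al phi : 0 < al -> csmth phi -> (forall x, 0 <= phi x) ->
  [/\ r1 (G al phi), rint (mu A) (fun x => V x * G al phi x) &
    \int[mu A]_x (N al x * phi x * rho x) = al * \int[mu A]_x (G al phi x * rho x) + \int[mu A]_x (V x * G al phi x)].
Proof.
move=> al0 cp p0; have Lp := Lc cp; have rp := csmth_r1 cp.
have [i1 i2] := pair_L1 srho sV rho0 V0 al0 (fun f => LGs al0) (fun f => LGs al0) (fun f => Gp al0) (fun f => Gp al0)
  (fun f h => Gs al0) (fun f h => Gs al0) (fun f v => G1 al0) Lp rp (aeM p0).
split=> //; apply: (cvg_unique (@Rhausdorff R) (N_cvg al0 Lp rp)).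
have l1 := theta_dot_cvg i1; have l2 := theta_pot_dot_cvg rho0 i2.
by apply: cvgD => //; apply: cvgM => //; exact: cvg_cst.
Qed.

(** The source alpha p + V / rho is not square-integrable in general, so it is cut off by theta_k
    before the elliptic comparison, and the limit is taken after pairing with phi. The factor p is 1
    for the minimality of N, and 1 minus the subsolution at a small time in the parabolic case. *)
Lemma N_super al (p s : M -> R) phi : 0 < al -> smth s -> (forall x, 0 <= s x) ->
  measurable_fun [set: borel M] p -> (forall x, 0 <= p x <= 1) ->
  (forall x, al * p x + V x / rho x <= al * s x - schr s x) -> csmth phi -> (forall x, 0 <= phi x) ->
  al * \int[mu A]_x (p x * (G al phi x * rho x)) + \int[mu A]_x (V x * G al phi x) <= \int[mu A]_x (s x * phi x * rho x).
Proof.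
move=> al0 ss s0 mp p01 Hs cp p0; have p1 x : `|p x| <= 1 by have /andP[a b] := p01 x; rewrite ger0_norm.
have Lp := Lc cp; have [i1 i2 _] := N_int al0 cp p0.
have LGp := LGs al0 Lp.
have mG : measurable_fun [set: borel M] (fun x => G al phi x * rho x) := rint_measurable i1.
have ip : rint (mu A) (fun x => p x * (G al phi x * rho x)).
  apply: rint_le (rint_norm i1); first exact: measurable_funM.
  by move=> x; rewrite normrM ler_piMl.
have Lq k : LL (fun x => th k x * p x).
  apply: (LL_le srho rho0 _ _ (Lth k)); first by apply: measurable_funM => //; exact: (csmth_measurable (theta_csmth A k)).
  by move=> x; rewrite normrM ler_piMr.
have is_ : rint (mu A) (fun x => s x * phi x * rho x).
  by have := csmth_rint_mu (csmthM srho (csmthM ss cp)); under eq_fun do rewrite mulrC.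
have lim : al * dot (fun x => th k x * p x) (G al phi) + dot (thV k) (G al phi) @[k --> \oo] -->
    al * \int[mu A]_x (p x * (G al phi x * rho x)) + \int[mu A]_x (V x * G al phi x).
  apply: cvgD; last exact: (theta_pot_dot_cvg rho0 i2).
  apply: cvgM; first exact: cvg_cst.
  have := theta_Int_cvg ip; apply: cvg_eq_seq => k.
  by congr (Rintegral _ _ _); apply/funext => x; rewrite !mulrA.
apply: (cvgr_to_le lim); apply: nearW => k.
have [u1 L1 E1] := Jf_prop GP al0 (Lq k); have [u2 L2 E2] := Jf_prop GP al0 (LthV k).
have L12 := Lop_lin srho sV rho0 V0 TP al L1 L2.
have le : \forall x \ae mu A, al * G al (fun x => th k x * p x) x + G al (thV k) x <= s x.
  apply: (elliptic_comparison srho sV rho0 V0 al0 L12 ss s0).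
  apply: aeS2 E1 E2 => x e1 e2; apply: le_trans (Hs x).
  have -> : al * (al * G al (fun x => th k x * p x) x + G al (thV k) x) - (al * u1 x + u2 x) = al * (th k x * p x) + thV k x.
    by rewrite -e1 -e2; ring.
  have /andP[_ tV] := theta_pot_bounds A rho0 V0 k x.
  have /andP[t0 t1] := theta01 A k x; have /andP[q0 _] := p01 x.
  by apply: lerD => //; rewrite ler_pM2l// ler_piMl.
have LG1 := LGs al0 (Lq k); have LG2 := LGs al0 (LthV k).
have LaG := LLD srho rho0 (LLZ srho rho0 al LG1) LG2.
have -> : al * dot (fun x => th k x * p x) (G al phi) + dot (thV k) (G al phi) =
    dot (fun x => al * G al (fun x => th k x * p x) x + G al (thV k) x) phi.
  rewrite (L2dotDl srho rho0 (LLZ srho rho0 al LG1) LG2 Lp) (L2dotZl srho rho0 al LG1 Lp).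
  by rewrite (Gs al0 (Lq k) Lp) (Gs al0 (LthV k) Lp).
apply: le_Int_ae => //; first exact: (dot_rint srho rho0 LaG Lp).
by apply: aeS le => x lx; apply: ler_wpM2r; [exact: ltW|exact: ler_wpM2r].
Qed.

Lemma N_le_super al s : 0 < al -> smth s -> (forall x, 0 <= s x) ->
  (forall x, al + V x / rho x <= al * s x - schr s x) -> forall x, N al x <= s x.
Proof.
move=> al0 ss s0 Hs x; have sN := N_smth al0.
pose F y := (s y - N al y) * rho y.
have sF : smth F by apply: msmoothM; [exact: openT|apply: msmoothB; [exact: openT|exact: ss|exact: sN]|exact: srho].
suff : 0 <= F x by rewrite /F pmulr_lge0// subr_ge0.
apply: (test_ge0 (smooth_cont sF)) => phi cp p0; have [i1 i2 E] := N_int al0 cp p0.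
have Hs1 y : al * 1 + V y / rho y <= al * s y - schr s y by rewrite mulr1.
have p1 (y : M) : 0 <= (1 : R) <= 1 by rewrite ler01 lexx.
have := N_super al0 ss s0 (measurable_cst (1 : R)) p1 Hs1 cp p0.
under [X in al * Rintegral _ _ X]eq_fun do rewrite mul1r; rewrite -E -subr_ge0.
have csp (f : M -> R) : smth f -> rint (mu A) (fun y => f y * phi y * rho y).
  by move=> sf; have := csmth_rint_mu (csmthM srho (csmthM sf cp)); under eq_fun do rewrite mulrC.
rewrite -(IntB (csp _ ss) (csp _ sN)) => H0; apply: le_trans H0 _.
by rewrite le_eqVlt; apply/orP; left; apply/eqP; congr (Rintegral _ _ _); apply/funext => y; rewrite /F; ring.
Qed.

Lemma subsolution_N_defect al g : 0 < al -> nontrivial g -> (forall x, 0 <= g x) -> bounded g -> smooth A g ->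
  (forall x, al * g x - schr g x <= 0) -> nontrivial (fun x => 1 - N al x).
Proof.
move=> al0 [x gx] g0 [C gC] /smoothE sg Hg; pose D := C + 1.
have D0 : 0 < D by rewrite /D ltr_wpDl// (le_trans _ (gC x)).
(* With D above the supremum of g, the function 1 - g / D is a nonnegative supersolution of the
   equation of N; hence N <= 1 - g / D, which is below 1 where g > 0. *)
pose s y := 1 + (- D^-1) * g y.
have ss : smth s by apply: msmoothD; [exact: openT|exact: msmooth_cst|exact: (msmoothZ _ (@openT M) sg)].
have s0 y : 0 <= s y.
  rewrite /s mulNr subr_ge0 ler_pdivrMl// mulr1; apply: le_trans (ler_norm _) _; apply: le_trans (gC y) _.
  by rewrite lerDl.
exists x; rewrite subr_eq0 eq_sym lt_eqF//; apply: (@le_lt_trans _ _ (s x)).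
  apply: (N_le_super al0 ss s0) => y.
  rewrite (schr_lin _ y (msmooth_cst A setT 1) sg) schr1 -subr_ge0 /s.
  move: (schr g y) (Hg y) => q qy.
  have -> : al * (1 + - D^-1 * g y) - (- (V y / rho y) + - D^-1 * q) - (al + V y / rho y) = D^-1 * - (al * g y - q) by ring.
  by rewrite mulr_ge0 ?invr_ge0 ?(ltW D0)// oppr_ge0.
by rewrite /s mulNr ltrBlDr ltrDl mulr_gt0 ?invr_gt0// lt_def gx g0.
Qed.

Lemma heat_solution_sqr (u : R -> M -> R) : tsmooth A u -> (forall t x, 0 < t -> heat_op A rho V u t x = 0) ->
  forall t x, 0 < t -> heat_op A rho V (fun t x => u t x * u t x) t x <= 0.
Proof.
move=> su uE t x t0; have := uE t x t0; rewrite /heat_op => /eqP; rewrite subr_eq0 => /eqP E.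
have [du _] := tderivable x su t0.
have -> : ((fun t x => u t x * u t x) ^~ x)^`()%classic t = 2 * u t x * schr (u t) x.
  rewrite -E !derive1E (_ : (fun s => u s x * u s x) = (u ^~ x) * (u ^~ x))//.
  rewrite deriveM//= /GRing.scale/=; ring.
rewrite subr_le0; apply: le_trans (schr_sqr_ge x (tslice su t0)).
by rewrite lerDl mulr_ge0 ?(pot_ge0 rho0 V0)// -expr2 sqr_ge0.
Qed.

Lemma heat_solution_subsolution :
  (exists u : R -> M -> R, [/\ nontrivial_pos_time u, smooth_pos_time A u, bounded_continuous u,
     forall t x, 0 < t -> heat_op A rho V u t x = 0 & forall x, u 0 x = 0]) ->
  exists u : R -> M -> R, [/\ nontrivial_pos_time u /\ (forall t x, 0 <= t -> 0 <= u t x),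
     smooth_pos_time A u, bounded_continuous u,
     forall t x, 0 < t -> heat_op A rho V u t x <= 0 & forall x, u 0 x = 0].
Proof.
move=> [u [[t [t0 [x ux]]] /tsmoothE su [cu [C uC]] uE u0]].
exists (fun t x => u t x * u t x); split.
- split; first by exists t; split=> //; exists x; rewrite mulf_neq0.
  by move=> s y _; rewrite -expr2 sqr_ge0.
- exact/tsmoothE/tsmoothM.
- split; last by exists (C * C) => s y s0; rewrite normrM ler_pM ?uC.
  by move=> p; exact: (cvgM (cu p) (cu p)).
- exact: heat_solution_sqr.
- by move=> y; rewrite u0 mulr0.
Qed.

(** * Discounted time integrals of parabolic subsolutions *)

Definition decay (al t : R) : R := expR (- al * t).

Lemma decay_Smooth al : Smooth setT (decay al).
Proof.
apply: (@Smooth_comp1 _ _ setT setT expR (fun t => - al * t)) => //; [exact: openT|exact: (Smooth_expR openT)|].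
apply: (SmoothM openT (Smooth_cst _ _)).
by apply: (@Smooth_linear _ _ _ _ idfun); [exact: openT|move=> t; exact: cvg_id].
Qed.

Lemma decay_derive (al t : R) : is_derive t 1 (decay al) (- al * decay al t).
Proof.
have -> : decay al = expR \o (fun t => - al * t) by [].
by rewrite /decay; apply: is_derive_eq; rewrite /GRing.scale/= mulr1 mulrC.
Qed.

Lemma discounted_tsmooth al (v : R -> M -> R) : tsmooth A v -> tsmooth A (fun t x => decay al t * v t x).
Proof. by apply: tsmoothM; apply: tsmooth_time; exact: decay_Smooth. Qed.

Lemma discounted_derive al (v : R -> M -> R) t x : tsmooth A v -> 0 < t ->
  ((fun t x => decay al t * v t x) ^~ x)^`()%classic t =
  decay al t * (v ^~ x)^`()%classic t - al * (decay al t * v t x).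
Proof.
move=> sv t0; have [dv _] := tderivable x sv t0; have [dd dE] := decay_derive al t.
rewrite !derive1E (_ : (fun s => decay al s * v s x) = (decay al) * (v ^~ x))//.
rewrite (deriveM dd dv) dE /GRing.scale/=.
by move: ('D_1 (v ^~ x) t) => q; ring.
Qed.

Section discounted.
Variables (al : R) (v : R -> M -> R) (b : R).
Hypotheses (al0 : 0 < al) (sv : tsmooth A v) (v01 : forall t x, 0 < t -> 0 <= v t x <= 1)
  (vsub : forall t x, 0 < t -> heat_op A rho V v t x <= 0).
Local Notation w := (fun t x => decay al t * v t x).
Local Notation g e := (fun x : M => \int[leb]_(t in `[e, b]) w t x).

Let decay_gt0 t : 0 < decay al t := expR_gt0 _.
Let w_ge0 t x : 0 < t -> 0 <= w t x.
Proof. by move=> t0; have /andP[a _] := v01 x t0; rewrite mulr_ge0// ltW. Qed.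
Let sw : tsmooth A w := discounted_tsmooth al sv.

Let w_cont (e : R) x (t : R) : 0 < e -> e <= t <= b -> {for t, continuous (w ^~ x)}.
Proof. by move=> e0 /andP[et _]; apply: (tcont_time (x := x) sw); exact: lt_le_trans et. Qed.

(** Here v <= 1, and alpha times the integral of exp(-alpha t) over [e, b] is exp(-alpha e) -
    exp(-alpha b) <= 1. *)
Lemma discounted_int_le1 e x : 0 < e -> e < b -> al * g e x <= 1.
Proof.
move=> e0 eb; have sd := tsmooth_time A (decay_Smooth al).
have E := tint_derive sd e0 (ltW eb) x eb.
have cd t : e <= t <= b -> {for t, continuous (fun t => al * decay al t)}.
  move=> /andP[et _]; apply: continuousM; first exact: cst_continuous.
  by apply: (tcont_time (x := x) sd); exact: lt_le_trans et.
have D : \int[leb]_(t in `[e, b]) (al * decay al t) = decay al e - decay al b.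
  rewrite -[RHS]opprB -E -mulN1r -RintegralZl//; last first.
    apply: itv_continuous_integrable => t /andP[et _].
    by apply: (tcont_time (x := x) (tderive sd)); exact: lt_le_trans et.
  apply: eq_Rintegral => t _; have [_ dE] := decay_derive al t.
  by rewrite derive1E dE; ring.
rewrite -RintegralZl//; last by apply: itv_continuous_integrable => t; exact: w_cont.
apply: (@le_trans _ _ (\int[leb]_(t in `[e, b]) (al * decay al t))).
  apply: le_Rintegral => //.
  - apply: itv_continuous_integrable => t tab; apply: continuousM; first exact: cst_continuous.
    exact: (w_cont (x := x) e0 tab).
  - exact: itv_continuous_integrable.
  - move=> t /=; rewrite in_itv/= => /andP[et _]; have /andP[_ v1] := v01 x (lt_le_trans e0 et).
    by rewrite ler_pM2l// ler_piMr// ltW.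
rewrite D lerBlDr; apply: (@le_trans _ _ 1).
  by rewrite -expR0 ler_expR mulNr oppr_le0 mulr_ge0// ltW.
by rewrite lerDl ltW.
Qed.

(** Integrating the time derivative of exp(-alpha t) v leaves boundary terms: the one at b has a
    favourable sign, and the one at e is at most v(e, x). *)
Lemma discounted_int_sub e x : 0 < e -> e < b -> al * g e x - schr (g e) x <= v e x.
Proof.
move=> e0 eb; have [iL EL] := laplacian_tint sw e0 (ltW eb) x.
have iw : leb.-integrable `[e, b] (EFin \o (w ^~ x)) by apply: itv_continuous_integrable => t; exact: w_cont.
have sdw : tsmooth A (fun t x => (w ^~ x)^`()%classic t) := tderive sw.
have id : leb.-integrable `[e, b] (EFin \o (fun t => (w ^~ x)^`()%classic t)).
  apply: itv_continuous_integrable => t /andP[et _].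
  by apply: (tcont_time (x := x) sdw); exact: lt_le_trans et.
have iZ (a : R) (f : R -> R) : leb.-integrable `[e, b] (EFin \o f) -> leb.-integrable `[e, b] (EFin \o (fun t => a * f t)).
  by move=> If; have := @integrableZl _ _ _ leb _ (@measurable_itv R `[e, b]) a _ If.
have iD (f h : R -> R) : leb.-integrable `[e, b] (EFin \o f) -> leb.-integrable `[e, b] (EFin \o h) ->
    leb.-integrable `[e, b] (EFin \o (fun t => f t + h t)).
  by move=> If Ih; have := @integrableD _ _ _ leb _ (@measurable_itv R `[e, b]) _ _ If Ih.
have Es : schr (g e) x = \int[leb]_(t in `[e, b]) ((rho x)^-1 * laplacian A (w t) x + (- ((rho x)^-1 * V x)) * w t x).
  rewrite /schrodinger EL RintegralD//; [|exact: iZ|exact: iZ].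
  have Z1 := RintegralZl (mu := leb) (rho x)^-1 (@measurable_itv R `[e, b]) iL.
  have Z2 := RintegralZl (mu := leb) (- ((rho x)^-1 * V x)) (@measurable_itv R `[e, b]) iw.
  by rewrite Z1 Z2 mulNr.
have wlow t : e <= t <= b -> al * w t x + (w ^~ x)^`()%classic t <=
    (rho x)^-1 * laplacian A (w t) x + (- ((rho x)^-1 * V x)) * w t x.
  move=> /andP[et _]; have t0 := lt_le_trans e0 et; rewrite discounted_derive//.
  have sc : schr (w t) x = decay al t * schr (v t) x.
    have := schr_lin (decay al t) x (msmooth_cst A setT 0) (tslice sv t0).
    by rewrite schr0 add0r; under eq_fun do rewrite add0r.
  have := vsub x t0; rewrite /heat_op subr_le0 => vs.
  have -> : (rho x)^-1 * laplacian A (w t) x + (- ((rho x)^-1 * V x)) * w t x = schr (w t) x.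
    by rewrite /schrodinger mulNr.
  by rewrite sc addrC subrK ler_pM2l.
have low : al * g e x + (w b x - w e x) <= schr (g e) x.
  rewrite Es -(tint_derive sw e0 (ltW eb) x eb) -RintegralZl// -RintegralD//; last exact: iZ.
  apply: le_Rintegral; [by []|exact: iD (iZ _ _ iw) id|exact: iD (iZ _ _ iL) (iZ _ _ iw)|].
  by move=> t; rewrite /= in_itv/=; exact: wlow.
have wb : 0 <= w b x by apply: w_ge0; exact: lt_trans eb.
have we : w e x <= v e x.
  have /andP[ve _] := v01 x e0; rewrite ler_piMl//.
  by rewrite -expR0 ler_expR mulNr oppr_le0 mulr_ge0// ltW.
lra.
Qed.

Lemma discounted_int_mono e d x : 0 < e -> e <= d -> d <= b -> g d x <= g e x.
Proof.
move=> e0 ed db; have iw (s t : R) : 0 < s -> leb.-integrable `[s, t] (EFin \o (w ^~ x)).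
  move=> s0; apply: itv_continuous_integrable => r /andP[sr _]; apply: (tcont_time (x := x) sw); exact: lt_le_trans sr.
have := Rintegral_itvB (x := d) (iw e b e0); rewrite !bnd_simp => /(_ ed db).
rewrite Rintegral_itv_obnd_cbnd; last first.
  apply: (integrableS _ _ _ (iw d b (lt_le_trans e0 ed))) => //; exact: subset_itv_oc_cc.
move=> <-; rewrite lerBlDr lerDl; apply: Rintegral_ge0 => t; rewrite /= in_itv/= => /andP[et _].
by apply: w_ge0; exact: lt_le_trans et.
Qed.

(** For e_k = d/(k+1) the function 1 - alpha g_(e_k) is a supersolution for the source alpha (1 -
    v_(e_k)) + V / rho, so [N_super] applies with p = 1 - v_(e_k). As k grows the left-hand side
    tends to the pairing of N with phi by dominated convergence, while 1 - alpha g_(e_k) stays below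
    1 - alpha g_d. *)
Lemma N_le_discounted d x : (forall y, v (d / k.+1%:R) y @[k --> \oo] --> (0 : R)) ->
  0 < d -> d < b -> N al x <= 1 - al * g d x.
Proof.
move=> v0 d0 db; pose e (k : nat) := d / k.+1%:R.
have e0 k : 0 < e k by rewrite divr_gt0.
have ed k : e k <= d by rewrite ler_pdivrMr// ler_peMr ?ler1n// ltW.
have eb k : e k < b := le_lt_trans (ed k) db.
have sN := N_smth al0.
have sg k : 0 < k -> k < b -> smth (g k) by move=> k0 kb; exact: (tint_smth sw k0 (ltW kb)).
pose s k y := 1 + (- al) * g k y.
have ss k : 0 < k -> k < b -> smth (s k).
  move=> k0 kb; apply: msmoothD; [exact: openT|exact: msmooth_cst|exact: (msmoothZ _ (@openT M) (sg k k0 kb))].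
have s0 k y : 0 < k -> k < b -> 0 <= s k y by move=> k0 kb; rewrite /s mulNr subr_ge0; exact: discounted_int_le1.
pose F y := (s d y - N al y) * rho y.
have sF : smth F.
  by apply: msmoothM; [exact: openT|apply: msmoothB; [exact: openT|exact: ss|exact: sN]|exact: srho].
suff : 0 <= F x by rewrite /F pmulr_lge0// subr_ge0 /s mulNr.
apply: (test_ge0 (smooth_cont sF)) => phi cp p0; have [i1 i2 E] := N_int al0 cp p0.
have csp (f : M -> R) : smth f -> rint (mu A) (fun y => f y * phi y * rho y).
  by move=> sf; have := csmth_rint_mu (csmthM srho (csmthM sf cp)); under eq_fun do rewrite mulrC.
have mv k : measurable_fun [set: borel M] (v (e k)) := smth_measurable (tslice sv (e0 k)).
have bound k : al * \int[mu A]_y ((1 - v (e k) y) * (G al phi y * rho y)) + \int[mu A]_y (V y * G al phi y) <=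
    \int[mu A]_y (s d y * phi y * rho y).
  apply: (@le_trans _ _ (\int[mu A]_y (s (e k) y * phi y * rho y))); last first.
    apply: le_Int; [exact: csp (ss _ (e0 k) (eb k))|exact: csp (ss _ d0 db)|] => y.
    apply: ler_wpM2r; first exact: ltW.
    apply: ler_wpM2r; first exact: p0.
    by rewrite /s lerD2l !mulNr lerN2 ler_pM2l//; apply: discounted_int_mono => //; exact: ltW.
  apply: (N_super al0 (ss _ (e0 k) (eb k))) => //.
  - by move=> y; exact: s0.
  - by apply: measurable_funB; [exact: measurable_cst|exact: mv].
  - by move=> y; have /andP[a c] := v01 y (e0 k); rewrite subr_ge0 c lerBlDr lerDl a.
  - move=> y; rewrite (schr_lin (- al) y (msmooth_cst A setT 1) (sg _ (e0 k) (eb k))) schr1 /s.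
    have := discounted_int_sub y (e0 k) (eb k).
    move: (schr (g (e k)) y) (g (e k) y) (v (e k) y) => q c z H1.
    rewrite -subr_ge0 (_ : _ - _ = al * (z - (al * c - q))); last by ring.
    by rewrite mulr_ge0 ?(ltW al0)// subr_ge0.
have lim : \int[mu A]_y ((1 - v (e k) y) * (G al phi y * rho y)) @[k --> \oo] --> \int[mu A]_y (G al phi y * rho y).
  have m1 := rint_measurable i1.
  apply: (@dominated_Int _ (borel M) R (mu A) (fun k y => (1 - v (e k) y) * (G al phi y * rho y))
    (fun y => G al phi y * rho y) (fun y => `|G al phi y * rho y|) _ m1 _ (rint_norm i1) _).2.
  - by move=> k; apply: measurable_funM => //; apply: measurable_funB; [exact: measurable_cst|exact: mv].
  - apply: aeM => y.
    have C1 : (1 - v (e k) y) * (G al phi y * rho y) @[k --> \oo] --> (1 - 0) * (G al phi y * rho y).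
      by apply: cvgM; [apply: cvgB; [exact: cvg_cst|exact: v0]|exact: cvg_cst].
    by rewrite subr0 mul1r in C1.
  - apply: aeM => y k; have /andP[a c] := v01 y (e0 k).
    by rewrite normrM ler_piMl// ger0_norm ?subr_ge0// lerBlDr lerDl.
have lim2 : al * \int[mu A]_y ((1 - v (e k) y) * (G al phi y * rho y)) + \int[mu A]_y (V y * G al phi y) @[k --> \oo] -->
    \int[mu A]_y (N al y * phi y * rho y).
  by rewrite E; apply: cvgD; [apply: cvgM; [exact: cvg_cst|exact: lim]|exact: cvg_cst].
have final : \int[mu A]_y (N al y * phi y * rho y) <= \int[mu A]_y (s d y * phi y * rho y).
  by apply: (cvgr_to_le lim2); exact: nearW.
rewrite (_ : (fun y => F y * phi y) = (fun y => s d y * phi y * rho y - N al y * phi y * rho y)); last first.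
  by apply/funext => y; rewrite /F; ring.
by rewrite (IntB (csp _ (ss _ d0 db)) (csp _ sN)) subr_ge0.
Qed.

End discounted.

Lemma heat_subsolution_N_defect al : 0 < al ->
  (exists u : R -> M -> R, [/\ nontrivial_pos_time u /\ (forall t x, 0 <= t -> 0 <= u t x),
     smooth_pos_time A u, bounded_continuous u,
     forall t x, 0 < t -> heat_op A rho V u t x <= 0 & forall x, u 0 x = 0]) ->
  nontrivial (fun x => 1 - N al x).
Proof.
move=> al0 [u [[[t1 [t1_gt0 [x1 ux1]]] u_ge0] /tsmoothE su [cu [C uC]] usub u0]].
(* The summand 1 makes D positive, so that u / D is defined and takes values in [0, 1]. *)
pose D := `|C| + 1; have D0 : 0 < D by rewrite ltr_wpDl.
pose v t x := D^-1 * u t x.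
have sv : tsmooth A v by apply: tsmoothM => //; exact: tsmooth_cst.
have v01 t x : 0 < t -> 0 <= v t x <= 1.
  move=> t0; have ut := u_ge0 t x (ltW t0); rewrite mulr_ge0 ?invr_ge0 ?(ltW D0)//= ler_pdivrMl// mulr1.
  apply: le_trans (ler_norm _) _; apply: le_trans (uC t x (ltW t0)) _; apply: le_trans (ler_norm _) _.
  by rewrite lerDl.
have vsub t x : 0 < t -> heat_op A rho V v t x <= 0.
  move=> t0; have := usub t x t0; rewrite /heat_op.
  have -> : schr (v t) x = D^-1 * schr (u t) x.
    have := schr_lin D^-1 x (msmooth_cst A setT 0) (tslice su t0).
    by rewrite schr0 add0r; under eq_fun do rewrite add0r.
  have [du _] := tderivable x su t0.
  have -> : (v ^~ x)^`()%classic t = D^-1 * (u ^~ x)^`()%classic t.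
    by rewrite !derive1E; exact: (deriveZ _ du).
  by rewrite -mulrBr pmulr_rle0// invr_gt0.
have vlim d y : 0 < d -> v (d / k.+1%:R) y @[k --> \oo] --> (0 : R).
  move=> d0; have /subspace_continuousP c0 := cu; have C0 := c0 (0, y) (lexx 0).
  have ce : d / k.+1%:R @[k --> \oo] --> (0 : R).
    by rewrite -(mulr0 d); apply: cvgM; [exact: cvg_cst|exact: cvg_harmonic].
  have cuy : u (d / k.+1%:R) y @[k --> \oo] --> (0 : R).
    apply/cvgrPdist_le => e e0; rewrite /from_subspace/= u0 in C0.
    have /cvgrPdist_le/(_ _ e0)[[P Q] /= [P0 Qy] PQ] := C0.
    have [K0 _ HK] := ce _ P0; exists K0 => // k /HK Pk; apply: (PQ (d / k.+1%:R, y)) => /=.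
      by split=> //; exact: nbhs_singleton.
    by rewrite divr_ge0// ltW.
  by rewrite -(mulr0 D^-1); apply: cvgM; [exact: cvg_cst|exact: cuy].
have vx1 : 0 < v t1 x1 by rewrite mulr_gt0 ?invr_gt0// lt_def ux1 u_ge0 ?(ltW t1_gt0).
pose w t x := decay al t * v t x.
have wx1 : 0 < w t1 x1 by rewrite mulr_gt0// expR_gt0.
have sw : tsmooth A w := discounted_tsmooth al sv.
have cw := tcont_time (x := x1) sw t1_gt0.
(* The window [d, t1] ends at a time where u is positive; by continuity the integrand is at least
   half its final value on it, so the integral in the bound for N is positive. *)
have [d [d0 dt1 dw]] : exists d, [/\ 0 < d, d < t1 & forall t, d <= t <= t1 -> w t1 x1 / 2 <= w t x1].
  have w2 : 0 < w t1 x1 / 2 by rewrite divr_gt0.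
  have /cvgrPdist_le/(_ _ w2)[r /= r0 Hr] := cw.
  pose q := Num.min (r / 2) (t1 / 2).
  have q0 : 0 < q by rewrite lt_min !divr_gt0.
  have qr : q <= r / 2 by rewrite ge_min lexx.
  have qt : q <= t1 / 2 by rewrite ge_min lexx orbT.
  exists (t1 - q); split; [lra|by rewrite ltrBlDr ltrDl|].
  move=> t /andP[a1 a2]; have := Hr t; rewrite /= => Ht.
  have : `|t1 - t| < r by rewrite ger0_norm ?subr_ge0//; lra.
  by move=> /Ht; rewrite ler_norml => /andP[_]; lra.
exists x1; rewrite subr_eq0 eq_sym lt_eqF//.
have Nle := N_le_discounted al0 sv v01 vsub x1 (fun y => vlim d y d0) d0 dt1.
apply: (le_lt_trans Nle).
rewrite ltrBlDr ltrDl mulr_gt0//; apply: (@lt_le_trans _ _ ((t1 - d) * (w t1 x1 / 2))).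
  by rewrite mulr_gt0 ?subr_gt0// divr_gt0.
have -> : (t1 - d) * (w t1 x1 / 2) = \int[leb]_(t in `[d, t1]) (w t1 x1 / 2).
  by rewrite Rintegral_cst//= lebesgue_measure_itv/= lte_fin dt1/= mulrC.
apply: le_Rintegral => //.
- by apply: itv_continuous_integrable => t _; exact: cst_continuous.
- by apply: itv_continuous_integrable => t /andP[dt _]; apply: (tcont_time (x := x1) sw); exact: lt_le_trans dt.
Qed.

(** * From H = 1 to N = 1 *)

Lemma T_G_dot al t f h : 0 < al -> 0 <= t -> LL f -> LL h -> dot (T t (G al f)) h = dot (T t f) (G al h).
Proof.
move=> al0 t0 Lf Lh; pose e := al^-1; have e0 : 0 < e by rewrite invr_gt0.
have LG1 := LGs al0 Lf; have LJ := LJf srho sV rho0 V0 GP e0 Lf.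
have LTf := LTs t0 Lf; have LJT := LJf srho sV rho0 V0 GP e0 LTf; have LTJ := LTs t0 LJ.
(* Commutation of the semigroup with the resolvent, transported from classes to functions. *)
have E : \forall x \ae mu A, T t (Jf G e f) x = Jf G e (T t f) x.
  have E1 := Tl_C srho rho0 TP t0 LJ; have E2 := Jf_C srho sV rho0 V0 TP GP e0 Lf.
  have E3 := Jf_C srho sV rho0 V0 TP GP e0 LTf; have E4 := Tl_C srho rho0 TP t0 Lf.
  rewrite E2 (J_T (ldot_ip _ _) (@L2_complete _ (borel M) R (mu A) (rho_weight srho rho0)) (sg_ax srho rho0 TP) (rs_ax srho sV rho0 V0 TP GP) _ e0 t0) E4 -E3 in E1.
  exact: (C_inj LTJ LJT (esym E1)).
have JG (q : M -> R) : Jf G e q = (fun x => al * G al q x) by apply/funext => x; rewrite /Jf /e invrK.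
have LTh := LTs t0 Lh.
have D1 : al * dot (T t (G al f)) h = dot (T t (Jf G e f)) h.
  by rewrite (Ts t0 LG1 Lh) (Ts t0 LJ Lh) JG (L2dotZl srho rho0 al LG1 LTh).
have LGT := LGs al0 LTf.
have D2 : dot (Jf G e (T t f)) h = al * dot (T t f) (G al h).
  by rewrite JG (L2dotZl srho rho0 al LGT Lh) (Gs al0 LTf Lh).
apply: (mulfI (lt0r_neq0 al0)); rewrite D1 -D2.
exact: (dot_ae LTJ LJT Lh E).
Qed.

Lemma It_G_dot al t f h : 0 < al -> 0 <= t -> LL f -> LL h -> dot (It t (G al f)) h = dot (G al (It t f)) h.
Proof.
move=> al0 t0 Lf Lh; have LG1 := LGs al0 Lf; have LGh := LGs al0 Lh; have LI := LIs t0 Lf.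
rewrite (Gs al0 LI Lh).
apply: etrans (It_dot t0 LG1 Lh) _; apply: etrans _ (esym (It_dot t0 Lf LGh)).
by apply: eq_Rintegral => s _; exact: (T_G_dot al0 (normr_ge0 s) Lf Lh).
Qed.

(** Pairing with theta_k and moving T_s onto theta_k <= 1 bounds the integral by t times that of phi
    rho, uniformly in k; Fatou's lemma concludes. *)
Lemma It_L1 t phi : 0 <= t -> csmth phi -> (forall x, 0 <= phi x) -> r1 (It t phi).
Proof.
move=> t0 cp p0; have Lp := Lc cp; have rp := csmth_r1 cp; have LI := LIs t0 Lp.
have I0 := Ip t0 Lp (aeM p0).
have mI : measurable_fun [set: borel M] (It t phi) := LI.1.
have m1 : measurable_fun [set: borel M] (fun x => It t phi x * rho x) by exact: measurable_funM.
have n1 : measurable_fun [set: borel M] (fun x => `|It t phi x * rho x|) by exact: measurableT_comp.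
have mt k : measurable_fun [set: borel M] (th k) := csmth_measurable (theta_csmth A k).
have q1 k : measurable_fun [set: borel M] (fun x => th k x * `|It t phi x * rho x|) by exact: measurable_funM.
have E1 k : \forall x \ae mu A, It t phi x * th k x * rho x = th k x * `|It t phi x * rho x|.
  by apply: aeS I0 => x px; rewrite ger0_norm ?(mulr_ge0 px (ltW (rho0 x)))//; ring.
have r k := rint_ae (q1 k) (E1 k) (dot_rint srho rho0 LI (Lth k)).
have b k : \int[mu A]_x (th k x * `|It t phi x * rho x|) <= t * \int[mu A]_x (phi x * rho x).
  rewrite -(Int_ae (rint_measurable (dot_rint srho rho0 LI (Lth k))) (q1 k) (E1 k)).
  have -> : \int[mu A]_x (It t phi x * th k x * rho x) = dot (It t phi) (th k) by [].
  rewrite (It_dot t0 Lp (Lth k)); apply: le_trans (ler_norm _) _.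
  rewrite -[X in X * _]subr0; apply: norm_Rintegral_itv_le => // s _.
    exact: (T_dot_cont srho rho0 TP Lp (Lth k)).
  rewrite (Ts (normr_ge0 s) Lp (Lth k)).
  have LTt := LTs (normr_ge0 s) (Lth k).
  have T0 : \forall x \ae mu A, 0 <= T `|s| (th k) x.
    by apply: (Tp (normr_ge0 s) (Lth k)); apply: aeM => x; case/andP: (theta01 A k x).
  have T1' : \forall x \ae mu A, T `|s| (th k) x <= 1.
    have b1 : \forall x \ae mu A, th k x <= 1 by apply: aeM => x; case/andP: (theta01 A k x).
    have := T1 (normr_ge0 s) (Lth k) (LL0 A rho0) b1 (aeM (pot_ge0 rho0 V0)).
    by apply: aeS2 (It0 srho rho0 TP (normr_ge0 s)) => x ->; rewrite mul1r addr0.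
  rewrite ger0_norm; last first.
    apply: Int_ge0_ae; first exact: (dot_rint srho rho0 Lp LTt).
    by apply: aeS T0 => x Tx; exact: mulr_ge0 (mulr_ge0 (p0 x) Tx) (ltW (rho0 x)).
  apply: le_Int_ae; [exact: (dot_rint srho rho0 Lp LTt)|exact: rp|].
  by apply: aeS T1' => x Tx; apply: ler_wpM2r; [exact: ltW|rewrite ler_piMr].
have cv x : th k x * `|It t phi x * rho x| @[k --> \oo] --> `|It t phi x * rho x|.
  by rewrite -[X in _ --> X]mul1r; apply: cvgM; [exact: theta_cvg|exact: cvg_cst].
have F0 k x : 0 <= th k x * `|It t phi x * rho x| by case/andP: (theta01 A k x) => a _; exact: mulr_ge0.
have Hr := fatou_rint r F0 n1 cv b.
exact: rint_le m1 _ Hr.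
Qed.

(** The constant 1 is not square-integrable in general, so the pairing is carried out with theta_k
    and theta_k V / rho, and the formulas for H and N enter in the limit. Short-time averages then
    replace the integral of the orbit by phi itself, which makes 1 - N orthogonal to all test
    functions. *)
Lemma conservative_N al : 0 < al -> (forall t x, 0 < t -> H t x = 1) -> forall x, N al x = 1.
Proof.
move=> al0 H1; have sN := N_smth al0.
have key phi t : csmth phi -> (forall x, 0 <= phi x) -> 0 < t ->
    \forall x \ae mu A, (1 - N al x) * It t phi x * rho x = 0.
  move=> cp p0 t0; have t0' := ltW t0; have Lp := Lc cp; have [rpsi _ _] := N_int al0 cp p0.
  have Lpsi := LGs al0 Lp; set psi := G al phi in rpsi Lpsi.
  have Lchi := LIs t0' Lp; have rchi := It_L1 t0' cp p0; set chi := It t phi in Lchi rchi *.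
  have chi0 : \forall x \ae mu A, 0 <= chi x := Ip t0' Lp (aeM p0).
  have LIpsi := LIs t0' Lpsi; have LTpsi := LTs t0' Lpsi; have LGchi := LGs al0 Lchi.
  have [u Lu Eu] := Jf_prop GP al0 Lp; have [_ LLu] := Lop_L2 srho sV rho0 V0 Lu; have LIu := LIs t0' LLu.
  have TE := T_Lop srho sV rho0 V0 TP t0' Lu.
  have E k : dot (T t psi) (th k) + dot (It t psi) (thV k) =
      dot psi (th k) - dot chi (th k) + (al * dot (th k) (G al chi) + dot (thV k) (G al chi)).
    have e1 : dot (T t psi) (th k) = dot psi (th k) + dot (It t u) (th k).
      rewrite -(L2dotDl srho rho0 Lpsi LIu (Lth k)); apply: (dot_ae) => //; first exact: LLD.
      by apply: aeS TE => x <-; rewrite addrC subrK.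
    have LIt_ := LIs t0' (Lth k).
    have e2 : dot (It t u) (th k) = al * dot (It t psi) (th k) - dot chi (th k).
      have Z := L2dotZl srho rho0 al Lpsi LIt_; have La := LLZ srho rho0 al Lpsi.
      have D := L2dotBr srho rho0 LIt_ La Lp.
      have U : dot u (It t (th k)) = dot (fun x => al * psi x - phi x) (It t (th k)).
        apply: (dot_ae LLu (LLB srho rho0 La Lp) LIt_).
        by apply: aeS Eu => x <-; rewrite /psi; ring.
      have I2 := Is t0' Lpsi (Lth k); have I3 := Is t0' Lp (Lth k).
      apply: etrans (Is t0' LLu (Lth k)) (etrans U (etrans (dC _ _) (etrans D _))).
      exact: (f_equal2 (fun a b => a - b) (etrans (dC _ _) (etrans Z (congr1 _ (esym I2)))) (etrans (dC _ _) (esym I3))).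
    have e3 : dot (It t psi) (th k) = dot (th k) (G al chi) by rewrite (It_G_dot al0 t0' Lp (Lth k)) dC.
    have e4 : dot (It t psi) (thV k) = dot (thV k) (G al chi) by rewrite (It_G_dot al0 t0' Lp (LthV k)) dC.
    (* The linear relation is isolated over plain real variables; it combines the generator
       identity, symmetry and the commutation of the time integral with G. *)
    have alg (a1 a2 a3 a4 a5 a6 a7 a8 : R) : a1 = a2 + a3 -> a3 = al * a4 - a5 -> a4 = a7 -> a6 = a8 ->
        a1 + a6 = a2 - a5 + (al * a7 + a8) by move=> -> -> -> ->; ring.
    exact: (alg _ _ _ _ _ _ _ _ e1 e2 e3 e4).
  have lH := H_cvg t0 Lpsi rpsi.
  have EH : \int[mu A]_x (H t x * psi x * rho x) = \int[mu A]_x (psi x * rho x).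
    by congr (Rintegral _ _ _); apply/funext => x; rewrite H1// mul1r.
  have lN := N_cvg al0 Lchi rchi.
  have l1 := theta_dot_cvg rpsi; have l2 := theta_dot_cvg rchi.
  have lim : dot (T t psi) (th k) + dot (It t psi) (thV k) @[k --> \oo] -->
      \int[mu A]_x (psi x * rho x) - \int[mu A]_x (chi x * rho x) + \int[mu A]_x (N al x * chi x * rho x).
    apply: (@cvg_eq_seq _ (fun k => dot (th k) psi - dot (th k) chi + (al * dot (th k) (G al chi) + dot (thV k) (G al chi)))).
      by move=> k; rewrite E (dC psi) (dC chi).
    by apply: cvgD; [exact: cvgB|exact: lN].
  have Eq : \int[mu A]_x (psi x * rho x) =
      \int[mu A]_x (psi x * rho x) - \int[mu A]_x (chi x * rho x) + \int[mu A]_x (N al x * chi x * rho x).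
    by rewrite -[LHS]EH; exact: (cvg_unique (@Rhausdorff R) lH lim).
  have alg (a b c : R) : a = a - b + c -> b - c = 0 by move=> E0; lra.
  have NI := alg _ _ _ Eq.
  have mN : measurable_fun [set: borel M] (N al) := smth_measurable sN.
  have rN : rint (mu A) (fun x => N al x * chi x * rho x).
    apply: rint_le (rint_norm rchi); first by apply: measurable_funM => //; apply: measurable_funM => //; exact: Lchi.1.
    move=> x; have /andP[n0 n1] := N_bounds x al0.
    by rewrite -mulrA normrM ler_piMl// ger0_norm.
  rewrite -(IntB rchi rN) in NI.
  have Ef : (fun x => chi x * rho x - N al x * chi x * rho x) = (fun x => (1 - N al x) * chi x * rho x).
    by apply/funext => x; ring.
  have rB := rintB rchi rN; rewrite Ef in NI rB.
  apply: Int_eq0 => //; apply: aeS chi0 => x cx; have /andP[_ n1] := N_bounds x al0.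
  by apply: mulr_ge0; [apply: mulr_ge0 => //; rewrite subr_ge0|exact: ltW].
have zero phi tau : csmth phi -> (forall x, 0 <= phi x) -> csmth tau ->
    dot phi (fun x => (1 - N al x) * tau x) = 0.
  move=> cp p0 ctau; have Lp := Lc cp.
  have s1 : smth (fun x => 1 - N al x) by apply: msmoothB; [exact: openT|exact: msmooth_cst|exact: sN].
  have ch := csmthM s1 ctau; have Lh := Lc ch; set h := fun x => _ in Lh *.
  have z t : 0 < t -> dot (It t phi) h = 0.
    move=> t0; have LI := LIs (ltW t0) Lp.
    rewrite -[RHS](Int0 (mu A)); apply: Int_ae => //.
      exact: (rint_measurable (dot_rint srho rho0 LI Lh)).
    apply: aeS (key phi t cp p0 t0) => x kx.
    have -> : It t phi x * h x * rho x = (1 - N al x) * It t phi x * rho x * tau x by rewrite /h; ring.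
    by rewrite kx mul0r.
  (* If the pairing were nonzero, the pairing of the integral of the orbit over the short time dl /
     2 would be nonzero as well: the tolerance is half the size of the pairing. *)
  apply/eqP/negPn/negP => nz; have e0 : 0 < `|dot phi h| / 2 by rewrite divr_gt0// normr_gt0.
  have [dl dl0 Hd] := It_avg srho rho0 TP Lp Lh e0.
  have d2 : 0 < dl / 2 by rewrite divr_gt0.
  have d1 : dl / 2 < dl by lra.
  have le1 := Hd (dl / 2) (ltW d2) d1; rewrite (z _ d2) sub0r normrN normrM (gtr0_norm d2) in le1.
  have nn : 0 < `|dot phi h| by rewrite normr_gt0.
  move: le1 nn; move: `|dot phi h| => D le1 D0.
  by have := mulr_gt0 D0 dl0; lra.
pose F x := - (1 - N al x) * rho x.
have sF : smth F.
  apply: msmoothM; [exact: openT| |exact: srho].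
  have := msmoothB (@openT M) sN (msmooth_cst A setT 1); congr (msmooth _ _ _); apply/funext => x.
  by rewrite opprB.
move=> x; have : 0 <= F x.
  apply: (test_ge0 (smooth_cont sF)) => phi cp p0.
  have rF := csmth_rint_mu (csmthM sF cp).
  have lim := theta_Int_cvg rF.
  have lim0 : \int[mu A]_x (theta A k x * (F x * phi x)) @[k --> \oo] --> (0 : R).
    apply: (@cvg_eq_seq _ (fun=> 0)) => [k|]; last exact: cvg_cst.
    have := zero phi (th k) cp p0 (theta_csmth A k) => Z.
    rewrite -[LHS]oppr0 -Z /L2dot -IntN; last first.
      apply: (dot_rint srho rho0 (Lc cp)); apply: Lc; apply: csmthM (theta_csmth A k).
      by apply: msmoothB; [exact: openT|exact: msmooth_cst|exact: sN].
    by congr (Rintegral _ _ _); apply/funext => y; rewrite /F; ring.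
  by rewrite (cvg_unique (@Rhausdorff R) lim lim0).
have /andP[_ n1] := N_bounds x al0.
rewrite /F pmulr_lge0// oppr_ge0 subr_le0 => n2.
by apply/eqP; rewrite eq_le n1 n2.
Qed.

Lemma N_defect_H_defect al : 0 < al -> nontrivial (fun x => 1 - N al x) ->
  nontrivial_pos_time (fun t x => 1 - H t x).
Proof.
move=> al0 [x /eqP Nx]; apply: contrapT => HH; apply: Nx.
rewrite (conservative_N al0) ?subrr// => t y t0; apply/eqP/negPn/negP => Hy.
by apply: HH; exists t; split=> //; exists y; rewrite subr_eq0 eq_sym.
Qed.

End heat_and_resolvent_of_one.

(** * The cycle of implications *)

Theorem theorem3p3 (R : realType) (n : nat) (M : ptopologicalType)
  (A : weighted R n M) (V rho : M -> R)
  (T G : R -> (M -> R) -> M -> R) (H N : R -> M -> R)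
  (M_connected : connected [set: M])
  (V_smooth : smooth A V) (V_ge0 : forall x, 0 <= V x)
  (rho_smooth : smooth A rho) (rho_gt0 : forall x, 0 < rho x)
  (TP : is_semigroup A rho V T) (GP : is_resolvent A rho V G)
  (HP : is_H A rho V T H) (NP : is_N A rho V G N) :
  let P2 alpha := nontrivial (fun x => 1 - N alpha x) in
  let P3 alpha := exists g : M -> R,
    [/\ nontrivial g, bounded g, smooth A g &
        forall x, alpha * g x - schrodinger A rho V g x = 0] in
  let P4 alpha := exists g : M -> R,
    [/\ nontrivial g, forall x, 0 <= g x, bounded g, smooth A g &
        forall x, alpha * g x - schrodinger A rho V g x <= 0] in
  [<-> nontrivial_pos_time (fun t x => 1 - H t x);
       exists alpha : R, 0 < alpha /\ P2 alpha;
       forall alpha : R, 0 < alpha -> P2 alpha;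
       exists alpha : R, 0 < alpha /\ P3 alpha;
       forall alpha : R, 0 < alpha -> P3 alpha;
       exists alpha : R, 0 < alpha /\ P4 alpha;
       forall alpha : R, 0 < alpha -> P4 alpha;
       exists u : R -> M -> R,
         [/\ nontrivial_pos_time u, smooth_pos_time A u, bounded_continuous u,
             forall t x, 0 < t -> heat_op A rho V u t x = 0 &
             forall x, u 0 x = 0];
       exists u : R -> M -> R,
         [/\ nontrivial_pos_time u /\ (forall t x, 0 <= t -> 0 <= u t x),
             smooth_pos_time A u, bounded_continuous u,
             forall t x, 0 < t -> heat_op A rho V u t x <= 0 &
             forall x, u 0 x = 0]].
Proof.
move=> P2 P3 P4.
have srho : msmooth A setT rho by exact/smoothE.
have sV : msmooth A setT V by exact/smoothE.
have c23 al : 0 < al -> P2 al -> P3 al := @N_defect_eigenfunction _ _ _ _ _ _ srho sV rho_gt0 V_ge0 _ _ _ TP GP NP al.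
have c34 al : 0 < al -> P3 al -> P4 al.
  move=> al0 [g [[x gx] [C gC] /smoothE sg gE]]; exists (fun y => g y * g y); split.
  - by exists x; rewrite mulf_neq0.
  - by move=> y; rewrite -expr2 sqr_ge0.
  - by exists (C * C) => y; rewrite normrM ler_pM.
  - exact/smoothE/(msmoothM (@openT M) sg sg).
  - exact: (eigenfunction_subsolution rho_gt0 V_ge0 al0 sg gE).
have c42 al : 0 < al -> P4 al -> P2 al.
  move=> al0 [g [gn g0 gb sg gE]].
  exact: (subsolution_N_defect srho sV rho_gt0 V_ge0 TP GP NP al0 gn g0 gb sg gE).
have c12any : nontrivial_pos_time (fun t x => 1 - H t x) -> forall al, 0 < al -> P2 al.
  move=> h1 al al0; exact: (heat_subsolution_N_defect srho sV rho_gt0 V_ge0 TP GP NP al0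
    (heat_solution_subsolution rho_gt0 V_ge0 (H_defect_heat srho sV rho_gt0 V_ge0 TP GP HP h1))).
have c21 al : 0 < al -> P2 al -> nontrivial_pos_time (fun t x => 1 - H t x).
  by move=> al0; exact: (N_defect_H_defect srho sV rho_gt0 V_ge0 TP GP HP NP al0).
tfae.
- by move=> h1; exists 1; split=> //; exact: c12any.
(* Passing from one alpha to all of them goes back through the defect of H, which does not involve
   alpha. *)
- by move=> [al [al0 h]] be be0; exact: c12any (c21 al al0 h) be be0.
- by move=> h; exists 1; split=> //; apply: c23 => //; exact: h.
- move=> [al [al0 h]] be be0; apply: (c23 _ be0).
  exact: c12any (c21 al al0 (c42 al al0 (c34 al al0 h))) be be0.
- by move=> h; exists 1; split=> //; apply: c34 => //; exact: h.
- move=> [al [al0 h]] be be0; apply: (c34 _ be0); apply: (c23 _ be0).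
  exact: c12any (c21 al al0 (c42 al al0 h)) be be0.
- move=> h; have := c21 1 ltr01 (c42 1 ltr01 (h 1 ltr01)).
  exact: (H_defect_heat srho sV rho_gt0 V_ge0 TP GP HP).
- exact: (heat_solution_subsolution rho_gt0 V_ge0).
- move=> h; apply: (c21 1 ltr01).
  exact: (heat_subsolution_N_defect srho sV rho_gt0 V_ge0 TP GP NP ltr01 h).
Qed.
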